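(* There exist $\kappa\in(0,1)$ and $\delta\in(0,1)$ such that the following holds. Let $c\in W^{1,2}(B_1)$ be a non-negative function that is homogeneous of degree $3$. If $$\|c-h_{\theta_1}\|_{W^{1,2}(B_1)}\le\delta\quad\text{for some } h_{\theta_1}\in\mathbb{H},$$ then there exists a function $v\in W^{1,2}(B_1)$ satisfying $v=c$ on $\partial B_1$ and $$M(v)\le(1-\kappa)M(c)+\kappa M(h_{\theta_1}).$$
   Context: $B_1\subset\mathbb{R}^2$ is the open unit ball centered at the origin, and $(r,\theta)$ denote polar coordinates. For $v\in W^{1,2}(B_1)$, $$M(v):=\int_{B_1}\left(|\nabla v|^2+2|x|v^+\right)dx-3\int_{\partial B_1}v^2\,d\mathcal{H}^1,$$ where $v^+=\max(v,0)$. Boundary values are understood in the sense of traces. The class $\mathbb{H}$ consists of all functions $$h_{\theta_1}(x)=\left(\frac{|x|^3}{9}-\frac{\cos3\theta_1}{9}(x_1^3-3x_1x_2^2)-\frac{\sin3\theta_1}{9}(3x_1^2x_2-x_2^3)\right)\chi_{\{\theta_1<\theta<\theta_2\}},\qquad \theta_2=\theta_1+\tfrac{2\pi}{3},\ \theta_1\in[0,2\pi),$$ where $\{\theta_1<\theta<\theta_2\}$ is the open sector of points whose polar angle (mod $2\pi$) lies in $(\theta_1,\theta_2)$; equivalently $h_{\theta_1}=\frac{r^3}{9}(1-\cos3(\theta-\theta_1))$ in that sector and $0$ elsewhere. *)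

(* Defs.v *)
From HB Require Import structures.
From mathcomp Require Import all_boot all_order all_algebra.
From mathcomp Require Import all_classical all_reals all_analysis.
Set Implicit Arguments.
Unset Strict Implicit.
Unset Printing Implicit Defensive.
Import Order.TTheory GRing.Theory Num.Theory.
Import numFieldNormedType.Exports.
Local Open Scope classical_set_scope.
Local Open Scope ring_scope.

Section Plane.
Context {R : realType}.
Implicit Types (x e : R * R) (u v g : R * R -> R).

Definition leb2 : set (measurableTypeR R * measurableTypeR R) -> \bar R :=
  (@lebesgue_measure R \x @lebesgue_measure R)%E.

(* The library norm on [R * R] is the sup norm, so the Euclidean norm and the
   Euclidean disc have to be spelled out. *)
Definition enorm x : R := Num.sqrt (x.1 ^+ 2 + x.2 ^+ 2).
Definition B1 : set (R * R) := [set x | enorm x < 1].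

Definition circ (t : R) : R * R := (cos t, sin t).

Definition e1 : R * R := (1, 0).
Definition e2 : R * R := (0, 1).

Fixpoint Ck (n : nat) (f : R * R -> R) : Prop :=
  continuous f /\
  if n is m.+1 then
    [/\ forall x, derivable f x e1, forall x, derivable f x e2,
        Ck m (fun x => 'D_e1 f x) & Ck m (fun x => 'D_e2 f x)]
  else True.

(* C_c^infty(B1), extended by 0 to the plane. *)
Definition test_function (phi : R * R -> R) : Prop :=
  (forall n, Ck n phi) /\
  exists K : set (R * R),
    [/\ compact K, K `<=` B1 & forall x, ~ K x -> phi x = 0].

Definition L2B1 v : Prop :=
  measurable_fun (B1 : set (measurableTypeR R * measurableTypeR R)) v /\
  leb2.-integrable B1 (fun x => (v x ^+ 2)%:E).

Definition is_weak_partial e v g : Prop :=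
  L2B1 g /\
  forall phi, test_function phi ->
    \int[leb2]_(x in B1) (v x * 'D_e phi x) =
    - \int[leb2]_(x in B1) (g x * phi x).

Definition W12 v : Prop :=
  [/\ L2B1 v, exists g, is_weak_partial e1 v g
            & exists g, is_weak_partial e2 v g].

(* A representative of the weak partial derivative, which is unique up to a
   null subset of [B1]; a dummy value when there is none. *)
Definition wpartial e v : R * R -> R :=
  xget (fun=> 0) [set g | is_weak_partial e v g].

Definition wgrad_sq v x : R := wpartial e1 v x ^+ 2 + wpartial e2 v x ^+ 2.

(* Meaningful on [W12], where the integrand is integrable: [\int] in [R] is 0
   when the integral is infinite. *)
Definition W12norm v : R :=
  Num.sqrt (\int[leb2]_(x in B1) (v x ^+ 2 + wgrad_sq v x)).

(* Integration with respect to H^1 over the unit circle, by arc length. *)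
Definition circle_int g : R :=
  \int[lebesgue_measure]_(t in `[0, 2 * pi]) g (circ t).

Definition L2circle g : Prop :=
  measurable_fun (`[0, 2 * pi] : set (measurableTypeR R)) (g \o circ) /\
  (@lebesgue_measure R).-integrable `[0, 2 * pi]
    (fun t => (g (circ t) ^+ 2)%:E).

(* The graph of the trace operator W^{1,2}(B1) -> L^2(circle) is the closure of
   the graph of the restriction operator on W^{1,2}(B1) /\ C(closed disc).
   Only the values of [g] on the unit circle matter. *)
Definition is_trace v g : Prop :=
  L2circle g /\
  exists u : nat -> R * R -> R,
    [/\ forall n, W12 (u n),
        forall n, {within [set x | enorm x <= 1], continuous (u n)},
        W12norm (u n \- v) @[n --> \oo] --> 0
      & circle_int (fun x => (u n x - g x) ^+ 2) @[n --> \oo] --> 0].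

Definition trace v : R * R -> R := xget (fun=> 0) [set g | is_trace v g].

Definition same_trace v w : Prop :=
  {ae @lebesgue_measure R,
    forall t, t \in `[0, 2 * pi] -> trace v (circ t) = trace w (circ t)}.

Definition M v : R :=
  \int[leb2]_(x in B1) (wgrad_sq v x + 2 * enorm x * Num.max (v x) 0)
  - 3 * circle_int (fun x => trace v x ^+ 2).

(* Elements of W^{1,2}(B1) are defined up to null sets, hence the "almost
   everywhere" in the next two definitions. *)
Definition ae_nonneg v : Prop := {ae leb2, forall x, B1 x -> 0 <= v x}.

Definition ae_homogeneous (d : nat) v : Prop :=
  forall t : R, 0 < t ->
    {ae leb2, forall x, B1 x -> B1 (t *: x) -> v (t *: x) = t ^+ d * v x}.

Definition sector (a b : R) : set (R * R) :=
  [set x | exists r t : R, [/\ 0 < r, a < t < b & x = r *: circ t]].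

Definition hfun (a : R) x : R :=
  (enorm x ^+ 3 / 9
   - cos (3 * a) / 9 * (x.1 ^+ 3 - 3 * x.1 * x.2 ^+ 2)
   - sin (3 * a) / 9 * (3 * x.1 ^+ 2 * x.2 - x.2 ^+ 3))
  * \1_(sector a (a + 2 * pi / 3)) x.

Definition HH : set (R * R -> R) := [set hfun a | a in `[0, 2 * pi[].

End Plane.

(* Main.v *)
(* A homogeneous [c] equals [r^3 f(theta)] with [f >= 0] in H^1 of the circle,
   and [h] equals [r^3 h_m(theta)]. Rotate the reference profile to [h_m] and
   pick [s] so that [B := f - s h_m] vanishes at the two points dividing the
   support of [h_m], an arc of length 2pi/3, into equal arcs (a parameter [m]
   close to the given one exists by the intermediate value theorem). The
   competitor is [v = r^3 s h_m + r^4 B]. With kappa = 3/28 the gain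
   [25/28 M c + 3/28 M h - M v] is a positive multiple of a one-dimensional
   integral. On the support of [h_m] it is, up to exact derivatives, at least
   the integral of [B'^2 - 16 B^2]; on each of the three arcs of length 2pi/9,
   the square of [B' + 4 tan(4(t - mid)) B] bounds this from below by boundary
   terms, of which only those at the two ends of the support remain. On the
   complementary arc, [f] is small, so that its linear term in the energy
   pays for these boundary terms. *)
From HB Require Import structures.
From mathcomp Require Import all_boot all_order all_algebra.
From mathcomp Require Import all_classical all_reals all_analysis.
From mathcomp Require Import measurable_realfun.
From mathcomp Require Import ring lra.
Require Import Defs.
Set Implicit Arguments.
Unset Strict Implicit.
Unset Printing Implicit Defensive.
Import Order.TTheory GRing.Theory Num.Theory.
Import numFieldNormedType.Exports.
Local Open Scope classical_set_scope.
Local Open Scope ring_scope.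

(** * Polar coordinates *)

(** On an arc of length 2pi/3 the Dirichlet eigenvalues of -d^2/dt^2 are (3j/2)^2; exactly two of
    them, 9/4 and 9, lie below 16. The two parameters [s] and [m] remove these two directions: the
    arcs between consecutive nodes have first eigenvalue 81/4 > 16, and the strict inequality keeps
    the tangent finite at the ends of the support, where [f] need not vanish. Passing from r^3 B to
    r^4 B changes the coefficient of B'^2 from 1/6 to 1/8 and that of the terms linear in B from 1/3
    to 2/7. With [kappa = 3/28] the gain is, up to the factor 1/42, [B'^2 - 57/4 B^2] plus half of
    the cross terms plus 3/4 of the terms in [h] alone. As -57/4 = -16 + 1 + 3/4 and h'' = 1 - 9h,
    the last 3/4 completes a square with (1 - s) B / 2, whatever the size of [s - 1]. Weak gradients
    and traces enter [M] through arbitrary representatives, so they can be computed only after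
    uniqueness is proved: for the gradient by the fundamental lemma, for the trace by bounds on
    Fourier coefficients and completeness of the trigonometric system. *)

Section density.
Context d (T : measurableType d) (R : realType).
Variables (mu : {measure set T -> \bar R}) (w : T -> R).
Local Open Scope ereal_scope.

(* The proofs are arguments so that [density mu mw w0] is canonically a
   measure. *)
Definition density of measurable_fun [set: T] w & (forall x, (0 <= w x)%R) :=
  fun A : set T => \int[mu]_(x in A) (w x)%:E.

Hypothesis mw : measurable_fun [set: T] w.
Hypothesis w0 : forall x, (0 <= w x)%R.
Local Notation dens := (density mw w0).

Let w0E x : 0 <= (w x)%:E. Proof. by rewrite lee_fin. Qed.
Let mwE : measurable_fun [set: T] (EFin \o w).
Proof. exact/measurable_EFinP. Qed.
Let density0 : dens set0 = 0. Proof. exact: integral_set0. Qed.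
Let density_ge0 A : 0 <= dens A. Proof. exact: integral_ge0. Qed.
Let density_sigma : semi_sigma_additive dens.
Proof.
move=> F mF tF mUF; rewrite /density ge0_integral_bigcup//; last first.
  exact: measurable_funTS.
by apply: is_cvg_ereal_nneg_natsum_cond => n _ _; exact: density_ge0.
Qed.

HB.instance Definition _ :=
  isMeasure.Build _ _ _ dens density0 density_ge0 density_sigma.

Import HBNNSimple.

(** Monotone approximation by simple functions reduces this to indicators, for which it is the
    definition of [density]. *)
Lemma ge0_integral_density (f : T -> \bar R) :
  measurable_fun setT f -> (forall x, 0 <= f x) ->
  \int[dens]_x f x = \int[mu]_x (f x * (w x)%:E).
Proof.
move=> mf f0.
pose h := nnsfun_approx measurableT mf.
have -> : \int[dens]_x f x =
    lim (\int[dens]_x (EFin \o h n) x @[n --> \oo]).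
  have fE x : f x = lim ((EFin \o h n) x @[n --> \oo]).
    by apply/esym/cvg_lim => //; exact: cvg_nnsfun_approx.
  under eq_integral => x _ do rewrite fE.
  apply: monotone_convergence => //.
  - by move=> n; apply/measurable_EFinP/measurable_funP.
  - by move=> n x _ //=; rewrite lee_fin.
  - by move=> x _ a b ab; rewrite lee_fin; exact/lefP/nd_nnsfun_approx.
have -> : \int[mu]_x (f x * (w x)%:E) =
    lim (\int[mu]_x ((EFin \o h n) x * (w x)%:E) @[n --> \oo]).
  have fg x : f x * (w x)%:E = lim (((EFin \o h n) x * (w x)%:E) @[n --> \oo]).
    by apply/esym/cvg_lim => //; apply: cvgeZr => //; exact: cvg_nnsfun_approx.
  under eq_integral => x _ do rewrite fg.
  apply: monotone_convergence => //.
  - by move=> n; apply/emeasurable_funM => //; apply/measurable_EFinP.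
  - by move=> n x _ /=; rewrite mule_ge0// lee_fin.
  - by move=> x _ a b ab/=; rewrite lee_wpmul2r ?lee_fin//; exact/lefP/nd_nnsfun_approx.
congr (lim (_ @ \oo)); apply/funext => n.
transitivity (\int[dens]_x
   (\sum_(y \in range (h n)) (y * \1_(h n @^-1` [set y]) x)%:E)).
  by apply: eq_integral => t tE; rewrite /= fimfunE -fsumEFin.
rewrite ge0_integral_fsum//; last 2 first.
  - by move=> y; exact/measurable_EFinP/measurable_funM.
  - by move=> y x _; exact: nnfun_muleindic_ge0.
transitivity (\int[mu]_x (\sum_(y \in range (h n))
    (y * \1_(h n @^-1` [set y]) x)%:E * (w x)%:E)); last first.
  apply: eq_integral => x xE.
  rewrite -ge0_mule_fsuml => [|y]; last exact: nnfun_muleindic_ge0.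
  by rewrite fsumEFin // -(fimfunE _ x).
rewrite ge0_integral_fsum//; last 2 first.
  - by move=> y; apply: emeasurable_funM => //; exact/measurable_EFinP/measurable_funM.
  - by move=> y x _; rewrite mule_ge0// nnfun_muleindic_ge0.
apply: eq_fsbigr => r rhn.
under eq_integral do rewrite EFinM.
rewrite integralZl_indic_nnsfun//.
under [RHS]eq_integral do rewrite EFinM -muleA.
rewrite ge0_integralZl//.
- under [in RHS]eq_integral do rewrite muleC.
  rewrite [in RHS](eq_integral ((EFin \o w) \_ (h n @^-1` [set r]))); last first.
    by move=> x xE; rewrite epatch_indic.
  by rewrite -integral_mkcond integral_indic// setIT.
- by apply: emeasurable_funM => //; exact/measurable_EFinP.
- by move=> t _; rewrite mule_ge0 ?lee_fin.
- by move: rhn; rewrite inE => -[t _ <-]; rewrite lee_fin.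
Qed.
End density.

Section scaling.
Context (R : realType).
Local Notation mu := (@lebesgue_measure R).
Local Open Scope ereal_scope.

(** Both sides agree on half-open intervals, and these determine Lebesgue measure; translations and
    the substitution by [tan] are treated in the same way. *)
Lemma lebesgue_measure_scale (c : R) (c0 : (0 < c)%R) (A : set R) :
  measurable A ->
  mu A = c%:E * pushforward mu (fun x : measurableTypeR R => (c * x)%R : measurableTypeR R) A.
Proof.
move=> mA.
have mphi : measurable_fun [set: measurableTypeR R] (fun x : measurableTypeR R => (c * x)%R : measurableTypeR R).
  exact: mulrl_measurable.
pose mphi_mixin := isMeasurableFun.Build _ _ _ _ _ mphi.
pose mphi_pack : {mfun _ >-> _} := HB.pack (fun x : measurableTypeR R => (c * x)%R : measurableTypeR R) mphi_mixin.
have c0' : (0 <= c)%R by exact: ltW.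
apply: (@lebesgue_measure_unique R (mscale (NngNum c0') (pushforward mu mphi_pack))) => // _ [[a b]] _ <-/=.
rewrite /mscale /= /pushforward.
have -> : mphi_pack @^-1` `]a, b]%classic = `](a / c)%R, (b / c)%R]%classic :> set R.
  by apply/seteqP; split => x /=; rewrite !in_itv/= ltr_pdivrMr// ler_pdivlMr// ![(x * c)%R]mulrC.
rewrite !lebesgue_measure_itv/= !lte_fin ltr_pM2r ?invr_gt0//.
case: ifP => _; last by rewrite mule0.
by rewrite -!EFinB -EFinM; congr EFin; field; rewrite gt_eqF.
Qed.

Lemma ge0_integral_scale (c : R) (F : R -> \bar R) : (c != 0)%R ->
  measurable_fun setT F -> (forall x, 0 <= F x) ->
  \int[mu]_x F x = \int[mu]_x (F (c * x)%R * `|c|%:E).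
Proof.
have main (c' : R) (F' : R -> \bar R) : (0 < c')%R -> measurable_fun setT F' ->
    (forall x, 0 <= F' x) -> \int[mu]_x F' x = \int[mu]_x (F' (c' * x)%R * `|c'|%:E).
  move=> c0 mF F0.
  have mphi : measurable_fun [set: measurableTypeR R] (fun x : measurableTypeR R => (c' * x)%R : measurableTypeR R).
    exact: mulrl_measurable.
  pose mphi_mixin := isMeasurableFun.Build _ _ _ _ _ mphi.
  pose mphi_pack : {mfun _ >-> _} := HB.pack (fun x : measurableTypeR R => (c' * x)%R : measurableTypeR R) mphi_mixin.
  have c0' : (0 <= c')%R by exact: ltW.
  rewrite (@eq_measure_integral _ _ _ setT (mscale (NngNum c0') (pushforward mu mphi_pack))); last first.
    by move=> A mA _; rewrite [LHS](lebesgue_measure_scale c0).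
  rewrite ge0_integral_mscale// ge0_integral_pushforward//=; last 1 first.
  rewrite ge0_integralZr//; last first.
    by apply: (measurableT_comp mF); exact: mphi.
  by rewrite muleC ger0_norm.
move=> c0 mF F0.
have [c1|] := ltP 0%R c; first exact: main.
rewrite le_eqVlt (negbTE c0)/= => c1.
have mN : measurable_fun setT (fun x : measurableTypeR R => (- x)%R : measurableTypeR R) by exact: oppr_measurable.
pose mN_mixin := isMeasurableFun.Build _ _ _ _ _ mN.
pose mN_pack : {mfun _ >-> _} := HB.pack (fun x : measurableTypeR R => (- x)%R : measurableTypeR R) mN_mixin.
rewrite (@eq_measure_integral _ _ _ setT (pushforward mu mN_pack)); last first.
  by move=> A mA _; apply/esym; exact: lebesgue_measureN.
rewrite ge0_integral_pushforward//=.
rewrite (main (- c)%R)//; first last.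
- exact: measurableT_comp mF mN.
- by rewrite oppr_gt0.
by rewrite normrN; apply: eq_integral => x _; rewrite /= mulNr opprK.
Qed.
End scaling.

Lemma integral_derive (R : realType) (F f : R -> R) (a b : R) : a <= b ->
  (forall x, a <= x <= b -> is_derive x 1 F (f x)) ->
  (forall x, a <= x <= b -> {for x, continuous f}) ->
  (\int[lebesgue_measure]_(x in `[a, b]) (f x)%:E = (F b - F a)%:E)%E.
Proof.
rewrite le_eqVlt => /predU1P[<-|ab] dF cf.
  by rewrite set_itv1 integral_set1 subrr.
have cF x : a <= x <= b -> {for x, continuous F}.
  move=> /dF Fx; apply: differentiable_continuous; exact/derivable1_diffP.
rewrite (@continuous_FTC2 _ f F)// ?EFinB//.
- apply: continuous_in_subspaceT => x; rewrite inE/= in_itv/=; exact: cf.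
- split.
  + by move=> x; rewrite in_itv/= => /andP[/ltW ax /ltW xb]; have [] := dF x; rewrite ?ax.
  + by apply: cvg_at_right_filter; apply: cF; rewrite lexx ltW.
  + by apply: cvg_at_left_filter; apply: cF; rewrite lexx ltW.
- move=> x; rewrite in_itv/= => /andP[/ltW ax /ltW xb]; rewrite derive1E.
  by have [] := dF x; rewrite ?ax.
Qed.

Section tan_subst.
Context (R : realType).
Local Notation mu := (@lebesgue_measure R).

Let I : set R := `](- (pi / 2)), (pi / 2)[%classic.

Lemma cos_gt0_itv (t : R) : t \in `](- (pi / 2)), (pi / 2)[ -> 0 < cos t.
Proof. by rewrite in_itv /= => h; exact: cos_gt0_pihalf. Qed.

Lemma measurable_cos : measurable_fun [set: R] (@cos R).
Proof. by apply: continuous_measurable_fun => x; exact: continuous_cos. Qed.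
Lemma measurable_sin : measurable_fun [set: R] (@sin R).
Proof. by apply: continuous_measurable_fun => x; exact: continuous_sin. Qed.

Lemma measurable_invr : measurable_fun [set: R] (@GRing.inv R).
Proof.
have -> : @GRing.inv R = (fun x => x * (x ^+ 2) `^ (- 1)).
  apply/funext => x; have [->|x0] := eqVneq x 0; first by rewrite invr0 mul0r.
  rewrite powR_inv1 ?sqr_ge0// expr2; by field.
apply: measurable_funM => //.
by apply: (measurableT_comp (measurable_powR _)); exact: measurable_funX.
Qed.

Lemma measurable_tan : measurable_fun [set: R] (@tan R).
Proof.
apply: measurable_funM; first exact: measurable_sin.
by apply: (measurableT_comp measurable_invr); exact: measurable_cos.
Qed.

Local Open Scope ereal_scope.

(** The derivative of [tan], cut off outside the branch on which [tan] is a bijection onto the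
    line. *)
Definition tan_weight (t : R) : R := (\1_I t * (cos t) ^- 2)%R.

Lemma measurable_tan_weight : measurable_fun setT tan_weight.
Proof.
apply: measurable_funM; first by apply: measurable_indic; exact: measurable_itv.
apply: (measurableT_comp measurable_invr).
by apply: measurable_funX; exact: measurable_cos.
Qed.

Lemma tan_weight_ge0 t : (0 <= tan_weight t)%R.
Proof. by rewrite /tan_weight mulr_ge0// invr_ge0 sqr_ge0. Qed.

Let tan_mixin := isMeasurableFun.Build _ _ (measurableTypeR R) (measurableTypeR R) _ measurable_tan.
Let tan_pack : {mfun (measurableTypeR R) >-> (measurableTypeR R)} := HB.pack (@tan R : measurableTypeR R -> measurableTypeR R) tan_mixin.

Lemma lebesgue_measure_tan (A : set R) : measurable A ->
  mu A = pushforward (density mu measurable_tan_weight tan_weight_ge0) tan_pack A.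
Proof.
apply: (@lebesgue_measure_unique R (pushforward (density mu measurable_tan_weight tan_weight_ge0) tan_pack)) => // _ [[a b]] _ <-/=.
rewrite /pushforward /density /tan_weight.
have [ba|ab] := leP b a.
  rewrite set_itv_ge; last by rewrite bnd_simp -leNgt.
  by rewrite measure0 preimage_set0 integral_set0.
have tanE : I `&` (@tan R) @^-1` `]a, b]%classic = `]atan a, atan b]%classic.
  have LI x : (tan x \in `]a, b]) && (x \in `](- (pi / 2))%R, (pi / 2)%R[) = (x \in `]atan a, atan b]).
    apply/idP/idP => [/andP[]|].
      rewrite !in_itv/= => /andP[ax xb] xI.
      have <- : atan (tan x) = x by apply: tanK; rewrite in_itv.
      by rewrite lt_atan// le_atan.
    rewrite !in_itv/= => /andP[ax xb].
    have xI : x \in `](- (pi / 2))%R, (pi / 2)%R[.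
      by rewrite in_itv/= (lt_trans _ ax) ?atan_gtNpi2// (le_lt_trans xb)// atan_ltpi2.
    have aI (c : R) : atan c \in `](- (pi / 2))%R, (pi / 2)%R[.
      by rewrite in_itv/= atan_gtNpi2 atan_ltpi2.
    have -> : (a < tan x)%R by rewrite -(atanK a) ltr_tan ?aI.
    have -> : (tan x <= b)%R by rewrite leNgt -(atanK b) ltr_tan ?aI -?leNgt.
    by move: xI; rewrite in_itv.
  apply/seteqP; split => x /=; rewrite -LI.
    by move=> [h1 h2]; apply/andP; split.
  by move=> /andP[h1 h2]; split.
rewrite lebesgue_measure_itv/= lte_fin ab.
transitivity (\int[mu]_(x in `]atan a, atan b]) ((cos x)^-2)%:E); last first.
  rewrite -tanE setIC integral_mkcondr; apply: eq_integral => x _.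
  by rewrite epatch_indic/= -EFinM mulrC.
rewrite integral_itv_obnd_cbnd; last first.
  apply: measurable_funTS; apply/measurable_EFinP.
  apply: (measurableT_comp measurable_invr).
  by apply: measurable_funX; exact: measurable_cos.
have cosx x : (atan a <= x <= atan b)%R -> cos x != 0%R.
  move=> /andP[ax xb]; rewrite gt_eqF// cos_gt0_pihalf//.
  by rewrite (lt_le_trans (atan_gtNpi2 _) ax) (le_lt_trans xb)// atan_ltpi2.
have /= -> := @integral_derive _ (@tan R) (fun x => (cos x)^-2)%R (atan a) (atan b)
  (ltW (lt_atan ab)) (fun x h => is_derive_tan (cosx x h)).
  by rewrite !atanK.
move=> x /cosx cx; apply: cvgV; first by rewrite expf_neq0.
by apply: (@cvg_comp _ _ _ cos (fun y : R => y ^+ 2)%R); [exact: continuous_cos|exact: exprn_continuous].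
Qed.

Lemma ge0_integral_tan (F : R -> \bar R) :
  measurable_fun setT F -> (forall x, 0 <= F x) ->
  \int[mu]_x F x = \int[mu]_x (F (tan x) * (tan_weight x)%:E).
Proof.
move=> mF F0.
rewrite (@eq_measure_integral _ _ _ setT (pushforward (density mu measurable_tan_weight tan_weight_ge0) tan_pack)); last first.
  by move=> A mA _; exact: lebesgue_measure_tan.
rewrite ge0_integral_pushforward//=; last exact: measurable_tan.
rewrite -(ge0_integral_density mu measurable_tan_weight tan_weight_ge0) //.
by apply: (measurableT_comp mF); exact: measurable_tan.
Qed.
End tan_subst.

Section shift.
Context (R : realType).
Local Notation mu := (@lebesgue_measure R).
Local Open Scope ereal_scope.

Lemma ge0_integral_shift (c : R) (F : R -> \bar R) :
  measurable_fun setT F -> (forall x, 0 <= F x) ->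
  \int[mu]_x F x = \int[mu]_x F (x + c)%R.
Proof.
move=> mF F0.
have mphi : measurable_fun [set: measurableTypeR R] (fun x : measurableTypeR R => (x + c)%R : measurableTypeR R).
  exact: measurable_funD.
pose mphi_mixin := isMeasurableFun.Build _ _ _ _ _ mphi.
pose mphi_pack : {mfun _ >-> _} := HB.pack (fun x : measurableTypeR R => (x + c)%R : measurableTypeR R) mphi_mixin.
rewrite (@eq_measure_integral _ _ _ setT (pushforward mu mphi_pack)); last first.
  move=> A + _; apply: (@lebesgue_measure_unique R (pushforward mu mphi_pack)) => // _ [[a b]] _ <-/=.
  rewrite /pushforward.
  have -> : mphi_pack @^-1` `]a, b]%classic = `](a - c)%R, (b - c)%R]%classic :> set R.
    by apply/seteqP; split => x /=; rewrite !in_itv/= ltrBlDr lerBrDr.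
  rewrite !lebesgue_measure_itv/= !lte_fin ltrD2r.
  by case: ifP => // _; rewrite -!EFinB opprB addrA subrK.
by rewrite ge0_integral_pushforward.
Qed.

Lemma ge0_integral_itv_shift (c a b : R) (F : R -> \bar R) :
  measurable_fun setT F -> (forall x, 0 <= F x) ->
  \int[mu]_(x in `[a, b[) F (x + c)%R = \int[mu]_(x in `[(a + c)%R, (b + c)%R[) F x.
Proof.
move=> mF F0.
rewrite [RHS]integral_mkcond (ge0_integral_shift c)/=; last 2 first.
- exact/(measurable_restrictT _ _).1/measurable_funTS.
- by move=> x; rewrite patchE; case: ifPn.
rewrite [LHS]integral_mkcond; apply: eq_integral => x _.
by rewrite !patchE !mem_setE !in_itv/= lerD2r ltrD2r.
Qed.

Lemma ge0_integral_itv_cat (a b c : R) (F : R -> \bar R) :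
  measurable_fun setT F -> (forall x, 0 <= F x) -> (a <= b <= c)%R ->
  \int[mu]_(x in `[a, c[) F x = \int[mu]_(x in `[a, b[) F x + \int[mu]_(x in `[b, c[) F x.
Proof.
move=> mF F0 /andP[ab bc].
rewrite -ge0_integral_setU//=.
- by rewrite -itv_bndbnd_setU.
- exact: measurable_funTS.
- apply/disj_setPS => y [/=]; rewrite 2!in_itv/= => /andP[_ yx] /andP[].
  by rewrite leNgt yx.
Qed.

(** For a shift of at most one period, the piece lost on the left reappears on the right, one period
    later. Longer shifts follow by induction on the number of periods. *)
Lemma ge0_integral_periodic (a b : R) (F : R -> \bar R) :
  measurable_fun setT F -> (forall x, 0 <= F x) ->
  (forall x, F (x + 2 * pi)%R = F x) ->
  \int[mu]_(x in `[a, (a + 2 * pi)%R[) F x = \int[mu]_(x in `[b, (b + 2 * pi)%R[) F x.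
Proof.
move=> mF F0 FP.
have step (x y : R) : (x <= y <= x + 2 * pi)%R ->
    \int[mu]_(x in `[x, (x + 2 * pi)%R[) F x = \int[mu]_(x in `[y, (y + 2 * pi)%R[) F x.
  move=> /andP[xy yx].
  rewrite (@ge0_integral_itv_cat x y)//; last by rewrite xy.
  rewrite (@ge0_integral_itv_cat y (x + 2 * pi)%R (y + 2 * pi)%R)//; last by rewrite yx lerD2r.
  rewrite -ge0_integral_itv_shift// addeC; congr (_ + _).
  by apply: eq_integral => z _; rewrite FP.
have step2 n (x y : R) : (x <= y <= x + 2 * pi *+ n)%R ->
    \int[mu]_(x in `[x, (x + 2 * pi)%R[) F x = \int[mu]_(x in `[y, (y + 2 * pi)%R[) F x.
  elim: n x y => [x y|n IHn x y].
    by rewrite mulr0n addr0 -eq_le => /eqP ->.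
  move=> /andP[xy yx]; have [h|h] := leP y (x + 2 * pi)%R.
    by apply: step; rewrite xy.
  have pi0 := @pi_gt0 R.
  rewrite (step x (x + 2 * pi)%R); last by rewrite lexx lerDl mulr_ge0// ltW.
  by apply: IHn; rewrite ltW//= -addrA -mulrS.
have step3 (x y : R) : (x <= y)%R ->
    \int[mu]_(x in `[x, (x + 2 * pi)%R[) F x = \int[mu]_(x in `[y, (y + 2 * pi)%R[) F x.
  move=> xy; apply: (step2 (Num.bound ((y - x)))); rewrite xy/=.
  have yx0 : (0 <= y - x)%R by rewrite subr_ge0.
  rewrite -lerBlDl (le_trans (ltW (archi_boundP yx0)))//.
  rewrite -[leRHS]mulr_natr ler_peMl// (le_trans _ (ler_wpM2l _ (@pi_ge2 R)))//.
  by rewrite -natrM ler1n.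
by have [ab|/ltW ba] := leP a b; [exact: step3|apply/esym/step3].
Qed.
End shift.

Section polar.
Context (R : realType).
Local Notation mu := (@lebesgue_measure R).
Local Notation T2 := (measurableTypeR R * measurableTypeR R)%type.
Local Open Scope ereal_scope.

(** Only one-dimensional substitutions occur: on each vertical line y = x s, then, after exchanging
    the integrals, s = tan t and x = r cos t. The angle runs over half a turn and [r] over the whole
    line. *)
Let polar_half (F : T2 -> \bar R) :
  measurable_fun [set: T2] F -> (forall x, 0 <= F x) ->
  \int[leb2]_x F x = \int[mu]_(t in `](- (pi / 2))%R, (pi / 2)%R[)
     \int[mu]_r (F (r * cos t, r * sin t)%R * `|r|%:E).
Proof.
move=> mF F0.
pose G (z : T2) : \bar R := F (z.1, z.1 * z.2)%R * `|z.1|%:E.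
have G0 z : 0 <= G z by rewrite mule_ge0.
have mG : measurable_fun [set: T2] G.
  apply: emeasurable_funM; last first.
    apply/measurable_EFinP; apply: measurableT_comp => //; exact: measurable_fst.
  apply: (measurableT_comp mF); apply: measurable_fun_pair => /=; first exact: measurable_fst.
  by apply: measurable_funM; [exact: measurable_fst|exact: measurable_snd].
have mF1 x : measurable_fun setT (fun y => F (x, y)).
  by apply: (measurableT_comp mF); exact: measurable_pair1.
have mG2 y : measurable_fun setT (fun x => G (x, y)).
  by apply: (measurableT_comp mG); exact: measurable_pair2.
rewrite /leb2 (fubini_tonelli1 F mF F0) /fubini_F.
transitivity (\int[mu]_x \int[mu]_s G (x, s)).
  apply: ge0_ae_eq_integral => //.
  - exact: measurable_fun_fubini_tonelli_F.
  - exact: (measurable_fun_fubini_tonelli_F G).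
  - by move=> x _; apply: integral_ge0.
  - by move=> x _; apply: integral_ge0.
  (* The substitution y = x s degenerates on the vertical axis only, which is a null set of
     abscissas. *)
  - exists [set 0%R]; split => //; first exact: lebesgue_measure_set1.
    move=> x /=; apply: contra_notP => /eqP x0 _.
    by rewrite (ge0_integral_scale x0) //; exact: mF1.
rewrite [LHS](fubini_tonelli G mG G0).
rewrite ge0_integral_tan; last 2 first.
- exact: (measurable_fun_fubini_tonelli_G G).
- by move=> x; apply: integral_ge0.
rewrite [RHS]integral_mkcond; apply: eq_integral => t _.
rewrite /tan_weight indicE patchE; case: ifPn => tI; last by rewrite mul0r mule0.
rewrite mul1r.
have ct0 : (0 < cos t)%R by apply: cos_gt0_itv; rewrite inE in tI.
have ct : cos t != 0%R by rewrite gt_eqF.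
rewrite (@ge0_integral_scale _ (cos t) (fun x => G (x, tan t)) ct (mG2 _) (fun x => G0 _)).
rewrite -ge0_integralZr//; last 3 first.
- apply: emeasurable_funM => //; apply: (measurableT_comp (mG2 _)).
  exact: mulrl_measurable.
- by move=> x _; rewrite !mule_ge0.
- by rewrite lee_fin invr_ge0 sqr_ge0.
apply: eq_integral => r _.
rewrite /G -!muleA; congr (_ * _).
  by congr (F (_, _)); rewrite /= ?[(cos t * r)%R]mulrC// /tan; field.
by rewrite -!EFinM; congr EFin; rewrite /= normrM (gtr0_norm ct0); field.
Qed.

Lemma circD2pi (t : R) : circ (t + 2 * pi) = circ t.
Proof. by rewrite /circ mulr_natl cosD2pi sinD2pi. Qed.

Lemma measurable_polar_fun (F : T2 -> \bar R) : measurable_fun [set: T2] F ->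
  measurable_fun [set: T2] (fun z => F (z.1 * cos z.2, z.1 * sin z.2)%R).
Proof.
move=> mF; apply: (measurableT_comp mF); apply: measurable_fun_pair => /=.
  apply: measurable_funM; first exact: measurable_fst.
  by apply: (measurableT_comp (@measurable_cos R)); exact: measurable_snd.
apply: measurable_funM; first exact: measurable_fst.
by apply: (measurableT_comp (@measurable_sin R)); exact: measurable_snd.
Qed.

Lemma ge0_integral_polar (a : R) (F : T2 -> \bar R) :
  measurable_fun [set: T2] F -> (forall x, 0 <= F x) ->
  \int[leb2]_x F x = \int[mu]_(t in `[a, (a + 2 * pi)%R[)
     \int[mu]_(r in `[0%R, +oo[) (F (r * cos t, r * sin t)%R * r%:E).
Proof.
move=> mF F0.
pose G (z : T2) : \bar R := F (z.1 * cos z.2, z.1 * sin z.2)%R * (Num.max z.1 0)%:E.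
have G0 z : 0 <= G z by rewrite mule_ge0// lee_fin le_max lexx orbT.
have mG : measurable_fun [set: T2] G.
  apply: emeasurable_funM; first exact: measurable_polar_fun.
  by apply/measurable_EFinP; apply: measurable_maxr => //; exact: measurable_fst.
pose Phi t := \int[mu]_r G (r, t).
have mPhi : measurable_fun setT Phi by exact: (measurable_fun_fubini_tonelli_G G).
have Phi0 t : 0 <= Phi t by exact: integral_ge0.
have PhiP t : Phi (t + 2 * pi)%R = Phi t.
  apply: eq_integral => r _; rewrite /G /=.
  by have [-> ->] : cos (t + 2 * pi) = cos t /\ sin (t + 2 * pi) = sin t by have [] := circD2pi t.
have PhiE t : \int[mu]_(r in `[0%R, +oo[) (F (r * cos t, r * sin t)%R * r%:E) = Phi t.
  rewrite integral_mkcond; apply: eq_integral => r _.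
  rewrite patchE /G mem_setE in_itv/= andbT; case: ifPn => r0; first by rewrite max_l.
  by rewrite max_r ?mule0// ltW// ltNge.
have -> : \int[mu]_(t in `[a, (a + 2 * pi)%R[)
     \int[mu]_(r in `[0%R, +oo[) (F (r * cos t, r * sin t)%R * r%:E) = \int[mu]_(t in `[a, (a + 2 * pi)%R[) Phi t.
  by apply: eq_integral => t _; exact: PhiE.
rewrite (@ge0_integral_periodic R a (- (pi / 2))%R Phi mPhi Phi0 PhiP) (polar_half mF F0).
(* The points with r < 0 at the angle t are those with r > 0 at the angle t + pi; together they fill
   the full turn. *)
transitivity (\int[mu]_(t in `](- (pi / 2))%R, (pi / 2)%R[) (Phi t + Phi (t + pi)%R)).
  apply: eq_integral => t _.
  have -> : Phi (t + pi)%R = \int[mu]_r G (- r, t + pi)%R.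
    rewrite /Phi [LHS](@ge0_integral_scale _ (- 1)) ?oppr_eq0 ?oner_neq0//; last first.
      by apply: (measurableT_comp mG); exact: measurable_pair2.
    by apply: eq_integral => r _; rewrite normrN1 mule1 mulN1r.
  rewrite -ge0_integralD//.
  - apply: eq_integral => r _; rewrite /G/= cosDpi sinDpi !mulrNN.
    rewrite -ge0_muleDr ?lee_fin ?le_max ?lexx ?orbT//; congr (_ * _); rewrite -EFinD; congr EFin.
    have [r0|/ltW r0] := leP 0%R r.
      by rewrite max_r ?oppr_le0// addr0 ger0_norm.
    by rewrite max_l ?oppr_ge0// add0r ler0_norm.
  - by apply: (measurableT_comp mG); exact: measurable_pair2.
  - apply: (measurableT_comp mG); apply: measurable_fun_pair => //.

have mPhi' : measurable_fun setT (fun t : R => Phi (t + pi)%R).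
  by apply: (measurableT_comp mPhi); exact: measurable_funD.
rewrite ge0_integralD//; last 2 first.
- exact: measurable_funTS.
- exact: measurable_funTS.
have oo (H : R -> \bar R) : measurable_fun setT H -> \int[mu]_(t in `](- (pi / 2))%R, (pi / 2)%R[) H t =
    \int[mu]_(t in `[(- (pi / 2))%R, (pi / 2)%R[) H t.
  by move=> mH; apply/esym; apply: (@integral_itv_bndoo R _ _ H true true); exact: measurable_funTS.
rewrite (oo _ mPhi) (oo _ mPhi') (ge0_integral_itv_shift _ _ _ mPhi Phi0).
have pi0 := @pi_gt0 R.
rewrite (@ge0_integral_itv_cat _ (- (pi / 2))%R (pi / 2)%R (- (pi / 2) + 2 * pi)%R _ mPhi Phi0); last lra.
have -> : (- (pi / 2) + 2 * pi = pi / 2 + pi :> R)%R by lra.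
by have -> : (- (pi / 2) + pi = pi / 2 :> R)%R by lra.
Qed.
End polar.

Section polar_disc.
Context (R : realType).
Local Notation mu := (@lebesgue_measure R).
Local Notation T1 := (measurableTypeR R).
Local Notation T2 := (T1 * T1)%type.

Definition pol (z : R * R) : R * R := (z.1 * cos z.2, z.1 * sin z.2).

(** The angles form a closed interval, so one null ray is covered twice; in return [rect 0] is a
    product with [0, 2 pi], the interval of [circle_int]. *)
Definition rect (a : R) : set T2 := `]0, 1[%classic `*` `[a, a + 2 * pi]%classic.

Lemma enorm_pol z : enorm (pol z) = `|z.1|.
Proof.
by rewrite /enorm /= !exprMn -mulrDr cos2Dsin2 mulr1 sqrtr_sqr.
Qed.

Lemma pol_circ r t : r *: circ t = pol (r, t).
Proof. by []. Qed.

Lemma measurable_rect a : measurable (rect a).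
Proof. by apply: measurableX; exact: measurable_itv. Qed.

Lemma measurable_enorm : measurable_fun [set: T2] (enorm : T2 -> R).
Proof.
apply: (measurableT_comp (f := @Num.sqrt R)).
  by apply: continuous_measurable_fun => x; exact: sqrt_continuous.
by apply: measurable_funD; apply: measurable_funX; [exact: measurable_fst|exact: measurable_snd].
Qed.

Lemma measurable_B1 : measurable (B1 : set T2).
Proof.
have -> : (B1 : set T2) = [set: T2] `&` (enorm @^-1` `]-oo, 1[).
  by rewrite setTI; apply/seteqP; split => x /=; rewrite in_itv.
by apply: measurable_enorm => //; exact: measurable_itv.
Qed.

Lemma rect_B1 a z : rect a z -> B1 (pol z).
Proof.
move=> [/=]; rewrite !in_itv/= => /andP[z0 z1] _.
by rewrite /B1/= enorm_pol gtr0_norm.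
Qed.

Lemma measurable_pol : measurable_fun [set: T2] (pol : T2 -> T2).
Proof.
apply: measurable_fun_pair => /=.
  apply: measurable_funM; first exact: measurable_fst.
  by apply: (measurableT_comp (@measurable_cos R)); exact: measurable_snd.
apply: measurable_funM; first exact: measurable_fst.
by apply: (measurableT_comp (@measurable_sin R)); exact: measurable_snd.
Qed.

Lemma measurable_pol_rect a d (U : measurableType d) (F : T2 -> U) : measurable_fun B1 F ->
  measurable_fun (rect a) (F \o pol).
Proof.
move=> mF; apply: (@measurable_comp _ _ _ _ _ _ B1 F).
- exact: measurable_B1.
- by move=> _ [z + <-]; exact: rect_B1.
- exact: mF.
- exact: measurable_funTS measurable_pol.
Qed.

Local Open Scope ereal_scope.

Lemma ge0_integral_B1 (a : R) (F : T2 -> \bar R) :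
  measurable_fun B1 F -> (forall x, B1 x -> 0 <= F x) ->
  \int[leb2]_(x in B1) F x = \int[leb2]_(z in rect a) (F (pol z) * z.1%:E).
Proof.
move=> mF F0.
have mB := measurable_B1.
pose F1 := F \_ B1.
have mF1 : measurable_fun [set: T2] F1 by exact/(measurable_restrictT _ _).1.
have F10 x : 0 <= F1 x.
  by rewrite /F1 patchE; case: ifPn => //; rewrite inE => /F0.
pose K z := F1 (pol z) * (Num.max z.1 0)%:E.
have K0 z : 0 <= K z by rewrite mule_ge0// lee_fin le_max lexx orbT.
have mK : measurable_fun [set: T2] K.
  apply: emeasurable_funM; first by apply: (measurableT_comp mF1); exact: measurable_pol.
  by apply/measurable_EFinP; apply: measurable_maxr => //; exact: measurable_fst.
have mKr t : measurable_fun setT (fun r => K (r, t)).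
  by apply: (measurableT_comp mK); exact: measurable_pair2.
have -> : \int[leb2]_(z in rect a) (F (pol z) * z.1%:E) = \int[leb2]_(z in rect a) K z.
  apply: eq_integral => z; rewrite inE => Dz; rewrite /K /F1 patchE ifT; last first.
    by rewrite inE; exact: rect_B1 Dz.
  case: Dz => /=; rewrite !in_itv/= => /andP[/ltW z0 _] _.
  by rewrite max_l.
rewrite [LHS]integral_mkcond -/F1 (ge0_integral_polar a)//.
have mKD D : measurable D -> measurable_fun [set: T2] (K \_ D).
  by move=> mD; apply/(measurable_restrictT _ _).1 => //; exact: measurable_funTS.
have KD0 D z : 0 <= (K \_ D) z by rewrite patchE; case: ifPn.
rewrite [RHS]integral_mkcond /leb2.
rewrite (fubini_tonelli2 (K \_ (rect a)) (mKD _ (measurable_rect a)) (KD0 _)) /fubini_G.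
pose D0 : set T2 := `]0%R, 1%R[%classic `*` setT.
have mD0 : measurable D0 by apply: measurableX => //; exact: measurable_itv.
transitivity (\int[mu]_(t in `[a, (a + 2 * pi)%R]) \int[mu]_(r in `]0%R, 1%R[) K (r, t)).
  rewrite -integral_itv_bndo_bndc; last first.
    apply: measurable_funTS.
    rewrite (_ : (fun _ => _) = fun t => \int[mu]_r (K \_ D0) (r, t)).
      exact: (measurable_fun_fubini_tonelli_G _ (mKD _ mD0) (KD0 _)).
    apply/funext => t; rewrite integral_mkcond; apply: eq_integral => r _.
    by rewrite !patchE in_setX in_setT andbT.
  apply: eq_integral => t _.
  rewrite -(@integral_itv_bndoo R 0%R 1%R _ true true); last exact: measurable_funTS.
  rewrite integral_mkcond [RHS]integral_mkcond; apply: eq_integral => r _.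
  rewrite !patchE !mem_setE !in_itv/= andbT /K /F1.
  have [r0|r0]//= := leP 0%R r.
  rewrite patchE.
  case: (ltP r 1%R) => r1 //.
  rewrite ifF ?mul0e//; apply/negP; rewrite inE => h.
  have : (enorm (pol (r, t)) < 1)%R := h.
  by rewrite enorm_pol/= ger0_norm// ltNge r1.
rewrite integral_mkcond; apply: eq_integral => t _.
rewrite patchE; case: ifPn => ta.
  rewrite [LHS]integral_mkcond; apply: eq_integral => r _.
  by rewrite !patchE in_setX ta andbT.
under [RHS]eq_integral do rewrite patchE in_setX (negbTE ta) andbF.
by rewrite integral0.
Qed.

End polar_disc.

Section polar_disc2.
Context (R : realType).
Local Notation mu := (@lebesgue_measure R).
Local Notation T1 := (measurableTypeR R).
Local Notation T2 := (T1 * T1)%type.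

Lemma measurable_funM_pol a (f : T2 -> R) : measurable_fun B1 f ->
  measurable_fun (rect a) (fun z => f (pol z) * z.1).
Proof.
move=> mf; apply: measurable_funM; first exact: (@measurable_pol_rect R a _ _ f mf).
by apply: measurable_funTS; exact: measurable_fst.
Qed.

Local Open Scope ereal_scope.

Lemma integral_B1 (a : R) (f : T2 -> R) : measurable_fun B1 f ->
  \int[leb2]_(x in B1) (f x)%:E = \int[leb2]_(z in rect a) (f (pol z) * z.1)%:E.
Proof.
move=> mf.
have mfE : measurable_fun B1 (EFin \o f) by exact/measurable_EFinP.
rewrite integralE [in RHS]integralE.
rewrite (ge0_integral_B1 a); last 2 first.
- exact: measurable_funepos.
- by move=> x _; exact: funepos_ge0.
rewrite (ge0_integral_B1 a); last 2 first.
- exact: measurable_funeneg.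
- by move=> x _; exact: funeneg_ge0.
have z0 z : z \in rect a -> (0 <= z.1)%R.
  by rewrite inE => -[/=]; rewrite in_itv/= => /andP[/ltW].
congr (_ - _); apply: eq_integral => z /z0 {}z0.
  by rewrite !funeposE /= -EFin_max -EFinM maxr_pMl// mul0r EFin_max.
by rewrite !funenegE /= -!EFin_max -EFinM maxr_pMl// mul0r mulNr.

Qed.

Lemma integrable_B1 (a : R) (f : T2 -> R) : measurable_fun B1 f ->
  leb2.-integrable B1 (EFin \o f) <->
  leb2.-integrable (rect a) (fun z => (f (pol z) * z.1)%:E).
Proof.
move=> mf.
have mfE : measurable_fun B1 (EFin \o f) by exact/measurable_EFinP.
have -> : leb2.-integrable B1 (EFin \o f) <-> \int[leb2]_(x in B1) `|(f x)%:E| < +oo.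
  by split=> [/integrableP[]//|h]; apply/integrableP.
have mg : measurable_fun (rect a) (fun z => (f (pol z) * z.1)%:E).
  by apply/measurable_EFinP; exact: measurable_funM_pol.
have -> : leb2.-integrable (rect a) (fun z => (f (pol z) * z.1)%:E) <->
    \int[leb2]_(z in rect a) `|(f (pol z) * z.1)%:E| < +oo.
  by split=> [/integrableP[]//|h]; apply/integrableP.
rewrite (ge0_integral_B1 a)//; last exact: measurableT_comp.
have -> // : \int[leb2]_(z in rect a) (`|(f (pol z))%:E| * z.1%:E) =
    \int[leb2]_(z in rect a) `|(f (pol z) * z.1)%:E|.
apply: eq_integral => z; rewrite inE => -[/=]; rewrite in_itv/= => /andP[z0 _] _.
by rewrite normrM (gtr0_norm z0).
Qed.

(** The area element [z.1] is positive on [rect a]; hence if the integral of an indicator vanishes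
    in the disc, the pulled back indicator vanishes almost everywhere. *)
Lemma ae_rect a (P : T2 -> Prop) : {ae leb2, forall x, B1 x -> P x} ->
  {ae (leb2 : {measure set T2 -> \bar R}), forall z, rect a z -> P (pol z)}.
Proof.
move=> [A [mA A0 PA]].
have mI : measurable_fun [set: T2] (fun x => (\1_A x : R)%:E).
  by apply/measurable_EFinP; exact: measurable_indic.
have : \int[leb2]_(x in B1) (\1_A x)%:E = 0.
  rewrite integral_indic//; last exact: measurable_B1.
  by apply: (subset_measure0 _ _ _ A0) => //; apply: measurableI => //; exact: measurable_B1.
rewrite (ge0_integral_B1 a); last 2 first.
- exact: measurable_funTS.
- by move=> x _; rewrite lee_fin.
move=> h.
have mK : measurable_fun (rect a) (fun z => (\1_A (pol z) * z.1)%:E).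
  apply/measurable_EFinP; apply: (@measurable_funM_pol a (\1_A)).
  by apply: measurable_funTS; exact: measurable_indic.
have : \int[leb2]_(z in rect a) `|(\1_A (pol z) * z.1)%:E| = 0.
  rewrite -[RHS]h; apply: eq_integral => z.
  rewrite inE => -[/=]; rewrite in_itv/= => /andP[z0 _] _.
  by rewrite normrM (gtr0_norm z0) ger0_norm.
move=> /(ae_eq_integral_abs _ (measurable_rect a) mK).
apply: filterS => z /= + Dz => /(_ Dz) [] /eqP.
rewrite mulf_eq0 => /orP[|]; last first.
  by case: Dz => /=; rewrite in_itv/= => /andP[/gt_eqF ->].
rewrite indicE pnatr_eq0 eqb0 notin_setE => nA.
apply: contrapT => nP; apply: nA; apply: PA => /=.
by move=> /(_ (rect_B1 Dz)).
Qed.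

Lemma ae_B1 a (f g : T2 -> R) : measurable_fun B1 f -> measurable_fun B1 g ->
  {ae leb2, forall z, rect a z -> f (pol z) = g (pol z)} ->
  {ae leb2, forall x, B1 x -> f x = g x}.
Proof.
move=> mf mg fg.
have mh : measurable_fun B1 (fun x => (f x - g x)%R) by exact: measurable_funB.
suff : ae_eq leb2 B1 (fun x => (f x - g x)%:E) (cst 0).
  by apply: filterS => x /= + Bx => /(_ Bx)[/eqP]; rewrite subr_eq0 => /eqP.
apply/ae_eq_integral_abs; first exact: measurable_B1.
  exact/measurable_EFinP.
rewrite (ge0_integral_B1 a)//; last by apply: measurableT_comp => //; exact/measurable_EFinP.
rewrite (ge0_ae_eq_integral (g := cst 0))//.
- exact: integral0.
- exact: measurable_rect.
- apply/measurable_EFinP; apply: (@measurable_funM_pol a (fun x => `|(f x - g x)|%R)).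
  exact: measurableT_comp.
- move=> z [/=]; rewrite in_itv/= => /andP[z0 _] _.
  by rewrite mule_ge0// lee_fin ltW.
- by move: fg; apply: filterS => z + Dz => /(_ Dz) -> /=; rewrite subrr normr0 mul0e.
Qed.

End polar_disc2.

(** * Fubini's theorem on rectangles, for real-valued integrals *)

Section fubini_box.
Context (R : realType).
Local Notation mu := (@lebesgue_measure R).
Local Notation T1 := (measurableTypeR R).
Local Notation T2 := (T1 * T1)%type.
Local Open Scope ereal_scope.
Variables (A B : set T1) (f : T2 -> R).
Hypotheses (mA : measurable A) (mB : measurable B)
  (intf : leb2.-integrable (A `*` B) (EFin \o f)).

Let g := (EFin \o f) \_ (A `*` B).
Let mAB : measurable (A `*` B). Proof. exact: measurableX. Qed.
Let intg : (mu \x mu).-integrable [set: T2] g.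
Proof. by move/(integrable_mkcond _ mAB) : intf. Qed.
Let mg : measurable_fun [set: T2] g. Proof. by case/integrableP : intg. Qed.

Let g1 y : y \in B -> (fun x => g (x, y)) = (fun x => (f (x, y))%:E) \_ A.
Proof. by move=> yB; apply/funext => x; rewrite /g !patchE in_setX yB andbT. Qed.
Let g2 x : x \in A -> (fun y => g (x, y)) = (fun y => (f (x, y))%:E) \_ B.
Proof. by move=> xA; apply/funext => y; rewrite /g !patchE in_setX xA. Qed.
Let g1N y : y \notin B -> (fun x => g (x, y)) = cst 0.
Proof. by move=> yB; apply/funext => x; rewrite /g !patchE in_setX (negbTE yB) andbF. Qed.
Let g2N x : x \notin A -> (fun y => g (x, y)) = cst 0.
Proof. by move=> xA; apply/funext => y; rewrite /g !patchE in_setX (negbTE xA). Qed.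

Lemma ae_integrable_box2 :
  {ae mu, forall y, B y -> mu.-integrable A (fun x => (f (x, y))%:E)}.
Proof.
have := ae_integrable2 intg; apply: filterS => y /= + /mem_set yB.
by rewrite g1// -integrable_mkcond.
Qed.

Let G := fubini_G mu g.
Let F := fubini_F mu g.

Let intG : mu.-integrable setT G.
Proof.
have mG := measurable_fubini_G intg.
apply/integrableP; split => //.
apply: le_lt_trans ((integrable21ltyP mu mu mg).1 intg).
apply: ge0_le_integral => //.
- exact: measurableT_comp.
- apply: (measurable_fun_fubini_tonelli_G (abse \o g)).
    exact: measurableT_comp.
  by move=> z /=; exact: abse_ge0.
- move=> y _; apply: le_abse_integral => //.
  by apply: (measurableT_comp mg); exact: measurable_pair2.
Qed.

Let GE : G = (fun y => \int[mu]_(x in A) (f (x, y))%:E) \_ B.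
Proof.
apply/funext => y; rewrite /G /fubini_G patchE; case: ifPn => yB.
  by rewrite g1// -integral_mkcond.
by rewrite g1N// integral0.
Qed.
Let FE : F = (fun x => \int[mu]_(y in B) (f (x, y))%:E) \_ A.
Proof.
apply/funext => y; rewrite /F /fubini_F patchE; case: ifPn => yB.
  by rewrite g2// -integral_mkcond.
by rewrite g2N// integral0.
Qed.
Let intG1 : mu.-integrable B (fun y => \int[mu]_(x in A) (f (x, y))%:E).
Proof. by apply/(integrable_mkcond _ mB); rewrite -GE. Qed.
Let intF1 : mu.-integrable A (fun x => \int[mu]_(y in B) (f (x, y))%:E).
Proof. by apply/(integrable_mkcond _ mA); rewrite -FE; exact: integrable_fubini_F. Qed.

Let fineK_ae (D : set T1) (h : T1 -> \bar R) : measurable D -> mu.-integrable D h ->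
  ae_eq mu D h (fun y => (fine (h y))%:E).
Proof.
move=> mD ih; have := integrable_ae mD ih; apply: filterS => y /= + Dy.
by move=> /(_ Dy) hy; rewrite fineK.
Qed.

Let fine_int (D : set T1) (h : T1 -> \bar R) : measurable D -> mu.-integrable D h ->
  mu.-integrable D (fun y => (fine (h y))%:E) /\
  \int[mu]_(y in D) h y = \int[mu]_(y in D) (fine (h y))%:E.
Proof.
move=> mD ih; have [mh hoo] := integrableP _ _ _ ih.
have mfh : measurable_fun D (fun y => (fine (h y))%:E).
  by apply/measurable_EFinP; apply: (measurableT_comp (@fine_measurable R setT measurableT)).
split; last by apply: ae_eq_integral => //; exact: fineK_ae.
apply/integrableP; split => //; apply: le_lt_trans hoo.
apply: ge0_le_integral => //.
- exact: measurableT_comp.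
- exact: measurableT_comp.
- by move=> x _; case: (h x) => //=; rewrite normr0 leey.
Qed.

Lemma integrable_box2 :
  mu.-integrable B (fun y => (\int[mu]_(x in A) f (x, y))%R%:E).
Proof. by have [] := fine_int mB intG1. Qed.

Lemma integrable_box1 :
  mu.-integrable A (fun x => (\int[mu]_(y in B) f (x, y))%R%:E).
Proof. by have [] := fine_int mA intF1. Qed.

Lemma Rintegral_box2 : (\int[leb2]_(z in A `*` B) f z =
   \int[mu]_(y in B) \int[mu]_(x in A) f (x, y))%R.
Proof.
rewrite /Rintegral; congr fine.
have [_ <-] := fine_int mB intG1.
rewrite [LHS]integral_mkcond /leb2 -(integral21_prod_meas1 intg) [RHS]integral_mkcond -GE.
by [].
Qed.

Lemma Rintegral_box1 : (\int[leb2]_(z in A `*` B) f z =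
   \int[mu]_(x in A) \int[mu]_(y in B) f (x, y))%R.
Proof.
rewrite /Rintegral; congr fine.
have [_ <-] := fine_int mA intF1.
rewrite [LHS]integral_mkcond /leb2 -(integral12_prod_meas1 intg) [RHS]integral_mkcond -FE.
by [].
Qed.

End fubini_box.

Section box_product.
Context (R : realType).
Local Notation mu := (@lebesgue_measure R).
Local Notation T1 := (measurableTypeR R).
Local Notation T2 := (T1 * T1)%type.
Local Open Scope ereal_scope.

Lemma integrable_box_mul (A B : set T1) (u v : T1 -> R) :
  measurable A -> measurable B ->
  mu.-integrable A (EFin \o u) -> mu.-integrable B (EFin \o v) ->
  leb2.-integrable (A `*` B) (fun z => (u z.1 * v z.2)%:E).
Proof.
move=> mA mB iu iv.
have [/measurable_EFinP mu' uoo] := integrableP _ _ _ iu.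
have [/measurable_EFinP mv voo] := integrableP _ _ _ iv.
have mAB : measurable (A `*` B) by exact: measurableX.
apply/(integrable_mkcond _ mAB).
rewrite (_ : _ \_ _ = fun z : T2 => ((u \_ A) z.1 * (v \_ B) z.2)%:E); last first.
  apply/funext => -[x y]; rewrite !patchE in_setX/=.
  by case: (x \in A) => //=; [case: (y \in B) => //=; rewrite mulr0|rewrite mul0r].
have mu1 : measurable_fun setT (u \_ A) by exact/(measurable_restrictT _ _).1.
have mv1 : measurable_fun setT (v \_ B) by exact/(measurable_restrictT _ _).1.
have mz : measurable_fun [set: T2] (fun z : T2 => ((u \_ A) z.1 * (v \_ B) z.2)%:E).
  apply/measurable_EFinP; apply: measurable_funM.
    by apply: (measurableT_comp mu1); exact: measurable_fst.
  by apply: (measurableT_comp mv1); exact: measurable_snd.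
apply/(integrable12ltyP mu mu mz).
have iu' : mu.-integrable setT (fun x => ((u \_ A) x)%:E).
  move/(integrable_mkcond _ mA) : iu; congr (_.-integrable _ _).
  by apply/funext => x; rewrite restrict_EFin.
have iv' : mu.-integrable setT (fun x => ((v \_ B) x)%:E).
  move/(integrable_mkcond _ mB) : iv; congr (_.-integrable _ _).
  by apply/funext => x; rewrite restrict_EFin.
have [_ uoo'] := integrableP _ _ _ iu'.
have [_ voo'] := integrableP _ _ _ iv'.
have -> : \int[mu]_x \int[mu]_y `|((u \_ A) x * (v \_ B) y)%:E| =
   (\int[mu]_x `|((u \_ A) x)%:E|) * (\int[mu]_y `|((v \_ B) y)%:E|).
  rewrite -ge0_integralZr//.
  - apply: eq_integral => x _; rewrite -ge0_integralZl//.
    + by apply: eq_integral => y _; rewrite EFinM abseM.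
    + by apply: measurableT_comp => //; exact/measurable_EFinP.
  - by apply: measurableT_comp => //; exact/measurable_EFinP.
  - exact: integral_ge0.
by rewrite lte_mul_pinfty// ?integral_ge0// ge0_fin_numE// integral_ge0.
Qed.

Lemma Rintegral_box_mul (A B : set T1) (u v : T1 -> R) :
  measurable A -> measurable B ->
  mu.-integrable A (EFin \o u) -> mu.-integrable B (EFin \o v) ->
  (\int[leb2]_(z in A `*` B) (u z.1 * v z.2) =
   (\int[mu]_(x in A) u x) * (\int[mu]_(y in B) v y))%R.
Proof.
move=> mA mB iu iv.
rewrite (@Rintegral_box1 _ A B (fun z => u z.1 * v z.2)%R)//; last first.
  exact: integrable_box_mul.
rewrite -RintegralZr//; apply: eq_Rintegral => x _ /=.
by rewrite RintegralZl.
Qed.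
End box_product.

Section polar_real.
Context (R : realType).
Local Notation mu := (@lebesgue_measure R).
Local Notation T1 := (measurableTypeR R).
Local Notation T2 := (T1 * T1)%type.

Lemma Rintegral_B1 a (f : T2 -> R) : measurable_fun B1 f ->
  \int[leb2]_(x in B1) f x = \int[leb2]_(z in rect a) (f (pol z) * z.1).
Proof. by move=> mf; rewrite /Rintegral (integral_B1 a). Qed.

Lemma ae_eq_Rintegral d (T : measurableType d) (m : {measure set T -> \bar R})
    (D : set T) (f g : T -> R) : measurable D ->
  measurable_fun D f -> measurable_fun D g ->
  {ae m, forall x, D x -> f x = g x} ->
  \int[m]_(x in D) f x = \int[m]_(x in D) g x.
Proof.
move=> mD mf mg fg; rewrite /Rintegral; congr fine.
apply: ae_eq_integral => //; first exact/measurable_EFinP.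
  exact/measurable_EFinP.
by apply: filterS fg => x /= + Dx => ->.
Qed.

Lemma ae_eq_integrable d (T : measurableType d) (m : {measure set T -> \bar R})
    (D : set T) (f g : T -> R) : measurable D ->
  measurable_fun D g ->
  {ae m, forall x, D x -> f x = g x} ->
  m.-integrable D (EFin \o f) -> m.-integrable D (EFin \o g).
Proof.
move=> mD mg fg /integrableP[mf foo].
apply/integrableP; split; first exact/measurable_EFinP.
have fgE : ae_eq m D (abse \o (EFin \o g)) (abse \o (EFin \o f)).
  by apply: filterS fg => x /= + Dx => ->.
have mgE : measurable_fun D (abse \o (EFin \o g)).
  by apply: measurableT_comp => //; exact/measurable_EFinP.
have mfE : measurable_fun D (abse \o (EFin \o f)) by exact: measurableT_comp.
have E := ge0_ae_eq_integral mD mgE mfE (fun x _ => abse_ge0 _) (fun x _ => abse_ge0 _) fgE.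
by rewrite E.
Qed.
End polar_real.

(** * Absolutely continuous functions of one variable *)

Section integrable1D.
Context (R : realType).
Local Notation mu := (@lebesgue_measure R).
Local Notation T1 := (measurableTypeR R).

Lemma integrable_mulb d (T : measurableType d) (m : {measure set T -> \bar R})
    (D : set T) (k g : T -> R) (C : R) : measurable D ->
  m.-integrable D (EFin \o k) -> measurable_fun D g ->
  (forall x, D x -> `|g x| <= C) -> m.-integrable D (fun x => (k x * g x)%:E).
Proof.
move=> mD ik mg gC.
have [/measurable_EFinP mk _] := integrableP _ _ _ ik.
apply: (@le_integrable _ _ _ _ _ mD _ (fun x => C%:E * (`|k x|)%:E)%E).
- by apply/measurable_EFinP; exact: measurable_funM.
- move=> x Dx /=; rewrite lee_fin normrM mulrC (ger0_norm (_ : 0 <= C * _)).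
    by rewrite ler_wpM2r ?gC.
  by rewrite mulr_ge0// (le_trans _ (gC x Dx)).
- apply: integrableZl => //.
  exact: (integrable_norm ik).
Qed.

Section integrable_real.
Context d (T : measurableType d) (m : {measure set T -> \bar R}) (D : set T).
Implicit Types f g : T -> R.
Hypothesis mD : measurable D.

Lemma integrable_eqR f g : (forall x, D x -> f x = g x) ->
  m.-integrable D (EFin \o f) -> m.-integrable D (EFin \o g).
Proof.
by move=> fg; apply: eq_integrable => // x; rewrite inE => Dx /=; rewrite fg.
Qed.

Lemma integrable_addR f g : m.-integrable D (EFin \o f) ->
  m.-integrable D (EFin \o g) -> m.-integrable D (fun x => (f x + g x)%:E).
Proof.
by move=> i1 i2; apply: (@eq_integrable _ _ _ _ _ mD _ _ _ (integrableD mD i1 i2)).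
Qed.

Lemma integrable_subR f g : m.-integrable D (EFin \o f) ->
  m.-integrable D (EFin \o g) -> m.-integrable D (fun x => (f x - g x)%:E).
Proof.
by move=> i1 i2; apply: (@eq_integrable _ _ _ _ _ mD _ _ _ (integrableB mD i1 i2)).
Qed.

Lemma integrable_scaleR c f : m.-integrable D (EFin \o f) ->
  m.-integrable D (fun x => (c * f x)%:E).
Proof.
by move=> i1; apply: (@eq_integrable _ _ _ _ _ mD _ _ _ (integrableZl mD c i1)).
Qed.
End integrable_real.

Lemma integrable_sub_itv (a b c e : R) (k : R -> R) : a <= c -> e <= b ->
  mu.-integrable `[a, b] (EFin \o k) -> mu.-integrable `[c, e] (EFin \o k).
Proof.
move=> ac eb; apply: integrableS => //.
move=> x /=; rewrite !in_itv/= => /andP[cx xe].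
by rewrite (le_trans ac) ?(le_trans xe).
Qed.

Lemma Rintegral_itv_cat (a b c : R) (k : R -> R) : a <= b -> b <= c ->
  mu.-integrable `[a, c] (EFin \o k) ->
  \int[mu]_(x in `[a, c]) k x = \int[mu]_(x in `[a, b]) k x + \int[mu]_(x in `[b, c]) k x.
Proof.
move=> ab bc ik.
rewrite -(@Rintegral_itv_obnd_cbnd _ b); last first.
  apply: (integrableS _ _ _ ik) => //; try exact: measurable_itv.
  by move=> x /=; rewrite !in_itv/= => /andP[/ltW bx ->]; rewrite (le_trans ab).
by rewrite -(Rintegral_itvB ik)// addrC subrK.
Qed.

Lemma integrable_within (a b : R) (g : R -> R) :
  {within `[a, b], continuous g} -> mu.-integrable `[a, b] (EFin \o g).
Proof.
by move=> cg; apply: continuous_compact_integrable => //; exact: segment_compact.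
Qed.

Lemma measurable_within (a b : R) (g : R -> R) :
  {within `[a, b], continuous g} -> measurable_fun `[a, b] g.
Proof.
by move=> cg; apply: subspace_continuous_measurable_fun => //; exact: measurable_itv.
Qed.
End integrable1D.

Section isAC.
Context (R : realType).
Local Notation mu := (@lebesgue_measure R).
Local Notation T1 := (measurableTypeR R).

Implicit Types (a b c e s x : R) (q k F f : R -> R).

(** Absolute continuity as an integral representation with a given density. Sums, products and end
    values then need only integration theory, and no differentiability at any point. *)
Definition isAC (a b : R) (q k : R -> R) : Prop :=
  mu.-integrable `[a, b] (EFin \o k) /\
  forall s, a <= s <= b -> q s = q a + \int[mu]_(x in `[a, s]) k x.

Lemma isAC_end a b q k : a <= b -> isAC a b q k ->
  q b - q a = \int[mu]_(x in `[a, b]) k x.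
Proof. by move=> ab [_ ->]; rewrite ?lexx ?ab// addrC addKr. Qed.

Lemma isAC_bounded a b q k : isAC a b q k ->
  forall s, a <= s <= b -> `|q s| <= `|q a| + \int[mu]_(x in `[a, b]) `|k x|.
Proof.
move=> [ik qk] s /[dup] /andP[sa sb] /qk ->.
rewrite (le_trans (ler_normD _ _))// lerD2l.
have iks : mu.-integrable `[a, s] (EFin \o k) by exact: integrable_sub_itv ik.
rewrite (le_trans (le_normr_Rintegral _ iks))//.
rewrite [leRHS](@Rintegral_itv_cat _ a s b)//; last exact: (integrable_norm ik).
by rewrite lerDl Rintegral_ge0.
Qed.

Lemma isAC_continuous a b q k : isAC a b q k -> {within `[a, b], continuous q}.
Proof.
move=> [ik qk].
have [ab|ab] := ltP b a.
  by rewrite set_itv_ge -?leNgt ?bnd_simp//; exact: continuous_subspace0.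
have c1 : {within `[a, b], continuous (fun s => q a + \int[mu]_(x in `[a, s]) k x)}.
  by move=> x; apply: cvgD; [exact: cvg_cst|exact: parameterized_integral_continuous].
apply: subspace_eq_continuous c1 => x xab /=; apply/esym/qk.
by move: xab; rewrite inE/= in_itv.
Qed.

Lemma isAC_C1 a b (F f : R -> R) :
  (forall x, a <= x <= b -> is_derive x 1 F (f x)) ->
  (forall x, a <= x <= b -> {for x, continuous f}) -> isAC a b F f.
Proof.
move=> dF cf; split.
  apply: integrable_within; apply: continuous_in_subspaceT => x.
  by rewrite inE/= in_itv/=; exact: cf.
move=> s /andP[sa sb].
have dF' x : a <= x <= s -> is_derive x 1 F (f x).
  by move=> /andP[ax xs]; apply: dF; rewrite ax (le_trans xs).
have cf' x : a <= x <= s -> {for x, continuous f}.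
  by move=> /andP[ax xs]; apply: cf; rewrite ax (le_trans xs).
by rewrite /Rintegral (integral_derive sa dF' cf')/= addrC subrK.
Qed.

Lemma isAC_cst a b c : isAC a b (cst c) (cst 0).
Proof.
by apply: isAC_C1 => // x _; exact: cst_continuous.
Qed.

Lemma isAC_add a b q1 k1 q2 k2 : isAC a b q1 k1 -> isAC a b q2 k2 ->
  isAC a b (fun x => q1 x + q2 x) (fun x => k1 x + k2 x).
Proof.
move=> [i1 e1] [i2 e2]; split.
  by apply: integrable_addR => //; exact: measurable_itv.
move=> s sab; rewrite e1// e2// RintegralD//; first by rewrite addrACA.
  by case/andP : sab => sa sb; exact: integrable_sub_itv i1.
by case/andP : sab => sa sb; exact: integrable_sub_itv i2.
Qed.

Lemma isAC_scale a b c q k : isAC a b q k ->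
  isAC a b (fun x => c * q x) (fun x => c * k x).
Proof.
move=> [i1 e1]; split.
  by apply: integrable_scaleR => //; exact: measurable_itv.
move=> s sab; rewrite e1// RintegralZl//; first by rewrite mulrDr.
by case/andP : sab => sa sb; exact: integrable_sub_itv i1.
Qed.

Lemma isAC_eq a b q k q' k' : {in `[a, b], q =1 q'} -> {in `[a, b], k =1 k'} ->
  isAC a b q k -> isAC a b q' k'.
Proof.
move=> qq kk [i1 e1]; split.
  by apply: integrable_eqR i1 => // x /= xab; exact: kk.
move=> s sab; rewrite -qq ?in_itv// e1//.
have ab : a <= b by case/andP: sab; exact: le_trans.
rewrite -qq ?in_itv/= ?lexx//; congr (_ + _); apply: eq_Rintegral => x.
rewrite inE/= in_itv/= => /andP[ax xs]; apply: kk; rewrite in_itv/= ax (le_trans xs)//.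
by case/andP: sab.
Qed.

Lemma isAC_integrable_mul a b k q k' : mu.-integrable `[a, b] (EFin \o k) ->
  isAC a b q k' -> mu.-integrable `[a, b] (fun x => (k x * q x)%:E).
Proof.
move=> ik qk; apply: (integrable_mulb _ ik) => //.
- by apply: measurable_within; exact: isAC_continuous qk.
- by move=> x /=; rewrite in_itv/=; exact: isAC_bounded qk x.
Qed.

(* Fubini on a square cut along its diagonal. *)
Lemma Rintegral_square_split (a b : R) (k1 k2 : R -> R) : a <= b ->
  mu.-integrable `[a, b] (EFin \o k1) -> mu.-integrable `[a, b] (EFin \o k2) ->
  (\int[mu]_(x in `[a, b]) k1 x) * (\int[mu]_(x in `[a, b]) k2 x) =
  \int[mu]_(x in `[a, b]) (k1 x * \int[mu]_(y in `[a, x]) k2 y +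
                           k2 x * \int[mu]_(y in `[a, x]) k1 y).
Proof.
move=> ab i1 i2.
pose A : set T1 := `[a, b]%classic.
have mA : measurable A by exact: measurable_itv.
pose L : set (T1 * T1) := [set z | z.2 <= z.1].
have mL : measurable L.
  have -> : L = (setT `&` (fun z : T1 * T1 => z.1 - z.2) @^-1` `[0, +oo[%classic).
    by rewrite setTI; apply/seteqP; split => z /=; rewrite in_itv/= andbT subr_ge0.
  have : measurable_fun setT (fun z : T1 * T1 => z.1 - z.2).
    by apply: measurable_funB; [exact: measurable_fst|exact: measurable_snd].
  by apply => //; exact: measurable_itv.
have i12 := integrable_box_mul mA mA i1 i2.
have mAA : measurable (A `*` A) by exact: measurableX.
have mLi : measurable_fun (A `*` A) (\1_L : T1 * T1 -> R) by exact: measurable_indic.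
have iL1 : leb2.-integrable (A `*` A) (fun z : T1 * T1 => ((k1 z.1 * k2 z.2) * \1_L z)%:E).
  apply: (integrable_mulb (C := 1) mAA i12 mLi) => x _.
  by rewrite indicE; case: (_ \in _); rewrite ?normr1// normr0.
have iL2 : leb2.-integrable (A `*` A) (fun z : T1 * T1 => ((k1 z.1 * k2 z.2) * (1 - \1_L z))%:E).
  apply: (integrable_mulb (C := 1) mAA i12) => //.
    by apply: measurable_funB.
  move=> x _.
  by rewrite indicE; case: (_ \in _); rewrite ?subrr ?normr0 ?subr0 ?normr1.
have -> : (\int[mu]_(x in A) k1 x) * (\int[mu]_(x in A) k2 x) =
   \int[leb2]_(z in A `*` A) (k1 z.1 * k2 z.2 * \1_L z) +
   \int[leb2]_(z in A `*` A) (k1 z.1 * k2 z.2 * (1 - \1_L z)).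
  rewrite -RintegralD// -Rintegral_box_mul//; apply: eq_Rintegral => z _.
  by rewrite -mulrDr addrC subrK mulr1.
have E1 x : x \in A -> \int[mu]_(y in A) (k1 x * k2 y * \1_L (x, y)) = k1 x * \int[mu]_(y in `[a, x]) k2 y.
  rewrite inE /A/= in_itv/= => /andP[ax xb].
  rewrite -RintegralZl//; last exact: integrable_sub_itv i2.
  rewrite [LHS]Rintegral_mkcond [RHS]Rintegral_mkcond; apply: eq_Rintegral => y _.
  rewrite !patchE !mem_setE !in_itv/= indicE /L/=.
  case: (leP a y) => //= ay.
  have [yx|yx] := leP y x.
    by rewrite (le_trans yx xb) mem_set// mulr1.
  by rewrite memNset ?mulr0 ?if_same// /= => /(lt_le_trans yx); rewrite ltxx.
have E2 y : y \in A -> \int[mu]_(x in A) (k1 x * k2 y * (1 - \1_L (x, y))) = k2 y * \int[mu]_(x in `[a, y]) k1 x.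
  rewrite inE /A/= in_itv/= => /andP[ax xb].
  have iy : mu.-integrable `[a, y] (EFin \o k1) by exact: integrable_sub_itv i1.
  rewrite -RintegralZl//.
  rewrite -[RHS]Rintegral_itv_bndo_bndc; last first.
    have i3 : mu.-integrable `[a, y] (fun x => (k2 y * k1 x)%:E) by exact: integrable_scaleR.
    by apply: (integrableS _ _ _ i3) => //; exact: subset_itv_co_cc.
  rewrite [LHS]Rintegral_mkcond [RHS]Rintegral_mkcond; apply: eq_Rintegral => x _.
  rewrite !patchE !mem_setE !in_itv/= indicE /L/=.
  case: (leP a x) => //= ax'.
  have [yx|yx] := ltP x y.
    by rewrite (le_trans (ltW yx) xb) memNset/= ?subr0 ?mulr1 1?mulrC//; apply/negP; rewrite -ltNge.
  by rewrite mem_set// subrr mulr0 if_same.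
rewrite (@Rintegral_box1 _ A A (fun z => k1 z.1 * k2 z.2 * \1_L z))//.
rewrite (@Rintegral_box2 _ A A (fun z => k1 z.1 * k2 z.2 * (1 - \1_L z)))//=.
have := integrable_box1 mA mA iL1; have := integrable_box2 mA mA iL2 => /= j2 j1.
rewrite RintegralD//.
- by congr (_ + _); apply: eq_Rintegral => x xA; rewrite ?E1 ?E2.
- by apply: eq_integrable j1 => // x xA /=; rewrite E1.
- by apply: eq_integrable j2 => // x xA /=; rewrite E2.
Qed.

(** Integration by parts. After subtraction of the values at [a] both factors are integrals over
    [a, s], and their product is [Rintegral_square_split]. *)
Lemma isAC_mul a b q1 k1 q2 k2 : isAC a b q1 k1 -> isAC a b q2 k2 ->
  isAC a b (fun x => q1 x * q2 x) (fun x => k1 x * q2 x + q1 x * k2 x).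
Proof.
move=> q1k1 q2k2; have [i1 e1] := q1k1; have [i2 e2] := q2k2.
have i12 := isAC_integrable_mul i1 q2k2.
have i21 := isAC_integrable_mul i2 q1k1.
have i21' : mu.-integrable `[a, b] (fun x => (q1 x * k2 x)%:E).
  by apply: eq_integrable i21 => // x _; rewrite mulrC.
split; first by apply: integrable_addR => //; exact: measurable_itv.
move=> s /[dup] sab /andP[sa sb].
have sub (k : R -> R) : mu.-integrable `[a, b] (EFin \o k) -> mu.-integrable `[a, s] (EFin \o k).
  exact: integrable_sub_itv.
have kk := Rintegral_square_split sa (sub _ i1) (sub _ i2).
have E : \int[mu]_(x in `[a, s]) (k1 x * q2 x + q1 x * k2 x) =
   \int[mu]_(x in `[a, s]) ((k1 x * \int[mu]_(y in `[a, x]) k2 y +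
                           k2 x * \int[mu]_(y in `[a, x]) k1 y) + (q2 a * k1 x + q1 a * k2 x)).
  apply: eq_Rintegral => x; rewrite inE/= in_itv/= => /andP[ax xs].
  have xab : a <= x <= b by rewrite ax (le_trans xs).
  by rewrite (e1 x xab) (e2 x xab); ring.
have j1 : mu.-integrable `[a, s] (EFin \o (fun x => q2 a * k1 x)).
  by apply: integrable_scaleR; [exact: measurable_itv|exact: sub].
have j2 : mu.-integrable `[a, s] (EFin \o (fun x => q1 a * k2 x)).
  by apply: integrable_scaleR; [exact: measurable_itv|exact: sub].
have AC0 (k : R -> R) : mu.-integrable `[a, b] (EFin \o k) ->
    isAC a b (fun x => \int[mu]_(y in `[a, x]) k y) k.
  by move=> ik; split => // t _; rewrite set_itv1 Rintegral_set1 add0r.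
rewrite E RintegralD//.
- rewrite -kk RintegralD// !RintegralZl//; last exact: sub.
    by rewrite (e1 s sab) (e2 s sab); ring.
  exact: sub.
- apply: integrable_addR => //.
  + exact: (sub _ (isAC_integrable_mul i1 (AC0 _ i2))).
  + exact: (sub _ (isAC_integrable_mul i2 (AC0 _ i1))).
- exact: integrable_addR.
Qed.

(** The form in which energies are estimated from below: the integrand dominates an exact
    derivative. *)
Lemma isAC_le a b q k F : a <= b -> isAC a b q k ->
  mu.-integrable `[a, b] (EFin \o F) -> (forall x, a <= x <= b -> k x <= F x) ->
  q b - q a <= \int[mu]_(x in `[a, b]) F x.
Proof.
move=> ab qk iF kF; rewrite (isAC_end ab qk); apply: le_Rintegral => //.
by case: qk.
Qed.

End isAC.

(** * Completeness of the trigonometric system *)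

Section trig_complete.
Context (R : realType).
Local Notation mu := (@lebesgue_measure R).
Local Notation T1 := (measurableTypeR R).
Local Notation A := (`[0, 2 * pi]%classic : set T1).

Let mA : measurable A. Proof. exact: measurable_itv. Qed.

Lemma is_derive_cosM (w x : R) : is_derive x 1 (fun t => cos (w * t)) (- w * sin (w * x)).
Proof. by apply: is_derive_eq; rewrite /GRing.scale/=; ring. Qed.

Lemma is_derive_sinM (w x : R) : is_derive x 1 (fun t => sin (w * t)) (w * cos (w * x)).
Proof. by apply: is_derive_eq; rewrite /GRing.scale/=; ring. Qed.

Lemma continuous_cosM (w : R) : continuous (fun t => cos (w * t)).
Proof.
move=> x; apply: differentiable_continuous; apply/derivable1_diffP.
by have [] := is_derive_cosM w x.
Qed.
Lemma continuous_sinM (w : R) : continuous (fun t => sin (w * t)).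
Proof.
move=> x; apply: differentiable_continuous; apply/derivable1_diffP.
by have [] := is_derive_sinM w x.
Qed.

Let intMc (V : R -> R) w : {within A, continuous V} -> mu.-integrable A (fun t => (V t * cos (w * t))%:E).
Proof.
move=> cV; apply: (integrable_mulb (C := 1) mA (integrable_within cV)).
  by apply: measurable_funTS; apply: continuous_measurable_fun; exact: continuous_cosM.
by move=> x _; exact: cos_max.
Qed.
Let intMs (V : R -> R) w : {within A, continuous V} -> mu.-integrable A (fun t => (V t * sin (w * t))%:E).
Proof.
move=> cV; apply: (integrable_mulb (C := 1) mA (integrable_within cV)).
  by apply: measurable_funTS; apply: continuous_measurable_fun; exact: continuous_sinM.
by move=> x _; exact: sin_max.
Qed.

(** Trigonometric polynomials with values in [0, 1] that concentrate at [tau] as [n] grows. *)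
Let kern (tau : R) n (t : R) := ((1 + cos (t - tau)) / 2) ^+ n.

Let continuous_kern tau n : continuous (kern tau n).
Proof.
move=> x; apply: (@cvg_comp _ _ _ (fun t => (1 + cos (t - tau)) / 2) (fun y : R => y ^+ n)); last exact: exprn_continuous.
apply: cvgMl; apply: cvgD; first exact: cvg_cst.
apply: (@cvg_comp _ _ _ (fun t => t - tau) cos); last exact: continuous_cos.
by apply: cvgB; [exact: cvg_id|exact: cvg_cst].
Qed.

Let kern_orth (V : R -> R) tau : {within A, continuous V} ->
  (forall z : int, \int[mu]_(t in A) (V t * cos (z%:~R * t)) = 0) ->
  (forall z : int, \int[mu]_(t in A) (V t * sin (z%:~R * t)) = 0) ->
  forall n, \int[mu]_(t in A) (V t * kern tau n t) = 0.
Proof.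
move=> cV Vc Vs n.
have cVk m : {within A, continuous (fun t => V t * kern tau m t)}.
  move=> x; apply: cvgM; first exact: cV.
  by apply: continuous_subspaceT; exact: continuous_kern.
(* Raising the power of the kernel by one shifts frequencies by one in both directions, so the
   induction carries all integer frequencies at once. *)
suff H m (z : int) : \int[mu]_(t in A) (V t * kern tau m t * cos (z%:~R * t)) = 0 /\
    \int[mu]_(t in A) (V t * kern tau m t * sin (z%:~R * t)) = 0.
  have [h _] := H n 0; rewrite -[RHS]h.
  by apply: eq_Rintegral => t _; rewrite mul0r cos0 mulr1.
elim: m z => [|m IHm] z.
  split; [rewrite -[RHS](Vc z)|rewrite -[RHS](Vs z)];
    by apply: eq_Rintegral => t _; rewrite /kern expr0 mulr1.
pose W := fun t => V t * kern tau m t.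
have cW : {within A, continuous W} by exact: cVk.
have IHc (y : int) : \int[mu]_(t in A) (W t * cos (y%:~R * t)) = 0 by have [] := IHm y.
have IHs (y : int) : \int[mu]_(t in A) (W t * sin (y%:~R * t)) = 0 by have [] := IHm y.
have ic (w : R) c : mu.-integrable A (fun t => (c * (W t * cos (w * t)))%:E).
  by apply: integrable_scaleR => //; exact: intMc.
have js (w : R) c : mu.-integrable A (fun t => (c * (W t * sin (w * t)))%:E).
  by apply: integrable_scaleR => //; exact: intMs.
have lin (c1 c2 c3 c4 c5 c6 : R) (y1 y2 y3 y4 : int) :
    \int[mu]_(t in A) (c1 * (W t * cos (y1%:~R * t)) + c2 * (W t * cos (y2%:~R * t)) +
      (c3 * (W t * sin (y3%:~R * t)) + c4 * (W t * sin (y4%:~R * t))) +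
      (c5 * (W t * cos (z%:~R * t)) + c6 * (W t * sin (z%:~R * t)))) = 0.
  have i1 := integrable_addR mA (ic y1%:~R c1) (ic y2%:~R c2).
  have i2 := integrable_addR mA (js y3%:~R c3) (js y4%:~R c4).
  have i3 := integrable_addR mA (ic z%:~R c5) (js z%:~R c6).
  have i4 := integrable_addR mA i1 i2.
  rewrite (RintegralD mA i4 i3) (RintegralD mA i1 i2).
  rewrite (RintegralD mA (ic _ _) (ic _ _)) (RintegralD mA (js _ _) (js _ _)).
  rewrite (RintegralD mA (ic _ _) (js _ _)).
  rewrite !(RintegralZl _ mA (intMc _ cW)) !(RintegralZl _ mA (intMs _ cW)).
  by rewrite !IHc !IHs !mulr0 !addr0.
have cosS (y : int) t : cos (y%:~R * t + t) = cos ((y + 1)%:~R * t).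
  by congr cos; rewrite intrD mulrDl mul1r.
have cosP (y : int) t : cos (y%:~R * t - t) = cos ((y - 1)%:~R * t).
  by congr cos; rewrite intrB mulrBl mul1r.
have sinS (y : int) t : sin (y%:~R * t + t) = sin ((y + 1)%:~R * t).
  by congr sin; rewrite intrD mulrDl mul1r.
have sinP (y : int) t : sin (y%:~R * t - t) = sin ((y - 1)%:~R * t).
  by congr sin; rewrite intrB mulrBl mul1r.
split.
- rewrite -[RHS](lin (cos tau / 4) (cos tau / 4) (sin tau / 4) (- sin tau / 4) (1 / 2) 0
    (z + 1) (z - 1) (z + 1) (z - 1)).
  apply: eq_Rintegral => t _; rewrite -cosS -cosP -sinS -sinP cosD cosB sinD sinB /W /kern exprS cosB.
  by field.
- rewrite -[RHS](lin (- sin tau / 4) (sin tau / 4) (cos tau / 4) (cos tau / 4) 0 (1 / 2)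
    (z + 1) (z - 1) (z + 1) (z - 1)).
  apply: eq_Rintegral => t _; rewrite -cosS -cosP -sinS -sinP cosD cosB sinD sinB /W /kern exprS cosB.
  by field.
Qed.

Lemma cos_lt (x y : R) : 0 <= x -> x < y -> y <= pi -> cos y < cos x.
Proof.
move=> x0 xy ypi; rewrite ltr_cos// in_itv/=.
  by apply/andP; split; lra.
by apply/andP; split; lra.
Qed.

Lemma cos_le (x y : R) : 0 <= x -> x <= y -> y <= pi -> cos y <= cos x.
Proof.
by move=> x0; rewrite le_eqVlt => /predU1P[->//|xy ypi]; rewrite ltW// cos_lt.
Qed.

(** If [V tau > 0], the points near [tau] contribute at least [V tau / 2 * a ^+ n * eta], while the
    points where [V] may be negative contribute at most [C * b ^+ n * (2 * pi)] in absolute value,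
    with [b < a]. For large [n] the integral cannot vanish. *)
Let kern_pos (V : R -> R) tau C : {within A, continuous V} ->
  (forall t, A t -> `|V t| <= C) -> 0 < tau < 2 * pi ->
  (forall n, \int[mu]_(t in A) (V t * kern tau n t) = 0) -> V tau <= 0.
Proof.
move=> cV VC /andP[tau0 tau2] VK; rewrite leNgt; apply/negP => v0.
have Atau : A tau by rewrite /= in_itv/= !ltW.
have C0 : 0 <= C by rewrite (le_trans _ (VC _ Atau)).
have pi2 := @pi_ge2 R.
have /subspace_continuousP /(_ tau Atau) /cvgrPdist_lt := cV.
have v2 : 0 < V tau / 2 by rewrite divr_gt0.
move=> /(_ _ v2) [e /= e0 eV].
have Ve t : A t -> `|tau - t| < e -> V tau / 2 < V t.
  move=> At te; have : `|V tau - V t| < V tau / 2 := eV t te At.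
  by rewrite ltr_norml => /andP[_ h]; lra.
(* The last two bounds keep the window inside [0, 2 pi] and prevent a point outside it from being
   close to [tau] modulo 2 pi. *)
pose eta := Num.min (e / 2) (Num.min (1 / 2) (Num.min tau (2 * pi - tau))).
have eta0 : 0 < eta.
  by rewrite /eta !lt_min !divr_gt0//= tau0 subr_gt0.
have [etae eta1 etat etat2] : [/\ eta < e, eta <= 1 / 2, eta <= tau & eta <= 2 * pi - tau].
  have h := lexx eta; rewrite {2}/eta !le_min in h; case/and4P : h => h1 h2 h3 h4.
  by split => //; rewrite (le_lt_trans h1)// ltr_pdivrMr// ltr_pMr// ltr1n.
clearbody eta; pose a := (1 + cos (eta / 2)) / 2; pose b := (1 + cos eta) / 2.
have ce : cos eta < cos (eta / 2).
  by apply: cos_lt; lra.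
have c0 : 0 < cos eta by apply: cos_gt0_pihalf; apply/andP; split; lra.
have b0 : 0 < b by rewrite /b; lra.
have ba : b < a by rewrite /a /b; lra.
have a0 : 0 < a by exact: lt_trans ba.
have hb t : 0 <= (1 + cos (t - tau)) / 2.
  by rewrite divr_ge0//; have := cos_geN1 (t - tau); lra.
have kern_ge0 n t : 0 <= kern tau n t by rewrite exprn_ge0.
have kern_ge n t : `|tau - t| <= eta / 2 -> a ^+ n <= kern tau n t.
  move=> h; apply: lerXn2r; rewrite ?nnegrE ?hb ?(ltW a0)//.
  rewrite /a ler_pM2r ?invr_gt0// lerD2l -[cos (t - tau)]cos_norm distrC.
  by apply: cos_le => //; lra.
have kern_le n t : A t -> eta < `|tau - t| -> kern tau n t <= b ^+ n.
  rewrite /= in_itv/= => /andP[t0 t2] h.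
  apply: lerXn2r; rewrite ?nnegrE ?hb ?(ltW b0)//.
  rewrite /b ler_pM2r ?invr_gt0// lerD2l -[cos (t - tau)]cos_norm distrC.
  have tt : `|tau - t| <= 2 * pi - eta by rewrite ler_norml; apply/andP; split; lra.
  have [hp|hp] := leP `|tau - t| pi.
    by apply: cos_le => //; lra.
  have -> : cos `|tau - t| = cos (2 * pi - `|tau - t|).
    by rewrite -[RHS]cosN opprB -[RHS]cosD2pi -[pi *+ 2]mulr_natl subrK.
  by apply: cos_le => //; lra.
pose S := `[tau - eta / 2, tau + eta / 2]%classic : set T1.
have SA : S `<=` A.
  move=> t St; have : t \in `[tau - eta / 2, tau + eta / 2] := St.
  by rewrite /= !in_itv/= => /andP[h1 h2]; apply/andP; split; lra.
have mS : measurable S by exact: measurable_itv.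
have main n : V tau / 2 * a ^+ n * eta <= C * b ^+ n * (2 * pi).
  have ic c : mu.-integrable A (EFin \o cst c : T1 -> \bar R).
    by apply: integrable_within; apply: continuous_subspaceT => x; exact: cvg_cst.
  have iS c : mu.-integrable A (fun t => (c * \1_S t)%:E).
    apply: (integrable_mulb (C := 1) mA (ic c)) => [|x _].
      by apply: measurable_indic.
    by rewrite indicE; case: (_ \in _); rewrite ?normr1// normr0.
  have cVk : {within A, continuous (fun t => V t * kern tau n t)}.
    move=> x; apply: cvgM; first exact: cV.
    by apply: continuous_subspaceT; exact: continuous_kern.
  have : \int[mu]_(t in A) (V tau / 2 * a ^+ n * \1_S t - C * b ^+ n) <= 0.
    rewrite -[leRHS](VK n); apply: le_Rintegral => //.
    - exact: integrable_subR (iS _) (ic _).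
    - exact: integrable_within.
    move=> t At; rewrite indicE.
    have Cb : 0 <= C * b ^+ n by rewrite mulr_ge0// exprn_ge0// ltW.
    have [tS|tS] := boolP (t \in S).
      have h : `|tau - t| <= eta / 2.
        by move: tS; rewrite inE /S/= in_itv/= ler_norml => /andP[? ?]; apply/andP; split; lra.
      rewrite mulr1 (@le_trans _ _ (V tau / 2 * a ^+ n))//; first by rewrite lerBlDr lerDl.
      rewrite ler_pM ?kern_ge// ?exprn_ge0 ?ltW//.
      by apply: Ve => //; rewrite (le_lt_trans h)// (lt_trans _ etae)//; lra.
    rewrite mulr0 sub0r.
    have [h|h] := leP `|tau - t| eta.
      rewrite (@le_trans _ _ 0)// ?oppr_le0// mulr_ge0//.
      by rewrite ltW// (lt_trans v2)// Ve// (le_lt_trans h).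
    have Vk : `|V t * kern tau n t| <= C * b ^+ n.
      by rewrite normrM (ger0_norm (kern_ge0 _ _)) ler_pM ?kern_le ?VC.
    by move: Vk; rewrite ler_norml => /andP[].
  rewrite RintegralB// ?subr_le0; [|exact: (iS _)|exact: (ic _)].
  have -> : \int[mu]_(t in A) (V tau / 2 * a ^+ n * \1_S t) = V tau / 2 * a ^+ n * eta.
    transitivity (\int[mu]_(t in S) (V tau / 2 * a ^+ n)).
      rewrite -[in RHS](setIidr SA) Rintegral_mkcondr; apply: eq_Rintegral => t _.
      by rewrite patchE indicE; case: (t \in S); rewrite ?mulr1// mulr0.
    rewrite Rintegral_cst//; congr (_ * _); rewrite /= lebesgue_measure_itv/= lte_fin.
    by rewrite ifT; [rewrite -EFinD /=; lra|lra].
  rewrite Rintegral_cst//= lebesgue_measure_itv/= lte_fin.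
  by rewrite ifT; [rewrite -EFinD /= subr0|lra].
have lim0 : (C * (2 * pi) * (b / a) ^+ n @[n --> \oo] --> C * (2 * pi) * 0).
  apply: cvgMr; apply: cvg_expr.
  have q0 : 0 <= b / a by rewrite divr_ge0// ltW.
  by rewrite (ger0_norm q0) ltr_pdivrMr ?mul1r.
rewrite mulr0 in lim0.
have ve : 0 < V tau / 2 * eta by rewrite mulr_gt0.
have /cvgrPdist_lt /(_ _ ve) [N _ /(_ N (leqnn N))/=] := lim0.
rewrite sub0r normrN ltNge => /negP; apply.
rewrite (le_trans _ (ler_norm _))// -(ler_pM2r (exprn_gt0 N a0)).
have aN0 : a ^+ N != 0 by rewrite expf_neq0// gt_eqF.
rewrite (expr_div_n b a) (_ : C * (2 * pi) * (b ^+ N / a ^+ N) * a ^+ N = C * b ^+ N * (2 * pi)); last by field.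
by rewrite mulrAC main.
Qed.

(** The kernel argument needs a continuous function, so it is applied to the primitive [U] minus its
    mean. [U] vanishes at both ends, and integration by parts transfers the orthogonality of [u] to
    all nonconstant modes. Hence [U] is constant, and [u] is its derivative almost everywhere. *)
Lemma trig_complete (u : R -> R) : mu.-integrable A (EFin \o u) ->
  (forall n : nat, \int[mu]_(t in A) (u t * cos (n%:R * t)) = 0) ->
  (forall n : nat, \int[mu]_(t in A) (u t * sin (n%:R * t)) = 0) ->
  {ae mu, forall t, A t -> u t = 0}.
Proof.
move=> iu uc us.
have pi0 := @pi_gt0 R.
have pi20 : 0 <= 2 * pi :> R by rewrite mulr_ge0// ltW.
pose U t := \int[mu]_(x in `[0, t]) u x.
have ACU : isAC 0 (2 * pi) U u.
  by split => // t _; rewrite /U set_itv1 Rintegral_set1 add0r.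
have U0 : U 0 = 0 by rewrite /U set_itv1 Rintegral_set1.
have U1 : U (2 * pi) = 0.
  by rewrite -[RHS](uc 0%N); apply: eq_Rintegral => t _; rewrite mul0r cos0 mulr1.
have cU := isAC_continuous ACU.
have ACc (w : R) : isAC 0 (2 * pi) (fun t => cos (w * t)) (fun t => - w * sin (w * t)).
  apply: isAC_C1 => x _; first exact: is_derive_cosM.
  by apply: cvgMr; exact: continuous_sinM.
have ACs (w : R) : isAC 0 (2 * pi) (fun t => sin (w * t)) (fun t => w * cos (w * t)).
  apply: isAC_C1 => x _; first exact: is_derive_sinM.
  by apply: cvgMr; exact: continuous_cosM.
have iuc (w : R) : mu.-integrable A (fun t => (u t * cos (w * t))%:E).
  exact: isAC_integrable_mul iu (ACc w).
have ius (w : R) : mu.-integrable A (fun t => (u t * sin (w * t))%:E).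
  exact: isAC_integrable_mul iu (ACs w).
have Uc (n : nat) : \int[mu]_(t in A) (U t * cos (n.+1%:R * t)) = 0.
  have i2 : mu.-integrable A (fun t => (U t * (n.+1%:R * cos (n.+1%:R * t)))%:E).
    by apply: (integrable_eqR mA _ (integrable_scaleR mA n.+1%:R (intMc n.+1%:R cU))) => t _; rewrite mulrCA.
  have := isAC_end pi20 (isAC_mul ACU (ACs n.+1%:R)).
  rewrite U0 U1 !mul0r subrr (RintegralD mA (ius _) i2) us add0r => /esym.
  under eq_Rintegral do rewrite mulrCA.
  rewrite (RintegralZl _ mA (intMc _ cU)).
  by move/eqP; rewrite mulf_eq0 pnatr_eq0/= => /eqP.
have Us (n : nat) : \int[mu]_(t in A) (U t * sin (n.+1%:R * t)) = 0.
  have i2 : mu.-integrable A (fun t => (U t * (- n.+1%:R * sin (n.+1%:R * t)))%:E).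
    by apply: (integrable_eqR mA _ (integrable_scaleR mA (- n.+1%:R) (intMs n.+1%:R cU))) => t _; rewrite mulrCA.
  have := isAC_end pi20 (isAC_mul ACU (ACc n.+1%:R)).
  rewrite U0 U1 !mul0r subrr (RintegralD mA (iuc _) i2) uc add0r => /esym.
  under eq_Rintegral do rewrite mulrCA.
  rewrite (RintegralZl _ mA (intMs _ cU)).
  by move/eqP; rewrite mulf_eq0 oppr_eq0 pnatr_eq0/= => /eqP.
pose m := (\int[mu]_(t in A) U t) / (2 * pi).
have ACV : isAC 0 (2 * pi) (fun t => U t + (- m)) (fun t => u t + 0).
  exact: isAC_add ACU (isAC_cst _ _ _).
pose V t := U t + (- m).
have cV : {within A, continuous V} := isAC_continuous ACV.
have icst c : isAC 0 (2 * pi) (cst c) (cst 0 : R -> R) by exact: isAC_cst.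
have iU : mu.-integrable A (EFin \o U) by exact: integrable_within.
have ic1 (w : R) : mu.-integrable A (fun t => (1 * cos (w * t))%:E).
  exact: (intMc w (isAC_continuous (icst 1))).
have is1 (w : R) : mu.-integrable A (fun t => (1 * sin (w * t))%:E).
  exact: (intMs w (isAC_continuous (icst 1))).
have Vcw (w : R) : \int[mu]_(t in A) (V t * cos (w * t)) =
    \int[mu]_(t in A) (U t * cos (w * t)) + - m * \int[mu]_(t in A) (1 * cos (w * t)).
  transitivity (\int[mu]_(t in A) (U t * cos (w * t) + - m * (1 * cos (w * t)))).
    by apply: eq_Rintegral => t _; rewrite /V; ring.
  by rewrite (RintegralD mA (intMc w cU) (integrable_scaleR mA (- m) (ic1 w))) (RintegralZl (- m) mA (ic1 w)).
have Vsw (w : R) : \int[mu]_(t in A) (V t * sin (w * t)) =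
    \int[mu]_(t in A) (U t * sin (w * t)) + - m * \int[mu]_(t in A) (1 * sin (w * t)).
  transitivity (\int[mu]_(t in A) (U t * sin (w * t) + - m * (1 * sin (w * t)))).
    by apply: eq_Rintegral => t _; rewrite /V; ring.
  by rewrite (RintegralD mA (intMs w cU) (integrable_scaleR mA (- m) (is1 w))) (RintegralZl (- m) mA (is1 w)).
have np2 (n : nat) : n%:R * (2 * pi) = pi *+ 2 *+ n :> R by rewrite !mulr_natl.
have c2pi (n : nat) : cos (n%:R * (2 * pi)) = 1 :> R.
  by have := periodicn (@cosD2pi R) n 0; rewrite add0r cos0 np2.
have s2pi (n : nat) : sin (n%:R * (2 * pi)) = 0 :> R.
  by have := periodicn (@sinD2pi R) n 0; rewrite add0r sin0 np2.
have C1 (n : nat) : \int[mu]_(t in A) (1 * cos (n.+1%:R * t)) = 0.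
  have := isAC_end pi20 (ACs n.+1%:R); rewrite s2pi mulr0 sin0 subrr => /esym.
  under eq_Rintegral do rewrite -[cos _]mul1r.
  by rewrite (RintegralZl _ mA (ic1 _)) => /eqP; rewrite mulf_eq0 pnatr_eq0/= => /eqP.
have S1 (n : nat) : \int[mu]_(t in A) (1 * sin (n.+1%:R * t)) = 0.
  have := isAC_end pi20 (ACc n.+1%:R); rewrite c2pi mulr0 cos0 subrr => /esym.
  under eq_Rintegral do rewrite -[sin _]mul1r.
  by rewrite (RintegralZl _ mA (is1 _)) => /eqP; rewrite mulf_eq0 oppr_eq0 pnatr_eq0/= => /eqP.
have A1 : fine (mu A) = 2 * pi.
  by rewrite /= lebesgue_measure_itv/= lte_fin mulr_gt0//= subr0.
have Vcn (n : nat) : \int[mu]_(t in A) (V t * cos (n%:R * t)) = 0.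
  rewrite Vcw; case: n => [|n]; last by rewrite Uc C1 mulr0 addr0.
  have -> : \int[mu]_(t in A) (1 * cos (0%:R * t)) = 2 * pi.
    transitivity (\int[mu]_(t in A) (1 : R)).
      by apply: eq_Rintegral => t _; rewrite mul0r cos0 mulr1.
    by rewrite (Rintegral_cst _ mA) A1 mul1r.
  have -> : \int[mu]_(t in A) (U t * cos (0%:R * t)) = \int[mu]_(t in A) U t.
    by apply: eq_Rintegral => t _; rewrite mul0r cos0 mulr1.
  by rewrite /m mulNr divfK ?subrr// mulf_neq0// gt_eqF.
have Vsn (n : nat) : \int[mu]_(t in A) (V t * sin (n%:R * t)) = 0.
  case: n => [|n]; last by rewrite Vsw Us S1 mulr0 addr0.
  transitivity (\int[mu]_(t in A) (0 : R)).
    by apply: eq_Rintegral => t _; rewrite mul0r sin0 mulr0.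
  by rewrite (Rintegral_cst _ mA) mul0r.
have Vc (z : int) : \int[mu]_(t in A) (V t * cos (z%:~R * t)) = 0.
  case: z => n; first exact: Vcn.
  by rewrite -[RHS](Vcn n.+1); apply: eq_Rintegral => t _; rewrite NegzE mulrNz mulNr cosN.
have Vs (z : int) : \int[mu]_(t in A) (V t * sin (z%:~R * t)) = 0.
  case: z => n; first exact: Vsn.
  transitivity (\int[mu]_(t in A) (-1 * (V t * sin (n.+1%:R * t)))).
    by apply: eq_Rintegral => t _; rewrite NegzE mulrNz [X in sin X]mulNr sinN mulrN mulN1r.
  by rewrite (RintegralZl (-1) mA (intMs _ cV)) Vsn mulr0.
have VC := isAC_bounded ACV.
have V0 tau : 0 < tau < 2 * pi -> V tau = 0.
  move=> tau02; apply/eqP; rewrite eq_le; apply/andP; split.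
    apply: (kern_pos cV _ tau02 (kern_orth tau cV Vc Vs)) => t; rewrite /= in_itv/=; exact: VC.
  rewrite -oppr_le0.
  have ACN := isAC_scale (- 1) ACV.
  have cN : {within A, continuous (fun t => - V t)}.
    by move=> x; apply: cvgN; exact: cV.
  apply: (kern_pos cN _ tau02) => [t|n].
    by rewrite normrN /= in_itv/=; exact: VC.
  have := kern_orth tau cV Vc Vs n.
  have ik : mu.-integrable A (fun t => (V t * kern tau n t)%:E).
    apply: integrable_within => x; apply: cvgM; first exact: cV.
    by apply: continuous_subspaceT; exact: continuous_kern.
  move=> h; transitivity (- 1 * \int[mu]_(t in A) (V t * kern tau n t)); last by rewrite h mulr0.
  by rewrite -(RintegralZl (-1) mA ik); apply: eq_Rintegral => t _; rewrite mulN1r mulNr.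
have Um tau : 0 < tau < 2 * pi -> U tau = m.
  by move/V0/eqP; rewrite subr_eq0 => /eqP.
pose u1 := u \_ A.
have iu1 : mu.-integrable setT (EFin \o u1).
  by have /(integrable_mkcond _ mA) := iu; rewrite restrict_EFin.
have lu1 : locally_integrable setT u1 by exact: integrable_locally.
have ne (c : R) : {ae mu, forall t : T1, t <> c}.
  exists [set c]; split => //; first exact: lebesgue_measure_set1.
  by move=> x /=; apply: contra_notP => xc h; apply: xc.
have iu2 (y : R) : mu.-integrable [set` Interval (BLeft 0) (BRight y)] (EFin \o u1).
  by apply: integrableS iu1.
apply: filterS3 (ne 0) (ne (2 * pi)) (FTC1 iu2 lu1) => t t0 t2 Ft At.
have : 0 <= t <= 2 * pi by move: At; rewrite /= in_itv.
move/eqP in t0; move/eqP in t2.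
rewrite le_eqVlt eq_sym (negbTE t0)/= le_eqVlt (negbTE t2)/= => /andP[t0' t2'].
have [] := Ft; first by rewrite lte_fin.
move=> _; rewrite {2}/u1 patchE mem_set// => <-.
rewrite derive1E -[RHS](derive_cst (m : R) (t : R) 1).
apply: near_eq_derive.
have : \forall x \near t, 0 < x < 2 * pi.
  near=> x; apply/andP; split; near: x; [exact: lt_nbhsr|exact: lt_nbhsl].
apply: filterS => x /[dup] /Um Ux /andP[x0 x2].
rewrite -[RHS]Ux /U; apply: eq_Rintegral => y; rewrite inE/= in_itv/= => /andP[y0 yx].
by rewrite /u1 patchE mem_set//= in_itv/= y0 (le_trans yx)// ltW.
Unshelve. all: by end_near. Qed.

End trig_complete.

(** * Smooth test functions *)

Section qexp.
Context (R : realType).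
Implicit Types (b s : R).

(** The function s^(-b) exp(-1/s), extended by 0. With the parameter [b] the family is stable under
    differentiation, so smoothness follows by an induction that quantifies over [b]. *)
Definition qexp b s : R := if 0 < s then expR (- s^-1 - b * ln s) else 0.

Lemma qexp_ge0 b s : 0 <= qexp b s.
Proof. by rewrite /qexp; case: ifP => // _; exact: expR_ge0. Qed.

Lemma qexp_gt0 b s : 0 < s -> 0 < qexp b s.
Proof. by move=> s0; rewrite /qexp s0 expR_gt0. Qed.

Lemma qexp_le0 b s : s <= 0 -> qexp b s = 0.
Proof. by rewrite /qexp leNgt => /negbTE ->. Qed.

Lemma qexpS b s : qexp (b + 1) s = qexp b s * s^-1.
Proof.
rewrite /qexp; case: ifPn => [s0|]; last by rewrite mul0r.
rewrite -[X in _ = _ * X](lnK (_ : s^-1 \is Num.pos)) ?posrE ?invr_gt0// -expRD lnV ?posrE//.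
by congr expR; ring.
Qed.

(** The exponential beats every power. Applied to [b + 1] it gives the derivative of [qexp b] at 0,
    since the difference quotient there is [qexp (b + 1)]. *)
Lemma qexp_bound b : exists2 C : R, 0 <= C & forall s, 0 < s < 1 -> qexp b s <= C * s.
Proof.
pose N := (Num.bound `|b|).+1.
exists (N.+1%:R ^+ N.+1) => [|s /andP[s0 s1]]; first by rewrite exprn_ge0.
have u1 : 1 <= s^-1 by rewrite invf_ge1// ltW.
have lnu : 0 <= ln s^-1 by rewrite ln_ge0.
have bN : b <= N%:R.
  rewrite (le_trans (ler_norm _))// (le_trans (ltW (archi_boundP (normr_ge0 b))))//.
  by rewrite ler_nat.
rewrite /qexp s0 expRD.
have -> : - (b * ln s) = b * ln s^-1 by rewrite lnV ?posrE// mulrN.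
have : expR (b * ln s^-1) <= s^-1 ^+ N.
  rewrite -[X in _ <= X ^+ _](lnK (_ : s^-1 \is Num.pos)) ?posrE ?invr_gt0// -expRM_natl.
  by rewrite ler_expR ler_wpM2r.
have e1 : (s^-1 / N.+1%:R) ^+ N.+1 <= expR s^-1.
  have -> : expR s^-1 = expR (s^-1 / N.+1%:R) ^+ N.+1.
    by rewrite -expRM_natl mulrC divfK.
  apply: lerXn2r; rewrite ?nnegrE ?expR_ge0 ?divr_ge0 ?invr_ge0 ?(ltW s0)//.
  by rewrite (le_trans _ (expR_ge1Dx _))// lerDr.
move=> e2; rewrite expRN mulrC -ler_pdivlMr ?invr_gt0 ?expR_gt0// invrK.
apply: (le_trans e2).
have -> : N.+1%:R ^+ N.+1 * s * expR s^-1 = s * (N.+1%:R ^+ N.+1 * expR s^-1) by ring.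
rewrite -ler_pdivrMl// (le_trans _ (ler_wpM2l _ e1)) ?exprn_ge0//.
by rewrite expr_div_n [leRHS]mulrC divfK ?expf_neq0// exprS.
Qed.

Lemma is_derive_qexp b s : is_derive s 1 (qexp b) (qexp (b + 2) s - b * qexp (b + 1) s).
Proof.
have [s0|s0|s0] := ltgtP s 0.
- rewrite !qexp_le0 ?(ltW s0)// mulr0 subrr.
  apply: (near_eq_is_derive (f := cst 0)).
    near=> x; rewrite /= qexp_le0// ltW//; near: x; exact: lt_nbhsl.
- have -> : qexp (b + 2) s - b * qexp (b + 1) s = qexp b s * (s ^- 2 - b * s^-1).
    rewrite (_ : b + 2 = b + 1 + 1); last by rewrite -addrA.
    by rewrite !qexpS; field; rewrite gt_eqF.
  have dl := is_derive1_ln s0.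
  have sn0 : s != 0 by rewrite gt_eqF.
  have dv := is_deriveV sn0 (is_derive_id s 1).
  apply: (near_eq_is_derive (f := fun s => expR (- s^-1 - b * ln s))).
  + near=> x; rewrite /qexp ifT//; near: x; exact: lt_nbhsr.
  + by apply: is_derive_eq; rewrite /qexp s0 /GRing.scale/=; field.
- rewrite s0 !qexp_le0// mulr0 subrr.
  have [C C0 qC] := qexp_bound (b + 1).
  have H : h^-1 *: (qexp b (h *: 1 + 0) - qexp b 0) @[h --> 0^'] --> (0 : R).
    apply/cvgrPdist_lt => e e0; near=> h.
    rewrite sub0r normrN [qexp b 0]qexp_le0// subr0 addr0 /GRing.scale/= mulr1.
    have [h0|h0] := leP h 0; first by rewrite qexp_le0// mulr0 normr0.
    rewrite mulrC -qexpS ger0_norm ?qexp_ge0//.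
    rewrite (le_lt_trans (qC _ _))//.
      by rewrite h0/= -(gtr0_norm h0); near: h; exact: dnbhs0_lt.
    have : `|h| < e / (C + 1) by near: h; apply: dnbhs0_lt; rewrite divr_gt0// ltr_wpDl.
    rewrite gtr0_norm// ltr_pdivlMr ?ltr_wpDl// => he; apply: le_lt_trans he.
    by rewrite mulrC ler_wpM2l ?(ltW h0)// lerDl.
  apply: DeriveDef; first by apply/cvg_ex; exists 0.
  by apply/cvg_lim.
Unshelve. all: by end_near. Qed.

Lemma continuous_qexp b : continuous (qexp b).
Proof.
move=> s; apply: differentiable_continuous; apply/derivable1_diffP.
by have [] := is_derive_qexp b s.
Qed.

End qexp.

Section plane_smooth.
Context (R : realType).
Implicit Types (f g A : R * R -> R) (x e : R * R).

(** The bridge to the one-variable rules, in particular to the chain rule. *)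
Lemma is_derive_line f x e df :
  is_derive (0 : R) 1 (fun h => f (h *: e + x)) df <-> is_derive x e f df.
Proof.
have E : 'D_1 (fun h : R => f (h *: e + x)) 0 = 'D_e f x.
  rewrite /derive; set g1 := (X in X @ _); set g2 := (X in _ = lim (X @ _)).
  suff -> : g1 = g2 by [].
  by rewrite /g1 /g2; apply/funext => h /=; rewrite addr0 scale0r add0r [_%:A]mulr1.
split=> -[d1 d2]; apply: DeriveDef.
- by apply: (derivable1P f x e).2.
- by rewrite -E.
- by apply: (derivable1P f x e).1.
- by rewrite E.
Qed.

Lemma is_derive_qexp_comp b A x e dA : is_derive x e A dA ->
  is_derive x e (fun y => qexp b (A y)) ((qexp (b + 2) (A x) - b * qexp (b + 1) (A x)) * dA).
Proof.
move=> /is_derive_line dA'; apply/is_derive_line.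
have d1 := is_derive_qexp b (A x).
have := @is_derive1_comp R (qexp b) (fun h => A (h *: e + x)) 0 _ dA _ dA'.
by rewrite scale0r add0r; apply.
Qed.

Lemma CkS n f (g1 g2 : R * R -> R) : continuous f ->
  (forall x, is_derive x e1 f (g1 x)) -> (forall x, is_derive x e2 f (g2 x)) ->
  Ck n g1 -> Ck n g2 -> Ck n.+1 f.
Proof.
move=> cf d1 d2 c1 c2; split => //.
have -> : (fun x => 'D_e1 f x) = g1 by apply/funext => x; have [] := d1 x.
have -> : (fun x => 'D_e2 f x) = g2 by apply/funext => x; have [] := d2 x.
by split => // x; apply: ex_derive.
Qed.

Lemma Ck_continuous n f : Ck n f -> continuous f.
Proof. by case: n => [|n] []. Qed.

Lemma Ck_derive1 n f : Ck n.+1 f -> forall x, is_derive x e1 f ('D_e1 f x).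
Proof. by move=> [_ [d1 _ _ _]] x; apply/derivableP. Qed.
Lemma Ck_derive2 n f : Ck n.+1 f -> forall x, is_derive x e2 f ('D_e2 f x).
Proof. by move=> [_ [_ d2 _ _]] x; apply/derivableP. Qed.

Lemma Ck_mono n f : Ck n.+1 f -> Ck n f.
Proof.
elim: n f => [|n IHn] f; first by move=> [].
move=> Cf; have [cf [d1 d2 c1 c2]] := Cf.
exact: (CkS cf (Ck_derive1 Cf) (Ck_derive2 Cf) (IHn _ c1) (IHn _ c2)).
Qed.

Lemma Ck_cst n (c : R) : Ck n (fun=> c : R).
Proof.
elim: n c => [|n IHn] c; first by split => // x; exact: cvg_cst.
apply: (@CkS n _ (fun=> 0) (fun=> 0)) => // x; exact: cvg_cst.
Qed.

Lemma is_derive_fst x e : is_derive x e fst e.1.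
Proof.
apply/is_derive_line.
have -> : (fun h : R => (h *: e + x).1) = (fun h => h * e.1 + x.1) by [].
by apply: is_derive_eq; rewrite /GRing.scale/=; ring.
Qed.

Lemma is_derive_snd x e : is_derive x e snd e.2.
Proof.
apply/is_derive_line.
have -> : (fun h : R => (h *: e + x).2) = (fun h => h * e.2 + x.2) by [].
by apply: is_derive_eq; rewrite /GRing.scale/=; ring.
Qed.

Lemma Ck_fst n : Ck n (fst : R * R -> R).
Proof.
case: n => [|n]; first by split => // x; exact: cvg_fst.
apply: (@CkS n _ (fun=> 1) (fun=> 0)) => [x|x|x||]; first exact: cvg_fst.
- exact: is_derive_fst x e1.
- exact: is_derive_fst x e2.
- exact: Ck_cst.
- exact: Ck_cst.
Qed.

Lemma Ck_snd n : Ck n (snd : R * R -> R).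
Proof.
case: n => [|n]; first by split => // x; exact: cvg_snd.
apply: (@CkS n _ (fun=> 0) (fun=> 1)) => [x|x|x||]; first exact: cvg_snd.
- exact: is_derive_snd x e1.
- exact: is_derive_snd x e2.
- exact: Ck_cst.
- exact: Ck_cst.
Qed.

Lemma Ck_add n f g : Ck n f -> Ck n g -> Ck n (fun x => f x + g x).
Proof.
elim: n f g => [|n IHn] f g Cf Cg.
  by split => // x; apply: cvgD; [exact: (Ck_continuous Cf)|exact: (Ck_continuous Cg)].
have [cf [_ _ f1 f2]] := Cf; have [cg [_ _ g1 g2]] := Cg.
apply: (CkS (g1 := fun x => 'D_e1 f x + 'D_e1 g x) (g2 := fun x => 'D_e2 f x + 'D_e2 g x)).
- by move=> x; apply: cvgD; [exact: cf|exact: cg].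
- by move=> x; apply: is_deriveD; [exact: Ck_derive1 Cf _|exact: Ck_derive1 Cg _].
- by move=> x; apply: is_deriveD; [exact: Ck_derive2 Cf _|exact: Ck_derive2 Cg _].
- exact: IHn.
- exact: IHn.
Qed.

Lemma Ck_mul n f g : Ck n f -> Ck n g -> Ck n (fun x => f x * g x).
Proof.
elim: n f g => [|n IHn] f g Cf Cg.
  by split => // x; apply: cvgM; [exact: (Ck_continuous Cf)|exact: (Ck_continuous Cg)].
have [cf [_ _ f1 f2]] := Cf; have [cg [_ _ g1 g2]] := Cg.
apply: (CkS (g1 := fun x => f x * 'D_e1 g x + g x * 'D_e1 f x) (g2 := fun x => f x * 'D_e2 g x + g x * 'D_e2 f x)).
- by move=> x; apply: cvgM; [exact: cf|exact: cg].
- by move=> x; apply: is_deriveM; [exact: Ck_derive1 Cf _|exact: Ck_derive1 Cg _].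
- by move=> x; apply: is_deriveM; [exact: Ck_derive2 Cf _|exact: Ck_derive2 Cg _].
- by apply: Ck_add; apply: IHn => //; exact: Ck_mono.
- by apply: Ck_add; apply: IHn => //; exact: Ck_mono.
Qed.

Lemma Ck_qexp b A : (forall n, Ck n A) -> forall n, Ck n (fun x => qexp b (A x)).
Proof.
move=> CA n; elim: n b => [|n IHn] b.
  split => // x; apply: (@cvg_comp _ _ _ A (qexp b)); first exact: (Ck_continuous (CA 0%N)).
  exact: continuous_qexp.
have [cA [_ _ A1 A2]] := CA n.+1.
apply: (CkS (g1 := fun x => (qexp (b + 2) (A x) + - b * qexp (b + 1) (A x)) * 'D_e1 A x)
            (g2 := fun x => (qexp (b + 2) (A x) + - b * qexp (b + 1) (A x)) * 'D_e2 A x)).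
- by move=> x; apply: (@cvg_comp _ _ _ A (qexp b)); [exact: cA|exact: continuous_qexp].
- by move=> x; rewrite mulNr; apply: is_derive_qexp_comp; exact: (Ck_derive1 (CA 1%N)).
- by move=> x; rewrite mulNr; apply: is_derive_qexp_comp; exact: (Ck_derive2 (CA 1%N)).
- by apply: Ck_mul => //; apply: Ck_add => //; apply: Ck_mul => //; exact: Ck_cst.
- by apply: Ck_mul => //; apply: Ck_add => //; apply: Ck_mul => //; exact: Ck_cst.
Qed.

End plane_smooth.

(** * The chain rule along curves and in polar coordinates *)

Section chain_rule.
Context (R : realType).
Variable phi : R * R -> R.
Hypothesis Cphi : Ck 1 phi.

Let c1 : continuous (fun x => 'D_e1 phi x).
Proof. by have [_ [_ _ [c _] _]] := Cphi. Qed.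
Let c2 : continuous (fun x => 'D_e2 phi x).
Proof. by have [_ [_ _ _ [c _]]] := Cphi. Qed.

Let unshift (f g : R -> R) (x d : R) : (forall h, g h = f (h + x)) ->
  is_derive (0 : R) 1 g d -> is_derive x 1 f d.
Proof.
move=> gf dg.
have ds : is_derive x 1 (fun a : R => a - x) 1.
  by apply: is_derive_eq; rewrite subr0.
rewrite -(subrr x) in dg.
have := @is_derive1_comp R g (fun a => a - x) x d 1 dg ds; rewrite mulr1.
by congr (is_derive _ _ _ _); apply/funext => a /=; rewrite gf subrK.
Qed.

Let slice1 (y x : R) : is_derive x 1 (fun a => phi (a, y)) ('D_e1 phi (x, y)).
Proof.
have /is_derive_line := Ck_derive1 Cphi (x, y); apply: unshift => h.
by congr (phi (_, _)); rewrite /= ?[h *: 1](mulr1 h) ?[h *: 0](mulr0 h) ?add0r.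
Qed.

Let slice2 (x y : R) : is_derive y 1 (fun b => phi (x, b)) ('D_e2 phi (x, y)).
Proof.
have /is_derive_line := Ck_derive2 Cphi (x, y); apply: unshift => h.
by congr (phi (_, _)); rewrite /= ?[h *: 1](mulr1 h) ?[h *: 0](mulr0 h) ?add0r.
Qed.

Let mvt (f df : R -> R) (a b : R) : (forall x : R, is_derive x 1 f (df x)) ->
  exists c, `|c - a| <= `|b - a| /\ f b - f a = df c * (b - a).
Proof.
move=> fdf.
have cf (u v : R) : {within `[u, v], continuous f}.
  apply: continuous_subspaceT => x; apply: differentiable_continuous.
  by apply/derivable1_diffP; have [] := fdf x.
have [ab|ba] := leP a b.
  have [c + E] := MVT_segment ab (fun x _ => fdf x) (cf a b).
  rewrite in_itv/= => /andP[ac cb]; exists c; split => //.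
  by rewrite !ger0_norm ?subr_ge0// lerB.
have [c + E] := MVT_segment (ltW ba) (fun x _ => fdf x) (cf b a).
rewrite in_itv/= => /andP[bc ca]; exists c; split.
  by rewrite ![`|_ - a|]distrC !ger0_norm ?subr_ge0 ?(ltW ba)// lerB.
by rewrite -opprB E -mulrN opprB.
Qed.

(** The increment of [phi] is split into a horizontal and a vertical one, and the mean value theorem
    is applied to each; the intermediate points converge, and the partial derivatives are
    continuous. *)
Lemma is_derive_curve (u v : R -> R) (s du dv : R) :
  is_derive s 1 u du -> is_derive s 1 v dv ->
  is_derive s 1 (fun t => phi (u t, v t))
    (du * 'D_e1 phi (u s, v s) + dv * 'D_e2 phi (u s, v s)).
Proof.
move=> hu hv.
have quot (w : R -> R) dw : is_derive s 1 w dw -> h^-1 * (w (h + s) - w s) @[h --> 0^'] --> dw.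
  move=> [d1 <-]; have := d1; rewrite /derivable/= => /cvgP; rewrite /derive.
  by under eq_fun do rewrite [_ *: 1]mulr1.
have cont (w : R -> R) dw : is_derive s 1 w dw -> w (h + s) @[h --> 0^'] --> w s.
  move=> [d1 _].
  have /continuous_withinNshiftx : {for s, continuous w}.
    by apply: differentiable_continuous; exact/derivable1_diffP.
  by [].
have hu1 := quot _ _ hu; have hv1 := quot _ _ hv.
have hu0 := cont _ _ hu; have hv0 := cont _ _ hv.
have /choice [xi Hxi] : forall h, exists c, `|c - u s| <= `|u (h + s) - u s| /\
    phi (u (h + s), v (h + s)) - phi (u s, v (h + s)) = 'D_e1 phi (c, v (h + s)) * (u (h + s) - u s).
  by move=> h; exact: (@mvt (fun a => phi (a, v (h + s))) _ (u s) (u (h + s)) (slice1 (v (h + s)))).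
have /choice [ze Hze] : forall h, exists c, `|c - v s| <= `|v (h + s) - v s| /\
    phi (u s, v (h + s)) - phi (u s, v s) = 'D_e2 phi (u s, c) * (v (h + s) - v s).
  by move=> h; exact: (@mvt (fun b => phi (u s, b)) _ (v s) (v (h + s)) (slice2 (u s))).
have sq (w : R -> R) (c : R -> R) : w (h + s) @[h --> 0^'] --> w s ->
    (forall h, `|c h - w s| <= `|w (h + s) - w s|) -> c h @[h --> 0^'] --> w s.
  move=> /cvgrPdist_lt cw Hc; apply/cvgrPdist_lt => e /cw; apply: filterS => h.
  by rewrite distrC => hh; rewrite distrC (le_lt_trans (Hc h)).
have xi0 := sq _ _ hu0 (fun h => (Hxi h).1).
have ze0 := sq _ _ hv0 (fun h => (Hze h).1).
have L : h^-1 * (phi (u (h + s), v (h + s)) - phi (u s, v s)) @[h --> 0^'] -->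
    (du * 'D_e1 phi (u s, v s) + dv * 'D_e2 phi (u s, v s)).
  have -> : (fun h => h^-1 * (phi (u (h + s), v (h + s)) - phi (u s, v s))) =
     (fun h => h^-1 * (u (h + s) - u s) * 'D_e1 phi (xi h, v (h + s)) +
               h^-1 * (v (h + s) - v s) * 'D_e2 phi (u s, ze h)).
    apply/funext => h; have [_ E1] := Hxi h; have [_ E2] := Hze h.
    transitivity (h^-1 * ((phi (u (h + s), v (h + s)) - phi (u s, v (h + s))) +
       (phi (u s, v (h + s)) - phi (u s, v s)))); first by congr (_ * _); ring.
    by rewrite E1 E2; ring.
  apply: cvgD; apply: cvgM => //.
    apply: (@cvg_comp _ _ _ (fun h => (xi h, v (h + s))) (fun x => 'D_e1 phi x)); last exact: c1.
    exact: (cvg_pair xi0 hv0).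
  apply: (@cvg_comp _ _ _ (fun h => (u s, ze h)) (fun x => 'D_e2 phi x)); last exact: c2.
  exact: (cvg_pair (cvg_cst (u s)) ze0).
apply: DeriveDef.
  apply/cvg_ex; exists (du * 'D_e1 phi (u s, v s) + dv * 'D_e2 phi (u s, v s)).
  by under eq_fun do rewrite [_ *: 1]mulr1.
apply/cvg_lim => //.
by under eq_fun do rewrite [_ *: 1]mulr1.
Qed.

Lemma is_derive_polr (r t : R) : is_derive r 1 (fun s => phi (pol (s, t)))
  (cos t * 'D_e1 phi (pol (r, t)) + sin t * 'D_e2 phi (pol (r, t))).
Proof.
have du : is_derive r 1 (fun s : R => s * cos t) (cos t).
  by apply: is_derive_eq; rewrite /GRing.scale/=; ring.
have dv : is_derive r 1 (fun s : R => s * sin t) (sin t).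
  by apply: is_derive_eq; rewrite /GRing.scale/=; ring.
exact: (is_derive_curve du dv).
Qed.

Lemma is_derive_polt (r t : R) : is_derive t 1 (fun s => phi (pol (r, s)))
  (- (r * sin t) * 'D_e1 phi (pol (r, t)) + (r * cos t) * 'D_e2 phi (pol (r, t))).
Proof.
have du : is_derive t 1 (fun s : R => r * cos s) (- (r * sin t)).
  by apply: is_derive_eq; rewrite /GRing.scale/=; ring.
have dv : is_derive t 1 (fun s : R => r * sin s) (r * cos t).
  by apply: is_derive_eq; rewrite /GRing.scale/=; ring.
exact: (is_derive_curve du dv).
Qed.

End chain_rule.

(** * Uniqueness of finite measures and the fundamental lemma *)

Section measure_unique.
Context (R : realType).
Local Notation T1 := (measurableTypeR R).
Local Notation T2 := (T1 * T1)%type.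
Local Open Scope ereal_scope.

Lemma ocitv_measure_unique (m1 m2 : {measure set T1 -> \bar R}) :
  (forall a b : R, m1 `]a, b]%classic = m2 `]a, b]%classic) -> m1 setT < +oo ->
  forall A, measurable A -> m1 A = m2 A.
Proof.
move=> m12 m1oo A mA.
apply: (@measure_unique _ R T1 (@ocitv R) (fun k => `](- k%:R)%R, k%:R]%classic)) => //.
- exact: ocitvI.
- by move=> k; exists ((- k%:R)%R, k%:R).
- apply/seteqP; split => // x _.
  exists (Num.bound `|x|).+1 => //=; rewrite in_itv/=.
  have := archi_boundP (normr_ge0 x); rewrite ltr_norml => /andP[h1 h2].
  by rewrite -natr1; apply/andP; split; lra.
- by move=> _ [[a b] _ <-]; exact: m12.
- move=> k; apply: le_lt_trans m1oo; apply: le_measure; rewrite ?inE//.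
Qed.

(** One factor at a time: with the other factor fixed, the restriction to a strip is pushed forward
    to the line, where half-open intervals suffice. *)
Lemma box_measure_unique (m1 m2 : {measure set T2 -> \bar R}) :
  (forall a b c d : R, m1 (`]a, b]%classic `*` `]c, d]%classic) = m2 (`]a, b]%classic `*` `]c, d]%classic)) ->
  m1 setT < +oo ->
  forall A, measurable A -> m1 A = m2 A.
Proof.
move=> m12 m1oo.
have sub A : measurable A -> m1 A < +oo.
  by move=> mA; apply: le_lt_trans m1oo; apply: le_measure; rewrite ?inE.
have mfst : measurable_fun [set: T2] (fst : T2 -> T1) by exact: measurable_fst.
have msnd : measurable_fun [set: T2] (snd : T2 -> T1) by exact: measurable_snd.
pose fst_mixin := isMeasurableFun.Build _ _ _ _ _ mfst.
pose pfst : {mfun T2 >-> T1} := HB.pack (fst : T2 -> T1) fst_mixin.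
pose snd_mixin := isMeasurableFun.Build _ _ _ _ _ msnd.
pose psnd : {mfun T2 >-> T1} := HB.pack (snd : T2 -> T1) snd_mixin.
have fE (A B : set T1) : fst @^-1` A `&` (setT `*` B) = A `*` B.
  by apply/seteqP; split => -[x y] /=; [move=> [? []]|move=> []].
have sE (A B : set T1) : snd @^-1` B `&` (A `*` setT) = A `*` B.
  by apply/seteqP; split => -[x y] /=; [move=> [? []]|move=> []].
have step1 (A : set T1) c d : measurable A ->
    m1 (A `*` `]c, d]%classic) = m2 (A `*` `]c, d]%classic).
  move=> mA.
  have mD : measurable ([set: T1] `*` (`]c, d]%classic : set T1)).
    by apply: measurableX => //; exact: measurable_itv.
  have p1 B : pushforward (mrestr m1 mD) pfst B = m1 (B `*` `]c, d]%classic) := congr1 m1 (fE B _).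
  have p2 B : pushforward (mrestr m2 mD) pfst B = m2 (B `*` `]c, d]%classic) := congr1 m2 (fE B _).
  rewrite -p1 -p2; apply: (@ocitv_measure_unique (pushforward (mrestr m1 mD) pfst) (pushforward (mrestr m2 mD) pfst)) => //.
  - by move=> a b; rewrite [LHS]p1 [RHS]p2.
  - by rewrite [X in X < _]p1; exact: sub.
have step2 (A B : set T1) : measurable A -> measurable B -> m1 (A `*` B) = m2 (A `*` B).
  move=> mA mB.
  have mD : measurable (A `*` [set: T1]) by exact: measurableX.
  have p1 C : pushforward (mrestr m1 mD) psnd C = m1 (A `*` C) := congr1 m1 (sE _ C).
  have p2 C : pushforward (mrestr m2 mD) psnd C = m2 (A `*` C) := congr1 m2 (sE _ C).
  rewrite -p1 -p2; apply: (@ocitv_measure_unique (pushforward (mrestr m1 mD) psnd) (pushforward (mrestr m2 mD) psnd)) => //.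
  - by move=> a b; rewrite [LHS]p1 [RHS]p2 step1.
  - by rewrite [X in X < _]p1; exact: sub.
move=> X mX.
apply: (@measure_unique _ R T2 [set A `*` B | A in (measurable : set (set T1)) & B in (measurable : set (set T1))] (fun=> setT)) => //.
- exact: measurable_prod_measurableType.
- move=> _ _ [A mA [B mB <-]] [C mC [D mD' <-]].
  exists (A `&` C); first exact: measurableI.
  by exists (B `&` D); [exact: measurableI|rewrite setXI].
- by move=> _; exists setT => //; exists setT => //; rewrite setXTT.
- by rewrite bigcup_const.
- by move=> _ [A mA [B mB <-]]; exact: step2.
Qed.

End measure_unique.

Section continuous_measurable.
Context (R : realType).
Local Notation T1 := (measurableTypeR R).
Local Notation T2 := (T1 * T1)%type.

(** Measurability here refers to the product sigma-algebra; an open set belongs to it because it is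
    a countable union of squares with rational centres. *)
Lemma open_measurable2 (U : set (R * R)) : open U -> measurable (U : set T2).
Proof.
move=> oU.
pose Q (i : rat * rat * nat) : set T2 :=
  ball (ratr i.1.1 : R) (i.2.+1%:R^-1) `*` ball (ratr i.1.2 : R) (i.2.+1%:R^-1).
have -> : (U : set T2) = \bigcup_i (if `[< Q i `<=` U >] then Q i else set0).
  apply/seteqP; split => [[x y] Uxy|x [i _]]; last first.
    by case: asboolP => // Ii; exact: Ii.
  have [e /= e0 eU] := (nbhs_ballP _ _).1 (open_nbhs_nbhs (conj oU Uxy)).
  pose n := Num.bound (2 / e).
  have e20 : 0 < 2 / e by rewrite divr_gt0.
  have ne : 2 * n.+1%:R^-1 < e.
    rewrite ltr_pdivrMr// mulrC -ltr_pdivrMr// (lt_le_trans (archi_boundP (ltW e20)))//.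
    by rewrite ler_nat.
  have n0 : 0 < n.+1%:R^-1 :> R by rewrite invr_gt0.
  have rat_near (z : R) : exists q : rat, ball (ratr q : R) n.+1%:R^-1 z.
    have bz : ball z n.+1%:R^-1 !=set0 by exists z; exact: ballxx.
    have [r [zq [q _ qr]]] := @dense_rat R _ bz (ball_open z _).
    by exists q; rewrite qr; exact: ball_sym.
  have [p Hp] := rat_near x; have [q Hq] := rat_near y.
  exists (p, q, n) => //; rewrite asboolT; first by split.
  move=> [x' y'] [/= hx hy]; apply: eU; split => /=.
    apply: le_ball (ball_triangle (ball_sym Hp) hx).
    by apply: ltW; apply: le_lt_trans ne; rewrite mulr_natl mulr2n.
  apply: le_ball (ball_triangle (ball_sym Hq) hy).
  by apply: ltW; apply: le_lt_trans ne; rewrite mulr_natl mulr2n.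
apply: countable_bigcupT_measurable; first exact: countableP.
by move=> i; case: ifP => // _; apply: measurableX; exact: measurable_ball.
Qed.

Lemma continuous_measurable2 (f : R * R -> R) : continuous f ->
  measurable_fun [set: T2] (f : T2 -> R).
Proof.
move=> cf; apply: (measurability (@RGenOpens.G R)); first exact: RGenOpens.measurableE.
move=> _ [B [a [b ->]] <-]; rewrite setTI; apply: open_measurable2.
by apply: open_comp => // x _; exact: cf.
Qed.

End continuous_measurable.

Section test_functions.
Context (R : realType).
Local Notation T1 := (measurableTypeR R).
Local Notation T2 := (T1 * T1)%type.
Implicit Types (phi : R * R -> R).

(** Unlike [enorm] it is smooth at the origin, so cutoffs in test functions are built from it. *)
Definition nsq (x : R * R) : R := x.1 ^+ 2 + x.2 ^+ 2.

Lemma B1E (x : R * R) : B1 x <-> nsq x < 1.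
Proof.
by rewrite /B1/= /enorm -{1}[1]sqrtr1 ltr_sqrt.
Qed.

Lemma nsq_pol (z : R * R) : nsq (pol z) = z.1 ^+ 2.
Proof. by rewrite /nsq /= !exprMn -mulrDr cos2Dsin2 mulr1. Qed.

Lemma continuous_nsq : continuous nsq.
Proof.
move=> x; apply: cvgD.
  by apply: (@cvg_comp _ _ _ fst (fun y : R => y ^+ 2)); [exact: cvg_fst|exact: exprn_continuous].
by apply: (@cvg_comp _ _ _ snd (fun y : R => y ^+ 2)); [exact: cvg_snd|exact: exprn_continuous].
Qed.

Lemma Ck_nsq n : Ck n nsq.
Proof. by apply: Ck_add; apply: Ck_mul; (exact: Ck_fst || exact: Ck_snd). Qed.

Lemma square_compact : compact ([set x | `|x.1| <= 1 /\ `|x.2| <= 1] : set (R * R)).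
Proof.
have := compact_setX (@segment_compact R (-1) 1) (@segment_compact R (-1) 1).
congr compact; apply/seteqP; split => x /=; rewrite !in_itv/= !ler_norml.
  by move=> [-> ->].
by move=> [-> ->].
Qed.

Lemma nsq_le1 (x : R * R) : nsq x <= 1 -> `|x.1| <= 1 /\ `|x.2| <= 1.
Proof.
move=> h; rewrite -!(ler_sqr (x := `|_|)) ?nnegrE// !expr1n !real_normK ?num_real//.
by split; apply: le_trans h; rewrite /nsq ?lerDl ?lerDr sqr_ge0.
Qed.

Lemma test_functionP phi (rho : R) : (forall n, Ck n phi) -> rho < 1 ->
  (forall x, rho < nsq x -> phi x = 0) -> test_function phi.
Proof.
move=> sphi rho1 phi0; split => //; exists [set x | nsq x <= rho]; split.
- apply: (subclosed_compact _ square_compact).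
    apply: (@closed_comp _ _ nsq [set y | y <= rho]); last exact: closed_le.
    by move=> x _; exact: continuous_nsq.
  by move=> x /= h; apply: nsq_le1; rewrite (le_trans h)// ltW.
- by move=> x /= h; apply/B1E; exact: le_lt_trans rho1.
- by move=> x /= /negP; rewrite -ltNge; exact: phi0.
Qed.

Lemma test_continuous phi : test_function phi -> continuous phi.
Proof. by move=> [/(_ 0%N)[]]. Qed.

Lemma continuous_bounded_B1 (f : R * R -> R) : continuous f ->
  exists C, forall x, nsq x <= 1 -> `|f x| <= C.
Proof.
move=> cf.
have /compact_bounded : compact (f @` [set x | `|x.1| <= 1 /\ `|x.2| <= 1]).
  by apply: continuous_compact square_compact; exact: continuous_subspaceT.
move=> [M [_ MP]]; exists (M + 1) => x /nsq_le1 h.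
by apply: (MP (M + 1)); [rewrite ltrDl|exists x].
Qed.

Lemma test_out phi : test_function phi -> forall x, ~ B1 x -> phi x = 0.
Proof. by move=> [_ [K [_ KB K0]]] x nB; apply: K0 => /KB. Qed.

End test_functions.

Section fundamental_lemma.
Context (R : realType).
Local Notation T1 := (measurableTypeR R).
Local Notation T2 := (T1 * T1)%type.

Lemma qexp0_le1 (s : R) : qexp 0 s <= 1.
Proof.
rewrite /qexp; case: ifP => // s0; rewrite mul0r subr0 -expR0 ler_expR.
by rewrite oppr_le0 invr_ge0 ltW.
Qed.

Lemma qexp0_cvg1 (s : nat -> R) (d : R) : 0 < d -> (forall n, d * n.+1%:R - 1 <= s n) ->
  qexp 0 (s n) @[n --> \oo] --> (1 : R).
Proof.
move=> d0 ds.
apply/cvgrPdist_le => e e0; near=> n.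
have h : e^-1 < s n.
  rewrite (lt_le_trans _ (ds n))// ltrBrDr mulrC -ltr_pdivrMr//.
  near: n; exists (Num.bound ((e^-1 + 1) / d)) => // n /= hn.
  have p0 : 0 <= (e^-1 + 1) / d by rewrite divr_ge0 ?addr_ge0 ?invr_ge0 ?ltW.
  by rewrite (lt_le_trans (archi_boundP p0))// ler_nat (leq_trans hn).
have s0 : 0 < s n by rewrite (lt_trans _ h)// invr_gt0.
rewrite ger0_norm ?subr_ge0 ?qexp0_le1//.
rewrite /qexp s0 mul0r subr0 lerBlDr -lerBlDl.
rewrite (le_trans _ (expR_ge1Dx _))// lerD2l lerN2.
by rewrite -[leRHS]invrK lef_pV2 ?posrE ?invr_gt0// ltW.
Unshelve. all: by end_near. Qed.

Lemma qexp0_cvg0 (s : nat -> R) (d : R) : 0 < d -> (forall n, s n <= n.+1%:R * (1 - d * n.+1%:R)) ->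
  qexp 0 (s n) @[n --> \oo] --> (0 : R).
Proof.
move=> d0 sd; apply: cvg_near_cst; near=> n.
apply: qexp_le0; apply: (le_trans (sd n)); rewrite pmulr_rle0// subr_le0 mulrC -ler_pdivrMr// mul1r.
near: n; exists (Num.bound d^-1) => // n /= hn.
have p0 : 0 <= d^-1 by rewrite invr_ge0 ltW.
by rewrite (le_trans (ltW (archi_boundP p0)))// ler_nat (leq_trans hn).
Unshelve. all: by end_near. Qed.

(** A smooth approximation of the indicator of []a, b]]. The inner [+ 1] makes the limit 1 at
    [x = b], whereas beyond [b] the argument becomes negative. *)
Let side (a b x : R) n : R := qexp 0 (n.+1%:R * (x - a)) * qexp 0 (n.+1%:R * (n.+1%:R * (b - x) + 1)).
Let cut (x : R * R) n : R := qexp 0 (n.+1%:R * (1 - nsq x) - 1).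

Let side_cvg a b x : side a b x n @[n --> \oo] --> (\1_(`]a, b]%classic) x : R).
Proof.
rewrite indicE mem_setE in_itv/=.
have [ax|xa] /= := ltP a x; last first.
  rewrite (_ : (fun n => side a b x n) = cst 0); first exact: cvg_cst.
  by apply/funext => n; rewrite /side qexp_le0 ?mul0r// pmulr_rle0// subr_le0.
have c1 : qexp 0 (n.+1%:R * (x - a)) @[n --> \oo] --> (1 : R).
  apply: (@qexp0_cvg1 _ (x - a)); first by rewrite subr_gt0.
  by move=> n; rewrite mulrC lerBlDr lerDl.
have [xb|bx] := leP x b.
  rewrite -[X in _ --> X]mulr1; apply: cvgM => //.
  apply: (@qexp0_cvg1 _ 1) => // n; rewrite mul1r (@le_trans _ _ n.+1%:R)//.
    by rewrite lerBlDr lerDl.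
  by rewrite ler_peMr// lerDr mulr_ge0// subr_ge0.
rewrite -[X in _ --> X](mulr0 1); apply: cvgM => //.
apply: (@qexp0_cvg0 _ (x - b)); first by rewrite subr_gt0.
by move=> n; rewrite ler_pM2l//; lra.
Qed.

Let cut_cvg x : nsq x < 1 -> cut x n @[n --> \oo] --> (1 : R).
Proof.
move=> x1; apply: (@qexp0_cvg1 _ (1 - nsq x)); first by rewrite subr_gt0.
by move=> n; rewrite mulrC.
Qed.

Let bump (a b c d : R) n (x : R * R) : R := side a b x.1 n * side c d x.2 n * cut x n.

Let bump_test a b c d n : test_function (bump a b c d n).
Proof.
have C1 k : Ck k (fun x : R * R => x.1) by exact: Ck_fst.
have C2 k : Ck k (fun x : R * R => x.2) by exact: Ck_snd.
have aff (f : R * R -> R) (u v : R) : (forall k, Ck k f) -> forall k, Ck k (fun x => u * f x + v).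
  by move=> Cf k; apply: Ck_add; [apply: Ck_mul => //|]; exact: Ck_cst.
apply: (@test_functionP _ _ (1 - n.+1%:R^-1)).
- move=> k; apply: Ck_mul; last first.
    rewrite /cut; have -> : (fun x : R * R => qexp 0 (n.+1%:R * (1 - nsq x) - 1)) =
        (fun x => qexp 0 (- n.+1%:R * nsq x + (n.+1%:R - 1))).
      by apply/funext => x; congr qexp; ring.
    by apply: Ck_qexp; apply: aff; exact: Ck_nsq.
  have S (f : R * R -> R) u v : (forall k, Ck k f) -> Ck k (fun x => side u v (f x) n).
    move=> Cf; apply: Ck_mul.
      have -> : (fun x : R * R => qexp 0 (n.+1%:R * (f x - u))) = (fun x => qexp 0 (n.+1%:R * f x + (- n.+1%:R * u))).
        by apply/funext => x; congr qexp; ring.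
      by apply: Ck_qexp; exact: aff.
    have -> : (fun x : R * R => qexp 0 (n.+1%:R * (n.+1%:R * (v - f x) + 1))) =
        (fun x => qexp 0 (- (n.+1%:R ^+ 2) * f x + (n.+1%:R ^+ 2 * v + n.+1%:R))).
      by apply/funext => x; congr qexp; ring.
    by apply: Ck_qexp; exact: aff.
  by apply: Ck_mul; exact: S.
- by rewrite gtrDl oppr_lt0 invr_gt0.
- move=> x h; rewrite /bump /cut qexp_le0 ?mulr0// subr_le0.
  by rewrite -ler_pdivlMl// mulr1 lerBlDr -lerBlDl ltW.
Qed.

Let bump_le1 a b c d n x : `|bump a b c d n x| <= 1.
Proof.
have q (s : R) : `|qexp 0 s| <= 1 by rewrite ger0_norm ?qexp_ge0// qexp0_le1.
by rewrite /bump /side /cut !normrM !mulr_ile1 ?mulr_ge0 ?q.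
Qed.

(** The bumps converge boundedly to indicators of boxes, so [h] integrates to 0 over every box. The
    finite measures with densities the positive and the negative part of [h] then agree on boxes,
    hence on all measurable sets. *)
Lemma fundamental_lemma (h : T2 -> R) : leb2.-integrable B1 (EFin \o h) ->
  (forall phi, test_function phi -> \int[leb2]_(x in B1) (h x * phi x) = 0) ->
  {ae leb2, forall x, B1 x -> h x = 0}.
Proof.
move=> ih hphi.
have mB := @measurable_B1 R.
have [/measurable_EFinP mh hoo] := integrableP _ _ _ ih.
have mbump a b c d n : measurable_fun [set: T2] (bump a b c d n : T2 -> R).
  by apply: continuous_measurable2; apply: test_continuous; exact: bump_test.
have mbox a b c d : measurable (`]a, b]%classic `*` `]c, d]%classic : set T2).
  by apply: measurableX; exact: measurable_itv.
have box0 a b c d : \int[leb2]_(x in B1) (h x * \1_(`]a, b]%classic `*` `]c, d]%classic) x) = 0.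
  have ibox : leb2.-integrable B1 (fun x => (h x * \1_(`]a, b]%classic `*` `]c, d]%classic) x)%:E).
    apply: (integrable_mulb (C := 1) mB ih) => [|x _].
      by apply: measurable_indic; exact: mbox.
    by rewrite indicE; case: (_ \in _); rewrite ?normr1// normr0.
  have := @dominated_convergence _ _ _ leb2 B1 mB (fun n x => (h x * bump a b c d n x)%:E)
    (fun x => (h x * \1_(`]a, b]%classic `*` `]c, d]%classic) x)%:E) (fun x => `|h x|%:E).
  case => //.
  - move=> n; apply/measurable_EFinP; apply: measurable_funM => //.
    exact: measurable_funTS.
  - by case/integrableP : ibox.
  - apply: aeW => x /= /B1E Bx; apply: cvg_EFin; first by apply: nearW.
    apply: cvgM; first exact: cvg_cst.
    rewrite /bump (_ : \1_(_) x = \1_(`]a, b]%classic) x.1 * \1_(`]c, d]%classic) x.2 * 1); last first.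
      rewrite mulr1 !indicE in_setX.
      by case: (_ \in _); case: (_ \in _); rewrite ?mulr1 ?mulr0.
    by apply: cvgM; [apply: cvgM; exact: side_cvg|exact: cut_cvg].
  - exact: (integrable_norm ih).
  - apply: aeW => x n _; rewrite lee_fin normrM -[leRHS]mulr1 ler_wpM2l//.
  move=> _ _; rewrite (_ : (fun n => _) = cst 0%E); last first.
    apply/funext => n /=.
    have E : fine (\int[leb2]_(x in B1) (h x * bump a b c d n x)%:E)%E = 0 := hphi _ (bump_test a b c d n).
    have fin : (\int[leb2]_(x in B1) (h x * bump a b c d n x)%:E)%E \is a fin_num.
      apply: integrable_fin_num => //; apply: (integrable_mulb (C := 1) mB ih).
        exact: measurable_funTS.
      by move=> x _; exact: bump_le1.
    by rewrite -(fineK fin) E.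
  move=> /cvg_lim lim0.
  by rewrite /Rintegral -lim0// lim_cst.
pose hp : T2 -> R := fun x => Num.max ((h \_ B1) x) 0.
pose hm : T2 -> R := fun x => Num.max (- (h \_ B1) x) 0.
have mh1 : measurable_fun setT (h \_ B1) by exact/(measurable_restrictT _ _).1.
have mhp : measurable_fun setT hp by exact: measurable_maxr.
have mhm : measurable_fun setT hm.
  by apply: measurable_maxr => //; exact: measurableT_comp.
have hp0 x : 0 <= hp x by rewrite /hp le_max lexx orbT.
have hm0 x : 0 <= hm x by rewrite /hm le_max lexx orbT.
have hpm x : (h \_ B1) x = hp x - hm x.
  rewrite /hp /hm; set y := (h \_ B1) x; have [y0|y0] := leP 0 y.
    by rewrite max_r ?subr0// oppr_le0.
  by rewrite max_l ?sub0r ?opprK// oppr_ge0 ltW.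
have ih1 : leb2.-integrable setT (EFin \o (h \_ B1)).
  by have /(integrable_mkcond _ mB) := ih; rewrite restrict_EFin.
have ihp : leb2.-integrable setT (EFin \o hp).
  apply: (le_integrable _ _ _ (integrable_norm ih1)) => //; first exact/measurable_EFinP.
  move=> x _ /=; rewrite lee_fin normr_id (ger0_norm (hp0 _)) /hp ge_max normr_ge0.
  by rewrite ler_norm.
have ihm : leb2.-integrable setT (EFin \o hm).
  apply: (le_integrable _ _ _ (integrable_norm ih1)) => //; first exact/measurable_EFinP.
  move=> x _ /=; rewrite lee_fin normr_id (ger0_norm (hm0 _)) /hm ge_max normr_ge0.
  by rewrite -normrN ler_norm.
have sub (A : set T2) (k : T2 -> R) : measurable A -> leb2.-integrable setT (EFin \o k) -> leb2.-integrable A (EFin \o k).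
  by move=> mA ik; apply: integrableS ik.
have eqm : forall A, measurable A -> density leb2 mhp hp0 A = density leb2 mhm hm0 A.
  apply: box_measure_unique.
    move=> a b c d; rewrite /density.
    set Q := _ `*` _.
    have mQ : measurable (Q : set T2) by exact: mbox.
    have E : \int[leb2]_(x in Q) hp x - \int[leb2]_(x in Q) hm x = 0.
      rewrite -RintegralB//; [|exact: sub|exact: sub].
      rewrite -[RHS](box0 a b c d) Rintegral_mkcond [RHS]Rintegral_mkcond.
      apply: eq_Rintegral => x _; rewrite [LHS]patchE -hpm !patchE indicE -/Q.
      by case: (x \in Q); case: (x \in B1); rewrite ?mulr1 ?mulr0.
    have fp : (\int[leb2]_(x in Q) (hp x)%:E)%E \is a fin_num.
      by apply: integrable_fin_num => //; exact: sub.
    have fm : (\int[leb2]_(x in Q) (hm x)%:E)%E \is a fin_num.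
      by apply: integrable_fin_num => //; exact: sub.
    move/eqP: E; rewrite subr_eq0 => /eqP E.
    exact: (eq_trans (esym (fineK fp)) (eq_trans (congr1 EFin E) (fineK fm))).
  have [_] := integrableP _ _ _ ihp; rewrite /density.
  by under eq_integral do rewrite /= (ger0_norm (hp0 _)).
have : ae_eq leb2 setT (EFin \o (h \_ B1)) (cst 0%E).
  apply: integral_ae_eq => // E _ mE.
  have := eqm E mE; rewrite /density integral0 => Epm.
  transitivity (\int[leb2]_(x in E) ((hp x)%:E - (hm x)%:E))%E.
    by apply: eq_integral => x _ /=; rewrite hpm.
  rewrite integralB_EFin//; [|exact: sub|exact: sub].
  rewrite Epm subee//.
  by apply: integrable_fin_num => //; exact: sub.
apply: filterS => x /= /(_ I) + Bx; rewrite patchE mem_set// => -[].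
by [].
Qed.

End fundamental_lemma.

#[global] Instance leb2_ae_filter (R : realType) : Filter (almost_everywhere (@leb2 R)).
Proof. exact: (@ae_filter_ringOfSetsType _ _ _ ((@lebesgue_measure R \x @lebesgue_measure R)%E)). Qed.

(** * Weak derivatives *)

Section L2B1.
Context (R : realType).
Local Notation T1 := (measurableTypeR R).
Local Notation T2 := (T1 * T1)%type.
Implicit Types (f g v w : R * R -> R).
Let mB := @measurable_B1 R.

Lemma normr_mul_le_sqr (a b : R) : `|a * b| <= a ^+ 2 + b ^+ 2.
Proof.
rewrite ler_norml; apply/andP; split.
  rewrite -subr_ge0 opprK.
  have -> : a * b + (a ^+ 2 + b ^+ 2) = ((a + b) ^+ 2 + a ^+ 2 + b ^+ 2) / 2 by field.
  by rewrite divr_ge0// !addr_ge0// sqr_ge0.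
rewrite -subr_ge0.
have -> : a ^+ 2 + b ^+ 2 - a * b = ((a - b) ^+ 2 + a ^+ 2 + b ^+ 2) / 2 by field.
by rewrite divr_ge0// !addr_ge0// sqr_ge0.
Qed.

Lemma integrable_B1_cst (c : R) : leb2.-integrable B1 (EFin \o cst c : T2 -> \bar R).
Proof.
apply: measurable_bounded_integrable => //.
- apply: (@le_lt_trans _ _ (leb2 (`[-1, 1]%classic `*` `[-1, 1]%classic))).
    apply: le_measure; rewrite ?inE//.
      by apply: measurableX; exact: measurable_itv.
    by move=> x /B1E /ltW /nsq_le1 []; rewrite !ler_norml /= !in_itv/=.
  rewrite /leb2 product_measure1E; [|exact: measurable_itv|exact: measurable_itv].
  by rewrite /= !lebesgue_measure_itv/= lte_fin ifT// -EFinD -EFinM ltry.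
- exact: bounded_cst.
Qed.

Lemma L2_measurable f : L2B1 f -> measurable_fun (B1 : set T2) f.
Proof. by case. Qed.

Lemma L2_mul_integrable f g : L2B1 f -> L2B1 g ->
  leb2.-integrable B1 (fun x => (f x * g x)%:E).
Proof.
move=> [mf f2] [mg g2].
apply: (@le_integrable _ _ _ _ _ mB _ (fun x => (f x ^+ 2 + g x ^+ 2)%:E)).
- by apply/measurable_EFinP; exact: measurable_funM.
- move=> x _ /=; rewrite lee_fin (@ger0_norm _ (_ + _)) ?addr_ge0 ?sqr_ge0// ler_norml.
  by rewrite -ler_norml; exact: normr_mul_le_sqr.
- exact: integrable_addR.
Qed.

Lemma L2_cst (c : R) : L2B1 (fun=> c).
Proof. by split => //; exact: integrable_B1_cst. Qed.

Lemma L2_integrable f : L2B1 f -> leb2.-integrable B1 (EFin \o f).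
Proof.
move=> f2; apply: integrable_eqR (L2_mul_integrable f2 (L2_cst 1)) => // x _.
by rewrite mulr1.
Qed.

Lemma L2_mulb f g (C : R) : L2B1 f -> measurable_fun (B1 : set T2) g ->
  (forall x, B1 x -> `|g x| <= C) -> L2B1 (fun x => f x * g x).
Proof.
move=> [mf f2] mg gC; split; first exact: measurable_funM.
apply: integrable_eqR (integrable_mulb (C := C ^+ 2) mB f2 _ _) => [//|x _||x Bx].
- by rewrite exprMn.
- exact: measurable_funX.
- by rewrite normrX lerXn2r ?nnegrE ?(le_trans _ (gC x Bx)) ?gC.
Qed.

Lemma L2_add f g : L2B1 f -> L2B1 g -> L2B1 (fun x => f x + g x).
Proof.
move=> f2 g2; have [mf if2] := f2; have [mg ig2] := g2.
split; first exact: measurable_funD.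
apply: integrable_eqR (integrable_addR mB (integrable_addR mB if2 ig2)
  (integrable_scaleR mB 2 (L2_mul_integrable f2 g2))) => // x _.
by rewrite sqrrD; ring.
Qed.

Lemma L2_scale (c : R) f : L2B1 f -> L2B1 (fun x => c * f x).
Proof.
move=> f2; have := @L2_mulb f (cst c) `|c| f2; move=> H.
have {H} : L2B1 (fun x => f x * cst c x) by apply: H.
by congr L2B1; apply/funext => x; rewrite mulrC.
Qed.

Lemma L2_sub f g : L2B1 f -> L2B1 g -> L2B1 (f \- g).
Proof.
move=> f2 g2; have := L2_add f2 (L2_scale (-1) g2).
by congr L2B1; apply/funext => x; rewrite mulN1r.
Qed.

Lemma L2_ae f g : measurable_fun (B1 : set T2) g ->
  {ae leb2, forall x, B1 x -> f x = g x} -> L2B1 f -> L2B1 g.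
Proof.
move=> mg fg [mf f2]; split => //.
apply: ae_eq_integrable f2 => //; first exact: measurable_funX.
by apply: filterS fg => x + Bx => ->.
Qed.

End L2B1.

Section weak_partial.
Context (R : realType).
Local Notation T1 := (measurableTypeR R).
Local Notation T2 := (T1 * T1)%type.
Implicit Types (f g v w : R * R -> R) (e : R * R).
Let mB := @measurable_B1 R.

Definition axis e := e = e1 \/ e = e2.

Lemma test_derive e phi : axis e -> test_function phi -> continuous (fun x => 'D_e phi x).
Proof.
move=> he [/(_ 1%N) [_ [_ _ c1 c2]] _]; case: he => ->.
  exact: (@Ck_continuous R 0 _ c1).
exact: (@Ck_continuous R 0 _ c2).
Qed.

Lemma test_bounded phi : test_function phi ->
  exists C, forall x : R * R, B1 x -> `|phi x| <= C.
Proof.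
move=> /test_continuous/continuous_bounded_B1[C PC]; exists C => x /B1E/ltW; exact: PC.
Qed.

Lemma test_derive_bounded e phi : axis e -> test_function phi ->
  exists C, forall x : R * R, B1 x -> `|'D_e phi x| <= C.
Proof.
move=> he /(test_derive he)/continuous_bounded_B1[C PC].
by exists C => x /B1E/ltW; exact: PC.
Qed.

Lemma measurable_test phi : test_function phi -> measurable_fun (B1 : set T2) phi.
Proof.
by move=> tp; apply: measurable_funTS; apply: continuous_measurable2; exact: test_continuous.
Qed.

Lemma measurable_test_derive e phi : axis e -> test_function phi ->
  measurable_fun (B1 : set T2) (fun x => 'D_e phi x).
Proof.
by move=> he tp; apply: measurable_funTS; apply: continuous_measurable2; exact: test_derive.
Qed.

Lemma integrable_test v phi : L2B1 v -> test_function phi ->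
  leb2.-integrable B1 (fun x => (v x * phi x)%:E).
Proof.
move=> v2 tp; have [C PC] := test_bounded tp.
by apply: (integrable_mulb mB (L2_integrable v2)) PC; exact: measurable_test.
Qed.

Lemma integrable_test_derive e v phi : axis e -> L2B1 v -> test_function phi ->
  leb2.-integrable B1 (fun x => (v x * 'D_e phi x)%:E).
Proof.
move=> he v2 tp; have [C PC] := test_derive_bounded he tp.
by apply: (integrable_mulb mB (L2_integrable v2)) PC; exact: measurable_test_derive.
Qed.

(** This ties [wpartial], an unspecified choice, to derivatives computed explicitly. *)
Lemma weak_partial_unique e v v' g g' : axis e ->
  measurable_fun (B1 : set T2) v -> measurable_fun (B1 : set T2) v' ->
  {ae leb2, forall x, B1 x -> v x = v' x} ->
  is_weak_partial e v g -> is_weak_partial e v' g' ->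
  {ae leb2, forall x, B1 x -> g x = g' x}.
Proof.
move=> he mv mv' vv' [g2 gP] [g'2 g'P].
have := @fundamental_lemma R (g \- g') (L2_integrable (L2_sub g2 g'2)).
move=> H; have : {ae leb2, forall x, B1 x -> (g \- g') x = 0}.
  apply: H => phi tp.
  transitivity (\int[leb2]_(x in B1) (g x * phi x - g' x * phi x)).
    by apply: eq_Rintegral => x _; rewrite /= mulrBl.
  rewrite (RintegralB mB (integrable_test g2 tp) (integrable_test g'2 tp)).
  rewrite -[X in X - _]opprK -(gP _ tp) -[X in _ - X]opprK -(g'P _ tp) opprK addrC.
  apply/eqP; rewrite subr_eq0; apply/eqP.
  apply: ae_eq_Rintegral => //.
  - by apply: measurable_funM => //; exact: measurable_test_derive.
  - by apply: measurable_funM => //; exact: measurable_test_derive.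
  - by apply: filterS vv' => x + Bx => ->.
by apply: filterS => x /= + Bx => /(_ Bx)/eqP; rewrite subr_eq0 => /eqP.
Qed.

Lemma weak_partial_ae e v v' g g' : axis e ->
  measurable_fun (B1 : set T2) v -> measurable_fun (B1 : set T2) v' ->
  {ae leb2, forall x, B1 x -> v x = v' x} ->
  measurable_fun (B1 : set T2) g' ->
  {ae leb2, forall x, B1 x -> g x = g' x} ->
  is_weak_partial e v g -> is_weak_partial e v' g'.
Proof.
move=> he mv mv' vv' mg' gg' [g2 gP]; split; first exact: L2_ae gg' g2.
move=> phi tp.
have -> : \int[leb2]_(x in B1) (v' x * 'D_e phi x) = \int[leb2]_(x in B1) (v x * 'D_e phi x).
  apply: ae_eq_Rintegral => //.
  - by apply: measurable_funM => //; exact: measurable_test_derive.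
  - by apply: measurable_funM => //; exact: measurable_test_derive.
  - by apply: filterS vv' => x + Bx => ->.
rewrite (gP _ tp); congr (- _); apply: ae_eq_Rintegral => //.
- by apply: measurable_funM; [exact: L2_measurable|exact: measurable_test].
- by apply: measurable_funM => //; exact: measurable_test.
- by apply: filterS gg' => x + Bx => ->.
Qed.

Lemma weak_partial_sub e v w g k : axis e -> L2B1 v -> L2B1 w ->
  is_weak_partial e v g -> is_weak_partial e w k ->
  is_weak_partial e (v \- w) (g \- k).
Proof.
move=> he v2 w2 [g2 gP] [k2 kP]; split; first exact: L2_sub.
move=> phi tp.
transitivity (\int[leb2]_(x in B1) (v x * 'D_e phi x - w x * 'D_e phi x)).
  by apply: eq_Rintegral => x _; rewrite /= mulrBl.
rewrite (RintegralB mB (integrable_test_derive he v2 tp) (integrable_test_derive he w2 tp)).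
rewrite (gP _ tp) (kP _ tp) -opprD; congr (- _).
transitivity (\int[leb2]_(x in B1) (g x * phi x - k x * phi x)).
  by rewrite (RintegralB mB (integrable_test g2 tp) (integrable_test k2 tp)).
by apply: eq_Rintegral => x _; rewrite /= mulrBl.
Qed.

Lemma wpartialP e v : (exists g, is_weak_partial e v g) ->
  is_weak_partial e v (wpartial e v).
Proof. by move=> [g gP]; rewrite /wpartial; exact: (@xgetPex _ (fun=> 0) [set g | is_weak_partial e v g] (ex_intro _ g gP)). Qed.

Lemma W12_wpartial e v : axis e -> W12 v -> is_weak_partial e v (wpartial e v).
Proof. by move=> [->|->] [_ h1 h2]; exact: wpartialP. Qed.

Lemma axis1 : axis e1. Proof. by left. Qed.
Lemma axis2 : axis e2. Proof. by right. Qed.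

Lemma W12_L2 v : W12 v -> L2B1 v. Proof. by case. Qed.

Lemma W12_sub v w : W12 v -> W12 w -> W12 (v \- w).
Proof.
move=> Wv Ww; split; first by apply: L2_sub; exact: W12_L2.
- exists (wpartial e1 v \- wpartial e1 w); apply: weak_partial_sub axis1 _ _ _ _.
  + exact: W12_L2.
  + exact: W12_L2.
  + exact: W12_wpartial axis1 Wv.
  + exact: W12_wpartial axis1 Ww.
- exists (wpartial e2 v \- wpartial e2 w); apply: weak_partial_sub axis2 _ _ _ _.
  + exact: W12_L2.
  + exact: W12_L2.
  + exact: W12_wpartial axis2 Wv.
  + exact: W12_wpartial axis2 Ww.
Qed.

End weak_partial.

(** * Functions r^p q(theta) *)

Section angle.
Context (R : realType).
Local Notation T1 := (measurableTypeR R).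
Local Notation T2 := (T1 * T1)%type.
Implicit Types (x : R * R) (q : R -> R).

(** The half-angle formula tan(t / 2) = x.2 / (x.1 + r), with values in ]-pi, pi]. The denominator
    vanishes on the nonpositive half of the first axis. *)
Definition angle x : R :=
  if x.1 + enorm x == 0 then pi else 2 * atan (x.2 / (x.1 + enorm x)).

Definition rfun p q x : R := enorm x ^+ p * q (angle x).

Lemma measurable_atan : measurable_fun [set: R] (@atan R).
Proof. by apply: continuous_measurable_fun => x; exact: continuous_atan. Qed.

Lemma measurable_angle : measurable_fun [set: T2] (angle : T2 -> R).
Proof.
have m1 : measurable_fun [set: T2] (fun x : T2 => x.1 + enorm x).
  by apply: measurable_funD; [exact: measurable_fst|exact: measurable_enorm].
apply: measurable_fun_if => //.
- exact: measurable_fun_eqr.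
- apply: measurable_funTS; apply: measurable_funM => //.
  apply: (measurableT_comp measurable_atan).
  apply: measurable_funM; first exact: measurable_snd.
  exact: (measurableT_comp (@measurable_invr R)).
Qed.

Lemma measurable_rfun p q : measurable_fun [set: R] q ->
  measurable_fun [set: T2] (rfun p q : T2 -> R).
Proof.
move=> mq; apply: measurable_funM.
  by apply: measurable_funX; exact: measurable_enorm.
by apply: (measurableT_comp mq); exact: measurable_angle.
Qed.

Lemma periodic_int q : (forall t, q (t + 2 * pi) = q t) ->
  forall (z : int) t, q (t + 2 * pi * z%:~R) = q t.
Proof.
move=> qP.
have N (n : nat) t : q (t + 2 * pi * n%:R) = q t.
  elim: n t => [|n IHn] t; first by rewrite mulr0 addr0.
  by rewrite [n.+1%:R]mulrSr [in X in t + X]mulrDr mulr1 addrA qP.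
case=> n t; first exact: N.
by rewrite NegzE mulrNz mulrN -[LHS](N n.+1) subrK.
Qed.

Lemma angle_pol (r t : R) : 0 < r -> - pi < t <= pi -> angle (pol (r, t)) = t.
Proof.
move=> r0 /andP[t1 t2].
have E : (pol (r, t)).1 + enorm (pol (r, t)) = 2 * r * cos (t / 2) ^+ 2.
  rewrite enorm_pol /= gtr0_norm//.
  have {1}-> : t = (t / 2) *+ 2 by rewrite -mulr_natr divfK.
  by rewrite cos_mulr2n -mulr_natr; ring.
have pi0 := @pi_gt0 R.
rewrite /angle E !mulf_eq0 pnatr_eq0/= (gt_eqF r0) /= orbb.
move: t2; rewrite le_eqVlt => /predU1P[->|t2].
  by rewrite cos_pihalf eqxx.
have c0 : 0 < cos (t / 2) by apply: cos_gt0_pihalf; apply/andP; split; lra.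
rewrite (gt_eqF c0).
have -> : (pol (r, t)).2 / (2 * r * cos (t / 2) ^+ 2) = tan (t / 2).
  rewrite /= /tan; have {1}-> : t = (t / 2) *+ 2 by rewrite -mulr_natr divfK.
  rewrite sin_mulr2n -mulr_natr; field; by rewrite (gt_eqF r0) (gt_eqF c0).
rewrite tanK; first by rewrite mulrC divfK.
by rewrite in_itv/=; apply/andP; split; lra.
Qed.

Lemma periodic_angle_pol q (r t : R) : (forall t, q (t + 2 * pi) = q t) -> 0 < r ->
  q (angle (pol (r, t))) = q t.
Proof.
move=> qP r0; have pi0 := @pi_gt0 R.
pose z := Num.ceil ((t - pi) / (2 * pi)).
pose t0 := t - 2 * pi * z%:~R.
have pE : pol (r, t0) = pol (r, t).
  have cP : cos t0 = cos t.
    rewrite -[LHS](@periodic_int cos _ z); first by rewrite subrK.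
    by move=> s; rewrite mulr_natl cosD2pi.
  have sP : sin t0 = sin t.
    rewrite -[LHS](@periodic_int sin _ z); first by rewrite subrK.
    by move=> s; rewrite mulr_natl sinD2pi.
  by rewrite /pol /= cP sP.
rewrite -pE angle_pol//.
  by rewrite -[LHS](periodic_int qP z) subrK.
have p20 : 0 < 2 * pi :> R by rewrite mulr_gt0.
have := ceil_itv ((t - pi) / (2 * pi)).
rewrite -/z => /andP[h1 h2].
move: h1 h2; rewrite ltr_pdivlMr// ler_pdivrMr// intrB mulrBl mul1r [_ * (2 * pi)]mulrC => h1 h2.
by rewrite /t0; apply/andP; split; lra.
Qed.

Lemma rfun_pol p q (z : R * R) : (forall t, q (t + 2 * pi) = q t) -> 0 < z.1 ->
  rfun p q (pol z) = z.1 ^+ p * q z.2.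
Proof.
case: z => r t qP /= r0.
by rewrite /rfun enorm_pol/= gtr0_norm// periodic_angle_pol.
Qed.

End angle.

Section box_continuous.
Context (R : realType).
Local Notation mu := (@lebesgue_measure R).
Local Notation T1 := (measurableTypeR R).
Local Notation T2 := (T1 * T1)%type.

Lemma continuous_bounded_rect (f : R * R -> R) : continuous f ->
  exists C, forall z, rect 0 z -> `|f z| <= C.
Proof.
move=> cf.
have K : compact (`[0 : R, 1]%classic `*` `[0 : R, 2 * pi]%classic).
  by apply: compact_setX; exact: segment_compact.
have : compact (f @` (`[0 : R, 1]%classic `*` `[0 : R, 2 * pi]%classic)).
  by apply: continuous_compact => //; exact: continuous_subspaceT.
move=> /compact_bounded[C [_ HC]]; exists (C + 1) => z [] /=.
rewrite add0r in_itv/= => /andP[z0 z1] z2.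
by apply: (HC (C + 1)); [rewrite ltrDl|exists z => //; split => //=; rewrite in_itv/= !ltW].
Qed.

Lemma integrable_cont (a b : R) (f : R -> R) : continuous f ->
  mu.-integrable `[a, b] (EFin \o f).
Proof. by move=> cf; apply: integrable_within; exact: continuous_subspaceT. Qed.

Lemma integrable_cont_oo (a b : R) (f : R -> R) : continuous f ->
  mu.-integrable `]a, b[ (EFin \o f).
Proof.
move=> cf; apply: (integrableS _ _ _ (@integrable_cont a b f cf)) => //.
exact: subset_itv_oo_cc.
Qed.

Lemma Rintegral_derive_oo (F f : R -> R) (a b : R) : a <= b ->
  (forall x : R, is_derive x 1 F (f x)) -> continuous f ->
  \int[mu]_(x in `]a, b[) f x = F b - F a.
Proof.
move=> ab dF cf.
rewrite Rintegral_itv_bndo_bndc; last exact: integrable_cont_oo.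
rewrite Rintegral_itv_obnd_cbnd.
  by rewrite /Rintegral (@integral_derive R F f) // => x _; exact: cf.
apply: (integrableS _ _ _ (@integrable_cont a b f cf)) => //.
exact: subset_itv_oc_cc.
Qed.

Lemma integrable_rect_cont (v : R -> R) (X : R * R -> R) :
  mu.-integrable `[0, 2 * pi] (EFin \o v) -> continuous X ->
  leb2.-integrable (rect 0) (fun z => (v z.2 * X z)%:E).
Proof.
move=> iv cX; have [C CP] := continuous_bounded_rect cX.
apply: (@integrable_mulb R _ _ _ _ (fun z : T2 => v z.2) X C) => //.
- exact: measurable_rect.
- have := @integrable_box_mul R `]0, 1[ `[0, 0 + 2 * pi] (fun=> 1) v.
  rewrite add0r => H.
  have -> : rect 0 = (`]0, 1[%classic `*` `[0, 2 * pi]%classic) :> set T2.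
    by rewrite /rect add0r.
  apply: integrable_eqR (H _ _ _ iv) => //.
  + by apply: measurableX; exact: measurable_itv.
  + by move=> z _; rewrite mul1r.
  + by apply: integrable_cont_oo => x; exact: cst_continuous.
- by apply: measurable_funTS; exact: continuous_measurable2.
Qed.

End box_continuous.

Section H1circ.
Context (R : realType).
Local Notation mu := (@lebesgue_measure R).
Local Notation T1 := (measurableTypeR R).
Local Notation T2 := (T1 * T1)%type.
Implicit Types (q k : R -> R).

(** H^1 of the circle, as periodic functions on the line that carry a representative [k] of the
    derivative. Absolute continuity is asked on every interval, so that the window of integration
    can be moved. *)
Definition H1circ q k : Prop :=
  [/\ measurable_fun [set: T1] q /\ measurable_fun [set: T1] k,
      forall t, q (t + 2 * pi) = q t, forall t, k (t + 2 * pi) = k t,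
      mu.-integrable `[0, 2 * pi] (fun t => (k t ^+ 2)%:E) &
      forall a b, a <= b -> isAC a b q k].

Lemma periodic_window q (t : R) : (forall s, q (s + 2 * pi) = q s) ->
  exists2 s, 0 <= s <= 2 * pi & q t = q s.
Proof.
move=> qP; have p20 : 0 < 2 * pi :> R by rewrite mulr_gt0// pi_gt0.
pose z := Num.floor (t / (2 * pi)).
exists (t - 2 * pi * z%:~R); last by rewrite -[RHS](periodic_int qP z) subrK.
have := floor_itv (t / (2 * pi)); rewrite -/z intrD ltr_pdivrMr// ler_pdivlMr//.
rewrite (_ : 1%:~R = 1) // mulrDl mul1r [z%:~R * _]mulrC => /andP[h1 h2].
by apply/andP; split; lra.
Qed.

Lemma H1circ_bounded q k : H1circ q k -> exists2 C, 0 <= C & forall t, `|q t| <= C.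
Proof.
move=> [_ qP _ _ ac].
have p20 : 0 < 2 * pi :> R by rewrite mulr_gt0// pi_gt0.
have B := isAC_bounded (ac 0 (2 * pi) (ltW p20)).
exists (`|q 0| + \int[mu]_(x in `[0, 2 * pi]) `|k x|).
  by rewrite (le_trans _ (B 0 _))// lexx ltW.
by move=> t; have [s s01 ->] := periodic_window t qP; exact: B.
Qed.

Lemma H1circ_integrable q k : H1circ q k -> mu.-integrable `[0, 2 * pi] (EFin \o k).
Proof. by move=> [_ _ _ _ /(_ 0 (2 * pi))]; case=> //; rewrite mulr_ge0// pi_ge0. Qed.

Lemma H1circ_integrable_mulb q k (v : R -> R) : H1circ q k ->
  mu.-integrable `[0, 2 * pi] (EFin \o v) ->
  mu.-integrable `[0, 2 * pi] (fun t => (v t * q t)%:E).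
Proof.
move=> qk iv; have [C _ qC] := H1circ_bounded qk; case: qk => -[mq _] _ _ _ _.
apply: (integrable_mulb (C := C) _ iv) => //; exact: measurable_funTS.
Qed.

Lemma H1circ_integrable_q q k : H1circ q k -> mu.-integrable `[0, 2 * pi] (EFin \o q).
Proof.
move=> qk; have := H1circ_integrable_mulb qk (integrable_cont 0 (2 * pi) (@cst_continuous R R 1)).
by apply: integrable_eqR => // x _; rewrite mul1r.
Qed.

Lemma continuous_expn_fst n : continuous (fun z : R * R => z.1 ^+ n).
Proof.
move=> z; apply: (@continuous_comp _ _ _ fst (fun r : R => r ^+ n)).
  exact: cvg_fst.
exact: exprn_continuous.
Qed.

Lemma L2_rfun p (g : R -> R) : measurable_fun [set: T1] g ->
  (forall t, g (t + 2 * pi) = g t) ->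
  mu.-integrable `[0, 2 * pi] (fun t => (g t ^+ 2)%:E) -> L2B1 (rfun p g).
Proof.
move=> mg gP ig.
have mr : measurable_fun [set: T2] (rfun p g : T2 -> R) by exact: measurable_rfun.
split; first exact: measurable_funTS.
apply/(@integrable_B1 R 0); first by apply: measurable_funTS; exact: measurable_funX.
apply: integrable_eqR (@integrable_rect_cont R (fun t => g t ^+ 2)
  (fun z => z.1 ^+ (p * 2).+1) ig _).
- exact: measurable_rect.
- move=> z [] /=; rewrite in_itv/= => /andP[z0 _] _.
  have E (r y : R) : y ^+ 2 * r ^+ (p * 2).+1 = r ^+ (p * 2) * y ^+ 2 * r.
    by rewrite [r ^+ _]exprSr; move: (r ^+ (p * 2)) => w; ring.
  by rewrite rfun_pol// exprMn -exprM; exact: E.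
- exact: continuous_expn_fst.
Qed.

End H1circ.

Section weak_partial_rfun.
Context (R : realType).
Local Notation mu := (@lebesgue_measure R).
Local Notation T1 := (measurableTypeR R).
Local Notation T2 := (T1 * T1)%type.
Implicit Types (q k : R -> R) (e : R * R).

(** [nu] and [tau] are the radial and the angular component of [e] at the angle [t]. *)
Definition nu e (t : R) : R := e.1 * cos t + e.2 * sin t.
Definition tau e (t : R) : R := - e.1 * sin t + e.2 * cos t.

Lemma is_derive_tau e (t : R) : is_derive t 1 (tau e) (- nu e t).
Proof.
apply: is_derive_eq; rewrite /GRing.scale/= /nu; ring.
Qed.

Lemma continuous_nu e : continuous (nu e).
Proof.
by move=> t; apply: cvgD; apply: cvgM; [exact: cvg_cst|exact: continuous_cos|
  exact: cvg_cst|exact: continuous_sin].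
Qed.

Lemma continuous_tau e : continuous (tau e).
Proof.
by move=> t; apply: cvgD; apply: cvgM; [exact: cvg_cst|exact: continuous_sin|
  exact: cvg_cst|exact: continuous_cos].
Qed.

Lemma continuous_pol : continuous (@pol R).
Proof.
move=> z.
have h1 : z'.1 * cos z'.2 @[z' --> z] --> z.1 * cos z.2.
  apply: cvgM; first exact: cvg_fst.
  exact: (@continuous_comp _ _ _ snd (@cos R) z cvg_snd (@continuous_cos R z.2)).
have h2 : z'.1 * sin z'.2 @[z' --> z] --> z.1 * sin z.2.
  apply: cvgM; first exact: cvg_fst.
  exact: (@continuous_comp _ _ _ snd (@sin R) z cvg_snd (@continuous_sin R z.2)).
exact: (cvg_pair h1 h2).
Qed.

Lemma axis_derive e phi x : axis e ->
  'D_e phi x = e.1 * 'D_e1 phi x + e.2 * 'D_e2 phi x :> R.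
Proof. by case=> ->; rewrite /= mul1r mul0r ?addr0 ?add0r. Qed.

Lemma continuous_snd (g : R -> R) : continuous g -> continuous (fun z : R * R => g z.2).
Proof. by move=> cg z; exact: (@continuous_comp _ _ _ snd g z cvg_snd (cg z.2)). Qed.

Lemma continuous_comp_pol (f : R * R -> R) : continuous f -> continuous (fun z => f (pol z)).
Proof.
by move=> cf z; exact: (@continuous_comp _ _ _ (@pol R) f z (@continuous_pol z) (cf (pol z))).
Qed.

Lemma continuous2D (f g : R * R -> R) : continuous f -> continuous g ->
  continuous (fun z => f z + g z).
Proof. by move=> cf cg z; apply: cvgD; [exact: cf|exact: cg]. Qed.

Lemma continuous2M (f g : R * R -> R) : continuous f -> continuous g ->
  continuous (fun z => f z * g z).
Proof. by move=> cf cg z; apply: cvgM; [exact: cf|exact: cg]. Qed.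

Lemma continuous2N (f : R * R -> R) : continuous f -> continuous (fun z => - f z).
Proof. by move=> cf z; apply: cvgN; exact: cf. Qed.

Lemma continuous2_cst (c : R) : continuous (fun _ : R * R => c).
Proof. by move=> z; exact: cvg_cst. Qed.

Lemma continuous_slice1 (f : R * R -> R) y : continuous f -> continuous (fun x => f (x, y)).
Proof.
move=> cf x; apply: (@continuous_comp _ _ _ (fun x : R => (x, y)) f); last exact: cf.
exact: (cvg_pair cvg_id (cvg_cst y)).
Qed.

Lemma continuous_slice2 (f : R * R -> R) x : continuous f -> continuous (fun y => f (x, y)).
Proof.
move=> cf y; apply: (@continuous_comp _ _ _ (fun y : R => (x, y)) f); last exact: cf.
exact: (cvg_pair (cvg_cst x) cvg_id).
Qed.

Lemma is_derive_expn n (x : R) : is_derive x 1 (fun x : R => x ^+ n) (n%:R * x ^+ n.-1).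
Proof.
have -> : (fun x : R => x ^+ n) = id ^+ n by apply/funext => y; rewrite exprfctE.
apply: is_derive_eq (is_deriveX _ (is_derive_id x 1)) _.
by rewrite /GRing.scale/= mulr1.
Qed.

Lemma integrable_mul_cont (v g : R -> R) : mu.-integrable `[0, 2 * pi] (EFin \o v) ->
  continuous g -> mu.-integrable `[0, 2 * pi] (fun t => (v t * g t)%:E).
Proof.
move=> iv cg; have [C HC] := continuous_bounded_rect (continuous_snd cg).
apply: (integrable_mulb (C := C) _ iv) => //.
  by apply: measurable_funTS; exact: continuous_measurable_fun.
move=> t It; apply: (HC (2^-1, t)); split => /=; last by rewrite add0r.
by rewrite in_itv/= invr_gt0 ltr0n/= invf_lt1// ltr1n.
Qed.

Lemma continuous_sqr (g : R -> R) : continuous g -> continuous (fun t => g t ^+ 2).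
Proof.
by move=> cg t; exact: (@continuous_comp _ _ _ g (fun x : R => x ^+ 2) t (cg t)
  (@exprn_continuous _ 2 (g t))).
Qed.

Lemma Rintegral0_eq d (T : measurableType d) (m : {measure set T -> \bar R}) (D : set T)
  (f : T -> R) : (forall x, D x -> f x = 0) -> \int[m]_(x in D) f x = 0.
Proof.
by move=> f0; rewrite /Rintegral integral0_eq// => x Dx; rewrite f0.
Qed.

(** The angular factor of the partial derivative of r^p q(theta) in the direction [e]; the radial
    factor is r^(p-1). *)
Definition grad_rfun p e q k (t : R) : R := p%:R * q t * nu e t + k t * tau e t.

Section test.
Variables (p : nat) (e : R * R) (q k : R -> R) (phi : R * R -> R).
Hypotheses (he : axis e) (qk : H1circ q k) (tp : test_function phi).
Let Phi z := phi (pol z).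
Let d1 z := 'D_e1 phi (pol z).
Let d2 z := 'D_e2 phi (pol z).
Let Dr z := cos z.2 * d1 z + sin z.2 * d2 z.
Let Dt z := - (z.1 * sin z.2) * d1 z + z.1 * cos z.2 * d2 z.
(** [X1] is the r-derivative of [nu e t * r^(p+2) * Phi], and [X3] the angular derivative of [X2].
    The combination [q X1 + (k X2 + q X3)] is the integrand of the weak identity, area element
    included. *)
Let X1 z := nu e z.2 * (z.1 ^+ p.+2 * Dr z + p.+2%:R * z.1 ^+ p.+1 * Phi z).
Let X2 z := z.1 ^+ p.+1 * (tau e z.2 * Phi z).
Let X3 z := z.1 ^+ p.+1 * (- nu e z.2 * Phi z + tau e z.2 * Dt z).

Let C1phi : Ck 1 phi. Proof. by case: tp. Qed.

Let cPhi : continuous Phi.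
Proof. by apply: continuous_comp_pol; exact: test_continuous. Qed.

Let cd1 : continuous d1.
Proof. exact: (@continuous_comp_pol (fun x => 'D_e1 phi x) (test_derive (@axis1 R) tp)). Qed.

Let cd2 : continuous d2.
Proof. exact: (@continuous_comp_pol (fun x => 'D_e2 phi x) (test_derive (@axis2 R) tp)). Qed.

Let cDr : continuous Dr.
Proof.
exact: (continuous2D (continuous2M (continuous_snd (@continuous_cos R)) cd1)
  (continuous2M (continuous_snd (@continuous_sin R)) cd2)).
Qed.

Let cDt : continuous Dt.
Proof.
have c1 : continuous (fun z : R * R => z.1) by move=> z; exact: cvg_fst.
exact: (continuous2D
  (continuous2M (continuous2N (continuous2M c1 (continuous_snd (@continuous_sin R)))) cd1)
  (continuous2M (continuous2M c1 (continuous_snd (@continuous_cos R))) cd2)).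
Qed.

Let cX1 : continuous X1.
Proof.
apply: continuous2M; first by apply: continuous_snd; exact: continuous_nu.
apply: continuous2D; first by apply: continuous2M => //; exact: continuous_expn_fst.
apply: continuous2M => //; apply: continuous2M; first exact: continuous2_cst.
exact: continuous_expn_fst.
Qed.

Let cX2 : continuous X2.
Proof.
apply: continuous2M; first exact: continuous_expn_fst.
by apply: continuous2M => //; apply: continuous_snd; exact: continuous_tau.
Qed.

Let cX3 : continuous X3.
Proof.
apply: continuous2M; first exact: continuous_expn_fst.
apply: continuous2D; apply: continuous2M => //; last by apply: continuous_snd; exact: continuous_tau.
by apply: continuous2N; apply: continuous_snd; exact: continuous_nu.
Qed.

Let p20 : 0 <= 2 * pi :> R. Proof. by rewrite mulr_ge0// pi_ge0. Qed.

Let i1 : leb2.-integrable (rect 0) (fun z => (q z.2 * X1 z)%:E).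
Proof. by apply: integrable_rect_cont => //; exact: H1circ_integrable_q qk. Qed.

Let i2 : leb2.-integrable (rect 0) (fun z => (k z.2 * X2 z)%:E).
Proof. by apply: integrable_rect_cont => //; exact: H1circ_integrable qk. Qed.

Let i3 : leb2.-integrable (rect 0) (fun z => (q z.2 * X3 z)%:E).
Proof. by apply: integrable_rect_cont => //; exact: H1circ_integrable_q qk. Qed.

Let int1 : \int[leb2]_(z in rect 0) (q z.2 * X1 z) = 0.
Proof.
rewrite (Rintegral_box2 _ _ i1); [|exact: measurable_itv|exact: measurable_itv].
apply: Rintegral0_eq => y _.
have dF (x : R) : is_derive x 1 (fun x => q y * (nu e y * (x ^+ p.+2 * Phi (x, y))))
    (q y * X1 (x, y)).
  have h1 := is_derive_polr C1phi x y.
  have h2 := is_derive_expn p.+2 x.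
  rewrite /X1 /Phi; apply: is_derive_eq; rewrite /GRing.scale/= /Dr /d1 /d2 /=.
  by ring.
have cF : continuous (fun x => q y * X1 (x, y)).
  have cX : continuous (fun z => q y * X1 z) by exact: (continuous2M (@continuous2_cst (q y)) cX1).
  exact: (@continuous_slice1 (fun z => q y * X1 z) y cX).
rewrite (Rintegral_derive_oo (@ler01 R) dF cF).
rewrite /Phi (@test_out R phi tp (pol (1, y))).
  by rewrite expr0n/= mul0r !mulr0 subrr.
by rewrite /B1 /= enorm_pol/= normr1 ltxx.
Qed.

Let dX2 (x y : R) : is_derive y 1 (fun y => X2 (x, y)) (X3 (x, y)).
Proof.
have h1 := is_derive_polt C1phi x y; have h2 := is_derive_tau e y.
rewrite /X2 /X3 /Phi /=; move: (x ^+ p.+1) => w; apply: is_derive_eq; rewrite /GRing.scale/= /Dt /d1 /d2 /Phi/=.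
by ring.
Qed.

Let int2 : \int[leb2]_(z in rect 0) (k z.2 * X2 z + q z.2 * X3 z) = 0.
Proof.
rewrite (@Rintegral_box1 R `]0, 1[ `[0, 0 + 2 * pi] (fun z => k z.2 * X2 z + q z.2 * X3 z));
  [|exact: measurable_itv|exact: measurable_itv|exact: (integrable_addR (measurable_rect 0) i2 i3)].
apply: Rintegral0_eq => x _; rewrite add0r.
have [_ qP kP _ /(_ _ _ p20) ac] := qk.
have ac2 : isAC 0 (2 * pi) (fun y => X2 (x, y)) (fun y => X3 (x, y)).
  apply: (@isAC_C1 R 0 (2 * pi) (fun y => X2 ((x : R), y)) (fun y => X3 ((x : R), y))).
    by move=> y _; exact: dX2.
  by move=> y _; have := @continuous_slice2 X3 x cX3 y.
have := isAC_end p20 (isAC_mul ac ac2) => /= <-.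
have -> : q (2 * pi) = q 0 by rewrite -[in RHS](qP 0) add0r.
have -> : X2 (x, 2 * pi) = X2 (x, 0).
  have c0 : circ (2 * pi) = circ 0 :> R * R by rewrite -(circD2pi 0) add0r.
  have c1 : cos (2 * pi) = cos 0 :> R := congr1 fst c0.
  have s1 : sin (2 * pi) = sin 0 :> R := congr1 snd c0.
  by rewrite /X2 /Phi /pol /tau/= c1 s1.
by rewrite subrr.
Qed.

Lemma rfun_grad_L2 : L2B1 (rfun p (grad_rfun p.+1 e q k)).
Proof.
have [[mq mk] qP kP ik2 _] := qk; have [C C0 qC] := H1circ_bounded qk.
have mnu : measurable_fun [set: T1] (nu e) by apply: continuous_measurable_fun; exact: continuous_nu.
have mtau : measurable_fun [set: T1] (tau e) by apply: continuous_measurable_fun; exact: continuous_tau.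
have cD t : cos (t + 2 * pi) = cos t :> R by rewrite mulr_natl cosD2pi.
have sD t : sin (t + 2 * pi) = sin t :> R by rewrite mulr_natl sinD2pi.
apply: L2_rfun.
- apply: measurable_funD; apply: measurable_funM => //.
  by apply: measurable_funM.
- by move=> t; rewrite /grad_rfun /nu /tau qP kP cD sD.
- have mI : measurable (`[0, 2 * pi]%classic : set T1) by exact: measurable_itv.
  have j1 : mu.-integrable `[0, 2 * pi] (fun t => (k t ^+ 2 * tau e t ^+ 2)%:E).
    by apply: integrable_mul_cont => // t; apply: continuous_sqr; exact: continuous_tau.
  have j2 : mu.-integrable `[0, 2 * pi] (fun t => (nu e t ^+ 2 * q t * q t)%:E).
    apply: (H1circ_integrable_mulb qk); apply: (H1circ_integrable_mulb qk).
    by apply: integrable_cont => t; apply: continuous_sqr; exact: continuous_nu.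
  have j3 : mu.-integrable `[0, 2 * pi] (fun t => (k t * nu e t * tau e t * q t)%:E).
    apply: (H1circ_integrable_mulb qk); apply: integrable_mul_cont; last exact: continuous_tau.
    apply: integrable_mul_cont; last exact: continuous_nu.
    exact: H1circ_integrable qk.
  apply: integrable_eqR (integrable_addR mI j1 (integrable_addR mI
    (integrable_scaleR mI (p.+1%:R ^+ 2) j2) (integrable_scaleR mI (2 * p.+1%:R) j3))) => // t _.
  by rewrite /grad_rfun; ring.
Qed.

(** In polar coordinates the sum of the two integrands is an exact r-derivative plus an exact
    angular derivative. The boundary terms vanish by the power of r at 0, by the support of [phi] at
    1, and by periodicity in the angle. *)
Lemma weak_partial_rfun_test :
  \int[leb2]_(x in B1) (rfun p.+1 q x * 'D_e phi x) =
  - \int[leb2]_(x in B1) (rfun p (grad_rfun p.+1 e q k) x * phi x).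
Proof.
have [[mq mk] qP kP ik2 _] := qk.
have mD := @measurable_rect R 0.
have gP t : grad_rfun p.+1 e q k (t + 2 * pi) = grad_rfun p.+1 e q k t.
  rewrite /grad_rfun /nu /tau qP kP.
  have -> : cos (t + 2 * pi) = cos t :> R by rewrite mulr_natl cosD2pi.
  by have -> : sin (t + 2 * pi) = sin t :> R by rewrite mulr_natl sinD2pi.
have L1 : L2B1 (rfun p.+1 q).
  apply: L2_rfun => //.
  have := H1circ_integrable_mulb qk (H1circ_integrable_q qk).
  by apply: integrable_eqR.
have I1 := integrable_test_derive he L1 tp.
have I2 := integrable_test rfun_grad_L2 tp.
have M1 : measurable_fun (B1 : set T2) (fun x => rfun p.+1 q x * 'D_e phi x).
  by apply: measurable_funM; [exact: L2_measurable|exact: measurable_test_derive].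
have M2 : measurable_fun (B1 : set T2) (fun x => rfun p (grad_rfun p.+1 e q k) x * phi x).
  by apply: measurable_funM; [exact: (L2_measurable rfun_grad_L2)|exact: measurable_test].
rewrite (Rintegral_B1 0 M1) (Rintegral_B1 0 M2).
apply/eqP; rewrite -addr_eq0; apply/eqP.
move/(integrable_B1 0 M1): I1 => I1; move/(integrable_B1 0 M2): I2 => I2.
rewrite -(RintegralD mD I1 I2).
transitivity (\int[leb2]_(z in rect 0) (q z.2 * X1 z + (k z.2 * X2 z + q z.2 * X3 z))).
  apply: eq_Rintegral => z /set_mem[] /=; rewrite in_itv/= => /andP[z0 _] _.
  rewrite !rfun_pol// (axis_derive _ _ he).
  have E (c s r D1 D2 P a b Q K : R) : c ^+ 2 + s ^+ 2 = 1 ->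
    r ^+ p.+1 * Q * (a * D1 + b * D2) * r +
    r ^+ p * (p.+1%:R * Q * (a * c + b * s) + K * (- a * s + b * c)) * P * r =
    Q * ((a * c + b * s) * (r ^+ p.+2 * (c * D1 + s * D2) + p.+2%:R * r ^+ p.+1 * P)) +
    (K * (r ^+ p.+1 * ((- a * s + b * c) * P)) +
     Q * (r ^+ p.+1 * (- (a * c + b * s) * P + (- a * s + b * c) * (- (r * s) * D1 + r * c * D2)))).
    move=> cs.
    have -> : p.+2%:R = p.+1%:R + 1 :> R by rewrite natr1.
    have -> : a * D1 + b * D2 = (c ^+ 2 + s ^+ 2) * (a * D1 + b * D2) by rewrite cs mul1r.
    rewrite [r ^+ p.+2]exprSr [r ^+ p.+1]exprSr.
    by move: (r ^+ p) (p.+1%:R : R) => v n; ring.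
  exact: (E _ _ _ _ _ _ _ _ _ _ (cos2Dsin2 (z.2 : R))).
have i23 := integrable_addR mD i2 i3.
by rewrite (RintegralD mD i1 i23) int1 int2 addr0.
Qed.

End test.

End weak_partial_rfun.

Section H1circ_theory.
Context (R : realType).
Local Notation mu := (@lebesgue_measure R).
Local Notation T1 := (measurableTypeR R).
Local Notation T2 := (T1 * T1)%type.
Implicit Types (q k : R -> R) (e : R * R).

Lemma integrable_addx (a b : R) (f g : R -> R) : mu.-integrable `[a, b] (EFin \o f) ->
  mu.-integrable `[a, b] (EFin \o g) -> mu.-integrable `[a, b] (fun t => (f t + g t)%:E).
Proof. by apply: integrable_addR; exact: measurable_itv. Qed.

Lemma integrable_scalex (a b c : R) (f : R -> R) : mu.-integrable `[a, b] (EFin \o f) ->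
  mu.-integrable `[a, b] (fun t => (c * f t)%:E).
Proof. by apply: integrable_scaleR; exact: measurable_itv. Qed.

Lemma integrable_eqx (a b : R) (f g : R -> R) : (forall t, f t = g t) ->
  mu.-integrable `[a, b] (EFin \o f) -> mu.-integrable `[a, b] (EFin \o g).
Proof. by move=> fg; apply: integrable_eqR; [exact: measurable_itv|move=> x _]. Qed.

Lemma integrable_mul_sqr (a b : R) (f g : R -> R) :
  measurable_fun [set: T1] f -> measurable_fun [set: T1] g ->
  mu.-integrable `[a, b] (fun t => (f t ^+ 2)%:E) ->
  mu.-integrable `[a, b] (fun t => (g t ^+ 2)%:E) ->
  mu.-integrable `[a, b] (fun t => (f t * g t)%:E).
Proof.
move=> mf mg f2 g2.
have mI : measurable (`[a, b]%classic : set T1) by exact: measurable_itv.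
apply: (@le_integrable _ _ _ _ _ mI _ (fun t => (f t ^+ 2 + g t ^+ 2)%:E)).
- by apply/measurable_EFinP; apply: measurable_funTS; exact: measurable_funM.
- move=> x _ /=; rewrite lee_fin (@ger0_norm _ (_ + _)) ?addr_ge0 ?sqr_ge0//.
  exact: normr_mul_le_sqr.
- exact: integrable_addR.
Qed.

Lemma H1circ_add q1 k1 q2 k2 : H1circ q1 k1 -> H1circ q2 k2 ->
  H1circ (fun t => q1 t + q2 t) (fun t => k1 t + k2 t).
Proof.
move=> [[mq1 mk1] qP1 kP1 i1 ac1] [[mq2 mk2] qP2 kP2 i2 ac2]; split.
- by split; exact: measurable_funD.
- by move=> t; rewrite qP1 qP2.
- by move=> t; rewrite kP1 kP2.
- apply: integrable_eqx (integrable_addx (integrable_addx i1 i2)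
    (integrable_scalex 2 (integrable_mul_sqr mk1 mk2 i1 i2))) => t; ring.
- by move=> a b ab; apply: isAC_add; [exact: ac1|exact: ac2].
Qed.

Lemma H1circ_scale c q k : H1circ q k -> H1circ (fun t => c * q t) (fun t => c * k t).
Proof.
move=> [[mq mk] qP kP ik ac]; split.
- by split; exact: measurable_funM.
- by move=> t; rewrite qP.
- by move=> t; rewrite kP.
- by apply: integrable_eqx (integrable_scalex (c ^+ 2) ik) => t; rewrite exprMn.
- by move=> a b ab; apply: isAC_scale; exact: ac.
Qed.

Lemma H1circ_sub q1 k1 q2 k2 : H1circ q1 k1 -> H1circ q2 k2 ->
  H1circ (fun t => q1 t - q2 t) (fun t => k1 t - k2 t).
Proof.
move=> h1 /(H1circ_scale (-1)) h2; have := H1circ_add h1 h2.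
by congr H1circ; apply/funext => t; rewrite mulN1r.
Qed.

Lemma H1circ0 : H1circ (fun=> 0 : R) (fun=> 0 : R).
Proof.
split => //.
- by apply: integrable_eqx (integrable_cont 0 (2 * pi) (@cst_continuous R R 0)) => t;
    rewrite expr0n.
- by move=> a b ab; exact: (@isAC_cst R a b 0).
Qed.

Lemma H1circ_integrable_sqr q k : H1circ q k ->
  mu.-integrable `[0, 2 * pi] (fun t => (q t ^+ 2)%:E).
Proof. by move=> qk; apply: (H1circ_integrable_mulb qk); exact: H1circ_integrable_q qk. Qed.

Lemma is_weak_partial_rfun p e q k : axis e -> H1circ q k ->
  is_weak_partial e (rfun p.+1 q) (rfun p (grad_rfun p.+1 e q k)).
Proof.
move=> he qk; split; first exact: rfun_grad_L2.
by move=> phi tp; exact: weak_partial_rfun_test.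
Qed.

Lemma L2_rfun_H1 p q k : H1circ q k -> L2B1 (rfun p q).
Proof.
by move=> qk; have [[mq _] qP _ _ _] := qk; apply: L2_rfun => //; exact: H1circ_integrable_sqr qk.
Qed.

Lemma W12_rfun p q k : H1circ q k -> W12 (rfun p.+1 q).
Proof.
move=> qk; split; first exact: L2_rfun_H1 qk.
- by exists (rfun p (grad_rfun p.+1 e1 q k)); apply: is_weak_partial_rfun => //; left.
- by exists (rfun p (grad_rfun p.+1 e2 q k)); apply: is_weak_partial_rfun => //; right.
Qed.

Lemma W12_ae v w : W12 v -> measurable_fun (B1 : set T2) w ->
  {ae leb2, forall x, B1 x -> v x = w x} -> W12 w.
Proof.
move=> Wv mw vw; have mv := L2_measurable (W12_L2 Wv); split.
- exact: L2_ae vw (W12_L2 Wv).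
- exists (wpartial e1 v); have W1 := W12_wpartial (@axis1 R) Wv.
  apply: (weak_partial_ae (@axis1 R) mv mw vw _ _ W1); last exact: filterE.
  by case: W1 => /L2_measurable.
- exists (wpartial e2 v); have W2 := W12_wpartial (@axis2 R) Wv.
  apply: (weak_partial_ae (@axis2 R) mv mw vw _ _ W2); last exact: filterE.
  by case: W2 => /L2_measurable.
Qed.

Section energy.
Variables (q1 k1 q2 k2 : R -> R) (v : R * R -> R).
Hypotheses (h1 : H1circ q1 k1) (h2 : H1circ q2 k2).
Hypotheses (mv : measurable_fun (B1 : set T2) v)
  (vE : {ae leb2, forall x, B1 x -> v x = rfun 3 q1 x - rfun 4 q2 x}).

(** One form serves [c], [h] and the competitor; for the first two [q2] is 0. Equality holds only
    almost everywhere because that is all that is known of [c]. *)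
Lemma W12_rfun34 : W12 v.
Proof.
have W := W12_sub (W12_rfun 2 h1) (W12_rfun 3 h2).
by apply: (W12_ae W mv); apply: filterS vE => x + Bx => ->.
Qed.

Lemma wpartial_rfun34 e : axis e -> {ae leb2, forall x, B1 x ->
  wpartial e v x = rfun 2 (grad_rfun 3 e q1 k1) x - rfun 3 (grad_rfun 4 e q2 k2) x}.
Proof.
move=> he.
have W := weak_partial_sub he (L2_rfun_H1 3 h1) (L2_rfun_H1 4 h2)
  (is_weak_partial_rfun 2 he h1) (is_weak_partial_rfun 3 he h2).
apply: (weak_partial_unique he mv _ vE (W12_wpartial he W12_rfun34) W).
by apply: measurable_funB; apply: L2_measurable; [exact: L2_rfun_H1 h1|exact: L2_rfun_H1 h2].
Qed.

Lemma grad_rfun_periodic p e q k : H1circ q k ->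
  forall t, grad_rfun p e q k (t + 2 * pi) = grad_rfun p e q k t.
Proof.
move=> [_ qP kP _ _] t; rewrite /grad_rfun /nu /tau qP kP.
have -> : cos (t + 2 * pi) = cos t :> R by rewrite mulr_natl cosD2pi.
by have -> : sin (t + 2 * pi) = sin t :> R by rewrite mulr_natl sinD2pi.
Qed.

Lemma wgrad_sq_rfun34 : {ae leb2, forall z, rect 0 z ->
  v (pol z) = z.1 ^+ 3 * q1 z.2 - z.1 ^+ 4 * q2 z.2 /\
  wgrad_sq v (pol z) = z.1 ^+ 4 * (9 * q1 z.2 ^+ 2 + k1 z.2 ^+ 2)
    - 2 * z.1 ^+ 5 * (12 * q1 z.2 * q2 z.2 + k1 z.2 * k2 z.2)
    + z.1 ^+ 6 * (16 * q2 z.2 ^+ 2 + k2 z.2 ^+ 2)}.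
Proof.
have := wpartial_rfun34 (@axis1 R); have := wpartial_rfun34 (@axis2 R).
move=> /(@ae_rect R 0) a2 /(@ae_rect R 0) a1; have a0 := @ae_rect R 0 _ vE.
apply: filterS3 a0 a1 a2 => z a0 a1 a2 Dz.
have z0 : 0 < z.1 by case: Dz; rewrite /= in_itv/= => /andP[].
have [_ qP1 _ _ _] := h1; have [_ qP2 _ _ _] := h2.
split; first by rewrite a0// !rfun_pol.
rewrite /wgrad_sq a1// a2// !rfun_pol//; try exact: grad_rfun_periodic.
have E (c s r Q1 K1 Q2 K2 : R) : c ^+ 2 + s ^+ 2 = 1 ->
  (r ^+ 2 * (3 * Q1 * (1 * c + 0 * s) + K1 * (- 1 * s + 0 * c))
   - r ^+ 3 * (4 * Q2 * (1 * c + 0 * s) + K2 * (- 1 * s + 0 * c))) ^+ 2 +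
  (r ^+ 2 * (3 * Q1 * (0 * c + 1 * s) + K1 * (- 0 * s + 1 * c))
   - r ^+ 3 * (4 * Q2 * (0 * c + 1 * s) + K2 * (- 0 * s + 1 * c))) ^+ 2 =
  r ^+ 4 * (9 * Q1 ^+ 2 + K1 ^+ 2) - 2 * r ^+ 5 * (12 * Q1 * Q2 + K1 * K2)
    + r ^+ 6 * (16 * Q2 ^+ 2 + K2 ^+ 2).
  move=> cs; set rhs := (RHS).
  transitivity ((c ^+ 2 + s ^+ 2) * rhs); last by rewrite cs mul1r.
  by rewrite /rhs; ring.
exact: (E _ _ _ _ _ _ _ (cos2Dsin2 (z.2 : R))).
Qed.

End energy.

Lemma Rintegral_rect_pow n (u : R -> R) : mu.-integrable `[0, 2 * pi] (EFin \o u) ->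
  leb2.-integrable (rect 0) (fun z => (u z.2 * z.1 ^+ n)%:E) /\
  \int[leb2]_(z in rect 0) (u z.2 * z.1 ^+ n) = (\int[mu]_(t in `[0, 2 * pi]) u t) / n.+1%:R.
Proof.
move=> iu; have i1 := integrable_rect_cont iu (@continuous_expn_fst R n); split => //.
rewrite (@Rintegral_box2 R `]0, 1[ `[0, 0 + 2 * pi] (fun z => u z.2 * z.1 ^+ n));
  [|exact: measurable_itv|exact: measurable_itv|exact: i1].
rewrite add0r.
have dF (x : R) : is_derive x 1 (fun x : R => x ^+ n.+1 / n.+1%:R) (x ^+ n).
  have h := is_derive_expn n.+1 x.
  apply: is_derive_eq; rewrite /GRing.scale/=.
  have : n.+1%:R != 0 :> R by rewrite pnatr_eq0.
  by move: (n.+1%:R : R) => m m0; field.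
transitivity (\int[mu]_(t in `[0, 2 * pi]) (n.+1%:R^-1 * u t)); last first.
  by rewrite RintegralZl// mulrC.
apply: eq_Rintegral => t _ /=.
rewrite RintegralZl; [|exact: measurable_itv|].
  rewrite (Rintegral_derive_oo (@ler01 R) dF); last by move=> x; exact: exprn_continuous.
  by rewrite expr1n expr0n/= mul0r subr0 mul1r mulrC.
by apply: integrable_cont_oo => x; exact: exprn_continuous.
Qed.

(** The powers 5, 6, 7 are those of the energy density of r^3 q1 - r^4 q2: products of gradients of
    degrees 2 and 3, and r times the function itself, each multiplied by the area element r. *)
Lemma Rintegral_B1_pow (F : R * R -> R) (u5 u6 u7 : R -> R) :
  measurable_fun (B1 : set T2) F ->
  mu.-integrable `[0, 2 * pi] (EFin \o u5) -> mu.-integrable `[0, 2 * pi] (EFin \o u6) ->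
  mu.-integrable `[0, 2 * pi] (EFin \o u7) ->
  {ae leb2, forall z, rect 0 z ->
    F (pol z) * z.1 = u5 z.2 * z.1 ^+ 5 + (u6 z.2 * z.1 ^+ 6 + u7 z.2 * z.1 ^+ 7)} ->
  leb2.-integrable B1 (EFin \o F) /\
  \int[leb2]_(x in B1) F x = (\int[mu]_(t in `[0, 2 * pi]) u5 t) / 6 +
   ((\int[mu]_(t in `[0, 2 * pi]) u6 t) / 7 + (\int[mu]_(t in `[0, 2 * pi]) u7 t) / 8).
Proof.
move=> mF i5 i6 i7 FE; have mD := @measurable_rect R 0.
have [j5 e5] := Rintegral_rect_pow 5 i5; have [j6 e6] := Rintegral_rect_pow 6 i6.
have [j7 e7] := Rintegral_rect_pow 7 i7.
have j67 := integrable_addR mD j6 j7; have j567 := integrable_addR mD j5 j67.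
have mP := @measurable_funM_pol R 0 F mF.
have mj : measurable_fun (rect 0) (fun z : T2 =>
    u5 z.2 * z.1 ^+ 5 + (u6 z.2 * z.1 ^+ 6 + u7 z.2 * z.1 ^+ 7)).
  by move/integrableP: j567 => [/measurable_EFinP].
split.
  apply/(integrable_B1 0 mF).
  apply: (@ae_eq_integrable _ _ _ _ _ _ _ mD mP _ j567).
  by apply: filterS FE => z + Dz => ->.
rewrite (Rintegral_B1 0 mF); transitivity (\int[leb2]_(z in rect 0)
    (u5 z.2 * z.1 ^+ 5 + (u6 z.2 * z.1 ^+ 6 + u7 z.2 * z.1 ^+ 7))).
  by apply: ae_eq_Rintegral; [exact: mD|exact: mP|exact: mj|exact: FE].
transitivity (\int[leb2]_(z in rect 0) (u5 z.2 * z.1 ^+ 5) +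
  \int[leb2]_(z in rect 0) (u6 z.2 * z.1 ^+ 6 + u7 z.2 * z.1 ^+ 7)).
  exact: (RintegralD mD j5 j67).
rewrite e5 -e6 -e7; congr (_ + _).
exact: (RintegralD mD j6 j7).
Qed.

End H1circ_theory.

(** * Weak derivatives in polar coordinates *)

Section harmonics.
Context (R : realType).
Local Notation T1 := (measurableTypeR R).
Local Notation T2 := (T1 * T1)%type.
Implicit Types (phi A : R * R -> R) (x : R * R) (b : bool) (k : nat).

(** Real and imaginary part of the k-th power of x.1 + i x.2: polynomials that become cos(k t) and
    sin(k t) on the circle. *)
Fixpoint CS k x : R * R :=
  if k is k'.+1 then
    (x.1 * (CS k' x).1 - x.2 * (CS k' x).2, x.1 * (CS k' x).2 + x.2 * (CS k' x).1)
  else (1, 0).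

Definition harm b k x : R := if b then (CS k x).1 else (CS k x).2.

Definition trig b k (t : R) : R := if b then cos (k%:R * t) else sin (k%:R * t).

Definition dtrig b k (t : R) : R :=
  if b then - k%:R * sin (k%:R * t) else k%:R * cos (k%:R * t).

Lemma CS_pol k (r t : R) :
  CS k (pol (r, t)) = (r ^+ k * cos (k%:R * t), r ^+ k * sin (k%:R * t)).
Proof.
elim: k => [|k IH]; first by rewrite /= mul0r cos0 sin0 expr0 mulr1 mulr0.
rewrite [LHS]/= IH /= mulrSr mulrDl mul1r cosD sinD exprSr.
by congr (_, _); ring.
Qed.

Lemma harm_pol b k (r t : R) : harm b k (pol (r, t)) = r ^+ k * trig b k t.
Proof. by rewrite /harm /trig CS_pol; case: b. Qed.

Lemma Ck_harm b k n : Ck n (harm b k).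
Proof.
suff H : Ck n (fun x => (CS k x).1) /\ Ck n (fun x => (CS k x).2).
  by rewrite /harm; case: b; case: H.
elim: k => [|k [IH1 IH2]]; first by split; exact: Ck_cst.
split; last by apply: Ck_add; apply: Ck_mul => //; [exact: Ck_fst|exact: Ck_snd].
have -> : (fun x => (CS k.+1 x).1) =
    (fun x => x.1 * (CS k x).1 + ((-1) * x.2) * (CS k x).2).
  by apply/funext => x /=; ring.
apply: Ck_add; apply: Ck_mul => //; first exact: Ck_fst.
by apply: Ck_mul; [exact: Ck_cst|exact: Ck_snd].
Qed.

Lemma is_derive_trig b k (t : R) : is_derive t 1 (trig b k) (dtrig b k t).
Proof. by case: b; [exact: is_derive_cosM|exact: is_derive_sinM]. Qed.

Lemma trig_le1 b k (t : R) : `|trig b k t| <= 1.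
Proof.
by rewrite ler_norml; case: b => /=; rewrite ?cos_geN1 ?cos_le1 ?sin_geN1 ?sin_le1.
Qed.

Lemma continuous_trig b k : continuous (trig b k).
Proof. by case: b; [exact: continuous_cosM|exact: continuous_sinM]. Qed.

Lemma continuous_dtrig b k : continuous (dtrig b k).
Proof.
case: b => t; apply: cvgM; try exact: cvg_cst.
  exact: continuous_sinM.
exact: continuous_cosM.
Qed.

Lemma test_mul A phi : (forall n, Ck n A) -> test_function phi ->
  test_function (fun x => A x * phi x).
Proof.
move=> cA [cphi [K [cK KB K0]]]; split; first by move=> n; exact: Ck_mul.
by exists K; split => // x /K0 ->; rewrite mulr0.
Qed.

Lemma test_Ck1 phi : test_function phi -> Ck 1 phi. Proof. by case. Qed.

Lemma derive_fstM phi x : test_function phi ->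
  ('D_e1 (fun x => x.1 * phi x) x = phi x + x.1 * 'D_e1 phi x) *
  ('D_e2 (fun x => x.1 * phi x) x = x.1 * 'D_e2 phi x).
Proof.
move=> /test_Ck1 C1; have h1 := Ck_derive1 C1 x; have h2 := Ck_derive2 C1 x.
have f1 := is_derive_fst x e1; have f2 := is_derive_fst x e2.
split; apply: derive_val; apply: is_derive_eq; rewrite /GRing.scale/=; ring.
Qed.

Lemma derive_sndM phi x : test_function phi ->
  ('D_e1 (fun x => x.2 * phi x) x = x.2 * 'D_e1 phi x) *
  ('D_e2 (fun x => x.2 * phi x) x = phi x + x.2 * 'D_e2 phi x).
Proof.
move=> /test_Ck1 C1; have h1 := Ck_derive1 C1 x; have h2 := Ck_derive2 C1 x.
have f1 := is_derive_snd x e1; have f2 := is_derive_snd x e2.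
split; apply: derive_val; apply: is_derive_eq; rewrite /GRing.scale/=; ring.
Qed.

Lemma weak_divergence v phi1 phi2 : W12 v -> test_function phi1 -> test_function phi2 ->
  \int[leb2]_(x in B1) (v x * ('D_e1 phi1 x + 'D_e2 phi2 x)) =
  - \int[leb2]_(x in B1) (wpartial e1 v x * phi1 x + wpartial e2 v x * phi2 x).
Proof.
move=> Wv t1 t2; have mB := @measurable_B1 R.
have [g1 w1] := W12_wpartial (@axis1 R) Wv; have [g2 w2] := W12_wpartial (@axis2 R) Wv.
have v2 := W12_L2 Wv.
have i1 := integrable_test_derive (@axis1 R) v2 t1.
have i2 := integrable_test_derive (@axis2 R) v2 t2.
have j1 := integrable_test g1 t1; have j2 := integrable_test g2 t2.
transitivity (\int[leb2]_(x in B1) (v x * 'D_e1 phi1 x + v x * 'D_e2 phi2 x)).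
  by apply: eq_Rintegral => x _; rewrite mulrDr.
transitivity (\int[leb2]_(x in B1) (v x * 'D_e1 phi1 x) + \int[leb2]_(x in B1) (v x * 'D_e2 phi2 x)).
  exact: (RintegralD mB i1 i2).
rewrite (w1 _ t1) (w2 _ t2) -opprD; congr (- _).
by rewrite -(RintegralD mB j1 j2).
Qed.

Variables (v phi : R * R -> R).
Hypotheses (Wv : W12 v) (tp : test_function phi).

(** Tested with the radial field [(x.1 * phi, x.2 * phi)], whose divergence is [2 phi] plus r times
    the radial derivative. *)
Lemma weak_radial (dr : R -> R -> R) :
  (forall r t : R, 0 < r < 1 -> is_derive r 1 (fun s => phi (pol (s, t))) (dr r t)) ->
  \int[leb2]_(z in rect 0) (v (pol z) * (2 * phi (pol z) + z.1 * dr z.1 z.2) * z.1) =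
  - \int[leb2]_(x in B1) ((x.1 * wpartial e1 v x + x.2 * wpartial e2 v x) * phi x).
Proof.
move=> drP.
have t1 := test_mul (@Ck_fst R) tp; have t2 := test_mul (@Ck_snd R) tp.
have := weak_divergence Wv t1 t2.
have -> : \int[leb2]_(x in B1) (wpartial e1 v x * (x.1 * phi x) + wpartial e2 v x * (x.2 * phi x)) =
   \int[leb2]_(x in B1) ((x.1 * wpartial e1 v x + x.2 * wpartial e2 v x) * phi x).
  have E (a b c d p : R) : a * (c * p) + b * (d * p) = (c * a + d * b) * p by ring.
  by apply: eq_Rintegral => x _; exact: E.
move=> <-; rewrite (@Rintegral_B1 R 0); last first.
  apply: measurable_funM; first exact: L2_measurable (W12_L2 Wv).
  by apply: measurable_funD; [exact: measurable_test_derive (@axis1 R) t1|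
    exact: measurable_test_derive (@axis2 R) t2].
apply: eq_Rintegral => z /set_mem[]; rewrite /= in_itv/= => z01 _.
rewrite (derive_fstM _ tp).1 (derive_sndM _ tp).2.
have h1 := is_derive_polr (test_Ck1 tp) z.1 z.2.
have h2 := drP z.1 z.2 z01.
have -> : dr z.1 z.2 = cos z.2 * 'D_e1 phi (pol (z.1, z.2)) + sin z.2 * 'D_e2 phi (pol (z.1, z.2)).
  exact: (etrans (esym (@derive_val _ _ _ _ _ _ _ h2)) (@derive_val _ _ _ _ _ _ _ h1)).
have -> : pol (z.1, z.2) = pol z by case: z {z01 h1 h2}.
rewrite /=; congr (_ * _ * _).
have E (r c s P D1 D2 : R) : 2 * P + r * (c * D1 + s * D2) = P + r * c * D1 + (P + r * s * D2).
  by ring.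
exact: E.
Qed.

(** Tested with the rotation field [(- x.2 * phi, x.1 * phi)], whose divergence is the angular
    derivative of [phi]. *)
Lemma weak_angular (dt : R -> R -> R) :
  (forall r t : R, 0 < r < 1 -> is_derive t 1 (fun s => phi (pol (r, s))) (dt r t)) ->
  \int[leb2]_(z in rect 0) (v (pol z) * dt z.1 z.2 * z.1) =
  - \int[leb2]_(x in B1) ((- x.2 * wpartial e1 v x + x.1 * wpartial e2 v x) * phi x).
Proof.
move=> dtP.
have c2 n : Ck n (fun x : R * R => (-1) * x.2).
  by apply: Ck_mul; [exact: Ck_cst|exact: Ck_snd].
have t1 := test_mul (@Ck_fst R) tp; have t2 := test_mul (@Ck_snd R) tp.
have t3 := test_mul (@Ck_cst R ^~ (-1)) t2.
have := weak_divergence Wv t3 t1.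
have -> : \int[leb2]_(x in B1) (wpartial e1 v x * (-1 * (x.2 * phi x)) + wpartial e2 v x * (x.1 * phi x)) =
   \int[leb2]_(x in B1) ((- x.2 * wpartial e1 v x + x.1 * wpartial e2 v x) * phi x).
  have E (a b c d p : R) : a * (-1 * (d * p)) + b * (c * p) = (- d * a + c * b) * p by ring.
  by apply: eq_Rintegral => x _; exact: E.
move=> <-; rewrite (@Rintegral_B1 R 0); last first.
  apply: measurable_funM; first exact: L2_measurable (W12_L2 Wv).
  by apply: measurable_funD; [exact: measurable_test_derive (@axis1 R) t3|
    exact: measurable_test_derive (@axis2 R) t1].
apply: eq_Rintegral => z /set_mem[]; rewrite /= in_itv/= => z01 _.
have -> : 'D_e1 (fun x => -1 * (x.2 * phi x)) (pol z) = - (pol z).2 * 'D_e1 phi (pol z).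
  have h := Ck_derive1 (test_Ck1 t2) (pol z).
  apply: derive_val; apply: is_derive_eq; rewrite (derive_sndM _ tp).1 /GRing.scale/=; ring.
rewrite (derive_fstM _ tp).2.
have h1 := is_derive_polt (test_Ck1 tp) z.1 z.2.
have h2 := dtP z.1 z.2 z01.
have -> : dt z.1 z.2 = - (z.1 * sin z.2) * 'D_e1 phi (pol (z.1, z.2)) + z.1 * cos z.2 * 'D_e2 phi (pol (z.1, z.2)).
  exact: (etrans (esym (@derive_val _ _ _ _ _ _ _ h2)) (@derive_val _ _ _ _ _ _ _ h1)).
by have -> : pol (z.1, z.2) = pol z by case: z {z01 h1 h2}.
Qed.

End harmonics.

(** * Traces *)

Section closed_disc.
Context (R : realType).
Local Notation mu := (@lebesgue_measure R).
Local Notation T1 := (measurableTypeR R).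
Local Notation T2 := (T1 * T1)%type.
Implicit Types (q k : R -> R) (x z : R * R).

Lemma H1circ_continuous q k : H1circ q k -> continuous q.
Proof.
move=> [_ _ _ _ ac] t; have ab : t - 1 < t + 1 by lra.
apply: (within_continuous_continuous ab (isAC_continuous (ac _ _ (ltW ab)))).
by rewrite in_itv/=; apply/andP; split; lra.
Qed.

Lemma circ_surj (u v : R) : u ^+ 2 + v ^+ 2 = 1 ->
  exists2 t, 0 <= t <= 2 * pi & circ t = (u, v).
Proof.
move=> uv; have pi0 := @pi_ge0 R.
have uE : 1 - u ^+ 2 = v ^+ 2 by rewrite -uv; ring.
have u1 : -1 <= u <= 1.
  rewrite -ler_norml -(ler_pXn2r (n := 2))// ?nnegrE// expr1n -normrX ger0_norm ?sqr_ge0//.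
  by rewrite -uv lerDl sqr_ge0.
have cu : cos (acos u) = u by apply: acosK; rewrite in_itv/=.
have a0 := acos_ge0 u1; have api := acos_lepi u1.
have sa : sin (acos u) = `|v| by rewrite sin_acos// uE sqrtr_sqr.
have [v0|v0] := leP 0 v.
  exists (acos u); first by apply/andP; split; lra.
  by rewrite /circ cu sa ger0_norm.
exists (2 * pi - acos u); first by apply/andP; split; lra.
have -> : 2 * pi - acos u = - acos u + 2 * pi by ring.
by rewrite circD2pi /circ cosN sinN cu sa ltr0_norm// opprK.
Qed.

Lemma polar_surj x : exists2 t, 0 <= t <= 2 * pi & x = pol (enorm x, t).
Proof.
have e2 : enorm x ^+ 2 = x.1 ^+ 2 + x.2 ^+ 2 by rewrite sqr_sqrtr// addr_ge0// sqr_ge0.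
have [x0|x0] := eqVneq (enorm x) 0.
  exists 0; first by rewrite lexx mulr_ge0// pi_ge0.
  move: e2; rewrite x0 expr0n/= => /esym/eqP.
  rewrite paddr_eq0 ?sqr_ge0// !sqrf_eq0 => /andP[/eqP h1 /eqP h2].
  by rewrite /pol /= !mul0r; case: x {x0} h1 h2 => a b /= -> ->.
have [t t0 [c s]] : exists2 t, 0 <= t <= 2 * pi & circ t = (x.1 / enorm x, x.2 / enorm x).
  by apply: circ_surj; rewrite !exprMn -mulrDl -e2 exprVn mulfV// expf_neq0.
exists t => //; rewrite /pol /= c s ![enorm x * _]mulrC !divfK//.
by case: x {e2 x0 c s}.
Qed.

Lemma rfun_pol_ge0 p q z : (forall t, q (t + 2 * pi) = q t) -> 0 <= z.1 ->
  rfun p.+1 q (pol z) = z.1 ^+ p.+1 * q z.2.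
Proof.
move=> qP; rewrite le_eqVlt => /predU1P[z0|z0]; last exact: rfun_pol.
by rewrite /rfun enorm_pol -z0 normr0 exprS !mul0r.
Qed.

(** [angle] jumps across a ray, so compactness is used instead: the polar points at which the
    function is at least [e] away from its value at [x] form a compact set, whose image under [pol]
    is closed and misses [x]. *)
Lemma rfun_disc_continuous p q : continuous q -> (forall t, q (t + 2 * pi) = q t) ->
  {within [set x | enorm x <= 1], continuous (rfun p.+1 q)}.
Proof.
move=> cq qP; apply/subspace_continuousP => x /= x1.
pose G z : R := z.1 ^+ p.+1 * q z.2.
have cG : continuous G.
  by apply: continuous2M; [exact: continuous_expn_fst|exact: continuous_snd].
apply/cvgrPdist_lt => e e0.
pose K : set (R * R) := `[0 : R, 1]%classic `*` `[0 : R, 2 * pi]%classic.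
have cK : compact K by apply: compact_setX; exact: segment_compact.
pose C : set (R * R) := G @^-1` [set y | e <= `|rfun p.+1 q x - y|].
have clC : closed C.
  apply: closed_comp => [z _|]; first exact: cG.
  apply: (@closed_comp _ _ (fun y => `|rfun p.+1 q x - y|) [set y | e <= y]).
    move=> y _; apply: cvg_norm; apply: cvgB; [exact: cvg_cst|exact: cvg_id].
  exact: closed_ge.
have cS : compact (@pol R @` (K `&` C)).
  apply: continuous_compact; last exact: compact_closedI.
  by apply: continuous_subspaceT; exact: continuous_pol.
have clS : closed (@pol R @` (K `&` C)) by apply: compact_closed => //; exact: norm_hausdorff.
have xS : ~ (@pol R @` (K `&` C)) x.
  move=> [z [[z1 z2] Cz] zx]; move: Cz; rewrite /C /= -zx.
  move: z1; rewrite /= in_itv/= => /andP[z10 _].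
  by rewrite rfun_pol_ge0// subrr normr0 leNgt e0.
have : \forall y \near nbhs x, ~ (@pol R @` (K `&` C)) y.
  have := closed_openC clS; rewrite openE => /(_ x xS).
  by rewrite /interior /=; apply: filterS.
apply: filterS => y yS /= y1.
have [t t0 yE] := polar_surj y.
rewrite ltNge; apply/negP => Cy; apply: yS; exists (enorm y, t) => //.
split; first by split; rewrite /= in_itv/=// y1 sqrtr_ge0.
rewrite /C /= /G.
have <- := @rfun_pol_ge0 p q (enorm y, t) qP (sqrtr_ge0 _).
by rewrite -yE.
Qed.

(** Clamping r to [0, 1] gives a function of the polar coordinates that is continuous on the whole
    plane, as the integral lemmas over [rect] require. *)
Lemma disc_clamp_continuous (u : R * R -> R) :
  {within [set x | enorm x <= 1], continuous u} ->
  continuous (fun z => u (pol (Num.min 1 (Num.max 0 z.1), z.2))).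
Proof.
move=> /subspace_continuousP cu z.
pose h z : R * R := pol (Num.min 1 (Num.max 0 z.1), z.2).
have ch : continuous h.
  move=> y.
  have c1 : Num.min 1 (Num.max 0 z'.1) @[z' --> y] --> Num.min 1 (Num.max 0 y.1).
    apply: (@continuous_comp _ _ _ fst (fun r : R => Num.min 1 (Num.max 0 r))).
      exact: cvg_fst.
    apply: continuous_min; first exact: cvg_cst.
    by apply: continuous_max; [exact: cvg_cst|exact: cvg_id].
  have c2 : z'.2 @[z' --> y] --> y.2 by exact: cvg_snd.
  exact: (@continuous_comp _ _ _ (fun z' => (Num.min 1 (Num.max 0 z'.1), z'.2)) (@pol R) y
    (cvg_pair c1 c2) (@continuous_pol R _)).
have hD y : enorm (h y) <= 1.
  rewrite enorm_pol /= ger0_norm; first by rewrite ge_min lexx.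
  by rewrite le_min ler01 le_max lexx.
move=> W /(cu (h z) (hD z)) /= => H.
by have := ch z _ H; rewrite /= /nbhs/=; apply: filterS => y; exact.
Qed.

End closed_disc.

(** * Boundary layers: integrals over the circle as limits of integrals over the disc *)

Section boundary_layer.
Context (R : realType).
Local Notation mu := (@lebesgue_measure R).
Local Notation T1 := (measurableTypeR R).
Local Notation T2 := (T1 * T1)%type.

(** It vanishes near r = 1 and tends to 1 inside the disc as [m] grows; minus its derivative,
    [layer m], is a mass that concentrates at r = 1. *)
Definition cutoff (m : nat) (r : R) : R := qexp 0 (m%:R * (1 - r ^+ 2) - 1).

Definition layer (m : nat) (r : R) : R := 2 * r * m%:R * qexp 2 (m%:R * (1 - r ^+ 2) - 1).

Lemma is_derive_cutoff m (r : R) : is_derive r 1 (cutoff m) (- layer m r).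
Proof.
have h1 : is_derive r 1 (fun r : R => m%:R * (1 - r ^+ 2) - 1) (- (2 * r * m%:R)).
  by apply: is_derive_eq; rewrite /GRing.scale/=; ring.
have h2 := is_derive_qexp 0 (m%:R * (1 - r ^+ 2) - 1).
have -> : - layer m r = (qexp (0 + 2) (m%:R * (1 - r ^+ 2) - 1) -
    0 * qexp (0 + 1) (m%:R * (1 - r ^+ 2) - 1)) * (- (2 * r * m%:R)).
  by rewrite /layer !add0r; ring.
exact: (@is_derive1_comp R (qexp 0) (fun r : R => m%:R * (1 - r ^+ 2) - 1) r _ _ h2 h1).
Qed.

Lemma continuous_layer m : continuous (layer m).
Proof.
move=> r; apply: cvgM.
  by apply: cvgM; [apply: cvgM; [exact: cvg_cst|exact: cvg_id]|exact: cvg_cst].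
apply: (@continuous_comp _ _ _ (fun r : R => m%:R * (1 - r ^+ 2) - 1) (qexp 2)); last exact: continuous_qexp.
apply: cvgB; last exact: cvg_cst.
apply: cvgM; first exact: cvg_cst.
by apply: cvgB; [exact: cvg_cst|exact: exprn_continuous].
Qed.

Lemma layer_ge0 m r : 0 <= r -> 0 <= layer m r.
Proof. by move=> r0; rewrite /layer !mulr_ge0// qexp_ge0. Qed.

Lemma qexp2_le (y : R) : 0 < y -> qexp 2 y <= y^-1 ^+ 2.
Proof.
move=> y0; have -> : (2 : R) = 0 + 1 + 1 by ring.
rewrite !qexpS expr2 ler_pM2r ?invr_gt0//.
by apply: ler_piMl; [rewrite invr_ge0 ltW|exact: qexp0_le1].
Qed.

Lemma layer_le m (d r : R) : 0 < d -> 2 <= m%:R * d -> 0 <= r -> r <= 1 - d ->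
  layer m r <= 8 / (m%:R * d ^+ 2).
Proof.
move=> d0 md r0 rd; have m0 : 0 < m%:R :> R.
  by rewrite -(pmulr_lgt0 _ d0); apply: lt_le_trans md.
set y := m%:R * (1 - r ^+ 2) - 1.
have yd : m%:R * d / 2 <= y.
  have h : m%:R * d <= m%:R * (1 - r ^+ 2).
    rewrite ler_pM2l// lerBrDr -lerBrDl (le_trans _ rd)// expr2 ler_piMr//.
    by rewrite (le_trans rd)// gerBl ltW.
  by rewrite /y; lra.
have y0 : 0 < y by apply: lt_le_trans yd; rewrite divr_gt0// mulr_gt0.
have h1 : qexp 2 y <= (m%:R * d / 2)^-1 ^+ 2.
  rewrite (le_trans (qexp2_le y0))// lerXn2r ?nnegrE ?invr_ge0 ?(ltW y0)//.
    by rewrite divr_ge0// mulr_ge0// ltW.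
  by rewrite lef_pV2 ?posrE// divr_gt0// mulr_gt0.
have -> : 8 / (m%:R * d ^+ 2) = 2 * 1 * m%:R * (m%:R * d / 2)^-1 ^+ 2.
  by field; rewrite gt_eqF//= gt_eqF.
rewrite /layer -/y ler_pM// ?qexp_ge0// ?mulr_ge0//.
by rewrite ler_pM2r// ler_pM2l// (le_trans rd)// gerBl ltW.
Qed.

Lemma Rintegral_layer m : \int[mu]_(r in `]0, 1[) layer m r = qexp 0 (m%:R - 1).
Proof.
have dF (x : R) : is_derive x 1 (fun r => - cutoff m r) (layer m x).
  by have h := is_derive_cutoff m x; apply: is_derive_eq; rewrite opprK.
rewrite (Rintegral_derive_oo (@ler01 R) dF); last exact: continuous_layer.
rewrite /cutoff expr1n subrr mulr0 sub0r [X in - X]qexp_le0 ?lerN10//.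
by rewrite expr0n/= subr0 mulr1 oppr0 sub0r opprK.
Qed.

Lemma Rintegral_rect_mul (v h : R -> R) :
  mu.-integrable `[0, 2 * pi] (EFin \o v) -> continuous h ->
  \int[leb2]_(z in rect 0) (v z.2 * h z.1) =
  (\int[mu]_(r in `]0, 1[) h r) * \int[mu]_(t in `[0, 2 * pi]) v t.
Proof.
move=> iv ch.
transitivity (\int[leb2]_(z in rect 0) (h z.1 * v z.2)).
  by apply: eq_Rintegral => z _; rewrite mulrC.
have -> : rect 0 = (`]0, 1[%classic `*` `[0, 2 * pi]%classic) :> set T2.
  by rewrite /rect add0r.
apply: Rintegral_box_mul => //; exact: integrable_cont_oo.
Qed.

Lemma Rintegral_1_circ (c : R) : \int[mu]_(t in `[0, 2 * pi]) c = c * (2 * pi).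
Proof.
rewrite Rintegral_cst; last exact: measurable_itv.
rewrite /= lebesgue_measure_itv/= lte_fin mulr_gt0 ?pi_gt0//.
by rewrite -EFinB subr0.
Qed.

Lemma integrable_circ_cst (c : R) : mu.-integrable `[0, 2 * pi] (EFin \o cst c).
Proof. exact: (integrable_cont 0 (2 * pi) (@cst_continuous R R c)). Qed.

Lemma boundary_modulus (Y : R * R -> R) (e : R) : continuous Y -> 0 < e ->
  exists2 d : R, 0 < d < 1 & forall r t, 1 - d < r <= 1 -> 0 <= t <= 2 * pi ->
    `|Y (r, t) - Y (1, t)| <= e.
Proof.
move=> cY e0.
have /compact_near_coveringP := @segment_compact R 0 (2 * pi).
move=> /(_ R (nbhs (1 : R)) (fun r t => `|Y (r, t) - Y (1, t)| <= e) _) [].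
  move=> t _.
  have c1 : continuous (fun z : R * R => Y (z.2, z.1) - Y (1, z.1)).
    move=> z.
    have a1 : z'.1 @[z' --> z] --> z.1 by exact: cvg_fst.
    have a2 : z'.2 @[z' --> z] --> z.2 by exact: cvg_snd.
    have a3 : (1 : R) @[z' --> z] --> (1 : R) by exact: cvg_cst.
    apply: cvgB.
      have h : (z'.2, z'.1) @[z' --> z] --> (z.2, z.1).
        exact: (cvg_pair a2 a1).
      exact: (@continuous_comp _ _ _ (fun z' : R * R => (z'.2, z'.1)) Y z h (cY _)).
    have h : (1 : R, z'.1) @[z' --> z] --> (1 : R, z.1).
      exact: (cvg_pair a3 a1).
    exact: (@continuous_comp _ _ _ (fun z' : R * R => (1 : R, z'.1)) Y z h (cY _)).
  have := c1 (t, 1); move=> /cvgrPdist_le /(_ e e0) /=.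
  by rewrite subrr; apply: filterS => z; rewrite sub0r normrN.
move=> d /= d0 H; exists (Num.min d (1 / 2)).
  by rewrite lt_min d0 divr_gt0//= gt_min; apply/orP; right; lra.
move=> r t /andP[r1 r2] t01; apply: H => /=; last by rewrite in_itv/=.
rewrite ger0_norm ?subr_ge0// ltrBlDr -ltrBlDl (le_lt_trans _ r1)//.
by rewrite lerB// ge_min lexx.
Qed.

(** The layer is uniformly small away from the circle, [Y] is close to its boundary values near it,
    and the total mass of the layer tends to 1. These three errors are collected in the constant
    [A]. *)
Lemma layer_approx (Y : R * R -> R) (e : R) : continuous Y -> 0 < e ->
  exists m, `|\int[leb2]_(z in rect 0) (Y z * layer m.+1 z.1) -
              \int[mu]_(t in `[0, 2 * pi]) Y (1, t)| <= e.
Proof.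
move=> cY e0; have pi0 := @pi_gt0 R; have mD := @measurable_rect R 0.
have cY1 : continuous (fun t => Y (1, t)) := @continuous_slice2 R Y 1 cY.
pose D z := Y z - Y (1, z.2).
have cD : continuous D.
  exact: (continuous2D cY (continuous2N (continuous_snd cY1))).
have [K KP] := continuous_bounded_rect cD.
have K0 : 0 <= K.
  apply: le_trans (KP (2^-1, 0) _) => //; split => /=.
    by rewrite in_itv/= invr_gt0 ltr0n/= invf_lt1// ltr1n.
  by rewrite in_itv/= lexx add0r mulr_ge0// ltW.
set I := \int[mu]_(t in `[0, 2 * pi]) Y (1, t).
pose A := 2 * pi + 2 * pi * K + `|I| + 1.
have A0 : 0 < A.
  by rewrite /A ltr_wpDl// !addr_ge0// ?mulr_ge0// ltW.
have [e' e'0 e'A] : exists2 e', 0 < e' & e' * A = e.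
  by exists (e / A); [rewrite divr_gt0|rewrite divfK// gt_eqF].
have [d /andP[d0 d1] dP] := boundary_modulus cY e'0.
have near1' : \forall n \near \oo, `|1 - qexp 0 (n.+1%:R - 1 : R)| <= e'.
  have h n : (1 : R) * n.+1%:R - 1 <= n.+1%:R - 1 by rewrite mul1r.
  by have /cvgrPdist_le /(_ e' e'0) := qexp0_cvg1 (@ltr01 R) h.
have : \forall n \near \oo, exists m, `|\int[leb2]_(z in rect 0) (Y z * layer m.+1 z.1) - I| <= e.
  have near2 := nbhs_infty_ger (2 / d + 8 / (e' * d ^+ 2)).
  near=> n; exists n.
  have n2 : 2 / d + 8 / (e' * d ^+ 2) <= n.+1%:R :> R.
    by rewrite (@le_trans _ _ n%:R)// ?ler_nat//; near: n.
  have S1 : `|1 - qexp 0 (n.+1%:R - 1)| <= e' by near: n.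
  have p1 : 0 <= 2 / d by rewrite divr_ge0// ltW.
  have p2 : 0 <= 8 / (e' * d ^+ 2) by rewrite divr_ge0// mulr_ge0 ?sqr_ge0// ltW.
  have m2 : 2 <= n.+1%:R * d by rewrite -ler_pdivrMr//; lra.
  have m8 : 8 / (n.+1%:R * d ^+ 2) <= e'.
    have h : 8 / (e' * d ^+ 2) <= n.+1%:R by lra.
    move: h; rewrite !ler_pdivrMr ?mulr_gt0 ?exprn_gt0// => h.
    by rewrite mulrCA.
  have cL : continuous (fun z : R * R => layer n.+1 z.1).
    by move=> z; exact: (@continuous_comp _ _ _ fst (layer n.+1) z cvg_fst (@continuous_layer _ _)).
  pose S := qexp 0 (n.+1%:R - 1) : R.
  have S01 : S <= 1 := @qexp0_le1 R _.
  have iY1 := integrable_cont 0 (2 * pi) cY1.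
  have i1 : leb2.-integrable (rect 0) (fun z => (Y (1, z.2) * layer n.+1 z.1)%:E).
    exact: (integrable_rect_cont iY1 cL).
  have i2 : leb2.-integrable (rect 0) (fun z => (D z * layer n.+1 z.1)%:E).
    have := integrable_rect_cont (integrable_circ_cst 1) (continuous2M cD cL).
    by apply: (integrable_eqR mD) => z _; rewrite mul1r.
  have i3 : leb2.-integrable (rect 0) (fun z => (e' * layer n.+1 z.1)%:E).
    exact: (integrable_rect_cont (integrable_circ_cst e') cL).
  have i4 : leb2.-integrable (rect 0) (fun z => (K * e' * 1)%:E).
    exact: (integrable_rect_cont (integrable_circ_cst (K * e')) (@continuous2_cst R 1)).
  have E : \int[leb2]_(z in rect 0) (Y z * layer n.+1 z.1) =
     \int[leb2]_(z in rect 0) (D z * layer n.+1 z.1) + S * I.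
    rewrite /S -Rintegral_layer -(Rintegral_rect_mul iY1 (@continuous_layer n.+1)).
    rewrite -(RintegralD mD i2 i1); apply: eq_Rintegral => z _.
    by rewrite -mulrDl /D subrK.
  have B : `|\int[leb2]_(z in rect 0) (D z * layer n.+1 z.1)| <= e' * (2 * pi) + K * e' * (2 * pi).
    apply: (@le_trans _ _ (\int[leb2]_(z in rect 0) (e' * layer n.+1 z.1 + K * e' * 1))).
      apply: le_trans (le_normr_Rintegral mD i2) _.
      apply: le_Rintegral => //.
      - exact: (integrable_norm i2).
      - exact: (integrable_addR mD i3 i4).
      move=> z Dz; have KD := KP z Dz; case: Dz => /=; rewrite in_itv/= => /andP[z0 z1].
      rewrite add0r in_itv/= => z2.
      have l0 := layer_ge0 n.+1 (ltW z0).
      rewrite normrM (ger0_norm l0) mulr1.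
      have [zd|zd] := leP z.1 (1 - d).
        apply: (@le_trans _ _ (K * e')); last by rewrite lerDr mulr_ge0// ltW.
        by rewrite ler_pM// (le_trans (layer_le d0 m2 (ltW z0) zd)).
      apply: (@le_trans _ _ (e' * layer n.+1 z.1)); last by rewrite lerDl mulr_ge0// ltW.
      rewrite ler_wpM2r//; have := dP z.1 z.2 _ z2; rewrite -surjective_pairing.
      by apply; rewrite zd ltW.
    rewrite (RintegralD mD i3 i4).
    rewrite (Rintegral_rect_mul (integrable_circ_cst e') (@continuous_layer n.+1)).
    rewrite (Rintegral_rect_mul (integrable_circ_cst (K * e')) (@cst_continuous R R 1)).
    rewrite Rintegral_layer !Rintegral_1_circ Rintegral_cst; last exact: measurable_itv.
    rewrite /= lebesgue_measure_itv/= lte_fin ltr01.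
    rewrite -EFinB subr0/= mul1r mul1r lerD2r ler_piMl// mulr_ge0// ?mulr_ge0// ltW//.
  rewrite E.
  have -> : \int[leb2]_(z in rect 0) (D z * layer n.+1 z.1) + S * I - I =
    \int[leb2]_(z in rect 0) (D z * layer n.+1 z.1) - (1 - S) * I by ring.
  apply: le_trans (ler_normB _ _) _; rewrite normrM.
  apply: (@le_trans _ _ (e' * (2 * pi) + K * e' * (2 * pi) + e' * `|I|)).
    by rewrite lerD// ler_wpM2r.
  rewrite -e'A.
  have -> : e' * A = e' * (2 * pi) + K * e' * (2 * pi) + e' * `|I| + e' by rewrite /A; ring.
  by rewrite lerDl ltW.
by move=> /filter_ex [n].
Unshelve. all: by end_near.
Qed.

End boundary_layer.

(** * Bounds on the Fourier coefficients of boundary values *)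

Section trace_bound.
Context (R : realType).
Local Notation mu := (@lebesgue_measure R).
Local Notation T1 := (measurableTypeR R).
Local Notation T2 := (T1 * T1)%type.
Implicit Types (q : R -> R) (x z : R * R) (b : bool) (k : nat).
Let mB := @measurable_B1 R.

(** It replaces the Cauchy-Schwarz inequality: squares enter divided by [nu], and [nu] is chosen
    last, of the size of the norm. *)
Lemma young_le (nu a : R) : 0 < nu -> `|a| <= nu + nu^-1 * a ^+ 2.
Proof.
move=> nu0.
have h : 0 <= nu^-1 * ((`|a| - nu) ^+ 2 + nu * `|a|).
  by rewrite mulr_ge0 ?invr_ge0 ?(ltW nu0)// addr_ge0 ?sqr_ge0// mulr_ge0// ltW.
rewrite -subr_ge0; have -> : nu + nu^-1 * a ^+ 2 - `|a| = nu^-1 * ((`|a| - nu) ^+ 2 + nu * `|a|).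
  by rewrite -[a ^+ 2]ger0_norm ?sqr_ge0// normrX; field; rewrite gt_eqF.
exact: h.
Qed.

Definition cuttest b k m x : R := harm b k x * qexp 0 (m%:R * (1 - nsq x) - 1).

Lemma cuttest_test b k m : test_function (@cuttest b k m.+1).
Proof.
have CA n : Ck n (fun x : R * R => m.+1%:R + (- m.+1%:R * nsq x + -1)).
  apply: Ck_add; first exact: Ck_cst.
  apply: Ck_add; last exact: Ck_cst.
  by apply: Ck_mul; [exact: Ck_cst|exact: Ck_nsq].
apply: (@test_functionP R _ (1 - m.+1%:R^-1)).
- move=> n; apply: Ck_mul; first exact: Ck_harm.
  have := Ck_qexp 0 CA n; congr Ck; apply/funext => x; congr qexp; ring.
- by rewrite ltrBlDr ltrDl invr_gt0.
- move=> x; rewrite ltrBlDr -ltrBlDl => xm; rewrite /cuttest qexp_le0 ?mulr0//.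
  by rewrite subr_le0 mulrC -ler_pdivlMr// mul1r ltW.
Qed.

Lemma CS_nsq k x : (CS k x).1 ^+ 2 + (CS k x).2 ^+ 2 = nsq x ^+ k.
Proof.
elim: k => [|k IH]; first by rewrite /= expr1n expr0n/= addr0 expr0.
by rewrite [RHS]exprS -IH /= /nsq; ring.
Qed.

Lemma harm_le1 b k x : B1 x -> `|harm b k x| <= 1.
Proof.
move=> /B1E x1.
have h : harm b k x ^+ 2 <= 1.
  apply: (@le_trans _ _ (nsq x ^+ k)).
    by rewrite -CS_nsq /harm; case: b; rewrite ?lerDl ?lerDr sqr_ge0.
  by apply: exprn_ile1; [rewrite /nsq addr_ge0// sqr_ge0|exact: ltW].
by rewrite -(@ler_pXn2r _ 2)// ?nnegrE// expr1n -normrX ger0_norm ?sqr_ge0.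
Qed.

Lemma cuttest_le1 b k m x : B1 x -> `|cuttest b k m x| <= 1.
Proof.
move=> Bx; rewrite normrM mulr_ile1// ?harm_le1//.
by rewrite ger0_norm ?qexp_ge0// qexp0_le1.
Qed.

Lemma cuttest_pol b k m (r t : R) :
  cuttest b k m (pol (r, t)) = r ^+ k * trig b k t * cutoff m r.
Proof. by rewrite /cuttest harm_pol nsq_pol. Qed.

Section bound.
Variables (z : R * R -> R) (b : bool) (k : nat).
Hypotheses (Wz : W12 z) (cz : {within [set x | enorm x <= 1], continuous z}).

Let bnd x := k.+2%:R * `|z x| + (`|wpartial e1 z x| + `|wpartial e2 z x|).

Let iz : leb2.-integrable B1 (EFin \o z).
Proof. exact: L2_integrable (W12_L2 Wz). Qed.

Let ig1 : leb2.-integrable B1 (EFin \o wpartial e1 z).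
Proof. by have [g2 _] := W12_wpartial (@axis1 R) Wz; exact: L2_integrable. Qed.

Let ig2 : leb2.-integrable B1 (EFin \o wpartial e2 z).
Proof. by have [g2 _] := W12_wpartial (@axis2 R) Wz; exact: L2_integrable. Qed.

Let ibnd : leb2.-integrable B1 (EFin \o bnd).
Proof.
exact: (integrable_addR mB (integrable_scaleR mB k.+2%:R (integrable_norm iz))
  (integrable_addR mB (integrable_norm ig1) (integrable_norm ig2))).
Qed.

Let Z y : R := z (pol (Num.min 1 (Num.max 0 y.1), y.2)).
Let Y y : R := Z y * trig b k y.2 * y.1 ^+ k.+2.

Let cY : continuous Y.
Proof.
apply: continuous2M; last exact: continuous_expn_fst.
apply: continuous2M; first exact: disc_clamp_continuous.
by apply: continuous_snd; exact: continuous_trig.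
Qed.

(** [weak_radial] is tested with [cuttest]. Its radial derivative consists of that of [harm], of
    degree [k], and of a term in [layer]; with the 2 from the divergence the former gives the factor
    [k + 2] in [bnd]. *)
Let layer_bound m : `|\int[leb2]_(y in rect 0) (Y y * layer m.+1 y.1)| <= \int[leb2]_(x in B1) bnd x.
Proof.
have tp := cuttest_test b k m; set phi := cuttest b k m.+1 in tp.
have mD := @measurable_rect R 0.
pose dr (r t : R) := trig b k t * (k%:R * r ^+ k.-1 * cutoff m.+1 r - r ^+ k * layer m.+1 r).
have drP (r t : R) : 0 < r < 1 -> is_derive r 1 (fun s => phi (pol (s, t))) (dr r t).
  move=> _.
  have -> : (fun s => phi (pol (s, t))) = (fun s => trig b k t * (s ^+ k * cutoff m.+1 s)).
    by apply/funext => s; rewrite /phi cuttest_pol; ring.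
  have h1 := is_derive_expn k r; have h2 := is_derive_cutoff m.+1 r.
  by rewrite /dr; apply: is_derive_eq; rewrite /GRing.scale/=; ring.
have W := weak_radial Wz tp drP.
have izp := integrable_test (W12_L2 Wz) tp.
have mzp : measurable_fun (B1 : set T2) (fun x => z x * phi x).
  by apply: measurable_funM; [exact: L2_measurable (W12_L2 Wz)|exact: measurable_test].
have i1 : leb2.-integrable (rect 0) (fun y => (k.+2%:R * (z (pol y) * phi (pol y) * y.1))%:E).
  by apply: (integrable_scaleR mD); move/(integrable_B1 0 mzp): izp.
have i2 : leb2.-integrable (rect 0) (fun y => (Y y * layer m.+1 y.1)%:E).
  have cL : continuous (fun z : R * R => layer m.+1 z.1).
    by move=> y; exact: (@continuous_comp _ _ _ fst (layer m.+1) y cvg_fst (@continuous_layer _ _ _)).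
  have := integrable_rect_cont (integrable_circ_cst 1) (continuous2M cY cL).
  by apply: (integrable_eqR mD) => y _; rewrite mul1r.
have E : \int[leb2]_(y in rect 0) (Y y * layer m.+1 y.1) =
    k.+2%:R * \int[leb2]_(x in B1) (z x * phi x) +
    \int[leb2]_(x in B1) ((x.1 * wpartial e1 z x + x.2 * wpartial e2 z x) * phi x).
  rewrite -[X in _ + X]opprK -W (Rintegral_B1 0 mzp).
  have i0 : leb2.-integrable (rect 0) (fun y => (z (pol y) * phi (pol y) * y.1)%:E).
    by move/(integrable_B1 0 mzp): izp.
  have HZ : \int[leb2]_(y in rect 0) (k.+2%:R * (z (pol y) * phi (pol y) * y.1)) =
    k.+2%:R * \int[leb2]_(y in rect 0) (z (pol y) * phi (pol y) * y.1).
    exact: (RintegralZl k.+2%:R mD i0).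
  rewrite -HZ.
  have pe y : rect 0 y -> z (pol y) * (2 * phi (pol y) + y.1 * dr y.1 y.2) * y.1 =
      k.+2%:R * (z (pol y) * phi (pol y) * y.1) - Y y * layer m.+1 y.1.
    case=> /=; rewrite in_itv/= => /andP[y0 y1] _.
    have YE : Y y = z (pol y) * trig b k y.2 * y.1 ^+ k.+2.
      rewrite /Y /Z max_r ?(ltW y0)// min_r ?(ltW y1)//.
    have -> : phi (pol y) = y.1 ^+ k * trig b k y.2 * cutoff m.+1 y.1.
      by rewrite -cuttest_pol.
    rewrite YE /dr.
    have H (r T c L v : R) : v * (2 * (r ^+ k * T * c) + r * (T * (k%:R * r ^+ k.-1 * c - r ^+ k * L))) * r =
        k.+2%:R * (v * (r ^+ k * T * c) * r) - v * T * r ^+ k.+2 * L.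
      have -> : r * (T * (k%:R * r ^+ k.-1 * c - r ^+ k * L)) = T * (k%:R * r ^+ k * c - r * r ^+ k * L).
        case: (k) => [|n]; first by rewrite expr0; ring.
        by rewrite /= exprS; ring.
      rewrite !exprS -[k.+2%:R]/(k.+2%:R) -(addn2 k) natrD.
      by move: (k%:R : R) (r ^+ k) => K w; ring.
    exact: H.
  transitivity (\int[leb2]_(y in rect 0) (k.+2%:R * (z (pol y) * phi (pol y) * y.1) -
      z (pol y) * (2 * phi (pol y) + y.1 * dr y.1 y.2) * y.1)).
    by apply: eq_Rintegral => y /set_mem Dy; rewrite pe// opprB addrC subrK.
  have iw : leb2.-integrable (rect 0)
      (fun y => (z (pol y) * (2 * phi (pol y) + y.1 * dr y.1 y.2) * y.1)%:E).
    by apply: (integrable_eqR mD _ (integrable_subR mD i1 i2)) => y Dy; rewrite pe.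
  exact: (RintegralB mD i1 iw).
have ib1 : leb2.-integrable B1 (fun x => (k.+2%:R * `|z x|)%:E).
  exact: (integrable_scaleR mB k.+2%:R (integrable_norm iz)).
have ib2 : leb2.-integrable B1 (fun x => (`|wpartial e1 z x| + `|wpartial e2 z x|)%:E).
  exact: (integrable_addR mB (integrable_norm ig1) (integrable_norm ig2)).
have -> : \int[leb2]_(x in B1) bnd x = k.+2%:R * (\int[leb2]_(x in B1) `|z x|) +
    \int[leb2]_(x in B1) (`|wpartial e1 z x| + `|wpartial e2 z x|).
  transitivity (\int[leb2]_(x in B1) (k.+2%:R * `|z x|) +
      \int[leb2]_(x in B1) (`|wpartial e1 z x| + `|wpartial e2 z x|)).
    exact: (RintegralD mB ib1 ib2).
  by congr (_ + _); exact: (RintegralZl k.+2%:R mB (integrable_norm iz)).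
rewrite E.
have phi1 x : B1 x -> `|phi x| <= 1 by exact: cuttest_le1.
apply: le_trans (ler_normD _ _) _; apply: lerD.
  rewrite normrM ger0_norm// ler_wpM2l//.
  apply: le_trans (le_normr_Rintegral mB izp) _.
  apply: (le_Rintegral mB (integrable_norm izp) (integrable_norm iz)) => x Bx /=.
  by rewrite normrM ler_piMr// phi1.
have [g12 _] := W12_wpartial (@axis1 R) Wz; have [g22 _] := W12_wpartial (@axis2 R) Wz.
have t1 := test_mul (@Ck_fst R) tp; have t2 := test_mul (@Ck_snd R) tp.
have ixg : leb2.-integrable B1 (fun x => ((x.1 * wpartial e1 z x + x.2 * wpartial e2 z x) * phi x)%:E).
  apply: (integrable_eqR mB _ (integrable_addR mB (integrable_test g12 t1) (integrable_test g22 t2))).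
  have H (a c d f p : R) : a * (c * p) + d * (f * p) = (c * a + f * d) * p by ring.
  by move=> x _; exact: H.
apply: le_trans (le_normr_Rintegral mB ixg) _.
apply: (le_Rintegral mB (integrable_norm ixg) ib2) => x Bx /=.
have [x1 x2] : `|x.1| <= 1 /\ `|x.2| <= 1 by apply: nsq_le1; apply: ltW; exact/B1E.
rewrite normrM (@le_trans _ _ (`|x.1 * wpartial e1 z x + x.2 * wpartial e2 z x|))//.
  by rewrite ler_piMr// phi1.
have H (a c d f : R) : `|a| <= 1 -> `|d| <= 1 -> `|a * c + d * f| <= `|c| + `|f|.
  move=> a1 d1; apply: le_trans (ler_normD _ _) _; rewrite !normrM.
  by apply: lerD; apply: ler_piMl.
exact: H.
Qed.

(** [layer_bound] is uniform in the width of the layer, and [layer_approx] makes the layer integral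
    as close to the circle integral as desired. *)
Lemma trace_bound : `|\int[mu]_(t in `[0, 2 * pi]) (z (circ t) * trig b k t)| <=
  \int[leb2]_(x in B1) bnd x.
Proof.
apply/ler_addgt0Pl => e e0; have [m mP] := layer_approx cY e0.
have YE t : Y (1, t) = z (circ t) * trig b k t.
  rewrite /Y /Z /= max_r// min_r// expr1n mulr1.
  by rewrite /pol /= !mul1r.
have -> : \int[mu]_(t in `[0, 2 * pi]) (z (circ t) * trig b k t) =
    \int[mu]_(t in `[0, 2 * pi]) Y (1, t) by apply: eq_Rintegral => t _; rewrite YE.
have := layer_bound m; move: mP; rewrite distrC => mP lb.
rewrite -[X in `|X|](subrK (\int[leb2]_(y in rect 0) (Y y * layer m.+1 y.1))).
by apply: le_trans (ler_normD _ _) _; exact: lerD.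
Qed.

Lemma W12norm_sqr : W12norm z ^+ 2 = \int[leb2]_(x in B1) (z x ^+ 2 + wgrad_sq z x).
Proof.
apply: sqr_sqrtr; apply: Rintegral_ge0 => x _.
apply: addr_ge0; first exact: sqr_ge0.
by apply: addr_ge0; exact: sqr_ge0.
Qed.

Lemma trace_bound_norm (nu : R) : 0 < nu ->
  `|\int[mu]_(t in `[0, 2 * pi]) (z (circ t) * trig b k t)| <=
  k.+2%:R * (3 * nu * (\int[leb2]_(x in @B1 R) 1) + W12norm z ^+ 2 / nu).
Proof.
move=> nu0; apply: le_trans trace_bound _; rewrite W12norm_sqr.
have [_ z2] := W12_L2 Wz.
have [[_ g12] _] := W12_wpartial (@axis1 R) Wz; have [[_ g22] _] := W12_wpartial (@axis2 R) Wz.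
have iN : leb2.-integrable B1 (fun x => (z x ^+ 2 + wgrad_sq z x)%:E).
  exact: (integrable_addR mB z2 (integrable_addR mB g12 g22)).
have i1 := @integrable_B1_cst R 1.
have i1' : leb2.-integrable B1 (fun _ : T2 => (3 * nu * 1)%:E).
  exact: (integrable_scaleR mB (3 * nu) i1).
have iN' := integrable_scaleR mB nu^-1 iN.
have i := integrable_addR mB i1' iN'.
have -> : k.+2%:R * (3 * nu * (\int[leb2]_(x in @B1 R) 1) +
    (\int[leb2]_(x in B1) (z x ^+ 2 + wgrad_sq z x)) / nu) =
  \int[leb2]_(x in B1) (k.+2%:R * (3 * nu * 1 + nu^-1 * (z x ^+ 2 + wgrad_sq z x))).
  rewrite [_ / nu]mulrC.
  have h1 := RintegralZl (3 * nu) mB i1; have h2 := RintegralZl nu^-1 mB iN.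
  have h3 := RintegralD mB i1' iN'; have h4 := RintegralZl k.+2%:R mB i.
  by apply/esym; apply: etrans h4 _; congr (_ * _); apply: etrans h3 _; congr (_ + _).
apply: (le_Rintegral mB ibnd (integrable_scaleR mB k.+2%:R i)) => x _.
rewrite /bnd /wgrad_sq.
have H (K a c d A C D n : R) : 1 <= K -> 0 <= c -> 0 <= d -> a <= n + nu^-1 * A -> c <= n + nu^-1 * C -> d <= n + nu^-1 * D ->
   K * a + (c + d) <= K * (3 * n * 1 + nu^-1 * (A + (C + D))).
  move=> K1 c0 d0 aA cC dD; have -> : K * (3 * n * 1 + nu^-1 * (A + (C + D))) =
    K * (n + nu^-1 * A) + (K * (n + nu^-1 * C) + K * (n + nu^-1 * D)) by ring.
  have K0 : 0 <= K by apply: le_trans K1.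
  apply: lerD; first by rewrite ler_wpM2l.
  apply: lerD; first by rewrite (le_trans cC)// ler_peMl// (le_trans c0).
  by rewrite (le_trans dD)// ler_peMl// (le_trans d0).
by apply: H (normr_ge0 _) (normr_ge0 _) (young_le _ nu0) (young_le _ nu0) (young_le _ nu0);
  rewrite ler1n.
Qed.

End bound.
End trace_bound.

#[global] Instance lebesgue_ae_filter (R : realType) :
  Filter (almost_everywhere (@lebesgue_measure R)).
Proof. exact: (@ae_filter_ringOfSetsType _ _ _ (@lebesgue_measure R)). Qed.

Section trace.
Context (R : realType).
Local Notation mu := (@lebesgue_measure R).
Local Notation T1 := (measurableTypeR R).
Local Notation T2 := (T1 * T1)%type.
Implicit Types (v w g : R * R -> R).
Let mB := @measurable_B1 R.

Lemma measurable_wgrad v : W12 v -> measurable_fun (B1 : set T2) (wgrad_sq v).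
Proof.
move=> Wv; have [[m1 _] _] := W12_wpartial (@axis1 R) Wv.
have [[m2 _] _] := W12_wpartial (@axis2 R) Wv.
exact: (measurable_funD (measurable_funX 2 m1) (measurable_funX 2 m2)).
Qed.

Lemma W12norm_ae v w : W12 v -> W12 w -> {ae leb2, forall x, B1 x -> v x = w x} ->
  W12norm v = W12norm w.
Proof.
move=> Wv Ww vw; apply: (congr1 (@Num.sqrt R)).
have mv := L2_measurable (W12_L2 Wv); have mw := L2_measurable (W12_L2 Ww).
have a1 := weak_partial_unique (@axis1 R) mv mw vw (W12_wpartial (@axis1 R) Wv)
  (W12_wpartial (@axis1 R) Ww).
have a2 := weak_partial_unique (@axis2 R) mv mw vw (W12_wpartial (@axis2 R) Wv)
  (W12_wpartial (@axis2 R) Ww).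
apply: ae_eq_Rintegral.
- exact: mB.
- exact: (measurable_funD (measurable_funX 2 mv) (measurable_wgrad Wv)).
- exact: (measurable_funD (measurable_funX 2 mw) (measurable_wgrad Ww)).
apply: filterS3 vw a1 a2 => x b0 b1 b2 Bx.
by rewrite /wgrad_sq (b0 Bx) (b1 Bx) (b2 Bx).
Qed.

Lemma disc_circ_continuous w : {within [set x | enorm x <= 1], continuous w} ->
  continuous (fun t => w (circ t)).
Proof.
move=> /disc_clamp_continuous/(@continuous_slice2 R _ 1).
have -> // : (fun t => w (circ t)) =
    (fun t => w (pol (Num.min 1 (Num.max 0 (1 : R, t).1), (1 : R, t).2))).
by apply/funext => t; rewrite /= max_r// min_r// /pol /= !mul1r.
Qed.

(** The approximants [u n] minus [w] are continuous up to the circle and small in [W12norm], so by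
    [trace_bound_norm] each of their Fourier coefficients is small. Hence all coefficients of
    [g - w] vanish, and [trig_complete] applies. *)
Lemma trace_unique v w g : W12 v -> W12 w ->
  {within [set x | enorm x <= 1], continuous w} ->
  {ae leb2, forall x, B1 x -> v x = w x} -> is_trace v g ->
  {ae mu, forall t, `[0, 2 * pi]%classic t -> g (circ t) = w (circ t)}.
Proof.
move=> Wv Ww cw vw [[mg ig2] [u [Wu cu uv ug]]].
have pi0 := @pi_gt0 R.
have mI : measurable (`[0, 2 * pi]%classic : set T1) by exact: measurable_itv.
have ig : mu.-integrable `[0, 2 * pi] (fun t => (g (circ t))%:E).
  apply: (@le_integrable _ _ _ _ _ mI _ (fun t => (1 + 1^-1 * g (circ t) ^+ 2)%:E)).
  - by apply/measurable_EFinP; exact: mg.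
  - move=> t _ /=; rewrite lee_fin (le_trans (young_le _ ltr01))//.
    by rewrite ler_norm.
  - exact: (integrable_addx (integrable_circ_cst 1) (integrable_scalex (1^-1) ig2)).
have cwc := disc_circ_continuous cw.
have iw := integrable_cont 0 (2 * pi) cwc.
have id : mu.-integrable `[0, 2 * pi] (EFin \o (fun t => g (circ t) - w (circ t))).
  exact: (integrable_subR mI ig iw).
have key b k : \int[mu]_(t in `[0, 2 * pi]) ((g (circ t) - w (circ t)) * trig b k t) = 0.
  set J := \int[mu]_(t in _) _.
  pose c1 := \int[leb2]_(x in @B1 R) 1.
  have c10 : 0 <= c1 by apply: Rintegral_ge0.
  have bound n nu : 0 < nu -> `|J| <= nu * (2 * pi) +
      nu^-1 * circle_int (fun x => (u n x - g x) ^+ 2) +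
      k.+2%:R * (3 * nu * c1 + W12norm (u n \- v) ^+ 2 / nu).
    move=> nu0; have cuc := disc_circ_continuous (cu n).
    have iu := integrable_cont 0 (2 * pi) cuc.
    have iug : mu.-integrable `[0, 2 * pi] (EFin \o (fun t => u n (circ t) - g (circ t))).
      exact: (integrable_subR mI iu ig).
    have iuw : mu.-integrable `[0, 2 * pi] (EFin \o (fun t => u n (circ t) - w (circ t))).
      exact: (integrable_subR mI iu iw).
    have iug2 : mu.-integrable `[0, 2 * pi] (EFin \o (fun t => (u n (circ t) - g (circ t)) ^+ 2)).
      have iug' := integrable_mul_cont ig cuc.
      have iu2 := integrable_cont 0 (2 * pi) (continuous_sqr cuc).
      apply: integrable_eqx (integrable_addx (integrable_addx iu2 ig2)
        (integrable_scalex (-2) iug')) => t; ring.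
    have Wz := W12_sub (Wu n) Ww.
    have Nz : W12norm (u n \- w) = W12norm (u n \- v).
      apply: (W12norm_ae Wz (W12_sub (Wu n) Wv)).
      by apply: filterS vw => x + Bx => /(_ Bx) /= ->.
    have cz : {within [set x | enorm x <= 1], continuous (u n \- w)}.
      by move=> x; apply: cvgB; [exact: (cu n)|exact: cw].
    have := @trace_bound_norm R (u n \- w) b k Wz cz nu nu0; rewrite Nz -/c1 => B2.
    have B1' : `|\int[mu]_(t in `[0, 2 * pi]) ((u n (circ t) - g (circ t)) * trig b k t)| <=
        nu * (2 * pi) + nu^-1 * circle_int (fun x => (u n x - g x) ^+ 2).
      have it := integrable_mul_cont iug (@continuous_trig R b k).
      apply: le_trans (le_normr_Rintegral mI it) _.
      rewrite -Rintegral_1_circ /circle_int -(RintegralZl nu^-1 mI iug2).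
      have ic := integrable_circ_cst nu; have iz := integrable_scalex nu^-1 iug2.
      rewrite -(RintegralD mI ic iz).
      apply: (le_Rintegral mI (integrable_norm it) (integrable_addx ic iz)) => t _ /=.
      rewrite normrM; apply: le_trans (young_le _ nu0).
      by apply: ler_piMr; [exact: normr_ge0|exact: trig_le1].
    have -> : J = \int[mu]_(t in `[0, 2 * pi]) ((u n \- w) (circ t) * trig b k t) -
        \int[mu]_(t in `[0, 2 * pi]) ((u n (circ t) - g (circ t)) * trig b k t).
      have it := integrable_mul_cont iug (@continuous_trig R b k).
      have it' := integrable_mul_cont iuw (@continuous_trig R b k).
      rewrite -(RintegralB mI it' it); apply: eq_Rintegral => t _ /=.
      by rewrite -mulrBl; congr (_ * _); ring.
    apply: le_trans (ler_normB _ _) _; rewrite addrC; apply: lerD; [exact: B1'|exact: B2].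
  pose A := 2 * pi + 1 + k.+2%:R * (3 * c1 + 1).
  have A0 : 0 < A.
    have h : 0 <= k.+2%:R * (3 * c1 + 1) :> R by rewrite mulr_ge0// addr_ge0// mulr_ge0.
    by rewrite /A; lra.
  (* Both convergences are used at the scale [nu]; then every term of [bound] is at most a constant
     times [nu]. *)
  have small nu : 0 < nu -> `|J| <= nu * A.
    move=> nu0.
    have s1 : \forall n \near \oo, circle_int (fun x => (u n x - g x) ^+ 2) <= nu ^+ 2.
      move/cvgrPdist_le: ug => /(_ (nu ^+ 2)); rewrite exprn_gt0// => /(_ isT).
      by apply: filterS => n; rewrite sub0r normrN; apply: le_trans; exact: ler_norm.
    have s2 : \forall n \near \oo, W12norm (u n \- v) <= nu.
      move/cvgrPdist_le: uv => /(_ nu nu0).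
      by apply: filterS => n; rewrite sub0r normrN; apply: le_trans; exact: ler_norm.
    have : \forall n \near \oo, `|J| <= nu * A.
      apply: filterS2 s1 s2 => n c2 N2; apply: le_trans (bound n nu nu0) _.
      move: c2 N2; move: (circle_int _) (sqrtr_ge0 (\int[leb2]_(x in B1) ((u n \- v) x ^+ 2 + wgrad_sq (u n \- v) x))).
      rewrite -/(W12norm _); move: (W12norm _) => N c N0 cn Nn.
      have h1 : nu^-1 * c <= nu by rewrite ler_pdivrMl// -expr2.
      have h2 : N ^+ 2 / nu <= nu.
        rewrite ler_pdivrMr// -expr2 lerXn2r// nnegrE// ltW//.
      have -> : nu * A = nu * (2 * pi) + nu + k.+2%:R * (3 * nu * c1 + nu) by rewrite /A; ring.
      apply: lerD; first by rewrite lerD2l.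
      by rewrite ler_wpM2l// lerD2l.
    by move=> /filter_ex [].
  apply/eqP; rewrite -normr_le0; apply/ler_addgt0Pr => e e0; rewrite add0r.
  by have := small (e / A); rewrite divfK ?gt_eqF// divr_gt0// => /(_ isT).
have := trig_complete id (fun n => key true n) (fun n => key false n).
by apply: filterS => t /= + It => /(_ It)/eqP; rewrite subr_eq0 => /eqP.
Qed.

(** Not immediate, since [wpartial] is only some representative; uniqueness of weak derivatives
    identifies it with 0. *)
Lemma W12norm0 v : W12 v -> {ae leb2, forall x, B1 x -> v x = 0} -> W12norm v = 0.
Proof.
move=> Wv v0; have h0 := @H1circ0 R.
have W0 := W12_rfun 0 h0; have m0 := L2_measurable (W12_L2 W0).
have m00 : measurable_fun (B1 : set T2) (fun=> 0 : R) by exact: measurable_cst.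
have vr : {ae leb2, forall x, B1 x -> v x = rfun 1 (fun=> 0) x}.
  by apply: filterS v0 => x + Bx => ->//; rewrite /rfun mulr0.
rewrite (W12norm_ae Wv W0 vr) /W12norm.
have w0 : {ae leb2, forall x : R * R, B1 x -> rfun 1 (fun=> 0) x = (0 : R)}.
  by apply: filterE => x _; rewrite /rfun mulr0.
have z0 e : is_weak_partial e (fun=> 0 : R) (fun=> 0 : R).
  split; first exact: L2_cst.
  move=> phi _; transitivity (0 : R); last apply/esym.
    by apply: Rintegral0_eq => x _; rewrite mul0r.
  by rewrite Rintegral0_eq ?oppr0// => x _; rewrite mul0r.
have a1 := weak_partial_unique (@axis1 R) m0 m00 w0 (W12_wpartial (@axis1 R) W0) (z0 _).
have a2 := weak_partial_unique (@axis2 R) m0 m00 w0 (W12_wpartial (@axis2 R) W0) (z0 _).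
have -> : \int[leb2]_(x in B1) (rfun 1 (fun=> 0) x ^+ 2 + wgrad_sq (rfun 1 (fun=> 0 : R)) x) =
    \int[leb2]_(x in B1) 0.
  apply: ae_eq_Rintegral.
  - exact: mB.
  - exact: (measurable_funD (measurable_funX 2 m0) (measurable_wgrad W0)).
  - exact: m00.
  apply: filterS3 w0 a1 a2 => x b0 b1 b2 Bx.
  by rewrite /wgrad_sq (b0 Bx) (b1 Bx) (b2 Bx) expr0n/= !addr0.
by rewrite Rintegral0_eq// sqrtr0.
Qed.

Lemma is_trace_continuous v w : W12 v -> W12 w ->
  {within [set x | enorm x <= 1], continuous w} ->
  {ae leb2, forall x, B1 x -> v x = w x} -> is_trace v w.
Proof.
move=> Wv Ww cw vw; have cwc := disc_circ_continuous cw.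
split.
  split; first by apply: measurable_funTS; exact: continuous_measurable_fun.
  exact: (integrable_cont 0 (2 * pi) (continuous_sqr cwc)).
exists (fun=> w); split => //.
  rewrite W12norm0; [exact: cvg_cst|exact: W12_sub|].
  by apply: filterS vw => x + Bx => /(_ Bx) /= ->; rewrite subrr.
have -> : circle_int (fun x => (w x - w x) ^+ 2) = 0.
  by apply: Rintegral0_eq => t _; rewrite subrr expr0n.
exact: cvg_cst.
Qed.

Section rfun34.
Variables (q1 k1 q2 k2 : R -> R) (v : R * R -> R).
Hypotheses (h1 : H1circ q1 k1) (h2 : H1circ q2 k2).
Hypotheses (mv : measurable_fun (B1 : set T2) v)
  (vE : {ae leb2, forall x, B1 x -> v x = rfun 3 q1 x - rfun 4 q2 x}).

Lemma trace_rfun34 : L2circle (trace v) /\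
  {ae mu, forall t, `[0, 2 * pi]%classic t -> trace v (circ t) = q1 t - q2 t}.
Proof.
have Wv := W12_rfun34 h1 h2 mv vE.
have Ww := W12_sub (W12_rfun 2 h1) (W12_rfun 3 h2).
have [_ qP1 _ _ _] := h1; have [_ qP2 _ _ _] := h2.
have cw : {within [set x | enorm x <= 1], continuous (rfun 3 q1 \- rfun 4 q2)}.
  by move=> x; apply: cvgB; apply: rfun_disc_continuous => //; apply: H1circ_continuous;
    [exact: h1|exact: h2].
have T := is_trace_continuous Wv Ww cw vE.
have T' : is_trace v (trace v).
  exact: (@xgetPex _ (fun=> 0) [set g | is_trace v g] (ex_intro _ _ T)).
split; first by case: T'.
have := trace_unique Wv Ww cw vE T'; apply: filterS => t /[apply] -> /=.
have -> : circ t = pol (1, t) by rewrite /pol /= !mul1r.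
by rewrite !rfun_pol// expr1n expr1n !mul1r.
Qed.

Lemma circle_int_trace :
  circle_int (fun x => trace v x ^+ 2) = \int[mu]_(t in `[0, 2 * pi]) (q1 t - q2 t) ^+ 2.
Proof.
have [[mt _] tE] := trace_rfun34.
have [[mq1 _] _ _ _ _] := h1; have [[mq2 _] _ _ _ _] := h2.
apply: ae_eq_Rintegral.
- exact: measurable_itv.
- exact: (measurable_funX 2 mt).
- by apply: measurable_funTS; apply: measurable_funX; exact: measurable_funB.
- by apply: filterS tE => t + It => ->.
Qed.

(** The sign conditions make [v] nonnegative, because it equals r^3 ((1 - r) q1 + r (q1 - q2)). The
    positive part then disappears, and the integrals of r^5, r^6, r^7 give the denominators 6, 7,
    8. *)
Lemma M_rfun34 : (forall t, 0 <= q1 t) -> (forall t, 0 <= q1 t - q2 t) ->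
  M v = \int[mu]_(t in `[0, 2 * pi])
    ((k1 t ^+ 2 - 9 * q1 t ^+ 2 + 2 * q1 t) / 6 - 2 * (k1 t * k2 t - 9 * (q1 t * q2 t) + q2 t) / 7
     + (k2 t ^+ 2 - 8 * q2 t ^+ 2) / 8).
Proof.
move=> q10 q120; have Wv := W12_rfun34 h1 h2 mv vE.
have mI : measurable (`[0, 2 * pi]%classic : set T1) by exact: measurable_itv.
have [[mq1 mk1] qP1 _ i1 _] := h1; have [[mq2 mk2] qP2 _ i2 _] := h2.
have j1 := H1circ_integrable_sqr h1; have j2 := H1circ_integrable_sqr h2.
have l1 := H1circ_integrable_q h1; have l2 := H1circ_integrable_q h2.
have j12 := integrable_mul_sqr mq1 mq2 j1 j2; have i12 := integrable_mul_sqr mk1 mk2 i1 i2.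
have mF : measurable_fun (B1 : set T2) (fun x => wgrad_sq v x + 2 * enorm x * Num.max (v x) 0).
  apply: (measurable_funD (measurable_wgrad Wv)); apply: measurable_funM.
    by apply: measurable_funM => //; apply: measurable_funTS; exact: measurable_enorm.
  by apply: measurable_maxr; [exact: L2_measurable (W12_L2 Wv)|exact: measurable_cst].
have u5 := integrable_addx (integrable_addx (integrable_scalex 9 j1) i1) (integrable_scalex 2 l1).
have u6 := integrable_scalex (-2) (integrable_addx (integrable_addx (integrable_scalex 12 j12) i12) l2).
have u7 := integrable_addx (integrable_scalex 16 j2) i2.
have FE : {ae leb2, forall z, rect 0 z ->
    (wgrad_sq v (pol z) + 2 * enorm (pol z) * Num.max (v (pol z)) 0) * z.1 =
    (9 * q1 z.2 ^+ 2 + k1 z.2 ^+ 2 + 2 * q1 z.2) * z.1 ^+ 5 +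
    (-2 * (12 * (q1 z.2 * q2 z.2) + k1 z.2 * k2 z.2 + q2 z.2) * z.1 ^+ 6 +
     (16 * q2 z.2 ^+ 2 + k2 z.2 ^+ 2) * z.1 ^+ 7)}.
  apply: filterS (wgrad_sq_rfun34 h1 h2 mv vE) => z /[swap] Dz /(_ Dz) [-> ->].
  case: Dz => /=; rewrite in_itv/= => /andP[z0 z1] _.
  have H (r Q1 K1 Q2 K2 : R) : 0 < r -> r < 1 -> 0 <= Q1 -> 0 <= Q1 - Q2 ->
    (r ^+ 4 * (9 * Q1 ^+ 2 + K1 ^+ 2) - 2 * r ^+ 5 * (12 * Q1 * Q2 + K1 * K2)
      + r ^+ 6 * (16 * Q2 ^+ 2 + K2 ^+ 2) + 2 * r * Num.max (r ^+ 3 * Q1 - r ^+ 4 * Q2) 0) * r =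
    (9 * Q1 ^+ 2 + K1 ^+ 2 + 2 * Q1) * r ^+ 5 +
    (-2 * (12 * (Q1 * Q2) + K1 * K2 + Q2) * r ^+ 6 + (16 * Q2 ^+ 2 + K2 ^+ 2) * r ^+ 7).
    move=> r0 r1 Q10 Q120; rewrite max_l; first by ring.
    have -> : r ^+ 3 * Q1 - r ^+ 4 * Q2 = r ^+ 3 * ((1 - r) * Q1 + r * (Q1 - Q2)) by ring.
    apply: mulr_ge0; first by rewrite exprn_ge0// ltW.
    by apply: addr_ge0; apply: mulr_ge0 => //; rewrite ?subr_ge0 ltW.
  by rewrite enorm_pol (gtr0_norm z0); exact: H.
have [_ E] := Rintegral_B1_pow mF u5 u6 u7 FE.
rewrite /M E circle_int_trace.
have jt : mu.-integrable `[0, 2 * pi] (fun t => ((q1 t - q2 t) ^+ 2)%:E).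
  exact: H1circ_integrable_sqr (H1circ_sub h1 h2).
have s5 := integrable_scalex (6^-1) u5; have s6 := integrable_scalex (7^-1) u6.
have s7 := integrable_scalex (8^-1) u7; have st := integrable_scalex (-3) jt.
have s7t := integrable_addx s7 st; have s67 := integrable_addx s6 s7t.
transitivity (\int[mu]_(t in `[0, 2 * pi]) (6^-1 * (9 * q1 t ^+ 2 + k1 t ^+ 2 + 2 * q1 t) +
  (7^-1 * (-2 * (12 * (q1 t * q2 t) + k1 t * k2 t + q2 t)) +
  (8^-1 * (16 * q2 t ^+ 2 + k2 t ^+ 2) + -3 * (q1 t - q2 t) ^+ 2)))).
  rewrite (RintegralD mI s5 s67) (RintegralD mI s6 s7t) (RintegralD mI s7 st).
  rewrite (RintegralZl _ mI u5) (RintegralZl _ mI u6) (RintegralZl _ mI u7) (RintegralZl _ mI jt).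
  by rewrite mulNr ![_ * (\int[_]_(_ in _) _)]mulrC !addrA.
apply: eq_Rintegral => t _; have H (Q1 K1 Q2 K2 : R) :
  6^-1 * (9 * Q1 ^+ 2 + K1 ^+ 2 + 2 * Q1) + (7^-1 * (-2 * (12 * (Q1 * Q2) + K1 * K2 + Q2)) +
  (8^-1 * (16 * Q2 ^+ 2 + K2 ^+ 2) + -3 * (Q1 - Q2) ^+ 2)) =
  (K1 ^+ 2 - 9 * Q1 ^+ 2 + 2 * Q1) / 6 - 2 * (K1 * K2 - 9 * (Q1 * Q2) + Q2) / 7
     + (K2 ^+ 2 - 8 * Q2 ^+ 2) / 8 by field.
exact: H.
Qed.

End rfun34.
End trace.

(** * Homogeneous functions *)

Section null_slices.
Context (R : realType).
Local Notation mu := (@lebesgue_measure R).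
Local Notation T1 := (measurableTypeR R).
Local Notation T2 := (T1 * T1)%type.
Local Open Scope ereal_scope.

(** Tonelli for an indicator. It exchanges the quantifiers in [ae_homogeneous], where the null set
    of points depends on the dilation. *)
Lemma null_swap d1 d2 (X : measurableType d1) (Y : measurableType d2)
    (m1 : {sigma_finite_measure set X -> \bar R}) (m2 : {sigma_finite_measure set Y -> \bar R})
    (N : set (X * Y)) : measurable N -> (forall x, m2 (xsection N x) = 0) ->
  {ae m2, forall y, m1 (ysection N y) = 0}.
Proof.
move=> mN N0.
have h : \int[m2]_y m1 (ysection N y) = 0.
  have := indic_fubini_tonelli m1 m2 mN.
  rewrite (indic_fubini_tonelli_FE m2 mN) (indic_fubini_tonelli_GE m1 mN) => <-.
  by apply: integral0_eq => x _ /=; exact: N0.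
have ms : measurable_fun setT (fun y => m1 (ysection N y)) by exact: measurable_fun_ysection.
have : \int[m2]_(y in setT) `|m1 (ysection N y)| = 0.
  by rewrite -[RHS]h; apply: eq_integral => y _; rewrite gee0_abs.
move=> /(ae_eq_integral_abs _ measurableT ms).
by apply: filterS => y /= /(_ I).
Qed.

Lemma ae_slice2 (P : T2 -> Prop) : {ae leb2, forall z, P z} ->
  {ae mu, forall y, {ae mu, forall x, P (x, y)}}.
Proof.
move=> [N [mN N0 PN]].
have h : \int[mu]_y mu (ysection N y) = 0.
  have := indic_fubini_tonelli mu mu mN.
  rewrite (indic_fubini_tonelli_FE mu mN) (indic_fubini_tonelli_GE mu mN) => <-.
  exact: N0.
have ms : measurable_fun setT (fun y => mu (ysection N y)) by exact: measurable_fun_ysection.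
have : \int[mu]_(y in setT) `|mu (ysection N y)| = 0.
  by rewrite -[RHS]h; apply: eq_integral => y _; rewrite gee0_abs.
move=> /(ae_eq_integral_abs _ measurableT ms).
apply: filterS => y /= /(_ I) Ny.
exists (ysection N y); split => //; first exact: measurable_ysection.
by move=> x /= Px; rewrite /ysection /= inE; exact: PN.
Qed.

Lemma ae_box_null (N : set T2) : measurable N ->
  {ae mu, forall y, {ae mu, forall x, ~ N (x, y)}} -> leb2 N = 0.
Proof.
move=> mN aN.
have -> : leb2 N = \int[mu]_y mu (ysection N y).
  have := indic_fubini_tonelli mu mu mN.
  by rewrite (indic_fubini_tonelli_FE mu mN) (indic_fubini_tonelli_GE mu mN) => <-.
have ms : measurable_fun setT (fun y => mu (ysection N y)) by exact: measurable_fun_ysection.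
transitivity (\int[mu]_(y in setT) (cst 0 y : \bar R)); last by rewrite integral0.
apply: ae_eq_integral => //.
apply: filterS aN => y [K [mK K0 NK]] _.
have my : measurable (ysection N y) by exact: measurable_ysection.
apply: (subset_measure0 my mK _ K0) => x; rewrite /ysection /= inE => Nx.
by apply: NK => /= nN; exact: nN.
Qed.

Lemma ae_itv_ex (a b : R) (P : R -> Prop) : (a < b)%R -> {ae mu, forall t, P t} ->
  exists2 t, (a < t < b)%R & P t.
Proof.
move=> ab [N [mN N0 PN]].
have h : mu `]a, b[%classic <> 0.
  rewrite lebesgue_measure_itv/= lte_fin ab -EFinB => -[/eqP].
  by rewrite subr_eq0 (gt_eqF ab).
apply: contrapT => H; apply: h.
have mI : measurable (`]a, b[%classic : set T1) by exact: measurable_itv.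
apply: (subset_measure0 mI mN _ N0) => t /=; rewrite in_itv/= => tab.
by apply: PN => Pt; apply: H; exists t.
Qed.

End null_slices.

(** * Periodic functions and their primitives *)

Section periodic.
Context (R : realType).
Local Notation mu := (@lebesgue_measure R).
Local Notation T1 := (measurableTypeR R).
Implicit Types (k : R -> R).

Lemma ge0_integral_itv_co (a b : R) (G : R -> \bar R) : measurable_fun [set: T1] G ->
  (\int[mu]_(t in `[a, b]) G t = \int[mu]_(t in `[a, b[) G t)%E.
Proof.
move=> mG; apply/esym; apply: integral_itv_bndo_bndc.
exact: measurable_funTS.
Qed.

Lemma ge0_integral_periodic_cc (a : R) (G : R -> \bar R) : measurable_fun [set: T1] G ->
  (forall t, 0 <= G t)%E -> (forall t : R, G (t + 2 * pi) = G t) ->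
  (\int[mu]_(t in `[a, (a + 2 * pi)%R]) G t = \int[mu]_(t in `[0%R, (2 * pi)%R]) G t)%E.
Proof.
move=> mG G0 GP; rewrite !ge0_integral_itv_co//.
by rewrite (ge0_integral_periodic a 0 mG G0 GP) add0r.
Qed.

Lemma integrable_itv_cat (a b c : R) k : measurable_fun [set: T1] k -> a <= b <= c ->
  mu.-integrable `[a, b] (EFin \o k) -> mu.-integrable `[b, c] (EFin \o k) ->
  mu.-integrable `[a, c] (EFin \o k).
Proof.
move=> mk abc /integrableP[_ i1] /integrableP[_ i2]; apply/integrableP; split.
  by apply/measurable_EFinP; exact: measurable_funTS.
have mG : measurable_fun [set: T1] (fun t => `|(k t)%:E|%E).
  by apply: measurableT_comp => //; exact/measurable_EFinP.
move: i1 i2; rewrite /= !ge0_integral_itv_co// => i1 i2.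
by rewrite (ge0_integral_itv_cat mG _ abc)// lte_add_pinfty.
Qed.

Section fixed.
Variable k : R -> R.
Hypotheses (mk : measurable_fun [set: T1] k) (kP : forall t, k (t + 2 * pi) = k t)
  (ik : mu.-integrable `[0, 2 * pi] (EFin \o k)).

Lemma integrable_periodic a : mu.-integrable `[a, a + 2 * pi] (EFin \o k).
Proof.
apply/integrableP; split; first by apply/measurable_EFinP; exact: measurable_funTS.
have mG : measurable_fun [set: T1] (fun t => `|(k t)%:E|%E).
  by apply: measurableT_comp => //; exact/measurable_EFinP.
rewrite /= ge0_integral_periodic_cc//; last by move=> t; rewrite kP.
by move/integrableP: ik => [].
Qed.

Lemma Rintegral_periodic a :
  \int[mu]_(t in `[a, a + 2 * pi]) k t = \int[mu]_(t in `[0, 2 * pi]) k t.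
Proof.
rewrite /Rintegral integralE [in RHS]integralE; congr fine.
have mE : measurable_fun [set: T1] (fun t => (k t)%:E) by exact/measurable_EFinP.
rewrite ge0_integral_periodic_cc//; last 2 first.
- exact: measurable_funepos.
- by move=> t; rewrite !funeposE kP.
rewrite ge0_integral_periodic_cc//.
- exact: measurable_funeneg.
- by move=> t; rewrite !funenegE kP.
Qed.

Lemma integrable_periodic_itv a b : mu.-integrable `[a, b] (EFin \o k).
Proof.
have p20 : 0 < 2 * pi :> R by rewrite mulr_gt0// pi_gt0.
have H n : mu.-integrable `[a, a + 2 * pi * n%:R] (EFin \o k).
  elim: n => [|n IH].
    by rewrite mulr0 addr0; apply: (integrable_sub_itv _ _ (integrable_periodic a)) => //;
      rewrite lerDl ltW.
  have h : 0 <= 2 * pi * n%:R :> R by rewrite mulr_ge0// ltW.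
  have -> : a + 2 * pi * n.+1%:R = a + 2 * pi * n%:R + 2 * pi by rewrite mulrSr; ring.
  by apply: (integrable_itv_cat mk _ IH (integrable_periodic _)); rewrite !lerDl h ltW.
apply: (integrable_sub_itv _ _ (H (Num.bound `|(b - a) / (2 * pi)|))) => //.
rewrite -lerBlDl [2 * pi * _]mulrC -ler_pdivrMr//.
exact: le_trans (ler_norm _) (ltW (archi_boundP (normr_ge0 _))).
Qed.

(** The primitive vanishing at 0, for [t] of either sign: at least one of the two intervals is empty
    or a point. *)
Definition prim t := \int[mu]_(x in `[0, t]) k x - \int[mu]_(x in `[t, 0]) k x.

Lemma prim_diff a b : a <= b -> prim b - prim a = \int[mu]_(x in `[a, b]) k x.
Proof.
have z1 t : 0 <= t -> \int[mu]_(x in `[t, 0]) k x = 0.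
  rewrite le_eqVlt => /predU1P[<-|t0]; first by rewrite set_itv1 Rintegral_set1.
  by rewrite set_itv_ge ?Rintegral_set0// bnd_simp -ltNge.
have z2 t : t <= 0 -> \int[mu]_(x in `[0, t]) k x = 0.
  rewrite le_eqVlt => /predU1P[->|t0]; first by rewrite set_itv1 Rintegral_set1.
  by rewrite set_itv_ge ?Rintegral_set0// bnd_simp -ltNge.
move=> ab; rewrite /prim; have [a0|/ltW a0] := leP 0 a.
  have b0 := le_trans a0 ab.
  rewrite (z1 a)// (z1 b)// (Rintegral_itv_cat a0 ab (integrable_periodic_itv 0 b)); ring.
have [b0|/ltW b0] := leP 0 b.
  rewrite (z1 b)// (z2 a)// (Rintegral_itv_cat a0 b0 (integrable_periodic_itv a b)); ring.
by rewrite (z2 b)// (z2 a)// (Rintegral_itv_cat ab b0 (integrable_periodic_itv a 0)); ring.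
Qed.

Lemma isAC_prim a b : a <= b -> isAC a b prim k.
Proof.
move=> ab; split; first exact: integrable_periodic_itv.
by move=> s /andP[as_ _]; rewrite -prim_diff// addrC subrK.
Qed.

Lemma prim_periodic t : \int[mu]_(x in `[0, 2 * pi]) k x = 0 -> prim (t + 2 * pi) = prim t.
Proof.
move=> k0; apply/eqP; rewrite -subr_eq0 prim_diff; last first.
  by rewrite lerDl mulr_ge0// pi_ge0.
by rewrite Rintegral_periodic k0.
Qed.

End fixed.

(** The representative of [t] modulo 2 pi in ]0, 2 pi], in a form whose measurability is already
    known. *)
Definition per (t : R) : R := angle (pol (1, t - pi)) + pi.

Lemma per_id t : 0 < t <= 2 * pi -> per t = t.
Proof.
by move=> /andP[t0 t1]; rewrite /per angle_pol// ?subrK//; apply/andP; split; lra.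
Qed.

Lemma per_periodic t : per (t + 2 * pi) = per t.
Proof.
rewrite /per; congr (angle _ + _).
have -> : t + 2 * pi - pi = t - pi + 2 * pi by ring.
by rewrite -!pol_circ circD2pi.
Qed.

Lemma measurable_per : measurable_fun [set: T1] per.
Proof.
apply: measurable_funD => //; apply: (measurableT_comp (@measurable_angle R)).
apply: (measurableT_comp (@measurable_pol R)).
by apply: measurable_fun_pair => //; exact: measurable_funB.
Qed.

End periodic.

Section homogeneous_ray.
Context (R : realType).
Local Notation mu := (@lebesgue_measure R).
Local Notation T1 := (measurableTypeR R).
Local Notation T2 := (T1 * T1)%type.

(** Positive on ]0, 1/2[, zero beyond 1/2 and flat at 0. The flatness lets [rweight r * trig b k t]
    be a smooth test function, and the support below 1/2 is used in [homogeneous_ray]. *)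
Definition rweight (s : R) : R := qexp 0 (s ^+ 2) * qexp 0 (1 / 4 - s ^+ 2).

Lemma continuous_rweight : continuous rweight.
Proof.
move=> s; apply: cvgM.
  apply: (@continuous_comp _ _ _ (fun s : R => s ^+ 2) (qexp 0)); last exact: continuous_qexp.
  exact: exprn_continuous.
apply: (@continuous_comp _ _ _ (fun s : R => 1 / 4 - s ^+ 2) (qexp 0)); last exact: continuous_qexp.
by apply: cvgB; [exact: cvg_cst|exact: exprn_continuous].
Qed.

Lemma rweight_ge0 s : 0 <= rweight s.
Proof. by rewrite mulr_ge0// qexp_ge0. Qed.

Lemma rweight_gt0 s : 0 < s < 1 / 2 -> 0 < rweight s.
Proof.
move=> /andP[s0 s1]; rewrite mulr_gt0 ?qexp_gt0 ?exprn_gt0//.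
by rewrite subr_gt0; nra.
Qed.

Lemma rweight_eq0 s : 1 / 2 <= s -> rweight s = 0.
Proof. by move=> s1; rewrite /rweight [X in _ * X]qexp_le0 ?mulr0// subr_le0; nra. Qed.

Definition rmoment n : R := \int[mu]_(s in `]0, 1[) (s ^+ n * rweight s).

Lemma continuous_rmoment n : continuous (fun s : R => s ^+ n * rweight s).
Proof. by move=> s; apply: cvgM; [exact: exprn_continuous|exact: continuous_rweight]. Qed.

Lemma rmoment_gt0 n : 0 < rmoment n.
Proof.
have h (s : R) : 1 / 8 <= s <= 1 / 4 -> 0 < s ^+ n * rweight s.
  by move=> /andP[s0 s1]; rewrite mulr_gt0 ?exprn_gt0 ?rweight_gt0//; try (apply/andP; split); lra.
have le01 : (1 / 8 : R) <= 1 / 4 by lra.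
have cw := @continuous_rmoment n.
have [c c01 cP] := @EVT_min R (fun s => s ^+ n * rweight s) (1 / 8) (1 / 4) le01
  (continuous_subspaceT cw).
set m := c ^+ n * rweight c in cP.
have m0 : 0 < m by apply: h; move: c01; rewrite in_itv.
have i1 : mu.-integrable `[1 / 8, 1 / 4] (EFin \o cst m).
  exact: (integrable_cont (1 / 8) (1 / 4) (@cst_continuous R R m)).
apply: (@lt_le_trans _ _ (\int[mu]_(s in `[1 / 8 : R, 1 / 4]) m)).
  rewrite Rintegral_cst; last exact: measurable_itv.
  rewrite /= lebesgue_measure_itv/= lte_fin ifT; last by lra.
  by rewrite -EFinB mulr_gt0//=; lra.
apply: (@le_trans _ _ (\int[mu]_(s in `[1 / 8 : R, 1 / 4]) (s ^+ n * rweight s))).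
  apply: le_Rintegral; [exact: measurable_itv|exact: i1|exact: (integrable_cont _ _ cw)|].
  by move=> s /=; rewrite in_itv/= => s1; apply: cP; rewrite in_itv.
rewrite /rmoment /Rintegral fine_le//.
- exact: (integrable_fin_num _ (integrable_cont _ _ cw)).
- exact: (integrable_fin_num _ (integrable_cont_oo _ _ cw)).
apply: ge0_subset_integral => //.
- by apply/measurable_EFinP; apply: measurable_funTS; exact: continuous_measurable_fun.
- by move=> s /=; rewrite in_itv/= lee_fin => /andP[s0 _];
    rewrite mulr_ge0 ?rweight_ge0// exprn_ge0// ltW.
- by move=> s /=; rewrite !in_itv/= => /andP[s0 s1]; apply/andP; split; lra.
Qed.

Lemma ae_scale (r : R) (P : R -> Prop) : 0 < r -> {ae mu, forall l, P (l * r)} ->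
  {ae mu, forall s, P s}.
Proof.
move=> r0 [N [mN N0 PN]].
pose A := (fun s : T1 => s / r : T1) @^-1` N.
have mA : measurable A.
  rewrite -[A]setTI; have : measurable_fun [set: T1] (fun s : T1 => s / r : T1).
    by apply: measurable_funM.
  exact.
exists A; split => //.
  rewrite (lebesgue_measure_scale r0 mA) /pushforward.
  have -> : (fun x : T1 => r * x : T1) @^-1` A = N.
    apply/seteqP; split => x; rewrite /A /= mulrAC divff ?gt_eqF// mul1r//.
  by rewrite N0 mule0.
move=> s /= nP; apply: PN => /= Pl; apply: nP.
by rewrite divfK ?gt_eqF in Pl.
Qed.

(** For a typical [r] in [1/2, 1[ the dilations of [r] give [u s = s^3 (u r / r^3)] for almost all
    [s < r], a range containing the support of the weight. So [u r / r^3] is the weighted average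
    [f], which does not depend on [r]; a fixed [r0] of this kind settles the radii below it. *)
Lemma homogeneous_ray (u : R -> R) : measurable_fun (`]0, 1[ : set T1) u ->
  {ae mu, forall r, 0 < r < 1 -> {ae mu, forall l, 0 < l < 1 -> u (l * r) = l ^+ 3 * u r}} ->
  {ae mu, forall r, 0 < r < 1 ->
    u r = r ^+ 3 * ((rmoment 4)^-1 * \int[mu]_(s in `]0, 1[) (u s * (s * rweight s)))}.
Proof.
move=> mu_ hom; set f := (_ * _)%R.
have W0 := @rmoment_gt0 4.
have up (r : R) : 0 < r < 1 -> {ae mu, forall l, 0 < l < 1 -> u (l * r) = l ^+ 3 * u r} ->
    {ae mu, forall s, 0 < s < r -> u s = s ^+ 3 * (u r / r ^+ 3)}.
  move=> /andP[r0 r1] h; apply: (ae_scale r0); apply: filterS h => l h /andP[l0 l1].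
  rewrite h; last by rewrite -(pmulr_lgt0 l r0) l0 -(ltr_pM2r r0) mul1r.
  by rewrite exprMn; field; rewrite gt_eqF.
have big (r : R) : 1 / 2 <= r -> r < 1 ->
    {ae mu, forall l, 0 < l < 1 -> u (l * r) = l ^+ 3 * u r} -> u r / r ^+ 3 = f.
  move=> r2 r1 h; have r0 : 0 < r by lra.
  have := up r _ h; rewrite r0 r1 => /(_ isT) ur.
  have E : \int[mu]_(s in `]0, 1[) (u s * (s * rweight s)) = u r / r ^+ 3 * rmoment 4.
    have iw : mu.-integrable `]0, 1[ (fun s => (s ^+ 4 * rweight s)%:E).
      by apply: integrable_cont_oo; exact: continuous_rmoment.
    rewrite /rmoment -(RintegralZl (u r / r ^+ 3) _ iw); last exact: measurable_itv.
    have cw : measurable_fun (`]0, 1[ : set T1) rweight.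
      by apply: measurable_funTS; apply: continuous_measurable_fun; exact: continuous_rweight.
    apply: ae_eq_Rintegral => //.
    - by apply: measurable_funM => //; apply: measurable_funM.
    - by apply: measurable_funM => //; apply: measurable_funM.
    apply: filterS ur => s us /=; rewrite in_itv/= => /andP[s0 s1].
    have [sr|rs] := ltP s r; first by rewrite us ?s0// exprSr; ring.
    by rewrite (rweight_eq0 (le_trans r2 rs)) !mulr0.
  by rewrite /f E mulrCA mulVf ?mulr1// gt_eqF.
have [r0 /andP[r02 r01] hr0] : exists2 r, 1 / 2 < r < 1 &
    (0 < r < 1 -> {ae mu, forall l, 0 < l < 1 -> u (l * r) = l ^+ 3 * u r}).
  by apply: ae_itv_ex hom; lra.
have r00 : 0 < r0 by lra.
move: hr0; rewrite r00 r01 => /(_ isT) hr0.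
have b0 := big r0 (ltW r02) r01 hr0.
have := up r0 _ hr0; rewrite r00 r01 => /(_ isT) ur.
apply: filterS2 hom ur => r h ur /andP[rp r1].
have [rr0|rr0] := ltP r r0; first by rewrite ur ?rp// b0.
have hr : {ae mu, forall l, 0 < l < 1 -> u (l * r) = l ^+ 3 * u r} by apply: h; rewrite rp.
rewrite -(big r _ r1 hr); last by rewrite (le_trans _ rr0)// ltW.
by rewrite mulrC divfK// expf_neq0// gt_eqF.
Qed.

End homogeneous_ray.

(** * The profile of the class H *)

Section cos_facts.
Context (R : realType).

Lemma cosD2piE (y : R) : cos (y + 2 * pi) = cos y.
Proof. by rewrite mulr_natl cosD2pi. Qed.

Lemma sinD2piE (y : R) : sin (y + 2 * pi) = sin y.
Proof. by rewrite mulr_natl sinD2pi. Qed.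

Lemma cos3M (y : R) : cos (3 * y) = 4 * cos y ^+ 3 - 3 * cos y.
Proof.
have -> : 3 * y = y + (y + y) by ring.
rewrite cosD cosD sinD.
have -> : cos y * (cos y * cos y - sin y * sin y) - sin y * (sin y * cos y + cos y * sin y) =
  cos y ^+ 3 - 3 * cos y * sin y ^+ 2 by ring.
by rewrite sin2cos2; ring.
Qed.

Lemma cos_pi3 : cos (pi / 3) = 1 / 2 :> R.
Proof.
have pi0 := @pi_gt0 R.
have c0 : 0 < cos (pi / 3) :> R by apply: cos_gt0_pihalf; apply/andP; split; lra.
have : cos (3 * (pi / 3)) = -1 :> R by rewrite mulrC divfK// cospi.
rewrite cos3M => h.
have : (1 + cos (pi / 3)) * (2 * cos (pi / 3) - 1) ^+ 2 = 0 :> R.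
  by transitivity (4 * cos (pi / 3) ^+ 3 - 3 * cos (pi / 3) + 1 : R); [ring|rewrite h addNr].
move/eqP; rewrite mulf_eq0 sqrf_eq0 => /orP[|] /eqP; lra.
Qed.

Lemma cos_gt_half (s : R) : - (pi / 3) < s < pi / 3 -> 1 / 2 < cos s.
Proof.
move=> /andP[s1 s2]; rewrite -cos_pi3; have pi0 := @pi_gt0 R.
have [s0|s0] := leP 0 s; first by apply: cos_lt => //; lra.
by rewrite -(cosN s); apply: cos_lt; lra.
Qed.

Lemma cos_le_half (s : R) : pi / 3 <= s <= 5 * pi / 3 -> cos s <= 1 / 2.
Proof.
move=> /andP[s1 s2]; rewrite -cos_pi3; have pi0 := @pi_gt0 R.
have [s0|s0] := leP s pi; first by apply: cos_le => //; lra.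
have -> : cos s = cos (2 * pi - s).
  by have := cosD2piE (s - 2 * pi); rewrite subrK => ->; rewrite -[LHS]cosN opprB.
by apply: cos_le; lra.
Qed.

End cos_facts.

Section hfun_profile.
Context (R : realType).
Local Notation mu := (@lebesgue_measure R).
Local Notation T1 := (measurableTypeR R).
Local Notation T2 := (T1 * T1)%type.

Definition ppos (x : R) : R := Num.max x 0.

Lemma continuous_ppos : continuous ppos.
Proof. by move=> x; apply: continuous_max; [exact: cvg_id|exact: cvg_cst]. Qed.

Lemma is_derive_ppos2 (x : R) : is_derive x 1 (fun x => ppos x ^+ 2) (2 * ppos x).
Proof.
have [x0|x0|->] := ltgtP x 0.
- rewrite /ppos max_r ?(ltW x0)// mulr0.
  apply: (near_eq_is_derive (f := cst 0)).
  near=> y; rewrite /= max_r ?expr0n//; apply: ltW; near: y; exact: lt_nbhsl.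
- rewrite /ppos max_l ?(ltW x0)//.
  apply: (near_eq_is_derive (f := fun y : R => y ^+ 2)).
    near=> y; rewrite /= max_l//; apply: ltW; near: y; exact: lt_nbhsr.
  by apply: is_derive_eq; rewrite /GRing.scale/=; ring.
- rewrite /ppos maxxx mulr0.
  have H : h^-1 *: (ppos (h *: 1 + 0) ^+ 2 - ppos 0 ^+ 2) @[h --> 0^'] --> (0 : R).
    apply/cvgrPdist_lt => e e0; near=> h.
    rewrite sub0r normrN addr0 /GRing.scale/= mulr1 /ppos maxxx expr0n/= subr0.
    have [h0|h0] := leP h 0; first by rewrite expr0n/= mulr0 normr0.
    rewrite expr2 mulrA mulVf ?gt_eqF// mul1r; near: h; exact: dnbhs0_lt.
  apply: DeriveDef; first by apply/cvg_ex; exists 0.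
  by apply/cvg_lim.
Unshelve. all: by end_near. Qed.

(** The profile of [hfun] seen from the middle of its sector. As 1 + cos 3y = (1 + cos y) (2 cos y -
    1)^2, the positive part restricts it to the sector, and its square keeps it continuously
    differentiable. *)
Definition hprof (y : R) : R := (1 + cos y) * ppos (2 * cos y - 1) ^+ 2 / 9.

Definition dhprof (y : R) : R := - sin y * (ppos (2 * cos y - 1) * (2 * cos y + 1)) / 3.

Lemma is_derive_hprof (y : R) : is_derive y 1 hprof (dhprof y).
Proof.
have h1 : is_derive y 1 (fun y : R => 2 * cos y - 1) (- (2 * sin y)).
  by apply: is_derive_eq; rewrite /GRing.scale/=; ring.
have h2 := @is_derive1_comp R (fun x => ppos x ^+ 2) (fun y : R => 2 * cos y - 1) y _ _
  (is_derive_ppos2 _) h1.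
have h3 : is_derive y 1 (fun y => ppos (2 * cos y - 1) ^+ 2)
   (2 * ppos (2 * cos y - 1) * - (2 * sin y)) by exact: h2.
have E : dhprof y = (- sin y * ppos (2 * cos y - 1) ^+ 2 +
   (1 + cos y) * (2 * ppos (2 * cos y - 1) * - (2 * sin y))) / 9.
  rewrite /dhprof; have [c0|c0] := leP (2 * cos y - 1) 0.
    by rewrite /ppos max_r//; field.
  by rewrite /ppos max_l ?(ltW c0)//; field.
rewrite E /hprof; apply: is_derive_eq; rewrite /GRing.scale/=; by field.
Qed.

Lemma continuous_dhprof : continuous dhprof.
Proof.
have c1 : continuous (fun y : R => 2 * cos y - 1).
  by move=> y; apply: cvgB; [apply: cvgM; [exact: cvg_cst|exact: continuous_cos]|exact: cvg_cst].
move=> y; apply: cvgM; last exact: cvg_cst.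
apply: cvgM; first by apply: cvgN; exact: continuous_sin.
apply: cvgM.
  exact: (@continuous_comp _ _ _ (fun y : R => 2 * cos y - 1) ppos y (c1 y) (@continuous_ppos _)).
by apply: cvgD; [apply: cvgM; [exact: cvg_cst|exact: continuous_cos]|exact: cvg_cst].
Qed.

Lemma hprof_ge0 y : 0 <= hprof y.
Proof.
by have c1 := cos_geN1 y; rewrite divr_ge0// mulr_ge0 ?sqr_ge0//; lra.
Qed.

Lemma hprof_periodic y : hprof (y + 2 * pi) = hprof y.
Proof. by rewrite /hprof cosD2piE. Qed.

Lemma dhprof_periodic y : dhprof (y + 2 * pi) = dhprof y.
Proof. by rewrite /dhprof cosD2piE sinD2piE. Qed.

Lemma hprof_out y : cos y <= 1 / 2 -> hprof y = 0 /\ dhprof y = 0.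
Proof.
move=> cy; rewrite /hprof /dhprof /ppos max_r; last by lra.
by rewrite expr0n/= !mul0r !mulr0 !mul0r.
Qed.

Definition hshift m (t : R) := hprof (t - m).
Definition dhshift m (t : R) := dhprof (t - m).

Lemma is_derive_hshift (m t : R) : is_derive t 1 (hshift m) (dhshift m t).
Proof.
have h1 : is_derive t 1 (fun t : R => t - m) 1.
  by apply: is_derive_eq; rewrite ?subr0 ?addr0.
have := @is_derive1_comp R hprof (fun t => t - m) t _ _ (is_derive_hprof (t - m)) h1.
by rewrite mulr1.
Qed.

Lemma continuous_dhshift m : continuous (dhshift m).
Proof.
move=> t; apply: (@continuous_comp _ _ _ (fun t : R => t - m) dhprof); last exact: continuous_dhprof.
by apply: cvgB; [exact: cvg_id|exact: cvg_cst].
Qed.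

Lemma continuous_hshift m : continuous (hshift m).
Proof.
move=> t; apply: differentiable_continuous; apply/derivable1_diffP.
by have [] := is_derive_hshift m t.
Qed.

Lemma H1circ_hshift m : H1circ (hshift m) (dhshift m).
Proof.
split.
- by split; apply: continuous_measurable_fun; [exact: continuous_hshift|exact: continuous_dhshift].
- by move=> t; rewrite /hshift addrAC hprof_periodic.
- by move=> t; rewrite /dhshift addrAC dhprof_periodic.
- exact: (integrable_cont 0 (2 * pi) (continuous_sqr (@continuous_dhshift m))).
- move=> a b ab; apply: isAC_C1 => x _; first exact: is_derive_hshift.
  exact: continuous_dhshift.
Qed.

(** A cosine condition describes the sector independently of the representative of the angle modulo
    2 pi. *)
Lemma sector_pol (a r t : R) : 0 < r ->
  sector a (a + 2 * pi / 3) (pol (r, t)) <-> 1 / 2 < cos (t - (a + pi / 3)).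
Proof.
move=> r0; have pi0 := @pi_gt0 R; split.
  move=> [r' [t' [r'0 /andP[t1 t2] E]]].
  have rr : r = r'.
    have : enorm (pol (r, t)) = enorm (pol (r', t')) by rewrite E pol_circ.
    by rewrite !enorm_pol/= !gtr0_norm.
  move: E; rewrite pol_circ rr => -[/(mulfI (lt0r_neq0 r'0)) c /(mulfI (lt0r_neq0 r'0)) s].
  rewrite cosB c s -cosB; apply: cos_gt_half; apply/andP; split; lra.
set m := a + pi / 3 => c2.
have [s s01 sE] := @circ_surj R (cos (t - m)) (sin (t - m)) (cos2Dsin2 _).
have [u [u1 u2]] : exists u, - (pi / 3) < u < pi / 3 /\ circ u = circ (t - m).
  move: s01 => /andP[s0 s1].
  have cs : cos s = cos (t - m) := congr1 fst sE.
  have [spi|spi] := leP s pi.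
    exists s; split => //; apply/andP; split; first by lra.
    rewrite ltNge; apply/negP => ps; have := @cos_le_half R s; rewrite cs => h.
    have : cos (t - m) <= 1 / 2 by apply: h; apply/andP; split; lra.
    by lra.
  exists (s - 2 * pi); split; last by transitivity (circ s); [rewrite -(circD2pi (s - 2 * pi)) subrK|exact: sE].
  apply/andP; split; last by lra.
  rewrite ltNge; apply/negP => ps; have := @cos_le_half R s; rewrite cs => h.
  have : cos (t - m) <= 1 / 2 by apply: h; apply/andP; split; lra.
  by lra.
exists r, (u + m); split => //.
  by move: u1 => /andP[u1 u1']; rewrite /m; apply/andP; split; lra.
rewrite pol_circ /pol /=.
have cu : cos u = cos (t - m) := congr1 fst u2.
have su : sin u = sin (t - m) := congr1 snd u2.
have cE : cos (u + m) = cos t by rewrite cosD cu su -cosD subrK.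
have sE' : sin (u + m) = sin t by rewrite sinD cu su -sinD subrK.
by rewrite cE sE'.
Qed.

(** With m the middle of the sector, 3 (t - a) = 3 (t - m) + pi, which turns 1 - cos 3(t - a) into 1
    + cos 3(t - m). *)
Lemma hfun_rfun (a : R) : hfun a = rfun 3 (hshift (a + pi / 3)).
Proof.
apply/funext => x; have [t _ ->] := polar_surj x.
have : 0 <= enorm x by exact: sqrtr_ge0.
move: (enorm x) => r; rewrite le_eqVlt => /predU1P[<-|r0].
  have -> : pol (0, t) = (0, 0) :> R * R by rewrite /pol /= !mul0r.
  have e0 : enorm (0, 0) = 0 :> R by rewrite /enorm /= expr0n/= addr0 sqrtr0.
  by rewrite /hfun /rfun e0 /=; field.
rewrite rfun_pol//; last by move=> s; rewrite /hshift addrAC hprof_periodic.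
set m := a + pi / 3; rewrite /= /hshift.
have P1 : (pol (r, t)).1 ^+ 3 - 3 * (pol (r, t)).1 * (pol (r, t)).2 ^+ 2 = r ^+ 3 * cos (3 * t).
  by rewrite -[RHS](congr1 fst (CS_pol 3 r t)) /=; ring.
have P2 : 3 * (pol (r, t)).1 ^+ 2 * (pol (r, t)).2 - (pol (r, t)).2 ^+ 3 = r ^+ 3 * sin (3 * t).
  by rewrite -[RHS](congr1 snd (CS_pol 3 r t)) /=; ring.
rewrite /hfun P1 P2 enorm_pol/= (gtr0_norm r0).
have E : cos (3 * a) * cos (3 * t) + sin (3 * a) * sin (3 * t) =
    - (4 * cos (t - m) ^+ 3 - 3 * cos (t - m)).
  rewrite -cos3M -cosB -cosN.
  have -> : - (3 * a - 3 * t) = 3 * (t - m) + pi by rewrite /m; field.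
  by rewrite cosDpi.
have -> : r ^+ 3 / 9 - cos (3 * a) / 9 * (r ^+ 3 * cos (3 * t)) - sin (3 * a) / 9 * (r ^+ 3 * sin (3 * t)) =
  r ^+ 3 / 9 * (1 - (cos (3 * a) * cos (3 * t) + sin (3 * a) * sin (3 * t))) by field.
rewrite E /hprof.
have [c|c] := ltP (1 / 2) (cos (t - m)).
  rewrite indicE mem_set; last exact/sector_pol.
  have -> : (true%:R : R) = 1 by [].
  rewrite mulr1 /ppos max_l; last by lra.
  by move: (cos (t - m)) => y; field.
rewrite indicE memNset; last by move/(sector_pol _ _ r0); rewrite -/m ltNge c.
by rewrite /ppos max_r ?expr0n/= ?mulr0 ?mul0r ?mulr0//; lra.
Qed.

End hfun_profile.

(** * Representation of homogeneous functions of class W^{1,2} *)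

Section structure.
Context (R : realType).
Local Notation mu := (@lebesgue_measure R).
Local Notation T1 := (measurableTypeR R).
Local Notation T2 := (T1 * T1)%type.
Let mB := @measurable_B1 R.
Let mI : measurable (`[0, 2 * pi]%classic : set T1).
Proof. exact: measurable_itv. Qed.
Let mJ : measurable (`]0, 1[%classic : set T1).
Proof. exact: measurable_itv. Qed.

Lemma measurable_patch_B1 (c : R * R -> R) : measurable_fun (B1 : set T2) c ->
  measurable_fun [set: T2] (c \_ B1 : T2 -> R).
Proof. by move=> mc; apply/(measurable_restrictT _ _).1. Qed.

Lemma patch_B1E (c : R * R -> R) x : B1 x -> (c \_ B1) x = c x.
Proof. by move=> Bx; rewrite patchE mem_set. Qed.

(** Each dilation comes with its own null set of points; [null_swap] turns this into a null set of
    dilations for almost every point. Factors below 1 keep the point inside the disc. *)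
Lemma homogeneous_ae (c : R * R -> R) : measurable_fun (B1 : set T2) c ->
  ae_homogeneous 3 c ->
  {ae leb2, forall x, B1 x -> {ae mu, forall l, 0 < l < 1 -> c (l *: x) = l ^+ 3 * c x}}.
Proof.
move=> mc hom; have mc0 := measurable_patch_B1 mc; set c0 := c \_ B1 in mc0.
have Bl (l : R) (x : R * R) : 0 < l < 1 -> B1 x -> B1 (l *: x).
  move=> /andP[l0 l1] /B1E x1; apply/B1E.
  have -> : nsq (l *: x) = l ^+ 2 * nsq x by rewrite /nsq /=  /GRing.scale/=; ring.
  have n0 : 0 <= nsq x by rewrite addr_ge0// sqr_ge0.
  by apply: le_lt_trans x1; rewrite ler_piMl// exprn_ile1// ltW.
pose G (y : T1 * T2) : T1 := c0 (y.1 * y.2.1, y.1 * y.2.2) - y.1 ^+ 3 * c0 y.2.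
have m1 : measurable_fun [set: T1 * T2] (fun y : T1 * T2 => y.1) by exact: measurable_fst.
have m2 : measurable_fun [set: T1 * T2] (fun y : T1 * T2 => y.2) by exact: measurable_snd.
have m21 : measurable_fun [set: T1 * T2] (fun y : T1 * T2 => y.2.1).
  exact: (measurableT_comp measurable_fst m2).
have m22 : measurable_fun [set: T1 * T2] (fun y : T1 * T2 => y.2.2).
  exact: (measurableT_comp measurable_snd m2).
have mG : measurable_fun [set: T1 * T2] G.
  apply: measurable_funB.
    apply: (measurableT_comp mc0); apply: measurable_fun_pair.
      exact: (measurable_funM m1 m21).
    exact: (measurable_funM m1 m22).
  exact: (measurable_funM (measurable_funX 3 m1) (measurableT_comp mc0 m2)).
pose N : set (T1 * T2) := (`]0, 1[%classic `*` (B1 : set T2)) `&` (G @^-1` [set~ 0]).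
have mN : measurable N.
  apply: measurableI; first exact: measurableX.
  rewrite -[X in measurable X]setTI.
  by apply: mG => //; apply: measurableC; exact: measurable_set1.
have N0 l : leb2 (xsection N l) = 0%E.
  have [l01|l01] := boolP (0 < l < 1); last first.
    have -> : xsection N l = set0; last exact: (@measure0 _ _ _ (@lebesgue_measure R \x @lebesgue_measure R)%E).
    rewrite -subset0 => x; rewrite /xsection /= inE => -[[]] /=.
    by rewrite in_itv/= (negbTE l01).
  have l0 : 0 < l by case/andP: l01.
  have [K [mK K0 PK]] := hom l l0.
  have mx : measurable (xsection N l) by exact: measurable_xsection.
  apply: (subset_measure0 mx mK _ K0) => x; rewrite /xsection /= inE => -[[_ Bx]] /= Gx.
  apply: PK => /= H; apply: Gx; rewrite /G /= /c0 !patch_B1E//; last exact: (Bl l x).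
  by rewrite (H Bx (Bl l x l01 Bx) : c (l * x.1, l * x.2) = _) subrr.
have B1oo : (leb2 (B1 : set T2) < +oo)%E.
  have /integrableP[_] := @integrable_B1_cst R 1.
  by rewrite /= integral_cst ?normr1 ?mul1e.
(* Restriction to the disc provides the finite, hence sigma-finite, measure to which [null_swap] is
   applied. *)
pose m2' : {finite_measure set T2 -> \bar R} := mfrestr mB B1oo.
have N0' l : m2' (xsection N l) = 0%E.
  have mx : measurable (xsection N l) by exact: measurable_xsection.
  rewrite /m2' /= /mfrestr /mrestr.
  by apply: (subset_measure0 (measurableI _ _ mx mB) mx _ (N0 l)) => x [].
have [K [mK K0 PK]] := @null_swap R _ _ T1 T2 (@lebesgue_measure R) m2' N mN N0'.
exists (K `&` (B1 : set T2)); split; [exact: measurableI|exact: K0|].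
move=> x /= nx; have Bx : B1 x by apply: contrapT => nB; apply: nx.
split => //; apply: PK => /= Nx; apply: nx => _; exists (ysection N x); split => //.
  exact: measurable_ysection.
move=> l /= H; rewrite /ysection /= inE; apply: contrapT => nN; apply: H => l01.
apply: contrapT => H; apply: nN; split; first by split => //=; rewrite in_itv.
rewrite /= /G /= /c0 !patch_B1E//; last exact: (Bl l x).
by move=> /eqP; rewrite subr_eq0 => /eqP.
Qed.

(** A weighted average along the ray at angle [t]. For F = r^3 f(theta) it is [rmoment R 4] times f,
    and it replaces a pointwise choice of f by a measurable formula. *)
Definition ray (F : R * R -> R) (t : R) : R :=
  \int[mu]_(r in `]0, 1[) (F (pol (r, t)) * (r * rweight r)).

Lemma ae_ray (c : R * R -> R) : measurable_fun (B1 : set T2) c -> ae_homogeneous 3 c ->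
  {ae mu, forall t, 0 <= t <= 2 * pi ->
    {ae mu, forall r, 0 < r < 1 -> c (pol (r, t)) = r ^+ 3 * ((rmoment R 4)^-1 * ray c t)}}.
Proof.
move=> mc hom.
have := ae_slice2 (@ae_rect R 0 _ (homogeneous_ae mc hom)).
apply: filterS => t ht t01.
have mc0 := measurable_patch_B1 mc.
have Bp r : 0 < r < 1 -> B1 (pol (r, t)).
  move=> /andP[r0 r1]; rewrite /B1 /= enorm_pol/= gtr0_norm//.
apply: (homogeneous_ray (u := fun r => c (pol (r, t)))).
  have mp : measurable_fun [set: T1] (fun r : T1 => (c \_ B1) (pol (r, t))).
    apply: (measurableT_comp mc0); apply: (measurableT_comp (@measurable_pol R)).
    by apply: measurable_fun_pair => //; exact: measurable_cst.
  apply: (eq_measurable_fun (fun r : T1 => (c \_ B1) (pol (r, t)))).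
    by move=> r; rewrite inE/= in_itv/= => r01; rewrite patch_B1E//; exact: Bp.
  exact: measurable_funTS.
apply: filterS ht => r h r01.
have Dr : rect 0 (r, t) by split => /=; rewrite in_itv//= add0r.
by apply: filterS (h Dr) => l hl /hl <-; congr c; rewrite /pol /= -!mulrA.
Qed.

Section ray_integral.
Variable F : R * R -> R.
Hypothesis iF : leb2.-integrable B1 (EFin \o F).
Let mF : measurable_fun (B1 : set T2) F.
Proof. by move/integrableP: iF => [/measurable_EFinP]. Qed.

Let cw : continuous (fun z : R * R => rweight z.1).
Proof.
by move=> z; exact: (@continuous_comp _ _ _ fst (@rweight R) z cvg_fst (@continuous_rweight R _)).
Qed.

Let i0 (X : R * R -> R) : continuous X ->
  leb2.-integrable (rect 0) (fun z => (F (pol z) * z.1 * X z)%:E).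
Proof.
move=> cX; have [C CP] := continuous_bounded_rect cX.
have := iF; move=> /(integrable_B1 0 mF) iP.
apply: (integrable_mulb (C := C) _ iP) => //; first exact: measurable_rect.
by apply: measurable_funTS; exact: continuous_measurable2.
Qed.

Let rectE : rect 0 = (`]0, 1[%classic `*` `[0, 2 * pi]%classic) :> set T2.
Proof. by rewrite /rect add0r. Qed.

Let i1 : leb2.-integrable (`]0, 1[ `*` `[0, 2 * pi]) (EFin \o (fun z : T2 => F (pol z) * z.1 * rweight z.1)).
Proof. by rewrite -rectE; exact: i0. Qed.

Let rayE t : ray F t = \int[mu]_(r in `]0, 1[) (F (pol (r, t)) * r * rweight r).
Proof. by apply: eq_Rintegral => r _; rewrite mulrA. Qed.

Lemma integrable_ray : mu.-integrable `[0, 2 * pi] (EFin \o ray F).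
Proof.
have := integrable_box2 mJ mI i1.
by apply: (integrable_eqR mI) => t _; rewrite rayE.
Qed.

Lemma ae_integrable_ray : {ae mu, forall t, 0 <= t <= 2 * pi ->
  mu.-integrable `]0, 1[ (fun r => (F (pol (r, t)) * (r * rweight r))%:E)}.
Proof.
have := ae_integrable_box2 mJ mI i1; apply: filterS => t h t01.
have := h _; rewrite /= in_itv/= => /(_ t01).
by apply: (integrable_eqR mJ) => r _ /=; rewrite mulrA.
Qed.

Lemma Rintegral_ray (psi : R -> R) : continuous psi ->
  \int[leb2]_(z in rect 0) (F (pol z) * (rweight z.1 * psi z.2) * z.1) =
  \int[mu]_(t in `[0, 2 * pi]) (ray F t * psi t).
Proof.
move=> cp; have cX := continuous2M cw (continuous_snd cp).
have i2 : leb2.-integrable (`]0, 1[ `*` `[0, 2 * pi])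
    (EFin \o (fun z : T2 => F (pol z) * z.1 * (rweight z.1 * psi z.2))).
  by rewrite -rectE; exact: i0.
transitivity (\int[leb2]_(z in `]0, 1[ `*` `[0, 2 * pi]) (F (pol z) * z.1 * (rweight z.1 * psi z.2))).
  by rewrite rectE; apply: eq_Rintegral => z _; rewrite mulrAC.
rewrite (Rintegral_box2 mJ mI i2).
apply: ae_eq_Rintegral => //.
- by move/integrableP: (integrable_box2 mJ mI i2) => [/measurable_EFinP].
- by move/integrableP: (integrable_mul_cont integrable_ray cp) => [/measurable_EFinP].
apply: filterS ae_integrable_ray => t h; rewrite /= in_itv/= => /h it.
rewrite mulrC -(RintegralZl (psi t) mJ it); apply: eq_Rintegral => r _ /=; ring.
Qed.

End ray_integral.

(** The Cauchy-Schwarz inequality for the weight [r * rweight r], from the nonnegative integral of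
    [(A * F - Q) ^+ 2]. *)
Lemma ray_sqr (F : R * R -> R) : L2B1 F ->
  {ae mu, forall t, 0 <= t <= 2 * pi ->
    ray F t ^+ 2 <= rmoment R 1 * ray (fun x => F x ^+ 2) t}.
Proof.
move=> F2; have iF := L2_integrable F2; have [mF iF2] := F2.
apply: filterS2 (ae_integrable_ray iF) (ae_integrable_ray iF2) => t h1 h2 t01.
have {}h1 := h1 t01; have {}h2 := h2 t01.
set A := rmoment R 1; set Q := ray F t; set S := ray _ t.
have A0 : 0 < A := @rmoment_gt0 R 1.
have ia : mu.-integrable `]0, 1[ (fun r : R => (r ^+ 1 * rweight r)%:E).
  by apply: integrable_cont_oo; exact: continuous_rmoment.
have k1 := integrable_scaleR mJ (A ^+ 2) h2; have k2 := integrable_scaleR mJ (- (2 * A * Q)) h1.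
have k3 := integrable_scaleR mJ (Q ^+ 2) ia.
have k23 := integrable_addR mJ k2 k3.
have : 0 <= A ^+ 2 * S + (- (2 * A * Q) * Q + Q ^+ 2 * A).
  have -> : A ^+ 2 * S + (- (2 * A * Q) * Q + Q ^+ 2 * A) =
    \int[mu]_(r in `]0, 1[) ((A * F (pol (r, t)) - Q) ^+ 2 * (r * rweight r)).
    transitivity (\int[mu]_(r in `]0, 1[) (A ^+ 2 * (F (pol (r, t)) ^+ 2 * (r * rweight r)) +
      (- (2 * A * Q) * (F (pol (r, t)) * (r * rweight r)) + Q ^+ 2 * (r ^+ 1 * rweight r)))).
      rewrite (RintegralD mJ k1 k23) (RintegralD mJ k2 k3).
      by rewrite (RintegralZl _ mJ h2) (RintegralZl _ mJ h1) (RintegralZl _ mJ ia).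
    by apply: eq_Rintegral => r _; rewrite expr1; ring.
  apply: Rintegral_ge0 => r /=; rewrite in_itv/= => /andP[r0 _].
  by rewrite mulr_ge0 ?sqr_ge0// mulr_ge0 ?rweight_ge0// ltW.
have -> : A ^+ 2 * S + (- (2 * A * Q) * Q + Q ^+ 2 * A) = A * (A * S - Q ^+ 2) by ring.
by rewrite pmulr_rge0// subr_ge0.
Qed.

Lemma integrable_ray_sqr (F : R * R -> R) : L2B1 F ->
  mu.-integrable `[0, 2 * pi] (fun t => (ray F t ^+ 2)%:E).
Proof.
move=> F2; have iF := L2_integrable F2; have [mF iF2] := F2.
have mr : measurable_fun (`[0, 2 * pi]%classic : set T1) (ray F).
  by move/integrableP: (integrable_ray iF) => [/measurable_EFinP].
have mr2 : measurable_fun (`[0, 2 * pi]%classic : set T1) (ray (fun x => F x ^+ 2)).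
  by move/integrableP: (integrable_ray iF2) => [/measurable_EFinP].
have iS := integrable_scaleR mI (rmoment R 1) (integrable_ray iF2).
have S0 t : 0 <= rmoment R 1 * ray (fun x => F x ^+ 2) t.
  apply: mulr_ge0; first exact: ltW (@rmoment_gt0 R 1).
  apply: Rintegral_ge0 => r /=; rewrite in_itv/= => /andP[r0 _].
  by rewrite mulr_ge0 ?sqr_ge0// mulr_ge0 ?rweight_ge0// ltW.
have mm : measurable_fun (`[0, 2 * pi]%classic : set T1)
    (fun t => Num.min (ray F t ^+ 2) (rmoment R 1 * ray (fun x => F x ^+ 2) t)).
  by apply: measurable_minr; [exact: measurable_funX|exact: measurable_funM].
(* The bound of [ray_sqr] holds only almost everywhere, while domination is checked at every point;
   the minimum satisfies it everywhere. *)
have im : mu.-integrable `[0, 2 * pi]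
    (EFin \o (fun t => Num.min (ray F t ^+ 2) (rmoment R 1 * ray (fun x => F x ^+ 2) t))).
  apply: (le_integrable mI _ _ iS); first exact/measurable_EFinP.
  move=> t _; rewrite /= lee_fin ger0_norm; last by rewrite le_min sqr_ge0 S0.
  by rewrite ger0_norm ?S0// ge_min lexx orbT.
apply: (ae_eq_integrable mI _ _ im); first exact: measurable_funX.
apply: filterS (ray_sqr F2) => t h; rewrite /= in_itv/= => /h ht.
by rewrite min_l.
Qed.

(** The parameter [k / 2] supplies r^(-k), which cancels the factor r^k of [harm]; what remains is
    [rweight r * trig b k t], smooth at the origin too. *)
Definition angtest b k (x : R * R) : R :=
  harm b k x * (qexp (k%:R / 2) (nsq x) * qexp 0 (1 / 4 + (-1) * nsq x)).

Lemma angtest_test b k : test_function (angtest b k).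
Proof.
have cA n : Ck n (fun x : R * R => 1 / 4 + (-1) * nsq x).
  by apply: Ck_add; [exact: Ck_cst|apply: Ck_mul; [exact: Ck_cst|exact: Ck_nsq]].
apply: (@test_functionP R _ (1 / 4)).
- move=> n; apply: Ck_mul; first exact: Ck_harm.
  by apply: Ck_mul; apply: Ck_qexp => // j; exact: Ck_nsq.
- by lra.
- by move=> x x4; rewrite /angtest [X in _ * (_ * X)]qexp_le0 ?mulr0//; lra.
Qed.

Lemma angtest_pol b k (r t : R) : 0 < r -> angtest b k (pol (r, t)) = rweight r * trig b k t.
Proof.
move=> r0; rewrite /angtest harm_pol nsq_pol /= /rweight.
have -> : 1 / 4 + -1 * r ^+ 2 = 1 / 4 - r ^+ 2 by rewrite mulN1r.
have E : r ^+ k * qexp (k%:R / 2) (r ^+ 2) = qexp 0 (r ^+ 2).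
  have r2 : 0 < r ^+ 2 by rewrite exprn_gt0.
  rewrite /qexp r2 mul0r subr0 lnXn//.
  have -> : - (r ^+ 2)^-1 - k%:R / 2 * (ln r *+ 2) = - (r ^+ 2)^-1 - k%:R * ln r.
    by congr (_ - _); rewrite -[ln r *+ 2]mulr_natr; field.
  rewrite expRD expRN expRM_natl lnK ?posrE// mulrCA mulfV ?mulr1//.
  by rewrite expf_neq0// gt_eqF.
by rewrite -E; ring.
Qed.

Lemma angular_L2 (c : R * R -> R) : W12 c ->
  L2B1 (fun x => - x.2 * wpartial e1 c x + x.1 * wpartial e2 c x).
Proof.
move=> Wc; have [g1 _] := W12_wpartial (@axis1 R) Wc; have [g2 _] := W12_wpartial (@axis2 R) Wc.
have x1 (x : R * R) : B1 x -> `|x.1| <= 1 /\ `|x.2| <= 1.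
  by move=> /B1E/ltW; exact: nsq_le1.
have m1 : measurable_fun (B1 : set T2) (fun x : T2 => x.1).
  by apply: measurable_funTS; exact: measurable_fst.
have m2 : measurable_fun (B1 : set T2) (fun x : T2 => - x.2).
  by apply: measurable_funTS; apply: measurableT_comp => //; exact: measurable_snd.
have b1 : L2B1 (fun x => wpartial e1 c x * - x.2).
  by apply: (L2_mulb (C := 1) g1 m2) => x /x1 []; rewrite normrN.
have b2 : L2B1 (fun x => wpartial e2 c x * x.1).
  by apply: (L2_mulb (C := 1) g2 m1) => x /x1 [].
have := L2_add b1 b2; congr L2B1; apply/funext => x.
by rewrite [- x.2 * _]mulrC [x.1 * _]mulrC.
Qed.

(** Averaging along rays commutes with the weak angular derivative: this is [weak_angular] tested
    with [angtest]. *)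
Lemma angular_identity b k (c : R * R -> R) : W12 c ->
  \int[mu]_(t in `[0, 2 * pi]) (ray c t * dtrig b k t) =
  - \int[mu]_(t in `[0, 2 * pi])
     (ray (fun x => - x.2 * wpartial e1 c x + x.1 * wpartial e2 c x) t * trig b k t).
Proof.
move=> Wc; have tp := angtest_test b k.
have ic := L2_integrable (W12_L2 Wc).
have L := angular_L2 Wc.
move: L; set Th := (fun x : R * R => _) => L.
have dtP (r t : R) : 0 < r < 1 ->
    is_derive t 1 (fun u => angtest b k (pol (r, u))) (rweight r * dtrig b k t).
  move=> /andP[r0 _].
  have -> : (fun u => angtest b k (pol (r, u))) = (fun u => rweight r * trig b k u).
    by apply/funext => u; rewrite angtest_pol.
  exact: (is_deriveZ (rweight r) (@is_derive_trig R b k t)).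
have W := weak_angular Wc tp dtP.
rewrite -(Rintegral_ray ic (@continuous_dtrig R b k)).
apply: etrans W _; congr (- _).
have mT : measurable_fun (B1 : set T2) (fun x => Th x * angtest b k x).
  by apply: measurable_funM; [exact: L2_measurable L|exact: measurable_test].
apply: etrans (Rintegral_B1 0 mT) _.
rewrite -(Rintegral_ray (L2_integrable L) (@continuous_trig R b k)).
apply: eq_Rintegral => z /set_mem[]; rewrite /= in_itv/= => /andP[z0 _] _.
by congr (_ * _ * _); rewrite -angtest_pol.
Qed.

Lemma trig_periodic b k (t : R) : trig b k (t + 2 * pi) = trig b k t.
Proof.
have h u : trig b k u = harm b k (pol (1, u)) by rewrite harm_pol expr1n mul1r.
by rewrite !h -!pol_circ circD2pi.
Qed.

Lemma Rintegral_dtrig b k : \int[mu]_(t in `[0, 2 * pi]) dtrig b k t = 0.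
Proof.
have p20 : 0 <= 2 * pi :> R by rewrite mulr_ge0// pi_ge0.
have ac : isAC 0 (2 * pi) (@trig R b k) (@dtrig R b k).
  by apply: (@isAC_C1 R 0 (2 * pi) (@trig R b k) (@dtrig R b k)) => t _;
    [exact: is_derive_trig|exact: continuous_dtrig].
by rewrite -(isAC_end p20 ac) -[2 * pi]add0r trig_periodic subrr.
Qed.

(** The du Bois-Reymond lemma on the circle: the functions [dtrig] reach every mode except the
    constant one, and the mean of [u] takes care of that. *)
Lemma dtrig_complete (u : R -> R) : mu.-integrable `[0, 2 * pi] (EFin \o u) ->
  (forall b k, \int[mu]_(t in `[0, 2 * pi]) (u t * dtrig b k t) = 0) ->
  exists C, {ae mu, forall t, `[0, 2 * pi]%classic t -> u t = C}.
Proof.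
move=> iu u0; have p20 : 0 < 2 * pi :> R by rewrite mulr_gt0// pi_gt0.
set J := \int[mu]_(t in `[0, 2 * pi]) u t; exists (J / (2 * pi)); set C := J / (2 * pi).
have iC := integrable_circ_cst C.
have iv : mu.-integrable `[0, 2 * pi] (EFin \o (fun t => u t - C)) by exact: (integrable_subR mI iu iC).
have v0 b k : \int[mu]_(t in `[0, 2 * pi]) ((u t - C) * dtrig b k t) = 0.
  have k1 := integrable_mul_cont iu (@continuous_dtrig R b k).
  have k2 := integrable_mul_cont iC (@continuous_dtrig R b k).
  transitivity (\int[mu]_(t in `[0, 2 * pi]) (u t * dtrig b k t - C * dtrig b k t)).
    by apply: eq_Rintegral => t _; rewrite mulrBl.
  rewrite (RintegralB mI k1 k2) u0 sub0r.
  have k3 := integrable_cont 0 (2 * pi) (@continuous_dtrig R b k).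
  by rewrite (RintegralZl C mI k3) Rintegral_dtrig mulr0 oppr0.
have vn (b : bool) (n : nat) (g : R -> R) : (forall t, dtrig b n.+1 t = (-1) ^+ b * n.+1%:R * g t) ->
    \int[mu]_(t in `[0, 2 * pi]) ((u t - C) * g t) = 0.
  move=> gE.
  have n0 : (-1) ^+ b * n.+1%:R != 0 :> R by rewrite mulf_neq0 ?signr_eq0 ?pnatr_eq0.
  have k1 := integrable_mul_cont iv (@continuous_dtrig R b n.+1).
  transitivity (\int[mu]_(t in `[0, 2 * pi]) (((-1) ^+ b * n.+1%:R)^-1 * ((u t - C) * dtrig b n.+1 t))).
    apply: eq_Rintegral => t _; rewrite gE; move: n0; move: ((-1) ^+ b * n.+1%:R : R) => w w0.
    by field.
  by rewrite (RintegralZl _ mI k1) v0 mulr0.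
have := @trig_complete R (fun t => u t - C) iv.
move=> H; have : {ae mu, forall t, `[0, 2 * pi]%classic t -> u t - C = 0}.
  apply: H => -[|n].
  - transitivity (\int[mu]_(t in `[0, 2 * pi]) (u t - C)).
      by apply: eq_Rintegral => t _; rewrite mul0r cos0 mulr1.
    by rewrite (RintegralB mI iu iC) Rintegral_1_circ divfK ?subrr// gt_eqF.
  - by apply: (vn false) => t; rewrite expr0 mul1r.
  - by apply: Rintegral0_eq => t _; rewrite mul0r sin0 mulr0.
  - by apply: (vn true) => t; rewrite expr1 mulN1r.
by apply: filterS => t /[apply] /eqP; rewrite subr_eq0 => /eqP.
Qed.

(** The normalized ray average [f0] of [c] has the weak derivative [Q], the same average of the
    angular derivative. A primitive of [Q] differs from [f0] by a constant almost everywhere, which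
    yields an absolutely continuous representative. *)
Lemma homogeneous_structure (c : R * R -> R) : W12 c -> ae_homogeneous 3 c ->
  exists f k, H1circ f k /\ {ae leb2, forall x, B1 x -> c x = rfun 3 f x}.
Proof.
move=> Wc hom; have p20 : 0 < 2 * pi :> R by rewrite mulr_gt0// pi_gt0.
have mc := L2_measurable (W12_L2 Wc); have ic := L2_integrable (W12_L2 Wc).
have L := angular_L2 Wc; have AI b k := angular_identity b k Wc.
move: L AI; set Th := (fun x : R * R => _) => L AI.
have iTh := L2_integrable L.
pose W := (rmoment R 4)^-1.
have W0 : 0 < W by rewrite invr_gt0; exact: rmoment_gt0.
pose f0 t := W * ray c t.
have if0 : mu.-integrable `[0, 2 * pi] (EFin \o f0).
  exact: (integrable_scaleR mI W (integrable_ray ic)).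
pose Q t := W * ray Th t.
have iQ : mu.-integrable `[0, 2 * pi] (EFin \o Q).
  exact: (integrable_scaleR mI W (integrable_ray iTh)).
have mQ : measurable_fun (`[0, 2 * pi]%classic : set T1) Q.
  by move/integrableP: iQ => [/measurable_EFinP].
have iQ2 : mu.-integrable `[0, 2 * pi] (EFin \o (fun t => Q t ^+ 2)).
  by apply: integrable_eqx (integrable_scalex (W ^+ 2) (integrable_ray_sqr L)) => t; rewrite exprMn.
have fQ b n : \int[mu]_(t in `[0, 2 * pi]) (f0 t * dtrig b n t) =
    - \int[mu]_(t in `[0, 2 * pi]) (Q t * trig b n t).
  have k1 := integrable_mul_cont (integrable_ray ic) (@continuous_dtrig R b n).
  have k2 := integrable_mul_cont (integrable_ray iTh) (@continuous_trig R b n).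
  transitivity (\int[mu]_(t in `[0, 2 * pi]) (W * (ray c t * dtrig b n t))).
    by apply: eq_Rintegral => t _; rewrite /f0 mulrA.
  rewrite (RintegralZl W mI k1) AI mulrN; congr (- _).
  rewrite -(RintegralZl W mI k2); by apply: eq_Rintegral => t _; rewrite /Q mulrA.
(* The periodic extension of [Q]; on [0, 2 pi] it can differ from [Q] only at 0, because [per] takes
   values in ]0, 2 pi]. *)
pose k t := (Q \_ `[0, 2 * pi]%classic) (per t).
have mk : measurable_fun [set: T1] k.
  apply: (measurableT_comp _ (@measurable_per R)).
  by apply/(measurable_restrictT _ _).1.
have kP t : k (t + 2 * pi) = k t by rewrite /k per_periodic.
have ne0 : {ae mu, forall t : R, t != 0}.
  exists [set 0]; split; [exact: measurable_set1|exact: lebesgue_measure_set1|].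
  by move=> t /= /negP; rewrite negbK => /eqP.
have Qk : {ae mu, forall t, `[0, 2 * pi]%classic t -> Q t = k t}.
  apply: filterS ne0 => t tn0; rewrite /= in_itv/= => /andP[t0 t1].
  have t01 : 0 < t <= 2 * pi by rewrite lt_neqAle eq_sym tn0 t0 t1.
  by rewrite /k per_id// patchE mem_set//= in_itv/= t0 t1.
have ik : mu.-integrable `[0, 2 * pi] (EFin \o k).
  by apply: (ae_eq_integrable mI _ Qk iQ); exact: measurable_funTS.
have ik2 : mu.-integrable `[0, 2 * pi] (EFin \o (fun t => k t ^+ 2)).
  apply: (ae_eq_integrable mI _ _ iQ2).
    by apply: measurable_funTS; exact: measurable_funX.
  by apply: filterS Qk => t /[apply] ->.
have Qint (g : R -> R) : continuous g -> \int[mu]_(t in `[0, 2 * pi]) (Q t * g t) =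
    \int[mu]_(t in `[0, 2 * pi]) (k t * g t).
  move=> cg; have mg : measurable_fun (`[0, 2 * pi]%classic : set T1) g.
    by apply: measurable_funTS; exact: continuous_measurable_fun.
  apply: ae_eq_Rintegral => //.
  - exact: measurable_funM.
  - by apply: measurable_funM => //; exact: measurable_funTS.
  - by apply: filterS Qk => t /[apply] ->.
(* The constant mode, whose derivative is 0, as a test function; mean zero is what makes the
   primitive periodic. *)
have k0 : \int[mu]_(t in `[0, 2 * pi]) k t = 0.
  transitivity (\int[mu]_(t in `[0, 2 * pi]) (k t * trig true 0 t)).
    by apply: eq_Rintegral => t _; rewrite /trig mul0r cos0 mulr1.
  rewrite -(Qint _ (@continuous_trig R true 0)) -[LHS]opprK -fQ.
  by rewrite Rintegral0_eq ?oppr0// => t _; rewrite /dtrig oppr0 mul0r mulr0.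
pose F := prim k.
have FP t : F (t + 2 * pi) = F t by exact: prim_periodic.
have acF a b : a <= b -> isAC a b F k by exact: isAC_prim.
have acFC (C : R) a b : a <= b -> isAC a b (fun t => F t + C) k.
  move=> ab; have [i1 E] := acF a b ab; split => // s sab.
  by rewrite (E s sab) addrAC.
have cF : continuous F.
  move=> t; have ab : t - 1 < t + 1 by lra.
  apply: (within_continuous_continuous ab (isAC_continuous (acF _ _ (ltW ab)))).
  by rewrite in_itv/=; apply/andP; split; lra.
have HF (C : R) : H1circ (fun t => F t + C) k.
  split => //; last exact: acFC.
  - split => //; apply: measurable_funD => //; exact: continuous_measurable_fun.
  - by move=> t; rewrite FP.
have iF := integrable_cont 0 (2 * pi) cF.
have id : mu.-integrable `[0, 2 * pi] (EFin \o (fun t => f0 t - F t)) by exact: (integrable_subR mI if0 iF).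
have [C CP] : exists C, {ae mu, forall t, `[0, 2 * pi]%classic t -> f0 t - F t = C}.
  apply: (dtrig_complete id) => b n.
  have k1 := integrable_mul_cont if0 (@continuous_dtrig R b n).
  have k2 := integrable_mul_cont iF (@continuous_dtrig R b n).
  have k3 := integrable_mul_cont ik (@continuous_trig R b n).
  transitivity (\int[mu]_(t in `[0, 2 * pi]) (f0 t * dtrig b n t - F t * dtrig b n t)).
    by apply: eq_Rintegral => t _; rewrite mulrBl.
  rewrite (RintegralB mI k1 k2) fQ (Qint _ (@continuous_trig R b n)).
  have ac : isAC 0 (2 * pi) (@trig R b n) (@dtrig R b n).
    by apply: (@isAC_C1 R 0 (2 * pi) (@trig R b n) (@dtrig R b n)) => t _;
      [exact: is_derive_trig|exact: continuous_dtrig].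
  have := isAC_end (ltW p20) (isAC_mul (acF _ _ (ltW p20)) ac).
  rewrite (RintegralD mI k3 k2) -[2 * pi]add0r FP trig_periodic subrr => /esym/eqP.
  by rewrite addrC addr_eq0 => /eqP ->; rewrite add0r opprK addrC subrr.
exists (fun t => F t + C), k; split; first exact: HF.
have mF : measurable_fun [set: T1] (fun t => F t + C) by case: (HF C) => -[].
have mr : measurable_fun [set: T2] (rfun 3 (fun t => F t + C) : T2 -> R) by exact: measurable_rfun.
have mr' : measurable_fun (B1 : set T2) (rfun 3 (fun t => F t + C)) by exact: measurable_funTS.
apply: (@ae_B1 R 0 _ _ mc mr').
(* Tonelli needs a measurable exceptional set, so it is written out explicitly, with [c] extended by
   0. *)
pose N : set T2 := rect 0 `&` [set z | (c \_ B1) (pol z) - z.1 ^+ 3 * (F z.2 + C) != 0].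
have mN : measurable N.
  apply: measurableI; first exact: measurable_rect.
  pose G (z : T2) : T1 := (c \_ B1) (pol z) - z.1 ^+ 3 * (F z.2 + C).
  have mG : measurable_fun [set: T2] G.
    apply: measurable_funB.
      exact: (measurableT_comp (measurable_patch_B1 mc) (@measurable_pol R)).
    apply: measurable_funM; first by apply: measurable_funX; exact: measurable_fst.
    exact: (measurableT_comp mF measurable_snd).
  have -> : [set z | (c \_ B1) (pol z) - z.1 ^+ 3 * (F z.2 + C) != 0] = setT `&` G @^-1` [set~ 0].
    by apply/seteqP; split => z /=; [move=> /eqP h; split => //|move=> [_ /eqP]].
  by apply: mG => //; apply: measurableC; exact: measurable_set1.
have N0 : leb2 N = 0%E.
  apply: ae_box_null => //.
  apply: filterS2 CP (ae_ray mc hom) => t tC tr.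
  have [t01|t01] := boolP (0 <= t <= 2 * pi); last first.
    by apply: filterE => r [[_ /=]]; rewrite add0r in_itv/= (negbTE t01).
  apply: filterS (tr t01) => r h [[/=]]; rewrite in_itv/= => r01 _ /negP; apply; apply/eqP.
  rewrite patch_B1E; last first.
    by rewrite /B1 /= enorm_pol/= gtr0_norm; case/andP: r01.
  rewrite (h r01); have := tC _; rewrite /= in_itv/= => /(_ t01) <-.
  have -> : F t + (f0 t - F t) = f0 t by rewrite addrC subrK.
  by rewrite /f0 subrr.
exists N; split => // z /= nz; split.
  by apply: contrapT => nD; apply: nz.
apply/eqP => h; apply: nz => Dz.
have z0 : 0 < z.1 by case: Dz => /=; rewrite in_itv/= => /andP[].
rewrite rfun_pol//; last by move=> t; rewrite FP.
apply/eqP; rewrite -subr_eq0; move: h; rewrite patch_B1E; last exact: rect_B1 Dz.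
by move=> /eqP.
Qed.

(** Continuity of [f] upgrades the sign from almost every angle to every angle: a negative value
    would persist on an interval. *)
Lemma structure_ge0 (c : R * R -> R) f k : H1circ f k ->
  {ae leb2, forall x, B1 x -> c x = rfun 3 f x} -> ae_nonneg c -> forall t, 0 <= f t.
Proof.
move=> fk cf c0 t'; have [_ fP _ _ _] := fk; have pi0 := @pi_gt0 R.
have [t0 t0I ->] := periodic_window t' fP; rewrite leNgt; apply/negP => ft0.
have ae0 : {ae leb2, forall x, B1 x -> 0 <= rfun 3 f x}.
  by apply: filterS2 cf c0 => x + + Bx => /(_ Bx) <- /(_ Bx).
have := ae_slice2 (@ae_rect R 0 _ ae0) => aet.
have aef : {ae mu, forall t, 0 <= t <= 2 * pi -> 0 <= f t}.
  apply: filterS aet => t h t01.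
  have [r /andP[r0 r1] hr] := ae_itv_ex (@ltr01 R) h.
  have Dr : rect 0 (r, t) by split => /=; rewrite in_itv/= ?r0 ?r1// add0r.
  by have := hr Dr; rewrite rfun_pol//= pmulr_rge0// exprn_gt0.
have cf' := H1circ_continuous fk.
have : \forall t \near t0, f t < 0.
  have /cvgrPdist_lt /(_ (- f t0)) := cf' t0; rewrite oppr_gt0 => /(_ ft0).
  by apply: filterS => t; rewrite ltr_norml => /andP[h _]; lra.
move=> /nbhs_ballP[d /= d0 dP].
move: t0I => /andP[t00 t01].
have [t /andP[t1 t2] /= ht] : exists2 t, Num.max 0 (t0 - d) < t < Num.min (2 * pi) (t0 + d) &
    (0 <= t <= 2 * pi -> 0 <= f t).
  apply: ae_itv_ex aef; rewrite lt_min !gt_max.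
  by apply/andP; split; apply/andP; split; lra.
move: t1 t2; rewrite gt_max lt_min => /andP[ta tb] /andP[tc td].
have : f t < 0.
  by apply: dP; rewrite /ball/= ltr_norml; apply/andP; split; lra.
by rewrite ltNge ht// !ltW.
Qed.

End structure.

Lemma sin3M (R : realType) (y : R) : sin (3 * y) = sin y * (4 * cos y ^+ 2 - 1).
Proof.
have -> : 3 * y = y + (y + y) by ring.
rewrite sinD cosD sinD; have := sin2cos2 y.
move: (sin y) (cos y) => S C SC.
transitivity (S * (3 * C ^+ 2 - S ^+ 2)); first by ring.
by rewrite SC; ring.
Qed.

(** * The one-dimensional inequality *)

Section one_dim.
Context (R : realType).
Local Notation mu := (@lebesgue_measure R).
Local Notation T1 := (measurableTypeR R).
Variables (f k : R -> R) (m s : R).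

(** The profile without its cutoff: equal to [hshift m] on the support, smooth everywhere, and a
    solution of Hm'' = 1 - 9 Hm. *)
Definition Hm (t : R) : R := (1 + cos (3 * (t - m))) / 9.
Definition dHm (t : R) : R := - sin (3 * (t - m)) / 3.
Definition ddHm (t : R) : R := - cos (3 * (t - m)).

Lemma is_derive_Hm (t : R) : is_derive t 1 Hm (dHm t).
Proof. by rewrite /Hm /dHm; apply: is_derive_eq; rewrite /GRing.scale/=; field. Qed.

Lemma is_derive_dHm (t : R) : is_derive t 1 dHm (ddHm t).
Proof. by rewrite /dHm /ddHm; apply: is_derive_eq; rewrite /GRing.scale/=; field. Qed.

Lemma continuous_of_derive (u v : R -> R) : (forall t : R, is_derive t 1 u (v t)) -> continuous u.
Proof.
move=> d t; apply: differentiable_continuous; apply/derivable1_diffP.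
by have [] := d t.
Qed.

Lemma continuous_ddHm : continuous ddHm.
Proof.
apply: (@continuous_of_derive _ (fun t => 3 * sin (3 * (t - m)))) => t.
by rewrite /ddHm; apply: is_derive_eq; rewrite /GRing.scale/=; ring.
Qed.

Lemma isAC_Hm a b : isAC a b Hm dHm.
Proof.
apply: isAC_C1 => t _; first exact: is_derive_Hm.
exact: (continuous_of_derive is_derive_dHm).
Qed.

Lemma isAC_dHm a b : isAC a b dHm ddHm.
Proof. by apply: isAC_C1 => t _; [exact: is_derive_dHm|exact: continuous_ddHm]. Qed.

Lemma hshift_in t : m - pi / 3 <= t <= m + pi / 3 -> hshift m t = Hm t /\ dhshift m t = dHm t.
Proof.
move=> /andP[t1 t2]; have pi0 := @pi_gt0 R.
have c0 : 1 / 2 <= cos (t - m).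
  rewrite -cos_pi3; have [y0|y0] := leP 0 (t - m); first by apply: cos_le; lra.
  by rewrite -(cosN (t - m)); apply: cos_le; lra.
rewrite /hshift /dhshift /hprof /dhprof /Hm /dHm cos3M sin3M /ppos max_l; last by lra.
by split; field.
Qed.

Lemma hshift_out t : m + pi / 3 <= t <= m + 5 * pi / 3 -> hshift m t = 0 /\ dhshift m t = 0.
Proof.
move=> /andP[t1 t2]; apply: hprof_out; apply: cos_le_half; apply/andP; split; lra.
Qed.

Definition Bt t := f t - s * hshift m t.
Definition dBt t := k t - s * dhshift m t.

(** The integrand of 25/28 M(c) + 3/28 M(h_m) - M(v), multiplied by 42. The coefficients are 3/4 =
    42 (3/28) / 6, 1/2 = 42 (25/84 - 2/7), 1 = 42 (25/168 - 1/8) and 57/4 = 42 (225/168 - 1). *)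
Definition gain (F K H L B D : R) : R :=
  3 / 4 * ((L ^+ 2 - 9 * H ^+ 2 + 2 * H) - (s ^+ 2 * (L ^+ 2 - 9 * H ^+ 2) + 2 * s * H)) +
  1 / 2 * (s * (L * D - 9 * (H * B)) + B) + D ^+ 2 - 57 / 4 * B ^+ 2.

Definition Ti t := gain (f t) (k t) (hshift m t) (dhshift m t) (Bt t) (dBt t).

(** The exact derivatives hidden in the gain. By H'' = 1 - 9H one has H'B' - 9HB = (H'B)' - B, H'^2
    - 9H^2 = (HH')' - H and H = (1 - H'') / 9. Every term contains H', so [Dv] vanishes at the ends
    of the support. *)
Definition Dv t := s / 2 * (dHm t * (f t - s * Hm t)) + (3 / 4 * (1 - s ^+ 2) * (Hm t * dHm t)
  + - ((s - 1) ^+ 2 / 12) * dHm t).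

(** The value of 4 tan(4(t - mid)) at the end of an arc of half-length pi/9; the tangent has no pole
    up to there because 4 pi/9 < pi/2. *)
Definition Ct : R := 4 * tan (4 * (pi / 9)).

Lemma Ct_ge0 : 0 <= Ct.
Proof.
have pi0 := @pi_gt0 R; rewrite mulr_ge0// /tan divr_ge0//.
  by apply: sin_ge0_pi; apply/andP; split; lra.
by apply: ltW; apply: cos_gt0_pihalf; apply/andP; split; lra.
Qed.

Hypotheses (fk : H1circ f k) (f0 : forall t, 0 <= f t).
Hypothesis fsmall : forall t, m + pi / 3 <= t <= m + 5 * pi / 3 ->
  f t <= 1 / (2 * (Ct ^+ 2 + Ct + 15)).
Hypotheses (fr : f (m + pi / 9) = s / 6) (fl : f (m - pi / 9) = s / 6).

Let mTi : measurable_fun [set: T1] Ti.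
Proof.
have [[mf mk] fP kP ik ac] := fk; have [[mh mdh] hP dhP ih hac] := H1circ_hshift m.
have mBt : measurable_fun [set: T1] Bt by apply: measurable_funB => //; exact: measurable_funM.
have mdBt : measurable_fun [set: T1] dBt by apply: measurable_funB => //; exact: measurable_funM.
have q1 : measurable_fun [set: T1] (fun t => dhshift m t ^+ 2 - 9 * hshift m t ^+ 2).
  by apply: measurable_funB; [exact: measurable_funX|apply: measurable_funM => //; exact: measurable_funX].
apply: measurable_funB; last by apply: measurable_funM => //; exact: measurable_funX.
apply: measurable_funD; last exact: measurable_funX.
apply: measurable_funD; apply: measurable_funM => //.
  apply: measurable_funB; first by apply: measurable_funD => //; exact: measurable_funM.
  by apply: measurable_funD; apply: measurable_funM.
apply: measurable_funD => //; apply: measurable_funM => //.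
by apply: measurable_funB; [exact: measurable_funM|apply: measurable_funM => //; exact: measurable_funM].
Qed.

Let TiP t : Ti (t + 2 * pi) = Ti t.
Proof.
have [_ fP kP _ _] := fk; have [_ hP dhP _ _] := H1circ_hshift m.
by rewrite /Ti /Bt /dBt fP kP hP dhP.
Qed.

Lemma integrable_gain a b : mu.-integrable `[a, b] (EFin \o Ti).
Proof.
have [[mf mk] fP kP ik ac] := fk; have [[mh mdh] hP dhP ih hac] := H1circ_hshift m.
apply: integrable_periodic_itv => //.
have B := H1circ_sub fk (H1circ_scale s (H1circ_hshift m)).
have [[mB1 mD1] _ _ iD2 _] := B.
have iB2 := H1circ_integrable_sqr B; have iB := H1circ_integrable_q B.
have iH2 := H1circ_integrable_sqr (H1circ_hshift m); have iH := H1circ_integrable_q (H1circ_hshift m).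
have iLD := integrable_mul_sqr mdh mD1 ih iD2; have iHB := integrable_mul_sqr mh mB1 iH2 iB2.
apply: integrable_eqx (integrable_addx (integrable_addx (integrable_addx
  (integrable_scalex (3 / 4 * (1 - s ^+ 2)) ih) (integrable_scalex (- (27 / 4) * (1 - s ^+ 2)) iH2))
  (integrable_addx (integrable_scalex (3 / 2 * (1 - s)) iH) (integrable_scalex (s / 2) iLD)))
  (integrable_addx (integrable_addx (integrable_scalex (- (9 / 2) * s) iHB) (integrable_scalex (1 / 2) iB))
  (integrable_addx iD2 (integrable_scalex (- (57 / 4)) iB2)))) => t.
by rewrite /Ti /gain /Bt /dBt; field.
Qed.

Let iTi := integrable_gain.

(** Here [p] stands for a solution of the Riccati equation p' = 16 + p^2, so that the subtracted
    bracket is the derivative of -p B^2 + Dv. The three squares come from B'^2 - 16 B^2, from the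
    spare B^2, and from 3/4 B^2 + (1 - s) B / 2 + (s - 1)^2 / 12. *)
Lemma gain_identity (F K H L p : R) :
  gain F K H L (F - s * H) (K - s * L) -
  (-1 * ((16 + p ^+ 2) * ((F - s * H) * (F - s * H)) + p * ((K - s * L) * (F - s * H) + (F - s * H) * (K - s * L))) +
   (s / 2 * ((1 - 9 * H) * (F - s * H) + L * (K - s * L)) + (3 / 4 * (1 - s ^+ 2) * (L * L + H * (1 - 9 * H))
  + - ((s - 1) ^+ 2 / 12) * (1 - 9 * H)))) =
  (K - s * L + p * (F - s * H)) ^+ 2 + (F - s * H) ^+ 2 + 3 / 4 * (F - s * H - (s - 1) / 3) ^+ 2.
Proof. by rewrite /gain; field. Qed.

(** By [gain_identity] the function -p B^2 + Dv with p = 4 tan(4(t - c)) grows at most at the rate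
    [Ti], and p equals [Ct] and [- Ct] at the two ends. The range of [c] keeps the arc inside the
    support, where [hshift m] is [Hm]. *)
Lemma piece (c : R) : m - 2 * (pi / 9) <= c <= m + 2 * (pi / 9) ->
  Dv (c + pi / 9) - Dv (c - pi / 9) -
    Ct * ((f (c + pi / 9) - s * Hm (c + pi / 9)) ^+ 2 + (f (c - pi / 9) - s * Hm (c - pi / 9)) ^+ 2)
  <= \int[mu]_(t in `[c - pi / 9, c + pi / 9]) Ti t.
Proof.
move=> /andP[c1 c2]; have pi0 := @pi_gt0 R; have [_ _ _ _ ac] := fk.
set a := c - pi / 9; set b := c + pi / 9.
have ab : a <= b by rewrite /a /b; lra.
pose p t := 4 * tan (4 * (t - c)); pose dp t := 16 + p t ^+ 2.
have cn0 t : a <= t <= b -> cos (4 * (t - c)) != 0.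
  move=> /andP[t1 t2]; rewrite gt_eqF//; apply: cos_gt0_pihalf.
  by move: t1 t2; rewrite /a /b => t1 t2; apply/andP; split; lra.
have dpP t : a <= t <= b -> is_derive t 1 p (dp t).
  move=> /cn0 ct; have h1 := is_derive_tan ct.
  have h2 : is_derive t 1 (fun t : R => 4 * (t - c)) 4.
    by apply: is_derive_eq; rewrite /GRing.scale/=; ring.
  have h3 := @is_derive1_comp R (@tan R) (fun t : R => 4 * (t - c)) t _ _ h1 h2.
  have -> : dp t = 4 * ((cos (4 * (t - c)) ^- 2) * 4).
    rewrite /dp /p /tan; have := sin2cos2 (4 * (t - c)).
    move: ct; move: (sin _) (cos _) => S C C0 SC.
    have -> : (4 * (S / C)) ^+ 2 = 16 * S ^+ 2 / C ^+ 2 by field.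
    by rewrite SC; field.
  have h4 := is_deriveZ 4 h3.
  exact: h4.
have acp : isAC a b p dp.
  apply: isAC_C1 => // t tab.
  have cp : {for t, continuous p}.
    apply: differentiable_continuous; apply/derivable1_diffP.
    by have [] := dpP t tab.
  apply: cvgD; first exact: cvg_cst.
  by apply: (@continuous_comp _ _ _ p (fun x : R => x ^+ 2)); [exact: cp|exact: exprn_continuous].
have acB : isAC a b (fun t => f t - s * Hm t) (fun t => k t - s * dHm t).
  have := isAC_add (ac a b ab) (isAC_scale (- s) (isAC_Hm a b)).
  by apply: isAC_eq => t _; rewrite mulNr.
have acq := isAC_add (isAC_scale (-1) (isAC_mul acp (isAC_mul acB acB)))
  (isAC_add (isAC_scale (s / 2) (isAC_mul (isAC_dHm a b) acB))
  (isAC_add (isAC_scale (3 / 4 * (1 - s ^+ 2)) (isAC_mul (isAC_Hm a b) (isAC_dHm a b)))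
    (isAC_scale (- ((s - 1) ^+ 2 / 12)) (isAC_dHm a b)))).
apply: (le_trans _ (isAC_le ab acq (iTi a b) _)); last first.
  move=> t tab.
  have [E1 E2] : hshift m t = Hm t /\ dhshift m t = dHm t.
    by apply: hshift_in; move: tab; rewrite /a /b => /andP[t1 t2]; apply/andP; split; lra.
  rewrite /Ti /Bt /dBt E1 E2.
  have dd : ddHm t = 1 - 9 * Hm t by rewrite /ddHm /Hm; field.
  rewrite dd /dp -subr_ge0 (gain_identity (f t) (k t) (Hm t) (dHm t) (p t)).
  apply: addr_ge0; first by apply: addr_ge0; exact: sqr_ge0.
  by apply: mulr_ge0; [lra|exact: sqr_ge0].
have pb : p b = Ct by rewrite /p /Ct /b; congr (4 * tan (4 * _)); ring.
have pa : p a = - Ct.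
  rewrite /p /Ct /a; have -> : 4 * (c - pi / 9 - c) = - (4 * (pi / 9)) by ring.
  by rewrite tanN mulrN.
rewrite /= pa pb /Dv.
move: (f b - s * Hm b) (f a - s * Hm a) (Hm b) (Hm a) (dHm b) (dHm a) Ct => X Y Z W U V C.
by rewrite le_eqVlt; apply/orP; left; apply/eqP; ring.
Qed.

(** Off the support the gain is f'^2 + f/2 - 57/4 f^2. It is compared with the derivative of -p f^2,
    where the affine function p falls from [Ct] to [- Ct] over the length 4pi/3. After completing
    the square (f' + p f)^2, the term f/2 absorbs (p^2 + D + 57/4) f^2 by the smallness of [f],
    since p^2 + D + 57/4 is at most Ct^2 + Ct + 15. *)
Lemma outer_piece : Ct * (f (m + pi / 3) ^+ 2 + f (m + 5 * pi / 3) ^+ 2) <=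
  \int[mu]_(t in `[m + pi / 3, m + 5 * pi / 3]) Ti t.
Proof.
have pi0 := @pi_gt0 R; have [_ _ _ _ ac] := fk; have C0 := Ct_ge0.
have pi2 : 2 <= pi :> R by exact: pi_ge2.
set a := m + pi / 3; set b := m + 5 * pi / 3.
have ab : a <= b by rewrite /a /b; lra.
pose D := Ct * 3 / (2 * pi).
have D0 : 0 <= D by apply: divr_ge0; apply: mulr_ge0 => //; exact: ltW.
have DC : D <= Ct.
  by rewrite /D ler_pdivrMr ?mulr_gt0// ler_wpM2l//; lra.
pose p t := Ct - D * (t - a).
have acp : isAC a b p (fun=> - D).
  apply: isAC_C1 => t _; last exact: cst_continuous.
  by rewrite /p; apply: is_derive_eq; rewrite /GRing.scale/=; ring.
have acq := isAC_scale (-1) (isAC_mul acp (isAC_mul (ac a b ab) (ac a b ab))).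
have pin : pi != 0 :> R by rewrite gt_eqF.
have pb : p b = - Ct.
  have ba : b - a = 4 * pi / 3 by rewrite /a /b; field.
  rewrite /p ba /D; have -> : Ct * 3 / (2 * pi) * (4 * pi / 3) = 2 * Ct.
    have E (C q : R) : q != 0 -> C * 3 / (2 * q) * (4 * q / 3) = 2 * C by move=> q0; field.
    exact: E.
  by ring.
have pa : p a = Ct by rewrite /p subrr mulr0 subr0.
apply: (le_trans _ (isAC_le ab acq (iTi a b) _)); last first.
  move=> t tab.
  have [E1 E2] := hshift_out tab.
  rewrite /Ti /Bt /dBt E1 E2 !mulr0 !subr0 -subr_ge0.
  have -> : gain (f t) (k t) 0 0 (f t) (k t) -
     -1 * (- D * (f t * f t) + p t * (k t * f t + f t * k t)) =
    (k t + p t * f t) ^+ 2 + f t * (1 / 2 - (p t ^+ 2 + D + 57 / 4) * f t).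
    by rewrite /gain; field.
  rewrite addr_ge0 ?sqr_ge0// mulr_ge0// subr_ge0.
  have p2 : p t ^+ 2 <= Ct ^+ 2.
    have p1 : p t <= Ct.
      by rewrite /p gerBl mulr_ge0// subr_ge0; case/andP: tab.
    have p3 : - Ct <= p t.
      by rewrite -pb /p lerD2l lerN2 ler_wpM2l// lerD2r; case/andP: tab.
    by rewrite -ler_sqrt ?sqr_ge0// !sqrtr_sqr (ger0_norm C0) ler_norml p3 p1.
  have E0 : 0 < Ct ^+ 2 + Ct + 15 by rewrite ltr_wpDl// addr_ge0// sqr_ge0.
  have := fsmall tab; rewrite ler_pdivlMr ?mulr_gt0// => fs.
  have h : (p t ^+ 2 + D + 57 / 4) * f t <= (Ct ^+ 2 + Ct + 15) * f t.
    by rewrite ler_wpM2r//; lra.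
  apply: le_trans h _; move: fs; rewrite mulrCA [f t * _]mulrC => fs; lra.
rewrite /= pa pb.
move: (f a) (f b) Ct => X Y C.
by rewrite le_eqVlt; apply/orP; left; apply/eqP; ring.
Qed.

(** At the two inner nodes f = s/6 = s Hm, so the tangent terms vanish; the [Dv] terms telescope and
    are 0 at the ends of the support. The two remaining boundary terms are exactly those supplied by
    [outer_piece]. *)
Lemma gain_ge0 : 0 <= \int[mu]_(t in `[0, 2 * pi]) Ti t.
Proof.
have pi0 := @pi_gt0 R; have [_ fP _ _ _] := fk.
rewrite -(Rintegral_periodic mTi TiP (m - pi / 3)).
have -> : m - pi / 3 + 2 * pi = m + 5 * pi / 3 by field.
have l1 : m - pi / 3 <= m - pi / 9 by lra.
have l2 : m - pi / 9 <= m + pi / 9 by lra.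
have l3 : m + pi / 9 <= m + pi / 3 by lra.
have l4 : m + pi / 3 <= m + 5 * pi / 3 by lra.
rewrite (Rintegral_itv_cat (le_trans l1 (le_trans l2 l3)) l4 (iTi _ _)).
rewrite (Rintegral_itv_cat (le_trans l1 l2) l3 (iTi _ _)).
rewrite (Rintegral_itv_cat l1 l2 (iTi _ _)).
have fE : f (m + 5 * pi / 3) = f (m - pi / 3).
  by rewrite -(fP (m - pi / 3)); congr f; field.
have cE : cos (pi / 3) = 1 / 2 := cos_pi3 R.
have H1 : Hm (m - pi / 9) = 1 / 6.
  rewrite /Hm; have -> : 3 * (m - pi / 9 - m) = - (pi / 3) by field.
  by rewrite cosN cE; field.
have H2 : Hm (m + pi / 9) = 1 / 6.
  rewrite /Hm; have -> : 3 * (m + pi / 9 - m) = pi / 3 by field.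
  by rewrite cE; field.
have E1 : 3 * (m - pi / 3 - m) = - pi by field.
have E2 : 3 * (m + pi / 3 - m) = pi by field.
have H0 : Hm (m - pi / 3) = 0 by rewrite /Hm E1 cosN cospi addrN mul0r.
have H3 : Hm (m + pi / 3) = 0 by rewrite /Hm E2 cospi addrN mul0r.
have D0 : Dv (m - pi / 3) = 0 by rewrite /Dv /dHm E1 sinN sinpi; field.
have D3 : Dv (m + pi / 3) = 0 by rewrite /Dv /dHm E2 sinpi; field.
have := @piece (m - 2 * (pi / 9)); have := @piece m; have := @piece (m + 2 * (pi / 9)).
have -> : m - 2 * (pi / 9) + pi / 9 = m - pi / 9 by field.
have -> : m - 2 * (pi / 9) - pi / 9 = m - pi / 3 by field.
have -> : m + 2 * (pi / 9) + pi / 9 = m + pi / 3 by field.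
have -> : m + 2 * (pi / 9) - pi / 9 = m + pi / 9 by field.
have c3 : m - 2 * (pi / 9) <= m + 2 * (pi / 9) <= m + 2 * (pi / 9) by apply/andP; split; lra.
have c2 : m - 2 * (pi / 9) <= m <= m + 2 * (pi / 9) by apply/andP; split; lra.
have c1 : m - 2 * (pi / 9) <= m - 2 * (pi / 9) <= m + 2 * (pi / 9) by apply/andP; split; lra.
move=> /(_ c3) + /(_ c2) + /(_ c1); have := outer_piece.
rewrite D0 D3 H0 H1 H2 H3 fr fl fE !mulr0 !subr0.
have -> : s / 6 - s * (1 / 6) = 0 by field.
rewrite expr0n/= ?addr0 ?add0r ?mulr0 ?subr0 ?sub0r.
move: (f (m + pi / 3) ^+ 2) (f (m - pi / 3) ^+ 2) => X Y.
move: (\int[mu]_(t in `[m + pi / 3, m + 5 * pi / 3]) Ti t)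
  (\int[mu]_(t in `[m + pi / 9, m + pi / 3]) Ti t)
  (\int[mu]_(t in `[m - pi / 9, m + pi / 9]) Ti t)
  (\int[mu]_(t in `[m - pi / 3, m - pi / 9]) Ti t) (Dv (m + pi / 9)) (Dv (m - pi / 9)).
rewrite mulrDr; move: (Ct * X) (Ct * Y) => x y i4 i3 i2 i1 d2 d1 h4 h3 h2 h1.
lra.
Qed.

End one_dim.

(** * Conclusion *)

Section final.
Context (R : realType).
Local Notation mu := (@lebesgue_measure R).
Local Notation T1 := (measurableTypeR R).
Local Notation T2 := (T1 * T1)%type.
Let mI : measurable (`[0, 2 * pi]%classic : set T1).
Proof. exact: measurable_itv. Qed.
Let mB := @measurable_B1 R.

(** The difference q(t)^2 - q(s)^2 is an integral of 2 q q', hence at most the integral E of q^2 +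
    q'^2. Averaging over s gives E / (2 pi) + E. *)
Lemma H1circ_sup (q k : R -> R) : H1circ q k -> forall t,
  q t ^+ 2 <= 2 * \int[mu]_(x in `[0, 2 * pi]) (q x ^+ 2 + k x ^+ 2).
Proof.
move=> qk t'; have [_ qP _ ik ac] := qk; have pi0 := @pi_gt0 R.
have pi2 : 2 <= pi :> R by exact: pi_ge2.
have p20 : 0 <= 2 * pi :> R by lra.
have iq2 := H1circ_integrable_sqr qk.
have iF : mu.-integrable `[0, 2 * pi] (EFin \o (fun x => q x ^+ 2 + k x ^+ 2)).
  exact: (integrable_addx iq2 ik).
have [t t01 ->] := periodic_window t' qP.
set E := \int[mu]_(x in _) _.
have sub a b : 0 <= a -> a <= b -> b <= 2 * pi ->
    \int[mu]_(x in `[a, b]) (q x ^+ 2 + k x ^+ 2) <= E.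
  move=> a0 ab b1; rewrite /E (Rintegral_itv_cat (le_trans a0 ab) b1 iF).
  rewrite (Rintegral_itv_cat a0 ab (integrable_sub_itv (lexx 0) b1 iF)).
  have p1 : 0 <= \int[mu]_(x in `[0, a]) (q x ^+ 2 + k x ^+ 2).
    by apply: Rintegral_ge0 => x _; rewrite addr_ge0 ?sqr_ge0.
  have p2 : 0 <= \int[mu]_(x in `[b, 2 * pi]) (q x ^+ 2 + k x ^+ 2).
    by apply: Rintegral_ge0 => x _; rewrite addr_ge0 ?sqr_ge0.
  by rewrite -addrA ler_wpDl// lerDl.
have young2 (a b : R) : `|a * b + b * a| <= b ^+ 2 + a ^+ 2.
  rewrite ler_norml; apply/andP; split; rewrite -subr_ge0.
    have -> : a * b + b * a - - (b ^+ 2 + a ^+ 2) = (a + b) ^+ 2 by ring.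
    exact: sqr_ge0.
  have -> : b ^+ 2 + a ^+ 2 - (a * b + b * a) = (a - b) ^+ 2 by ring.
  exact: sqr_ge0.
have key s : 0 <= s <= 2 * pi -> q t ^+ 2 <= q s ^+ 2 + E.
  move: t01 => /andP[t0 t1] /andP[s0 s1]; rewrite -lerBlDl.
  have [st|/ltW ts] := leP s t.
    have acs := isAC_mul (ac _ _ st) (ac _ _ st).
    apply: le_trans (sub _ _ s0 st t1).
    apply: (le_trans _ (isAC_le st acs (integrable_sub_itv s0 t1 iF) _)).
      by rewrite /= !expr2.
    by move=> x _ /=; apply: le_trans (ler_norm _) (young2 _ _).
  have acs := isAC_scale (-1) (isAC_mul (ac _ _ ts) (ac _ _ ts)).
  apply: le_trans (sub _ _ t0 ts s1).
  apply: (le_trans _ (isAC_le ts acs (integrable_sub_itv t0 s1 iF) _)).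
    by rewrite /= !expr2 !mulN1r opprK addrC.
  by move=> x _ /=; rewrite mulN1r; apply: le_trans (ler_norm _) _; rewrite normrN; exact: young2.
have iE := integrable_circ_cst E.
have h1 : \int[mu]_(s in `[0, 2 * pi]) (q t ^+ 2) <= \int[mu]_(s in `[0, 2 * pi]) (q s ^+ 2 + E).
  apply: (le_Rintegral mI (integrable_circ_cst _) (integrable_addx iq2 iE)) => s.
  by rewrite /= in_itv/=; exact: key.
have h2 : \int[mu]_(s in `[0, 2 * pi]) (q s ^+ 2) <= E.
  by apply: (le_Rintegral mI iq2 iF) => s _; rewrite lerDl sqr_ge0.
have E0 : 0 <= E by apply: Rintegral_ge0 => x _; rewrite addr_ge0 ?sqr_ge0.
move: h1; rewrite (RintegralD mI iq2 iE) !Rintegral_1_circ => h1.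
have h3 : q t ^+ 2 * (2 * pi) <= 2 * E * (2 * pi).
  apply: (le_trans h1); have : E * 1 <= E * (2 * pi) by rewrite ler_wpM2l//; lra.
  rewrite mulr1 => h4; have -> : 2 * E * (2 * pi) = E * (2 * pi) + E * (2 * pi) by ring.
  by apply: lerD => //; exact: le_trans h2 h4.
by rewrite -(ler_pM2r (_ : 0 < 2 * pi))//; lra.
Qed.

(** The factor 6 is the inverse of the integral of r^5, the weight of the squared gradient of r^3
    q. *)
Lemma W12norm_rfun3 (v : R * R -> R) (q k : R -> R) : H1circ q k ->
  measurable_fun (B1 : set T2) v ->
  {ae leb2, forall x, B1 x -> v x = rfun 3 q x} ->
  \int[mu]_(x in `[0, 2 * pi]) (q x ^+ 2 + k x ^+ 2) <= 6 * W12norm v ^+ 2.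
Proof.
move=> qk mv vq; have h0 := @H1circ0 R.
have vE : {ae leb2, forall x, B1 x -> v x = rfun 3 q x - rfun 4 (fun=> 0) x}.
  by apply: filterS vq => x + Bx => -> //; rewrite /rfun mulr0 subr0.
have Wv := W12_rfun34 qk h0 mv vE.
have [_ _ _ ik _] := qk; have iq2 := H1circ_integrable_sqr qk.
have i0 := integrable_circ_cst (0 : R).
have mF : measurable_fun (B1 : set T2) (fun x => v x ^+ 2 + wgrad_sq v x).
  exact: (measurable_funD (measurable_funX 2 mv) (measurable_wgrad Wv)).
have u5 := integrable_addx (integrable_scalex 9 iq2) ik.
have FE : {ae leb2, forall z, rect 0 z -> (v (pol z) ^+ 2 + wgrad_sq v (pol z)) * z.1 =
    (9 * q z.2 ^+ 2 + k z.2 ^+ 2) * z.1 ^+ 5 + (cst 0 z.2 * z.1 ^+ 6 + q z.2 ^+ 2 * z.1 ^+ 7)}.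
  apply: filterS (wgrad_sq_rfun34 qk h0 mv vE) => z /[swap] Dz /(_ Dz) [-> ->].
  have H (r Q K : R) : ((r ^+ 3 * Q - r ^+ 4 * 0) ^+ 2 + (r ^+ 4 * (9 * Q ^+ 2 + K ^+ 2) -
    2 * r ^+ 5 * (12 * Q * 0 + K * 0) + r ^+ 6 * (16 * 0 ^+ 2 + 0 ^+ 2))) * r =
    (9 * Q ^+ 2 + K ^+ 2) * r ^+ 5 + (0 * r ^+ 6 + Q ^+ 2 * r ^+ 7) by ring.
  exact: H.
have [_ E] := Rintegral_B1_pow mF u5 i0 iq2 FE.
have -> : W12norm v ^+ 2 = \int[leb2]_(x in B1) (v x ^+ 2 + wgrad_sq v x) by exact: W12norm_sqr.
rewrite E Rintegral_1_circ mul0r mul0r add0r.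
have h1 : \int[mu]_(x in `[0, 2 * pi]) (q x ^+ 2 + k x ^+ 2) <=
    \int[mu]_(x in `[0, 2 * pi]) (9 * q x ^+ 2 + k x ^+ 2).
  apply: (le_Rintegral mI (integrable_addx iq2 ik) u5) => x _.
  by rewrite lerD2r ler_peMl ?sqr_ge0// ler1n.
have h2 : 0 <= \int[mu]_(x in `[0, 2 * pi]) q x ^+ 2.
  by apply: Rintegral_ge0 => x _; exact: sqr_ge0.
move: h1 h2; move: (Rintegral _ _ _) (Rintegral _ _ _) (Rintegral _ _ _) => a b d h1 h2.
by lra.
Qed.

Lemma dhprof_le1 (y : R) : `|dhprof y| <= 1.
Proof.
have c1 := cos_le1 y; have c2 := cos_geN1 y.
have P0 : 0 <= ppos (2 * cos y - 1) by rewrite /ppos le_max lexx orbT.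
have P1 : ppos (2 * cos y - 1) <= 1 by rewrite /ppos ge_max ler01 andbT; lra.
have s1 : `|sin y| <= 1 by rewrite ler_norml sin_geN1 sin_le1.
have c3 : `|2 * cos y + 1| <= 3 by rewrite ler_norml; apply/andP; split; lra.
rewrite /dhprof normrM normrM normrN normrM (ger0_norm P0) (@ger0_norm _ (3^-1))//.
rewrite ler_pdivrMr// mul1r -[leRHS]mul1r ler_pM// ?mulr_ge0//.
by rewrite -[leRHS]mul1r ler_pM.
Qed.

Lemma hprof_lipschitz (a b : R) : `|hprof b - hprof a| <= `|b - a|.
Proof.
wlog ab : a b / a <= b.
  by move=> H; have [/H//|/ltW/H] := leP a b; rewrite distrC [`|a - b|]distrC.
have ac : isAC a b (@hprof R) (@dhprof R).
  by apply: isAC_C1 => x _; [exact: is_derive_hprof|exact: continuous_dhprof].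
have i1 : mu.-integrable `[a, b] (EFin \o cst (1 : R)).
  exact: (integrable_cont a b (@cst_continuous R R 1)).
have e1 : \int[mu]_(x in `[a, b]) cst (1 : R) x = b - a.
  rewrite Rintegral_cst; last exact: measurable_itv.
  rewrite /= lebesgue_measure_itv/= lte_fin mul1r.
  move: ab; rewrite le_eqVlt => /predU1P[->|ab]; first by rewrite ltxx subrr.
  by rewrite ab -EFinB.
rewrite [leRHS]ger0_norm ?subr_ge0// ler_norml -e1; apply/andP; split.
  rewrite -[leRHS]opprK lerN2.
  apply: (le_trans _ (isAC_le ab (isAC_scale (-1) ac) i1 _)); first by rewrite !mulN1r opprB opprK addrC.
  by move=> x _; rewrite mulN1r (le_trans (ler_norm _))// normrN dhprof_le1.
apply: (isAC_le ab ac i1) => x _.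
by apply: le_trans (ler_norm _) (dhprof_le1 _).
Qed.

(** The value does not depend on [m], so the energy of the rotated profile in the competitor equals
    that of the given one. Up to the exact derivative of h h', the integrand is h itself. *)
Lemma Rintegral_hshift (m : R) :
  \int[mu]_(t in `[0, 2 * pi]) (dhshift m t ^+ 2 - 9 * hshift m t ^+ 2 + 2 * hshift m t) = 2 * pi / 27.
Proof.
have pi0 := @pi_gt0 R; have [[mh mdh] hP dhP ih hac] := H1circ_hshift m.
pose e (t : R) : R := dhshift m t ^+ 2 - 9 * hshift m t ^+ 2 + 2 * hshift m t.
rewrite -[LHS]/(\int[mu]_(t in `[0, 2 * pi]) e t).
have ie : mu.-integrable `[0, 2 * pi] (EFin \o e).
  have := integrable_addx (integrable_addx ih
    (integrable_scalex (-9) (H1circ_integrable_sqr (H1circ_hshift m))))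
    (integrable_scalex 2 (H1circ_integrable_q (H1circ_hshift m))).
  by apply: integrable_eqx => t; rewrite /e mulNr.
have me : measurable_fun [set: T1] e.
  apply: measurable_funD; last exact: measurable_funM.
  by apply: measurable_funB; [exact: measurable_funX|apply: measurable_funM => //; exact: measurable_funX].
have eP t : e (t + 2 * pi) = e t by rewrite /e hP dhP.
rewrite -(Rintegral_periodic me eP (m - pi / 3)).
have -> : m - pi / 3 + 2 * pi = m + 5 * pi / 3 by field.
have l1 : m - pi / 3 <= m + pi / 3 by lra.
have l2 : m + pi / 3 <= m + 5 * pi / 3 by lra.
rewrite (Rintegral_itv_cat l1 l2 (integrable_periodic_itv me eP ie _ _)).
rewrite [X in _ + X]Rintegral0_eq; last first.
  move=> t; rewrite /= in_itv/= => /hshift_out[E1 E2].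
  by rewrite /e E1 E2 expr0n/= !mulr0 subrr addr0.
pose q (t : R) := Hm m t * dHm m t + (t + sin (3 * (t - m)) / 3) / 9.
have ac : isAC (m - pi / 3) (m + pi / 3) q e.
  have acq : isAC (m - pi / 3) (m + pi / 3) q
      (fun t => (dHm m t * dHm m t + Hm m t * ddHm m t) + Hm m t).
    apply: isAC_add (isAC_mul (isAC_Hm m _ _) (isAC_dHm m _ _)) _.
    apply: isAC_C1 => t _; last exact: (continuous_of_derive (is_derive_Hm m)).
    by rewrite /Hm; apply: is_derive_eq; rewrite /GRing.scale/=; field.
  apply: isAC_eq acq => // t; rewrite in_itv/= => /hshift_in[E1 E2].
  rewrite /e E1 E2; have -> : ddHm m t = 1 - 9 * Hm m t by rewrite /ddHm /Hm; field.
  by ring.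
rewrite -(isAC_end l1 ac) addr0 /q.
have E1 : 3 * (m - pi / 3 - m) = - pi by field.
have E2 : 3 * (m + pi / 3 - m) = pi by field.
by rewrite /Hm /dHm E1 E2 sinN sinpi cosN cospi; field.
Qed.

Section comparison.
Variables (f k : R -> R) (m s : R).
Hypotheses (fk : H1circ f k) (f0 : forall t, 0 <= f t) (s0 : 0 <= s).
Let g t := s * hshift m t.
Let b t := g t - f t.
Let gH : H1circ g (fun t => s * dhshift m t) := H1circ_scale s (H1circ_hshift m).
Let bH : H1circ b (fun t => s * dhshift m t - k t) := H1circ_sub gH fk.

(** As [b] is minus the B of the overview, [v] is r^3 s h_m + r^4 B. [M_rfun34] applies because both
    [g] and [g - b = f] are nonnegative, and the constant term is 3/28 of the energy of the
    profile. *)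
Lemma comparison_M (c v : R * R -> R) : measurable_fun (B1 : set T2) c ->
  {ae leb2, forall x, B1 x -> c x = rfun 3 f x} ->
  measurable_fun (B1 : set T2) v ->
  {ae leb2, forall x, B1 x -> v x = rfun 3 g x - rfun 4 b x} ->
  M v = 25 / 28 * M c + 3 / 28 * (2 * pi / 27 / 6) - (\int[mu]_(t in `[0, 2 * pi]) Ti f k m s t) / 42.
Proof.
move=> mc cf mv vE; have h0 := @H1circ0 R.
have cE : {ae leb2, forall x, B1 x -> c x = rfun 3 f x - rfun 4 (fun=> 0) x}.
  by apply: filterS cf => x + Bx => -> //; rewrite /rfun mulr0 subr0.
have g0 t : 0 <= g t by rewrite mulr_ge0// hprof_ge0.
have gb t : 0 <= g t - b t by rewrite /b opprB addrC subrK.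
have f00 t : 0 <= f t - (fun=> 0) t by rewrite subr0.
rewrite (M_rfun34 gH bH mv vE g0 gb) (M_rfun34 fk h0 mc cE f0 f00).
have [_ _ _ ik _] := fk; have [_ _ _ ih _] := H1circ_hshift m.
have iq2 := H1circ_integrable_sqr fk; have iq := H1circ_integrable_q fk.
have ih2 := H1circ_integrable_sqr (H1circ_hshift m); have ih1 := H1circ_integrable_q (H1circ_hshift m).
have iT := @integrable_gain R f k m s fk 0 (2 * pi).
have ic : mu.-integrable `[0, 2 * pi] (EFin \o (fun t => (k t ^+ 2 - 9 * f t ^+ 2 + 2 * f t) / 6)).
  apply: integrable_eqx (integrable_scalex (6^-1) (integrable_addx (integrable_addx ik
    (integrable_scalex (-9) iq2)) (integrable_scalex 2 iq))) => t; ring.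
have ihh : mu.-integrable `[0, 2 * pi]
    (EFin \o (fun t => dhshift m t ^+ 2 - 9 * hshift m t ^+ 2 + 2 * hshift m t)).
  apply: integrable_eqx (integrable_addx (integrable_addx ih
    (integrable_scalex (-9) ih2)) (integrable_scalex 2 ih1)) => t; ring.
have -> : \int[mu]_(t in `[0, 2 * pi]) ((k t ^+ 2 - 9 * f t ^+ 2 + 2 * f t) / 6 -
   2 * (k t * (fun=> 0) t - 9 * (f t * (fun=> 0) t) + (fun=> 0) t) / 7 +
   ((fun=> 0) t ^+ 2 - 8 * (fun=> 0) t ^+ 2) / 8) =
  \int[mu]_(t in `[0, 2 * pi]) ((k t ^+ 2 - 9 * f t ^+ 2 + 2 * f t) / 6).
  by apply: eq_Rintegral => t _; rewrite !mulr0 !expr0n/= mulr0 !subr0 addr0 mulr0 !mul0r subr0 addr0.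
have j1 := integrable_scalex (25 / 28) ic; have j2 := integrable_scalex (3 / 28 / 6) ihh.
have j3 := integrable_scalex (42^-1) iT; have j12 := integrable_addx j1 j2.
transitivity (\int[mu]_(t in `[0, 2 * pi]) (25 / 28 * ((k t ^+ 2 - 9 * f t ^+ 2 + 2 * f t) / 6) +
    3 / 28 / 6 * (dhshift m t ^+ 2 - 9 * hshift m t ^+ 2 + 2 * hshift m t) - 42^-1 * Ti f k m s t)).
  apply: eq_Rintegral => t _; rewrite /Ti /Bt /dBt /gain /b /g.
  by move: (f t) (k t) (hshift m t) (dhshift m t) => F K H L; field.
rewrite (RintegralB mI j12 j3) (RintegralD mI j1 j2).
rewrite (RintegralZl _ mI ic) (RintegralZl _ mI ihh) (RintegralZl _ mI iT) Rintegral_hshift.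
by congr (_ + _ - _); [field|rewrite mulrC].
Qed.

Lemma comparison_trace (c v : R * R -> R) : measurable_fun (B1 : set T2) c ->
  {ae leb2, forall x, B1 x -> c x = rfun 3 f x} ->
  measurable_fun (B1 : set T2) v ->
  {ae leb2, forall x, B1 x -> v x = rfun 3 g x - rfun 4 b x} -> same_trace v c.
Proof.
move=> mc cf mv vE; have h0 := @H1circ0 R.
have cE : {ae leb2, forall x, B1 x -> c x = rfun 3 f x - rfun 4 (fun=> 0) x}.
  by apply: filterS cf => x + Bx => -> //; rewrite /rfun mulr0 subr0.
have [_ t1] := trace_rfun34 gH bH mv vE; have [_ t2] := trace_rfun34 fk h0 mc cE.
rewrite /same_trace; apply: filterS2 t1 t2 => t e1 e2 t01.
by rewrite e1// e2// /b opprB addrC subrK subr0.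
Qed.

Lemma comparison_W12 : W12 (rfun 3 g \- rfun 4 b) /\
  measurable_fun (B1 : set T2) (rfun 3 g \- rfun 4 b).
Proof.
have W := W12_sub (W12_rfun 2 gH) (W12_rfun 3 bH); split => //.
exact: L2_measurable (W12_L2 W).
Qed.

End comparison.

(** The smallness of [f] off the support that [outer_piece] requires. *)
Definition eps0 : R := 1 / (2 * (Ct R ^+ 2 + Ct R + 15)).

Lemma eps0_bounds : 0 < eps0 <= 1 / 30.
Proof.
have C0 := Ct_ge0 R; have C2 := sqr_ge0 (Ct R).
rewrite /eps0; apply/andP; split; first by rewrite divr_gt0//; lra.
by rewrite ler_pdivlMr// mulrC mulrA ler_pdivrMr; lra.
Qed.

(** When the pair of nodes is rotated by [eps0 / 2], the values of the unrotated profile at the two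
    nodes differ by this amount. *)
Definition gap : R := 2 * sin (3 * (eps0 / 2)) * sin (pi / 3) / 9.

Lemma gap_gt0 : 0 < gap.
Proof.
have /andP[e0 e1] := eps0_bounds; have pi2 : 2 <= pi :> R by exact: pi_ge2.
by rewrite divr_gt0// !mulr_gt0// sin_gt0_pi//; apply/andP; split; lra.
Qed.

(* The free rotation parameter makes the two interior nodes of [f - s h]
   simultaneous zeros. *)
Lemma choose_rotation (f : R -> R) (m0 eta : R) : continuous f ->
  (forall t, `|f t - hshift m0 t| <= eta) -> 2 * eta < gap ->
  exists m, `|m - m0| <= eps0 / 2 /\ f (m + pi / 9) = f (m - pi / 9).
Proof.
move=> cf fh eg; have /andP[e0 e1] := eps0_bounds; have pi2 : 2 <= pi :> R by exact: pi_ge2.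
set d := eps0 / 2; have d0 : 0 < d by rewrite /d; lra.
have dpi : d <= pi / 9 by rewrite /d; lra.
(* For the profile itself this difference is [gap] at [m0 - d] and [- gap] at [m0 + d]; the error
   [2 * eta] is smaller than [gap], so the signs persist for [f]. *)
pose D t := f (t + pi / 9) - f (t - pi / 9).
have cD : continuous D.
  move=> t; apply: cvgB.
    apply: (@continuous_comp _ _ _ (fun t : R => t + pi / 9) f); last exact: cf.
    by apply: cvgD; [exact: cvg_id|exact: cvg_cst].
  apply: (@continuous_comp _ _ _ (fun t : R => t - pi / 9) f); last exact: cf.
  by apply: cvgB; [exact: cvg_id|exact: cvg_cst].
have hin u : - (pi / 3) <= u <= pi / 3 -> hshift m0 (m0 + u) = (1 + cos (3 * u)) / 9.
  move=> /andP[u1 u2].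
  have [-> _] : hshift m0 (m0 + u) = Hm m0 (m0 + u) /\ dhshift m0 (m0 + u) = dHm m0 (m0 + u).
    by apply: hshift_in; apply/andP; split; lra.
  by rewrite /Hm; congr ((1 + cos (3 * _)) / 9); ring.
have cc : cos (3 * (d + pi / 9)) - cos (3 * (d - pi / 9)) = - (9 * gap).
  have -> : 3 * (d + pi / 9) = 3 * d + pi / 3 by field.
  have -> : 3 * (d - pi / 9) = 3 * d - pi / 3 by field.
  by rewrite cosD cosB /gap -/d; field.
have bnd t := fh t; have Dr : D (m0 + d) <= 0.
  have := bnd (m0 + d + pi / 9); have := bnd (m0 + d - pi / 9).
  have -> : hshift m0 (m0 + d + pi / 9) = (1 + cos (3 * (d + pi / 9))) / 9.
    by rewrite -addrA hin//; apply/andP; split; lra.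
  have -> : hshift m0 (m0 + d - pi / 9) = (1 + cos (3 * (d - pi / 9))) / 9.
    by rewrite -addrA hin//; apply/andP; split; lra.
  rewrite !ler_norml /D; move: cc eg.
  move: (cos (3 * (d + pi / 9))) (cos (3 * (d - pi / 9))) (f (m0 + d + pi / 9)) (f (m0 + d - pi / 9)) gap.
  move=> c1 c2 f1 f2 G cc eg /andP[a1 a2] /andP[a3 a4]; lra.
have Dl : 0 <= D (m0 - d).
  have := bnd (m0 - d + pi / 9); have := bnd (m0 - d - pi / 9).
  have -> : hshift m0 (m0 - d + pi / 9) = (1 + cos (3 * (d - pi / 9))) / 9.
    rewrite -addrA hin; last by apply/andP; split; lra.
    by rewrite -(cosN (3 * (d - pi / 9))); congr ((1 + cos _) / 9); ring.
  have -> : hshift m0 (m0 - d - pi / 9) = (1 + cos (3 * (d + pi / 9))) / 9.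
    rewrite -addrA hin; last by apply/andP; split; lra.
    by rewrite -(cosN (3 * (d + pi / 9))); congr ((1 + cos _) / 9); ring.
  rewrite !ler_norml /D; move: cc eg.
  move: (cos (3 * (d + pi / 9))) (cos (3 * (d - pi / 9))) (f (m0 - d + pi / 9)) (f (m0 - d - pi / 9)) gap.
  move=> c1 c2 f1 f2 G cc eg /andP[a1 a2] /andP[a3 a4]; lra.
have le1 : m0 - d <= m0 + d by lra.
have [m mI' mD] : exists2 m, m \in `[m0 - d, m0 + d] & D m = 0.
  apply: IVT => //; first exact: continuous_subspaceT.
  by rewrite ge_min le_max Dr Dl orbT.
exists m; split; last by apply/eqP; rewrite -subr_eq0; apply/eqP.
move: mI'; rewrite in_itv/= => /andP[m1 m2].
by rewrite ler_norml; apply/andP; split; lra.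
Qed.

End final.

Theorem theorem1p1 (R : realType) :
  exists kappa delta : R,
    [/\ 0 < kappa < 1, 0 < delta < 1 &
     forall c : R * R -> R,
       W12 c -> ae_nonneg c -> ae_homogeneous 3 c ->
       forall h0 : R * R -> R, HH h0 -> W12norm (c \- h0) <= delta ->
       exists v : R * R -> R,
         [/\ W12 v, same_trace v c &
             M v <= (1 - kappa) * M c + kappa * M h0]].
Proof.
have /andP[e0 e1] := eps0_bounds R; have G0 := gap_gt0 R.
(* The uniform distance between [f] and the profile is at most [4 * delta]. The first bound makes it
   at most [eps0 / 2], the second makes its double smaller than [gap]. *)
pose delta := Num.min (eps0 R / 8) (gap R / 10).
have d0 : 0 < delta by rewrite lt_min; apply/andP; split; lra.
have d1 : delta <= eps0 R / 8 by rewrite ge_min lexx.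
have d2 : delta <= gap R / 10 by rewrite ge_min lexx orbT.
exists (3 / 28), delta; split; [by apply/andP; split; lra|by apply/andP; split; lra|].
move=> c Wc c0 hom h0 [a _ <-]; rewrite hfun_rfun; set m0 := a + pi / 3 => cd.
have [f [k [fk cf]]] := homogeneous_structure Wc hom.
have f0 := structure_ge0 fk cf c0.
have mc := L2_measurable (W12_L2 Wc).
have hH := H1circ_hshift m0; have Wh := W12_rfun 2 hH.
have mh := L2_measurable (W12_L2 Wh).
have Wd := W12_sub Wc Wh; have md := L2_measurable (W12_L2 Wd).
have dH := H1circ_sub fk hH.
have dE : {ae leb2, forall x, B1 x ->
    (c \- rfun 3 (hshift m0)) x = rfun 3 (fun t => f t - hshift m0 t) x}.
  by apply: filterS cf => x + Bx => /(_ Bx) /= ->; rewrite /rfun mulrBr.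
have N0 : 0 <= W12norm (c \- rfun 3 (hshift m0)) by exact: sqrtr_ge0.
have fh t : `|f t - hshift m0 t| <= 4 * delta.
  have h1 := H1circ_sup dH t; have h2 := W12norm_rfun3 dH md dE.
  have h3 : W12norm (c \- rfun 3 (hshift m0)) ^+ 2 <= delta ^+ 2.
    by rewrite lerXn2r// nnegrE ltW.
  have h4 : (f t - hshift m0 t) ^+ 2 <= (4 * delta) ^+ 2.
    (* The two preceding bounds give 2 * 6 = 12 times [delta ^+ 2], rounded up to a square. *)
    have -> : (4 * delta) ^+ 2 = 16 * delta ^+ 2 by ring.
    have := sqr_ge0 delta; move: h1 h2 h3; move: (W12norm _ ^+ 2) (delta ^+ 2) (Rintegral _ _ _).
    by move=> x y z h1 h2 h3 h5; lra.
  by rewrite -ler_sqrt ?sqr_ge0// !sqrtr_sqr in h4; rewrite (le_trans h4)// ger0_norm// mulr_ge0// ltW.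
have [m [mm fm]] : exists m, `|m - m0| <= eps0 R / 2 /\ f (m + pi / 9) = f (m - pi / 9).
  apply: choose_rotation fh _; first exact: H1circ_continuous fk.
  by lra.
(* The profile [hshift m] takes the value 1/6 at both nodes, so this [s] makes [f - s h] vanish
   there. *)
pose s := 6 * f (m + pi / 9).
have s0 : 0 <= s by rewrite mulr_ge0.
have fr : f (m + pi / 9) = s / 6 by rewrite /s; field.
have fl : f (m - pi / 9) = s / 6 by rewrite -fm.
(* The rotated profile vanishes here. Half of [eps0] pays for the distance of [f] to the given
   profile, the other half for the rotation, the profile being 1-Lipschitz. *)
have fsmall t : m + pi / 3 <= t <= m + 5 * pi / 3 -> f t <= 1 / (2 * (Ct R ^+ 2 + Ct R + 15)).
  move=> /hshift_out[ht _]; rewrite -/(eps0 R).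
  have := fh t; rewrite ler_norml => /andP[_ f1].
  have := hprof_lipschitz (t - m) (t - m0); rewrite -/(hshift m t) -/(hshift m0 t) ht subr0.
  have -> : t - m0 - (t - m) = m - m0 by ring.
  move=> /(le_trans (ler_norm _)) h2; have := le_trans h2 mm; lra.
have T0 := gain_ge0 fk f0 fsmall fr fl.
have [Wv mv] := comparison_W12 m s fk.
have vE : {ae leb2, forall x, B1 x ->
    (rfun 3 (fun t => s * hshift m t) \- rfun 4 (fun t => s * hshift m t - f t)) x =
    rfun 3 (fun t => s * hshift m t) x - rfun 4 (fun t => s * hshift m t - f t) x}.
  by apply: filterE.
exists (rfun 3 (fun t => s * hshift m t) \- rfun 4 (fun t => s * hshift m t - f t)); split => //.
  exact: (comparison_trace fk mc cf mv vE).
rewrite (comparison_M fk f0 s0 mc cf mv vE).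
have -> : M (rfun 3 (hshift m0)) = 2 * pi / 27 / 6.
  have z0 := @H1circ0 R.
  have hE : {ae leb2, forall x, B1 x -> rfun 3 (hshift m0) x = rfun 3 (hshift m0) x - rfun 4 (fun=> 0) x}.
    by apply: filterE => x _; rewrite [X in _ - X]/rfun mulr0 subr0.
  have hh0 t : 0 <= hshift m0 t by exact: hprof_ge0.
  have hh1 t : 0 <= hshift m0 t - (fun=> 0) t by rewrite subr0.
  rewrite (M_rfun34 hH z0 mh hE hh0 hh1) -(Rintegral_hshift m0).
  have [_ _ _ ih _] := hH.
  have ihh : (@lebesgue_measure R).-integrable `[0, 2 * pi]
    (EFin \o (fun t => dhshift m0 t ^+ 2 - 9 * hshift m0 t ^+ 2 + 2 * hshift m0 t)).
    apply: integrable_eqx (integrable_addx (integrable_addx ih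
      (integrable_scalex (-9) (H1circ_integrable_sqr hH))) (integrable_scalex 2 (H1circ_integrable_q hH))) => t; ring.
  rewrite [RHS]mulrC -(RintegralZl (6^-1) _ ihh)//.
  apply: eq_Rintegral => t _.
  by rewrite !mulr0 !expr0n/= mulr0 !subr0 addr0 mulr0 !mul0r subr0 addr0 mulrC.
have -> : 1 - 3 / 28 = 25 / 28 :> R by field.
by rewrite gerBl divr_ge0.
Qed.
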